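(* Let the standing assumptions (1)--(4) of the context hold, and let $Lu:=L^0u+\langle\mathbf{B},\nabla u\rangle$, $u\in D(L^0)_{0,b}$. The following statements are equivalent: (i) $(L,D(L^0)_{0,b})$ is $L^1$-unique. (ii) $\mu$ is $(\overline{T}_t)_{t>0}$-invariant. (iii) There exist $\chi_n\in H^{1,2}_{loc}(\mathbb{R}^d,\mu)$, $n\ge1$, and $\alpha>0$ such that $(\chi_n-1)^-\in H^{1,2}_0(\mathbb{R}^d,\mu)_{0,b}$ for all $n$, $\lim_{n\to\infty}\chi_n=0$ $\mu$-a.e., and $$\mathcal{E}^0_\alpha(\chi_n,v)+\int_{\mathbb{R}^d}\langle\mathbf{B},\nabla\chi_n\rangle v\,d\mu\ge0\quad\text{for all }v\in H^{1,2}_0(\mathbb{R}^d,\mu)_{0,b},\ v\ge0.$$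
   Context: Function spaces. For open $V\subset\mathbb{R}^d$, $H^{1,2}_0(V,\mu)$ is the closure of $C_0^\infty(V)$ in $L^2(V,\mu)$ w.r.t. the norm $(\int_V u^2d\mu+\int_V\|\nabla u\|^2d\mu)^{1/2}$, and $H^{1,2}_{loc}(V,\mu)$ is the space of all $u$ with $u\chi\in H^{1,2}_0(V,\mu)$ for all $\chi\in C_0^\infty(V)$. For a space $\mathcal{A}$ of functions on $V$, $\mathcal{A}_0$ denotes the elements $u$ such that the support of $|u|\mu$ is a compact subset of $V$, $\mathcal{A}_b$ the (essentially) bounded elements, $\mathcal{A}_{0,b}=\mathcal{A}_0\cap\mathcal{A}_b$. Standing assumptions ($d\ge1$): (1) $\mu=\rho\,dx$, $\rho=\varphi^2$ with $\varphi\in H^{1,2}_{loc}(\mathbb{R}^d)$, and $\mathrm{supp}(\mu)=\mathbb{R}^d$. (2) $A=(a_{ij})_{1\le i,j\le d}$ with $a_{ji}=a_{ij}\in H^{1,2}_{loc}(\mathbb{R}^d,\mu)$ is locally strictly elliptic: for every relatively compact $V$ there is $\nu_V>0$ with $\nu_V^{-1}\|\xi\|^2\le\langle A(x)\xi,\xi\rangle\le\nu_V\|\xi\|^2$ for all $\xi\in\mathbb{R}^d$, $x\in V$. (3) $\mathbf{G}=(g_1,\dots,g_d)\in L^2_{loc}(\mathbb{R}^d,\mathbb{R}^d,\mu)$. (4) $\int_{\mathbb{R}^d}\big(\tfrac12\sum_{i,j}a_{ij}\partial_{ij}u+\langle\mathbf{G},\nabla u\rangle\big)d\mu=0$ for all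 $u\in C_0^\infty(\mathbb{R}^d)$. Notation. $\beta^{\rho,A}_i=\tfrac12\sum_{j=1}^d\big(\partial_ja_{ij}+a_{ij}\tfrac{\partial_j\rho}{\rho}\big)$, $\beta^{\rho,A}=(\beta^{\rho,A}_1,\dots,\beta_d^{\rho,A})$, $\mathbf{B}=\mathbf{G}-\beta^{\rho,A}$. $(\mathcal{E}^0,D(\mathcal{E}^0))$ is the closure in $L^2(\mathbb{R}^d,\mu)$ of $\mathcal{E}^0(u,v)=\tfrac12\int_{\mathbb{R}^d}\langle A\nabla u,\nabla v\rangle d\mu$, $u,v\in C_0^\infty(\mathbb{R}^d)$, with self-adjoint generator $(L^0,D(L^0))$. $\mathcal{E}^0_\alpha(u,v)=\mathcal{E}^0(u,v)+\alpha\int_{\mathbb{R}^d}uv\,d\mu$; the integral expressions are also used for $u\in H^{1,2}_{loc}(\mathbb{R}^d,\mu)$ and $v\in H^{1,2}_0(\mathbb{R}^d,\mu)_{0,b}$. The semigroup $(\overline{T}_t)_{t>0}$. For a relatively compact open $V$, let $(L^{0,V},D(L^{0,V}))$ be the self-adjoint generator on $L^2(V,\mu)$ of the Dirichlet form $\tfrac12\int_V\langle A\nabla u,\nabla v\rangle d\mu$, $u,v\in H^{1,2}_0(V,\mu)$. The operator $L^{0,V}u+\langle\mathbf{B},\nabla u\rangle$, $u\in D(L^{0,V})_b$, is closable on $L^1(V,\mu)$ and its closure generates a sub-Markovian $C_0$-semigroup of contractions on $L^1(V,\mu)$; let $\overline{G}^V_\alpha$ be its resolvent, and for $f\in L^1(\mathbb{R}^d,\mu)$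 put $\overline{G}^V_\alpha f:=\overline{G}^V_\alpha(f1_V)$ (zero outside $V$). For any increasing sequence $(V_n)$ of relatively compact open sets with union $\mathbb{R}^d$, $\overline{G}_\alpha f=\lim_n\overline{G}_\alpha^{V_n}f$ exists in $L^1(\mathbb{R}^d,\mu)$, is independent of $(V_n)$, and is the resolvent of a sub-Markovian $C_0$-semigroup of contractions $(\overline{T}_t)_{t>0}$ on $L^1(\mathbb{R}^d,\mu)$, whose generator $(\overline{L},D(\overline{L}))$ extends $(L,D(L^0)_{0,b})$. Definitions. A densely defined operator $(\mathcal L,D)$ on $L^1(\mathbb{R}^d,\mu)$ is $L^1$-unique if there is only one extension of it on $L^1(\mathbb{R}^d,\mu)$ that generates a $C_0$-semigroup. $\mu$ is $(\overline{T}_t)_{t>0}$-invariant if $\int\overline{T}_tf\,d\mu=\int f\,d\mu$ for all bounded $f\in L^1(\mathbb{R}^d,\mu)$, $f\ge0$, and all $t>0$. *)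

(* Defs.v *)
From HB Require Import structures.
From mathcomp Require Import all_boot all_order all_algebra.
From mathcomp Require Import all_classical all_reals all_analysis.
Import Order.TTheory GRing.Theory Num.Theory.
Import numFieldNormedType.Exports.

Set Implicit Arguments.
Unset Strict Implicit.
Unset Printing Implicit Defensive.

Local Open Scope classical_set_scope.
Local Open Scope ring_scope.

(* R^d is 'rV[R]_d.  Its sigma-algebra is generated by the coordinate maps
   (= the Borel sigma-algebra). *)
Section borel_rV.
Context {R : realType} (d : nat).

Let coord (i : 'I_d) (x : 'rV[R]_d) : measurableTypeR R := x ord0 i.

Let rV_set0 : g_sigma_preimage coord set0.
Proof. exact: sigma_algebra0. Qed.

Let rV_setC A : g_sigma_preimage coord A -> g_sigma_preimage coord (~` A).
Proof. exact: sigma_algebraC. Qed.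

Let rV_bigcup (F : (set 'rV[R]_d)^nat) :
  (forall i, g_sigma_preimage coord (F i)) ->
  g_sigma_preimage coord (\bigcup_i (F i)).
Proof. exact: sigma_algebra_bigcup. Qed.

HB.instance Definition _ := @isMeasurable.Build default_measure_display
  'rV[R]_d (g_sigma_preimage coord) rV_set0 rV_setC rV_bigcup.

Lemma measurable_coord (i : 'I_d) :
  measurable_fun [set: 'rV[R]_d] (fun x : 'rV[R]_d => x ord0 i).
Proof.
move=> _ Y mY; rewrite setTI; apply: sub_sigma_algebra => /=.
rewrite -bigcup_seq/=; exists i => /=; first by rewrite mem_index_enum.
by exists Y => //; rewrite setTI.
Qed.

Lemma measurable_fun_rV d1 (T1 : measurableType d1) (f : T1 -> 'rV[R]_d) :
  (forall i, measurable_fun [set: T1] (fun t => f t ord0 i)) ->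
  measurable_fun [set: T1] f.
Proof.
move=> mf.
have prefS : g_sigma_preimage (fun i => coord i \o f) `<=` measurable.
  apply: smallest_sub; first exact: sigma_algebra_measurable.
  rewrite -bigcup_seq; apply: bigcup_sub => i _ A [B mB <-].
  exact: mf.
move: prefS; rewrite g_sigma_preimage_comp => prefS _ A mA.
by apply: prefS; exists A.
Qed.

End borel_rV.

Section lebesgue_rV.
Context {R : realType}.

Definition rV_cons d (p : 'rV[R]_d * measurableTypeR R) : 'rV[R]_d.+1 :=
  \row_i (if unlift ord0 i is Some j then p.1 ord0 j else p.2).

Lemma measurable_rV_cons d : measurable_fun setT (@rV_cons d).
Proof.
apply: measurable_fun_rV => i; rewrite /rV_cons.
under eq_fun do rewrite mxE.
case: (unlift ord0 i) => [j|]; last exact: measurable_snd.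
exact: measurableT_comp (measurable_coord j) measurable_fst.
Qed.

Section lebesgue_cons.
Local Open Scope ereal_scope.
Variables (d : nat) (m : {measure set 'rV[R]_d -> \bar R}).

Definition lebesgue_cons : set 'rV[R]_d.+1 -> \bar R :=
  pushforward (m \x lebesgue_measure) (@rV_cons d).

Let m0 : lebesgue_cons set0 = 0.
Proof. by rewrite /lebesgue_cons /pushforward preimage_set0 measure0. Qed.

Let m_ge0 A : 0 <= lebesgue_cons A.
Proof. by rewrite /lebesgue_cons /pushforward measure_ge0. Qed.

Let m_sigma_additive : semi_sigma_additive lebesgue_cons.
Proof.
move=> F mF tF mUF; rewrite /lebesgue_cons /pushforward preimage_bigcup.
have mcons := @measurable_rV_cons d.
apply: measure_semi_sigma_additive.
- by move=> n; rewrite -[X in measurable X]setTI; exact: mcons.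
- apply/trivIsetP => /= i j _ _ ij; rewrite -preimage_setI.
  by move/trivIsetP : tF => /(_ _ _ _ _ ij) ->//; rewrite preimage_set0.
- by rewrite -preimage_bigcup -[X in measurable X]setTI; exact: mcons.
Qed.

HB.instance Definition _ :=
  isMeasure.Build _ _ _ lebesgue_cons m0 m_ge0 m_sigma_additive.

End lebesgue_cons.

(* d-fold product of the Lebesgue measure on R *)
Fixpoint lebesgue_rV (d : nat) : {measure set 'rV[R]_d -> \bar R} :=
  match d with
  | 0 => dirac (0 : 'rV[R]_0)
  | d'.+1 => lebesgue_cons (lebesgue_rV d')
  end.

End lebesgue_rV.

Section calculus.
Context {R : realType} {d : nat}.
Implicit Types (f u : 'rV[R]_d -> R) (V : set 'rV[R]_d).

(* Euclidean inner product; the library norm on 'rV[R]_d is the sup norm. *)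
Definition dot (x y : 'rV[R]_d) : R := (x *m y^T) ord0 ord0.

(* <A xi, eta> for column vectors xi^T, eta^T *)
Definition bilin (A : 'M[R]_d) (xi eta : 'rV[R]_d) : R :=
  (eta *m A *m xi^T) ord0 ord0.

Definition partial (j : 'I_d) f : 'rV[R]_d -> R :=
  fun x => 'D_(delta_mx ord0 j) f x.

Definition cgrad f : 'rV[R]_d -> 'rV[R]_d := fun x => \row_j partial j f x.

Definition smooth f : Prop := forall s : seq 'I_d,
  continuous (foldr partial f s) /\
  forall (j : 'I_d) (x : 'rV[R]_d),
    derivable (foldr partial f s) x (delta_mx ord0 j).

(* C_0^\infty(V), functions being extended by zero outside V *)
Definition test_fun V : set ('rV[R]_d -> R) := [set f |
  [/\ smooth f, compact (closure [set x | f x != 0]) &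
      closure [set x | f x != 0] `<=` V]].

Definition relatively_compact V : Prop := compact (closure V).

Definition msupp (m : set 'rV[R]_d -> \bar R) : set 'rV[R]_d :=
  [set x | forall U, open U -> U x -> (0 < m U)%E].

End calculus.

(* Elements of L^p, of the Sobolev spaces, etc. are represented by measurable
   functions R^d -> R; spaces over an open set V consist of functions on R^d
   vanishing a.e. outside V.  Operators are given by their graphs. *)
Section function_spaces.
Context {R : realType} {d : nat} (mu : {measure set 'rV[R]_d -> \bar R}).
Implicit Types (u v f w : 'rV[R]_d -> R) (V : set 'rV[R]_d).

Definition Lp (p : \bar R) V : set ('rV[R]_d -> R) := [set f |
  f \in Lfun mu p /\ {ae mu, forall x, ~ V x -> f x = 0}].

Definition cvg_Lp (p : \bar R) (u_ : ('rV[R]_d -> R)^nat) u : Prop :=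
  'N[mu]_p[EFin \o (u_ n \- u)%R]%E @[n --> \oo] --> 0%E.

Definition ess_bounded u : Prop :=
  exists M : R, {ae mu, forall x, `|u x| <= M}.

Definition compact_supp u : Prop :=
  compact (msupp (fun U => \int[mu]_(x in U) `|u x|%:E)%E).

Definition bounded0 (D : set ('rV[R]_d -> R)) : set ('rV[R]_d -> R) :=
  [set u | [/\ D u, compact_supp u & ess_bounded u]].

(* u is in H^{1,2}_0(V, mu), with gradient g *)
Definition H0_grad V u (g : 'rV[R]_d -> 'rV[R]_d) : Prop :=
  [/\ u \in Lfun mu 2%:E,
      forall j, (fun x => g x ord0 j) \in Lfun mu 2%:E &
      exists u_ : ('rV[R]_d -> R)^nat,
        [/\ forall n, test_fun V (u_ n), cvg_Lp 2%:E u_ u &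
            forall j, cvg_Lp 2%:E (fun n => partial j (u_ n))
                                  (fun x => g x ord0 j)]].

Definition H0 V : set ('rV[R]_d -> R) := [set u | exists g, H0_grad V u g].

Definition Hloc : set ('rV[R]_d -> R) :=
  [set u | forall chi, test_fun setT chi -> H0 setT (u \* chi)].

(* g = nabla(u chi) a.e. on every open set where the cut-off chi is 1 *)
Definition is_wgrad u (g : 'rV[R]_d -> 'rV[R]_d) : Prop :=
  (forall j, measurable_fun setT (fun x => g x ord0 j)) /\
  forall chi h (U : set 'rV[R]_d),
    test_fun setT chi -> H0_grad setT (u \* chi) h ->
    open U -> (forall x, U x -> chi x = 1) ->
    {ae mu, forall x, U x -> g x = h x}.

(* nabla u, for u in H^{1,2}_loc(R^d, mu), hence also for u in
   H^{1,2}_0(V, mu) *)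
Definition wgrad u : 'rV[R]_d -> 'rV[R]_d := xget (fun=> 0) (is_wgrad u).

End function_spaces.

Section distributional.
Context {R : realType} {d : nat}.
Local Notation dx := (lebesgue_rV d).

Definition is_weak_partial (j : 'I_d) (f g : 'rV[R]_d -> R) : Prop :=
  [/\ measurable_fun setT g,
      forall K, compact K -> (\int[dx]_(x in K) `|g x|%:E < +oo)%E &
      forall eta, test_fun setT eta ->
        \int[dx]_x (f x * partial j eta x) = - \int[dx]_x (g x * eta x)].

Definition weak_partial (j : 'I_d) (f : 'rV[R]_d -> R) : 'rV[R]_d -> R :=
  xget (fun=> 0) (is_weak_partial j f).

End distributional.

Section forms.
Context {R : realType} {d : nat} (mu : {measure set 'rV[R]_d -> \bar R}).
Implicit Types (u v f w : 'rV[R]_d -> R) (V : set 'rV[R]_d).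

Section form_closure.
Variables (C : set ('rV[R]_d -> R))
  (e : ('rV[R]_d -> R) -> ('rV[R]_d -> R) -> R).

Definition form_approx (u_ : ('rV[R]_d -> R)^nat) u : Prop :=
  [/\ forall n, C (u_ n), cvg_Lp mu 2%:E u_ u &
      forall eps : R, 0 < eps -> exists N, forall m n, (N <= m)%N ->
        (N <= n)%N -> e (u_ m \- u_ n) (u_ m \- u_ n) < eps].

(* domain and values of the closure in L^2(R^d, mu) of the form (e, C) *)
Definition closure_dom : set ('rV[R]_d -> R) :=
  [set u | u \in Lfun mu 2%:E /\
           exists u_ : ('rV[R]_d -> R)^nat, form_approx u_ u].

Definition closure_form u v : R := xget 0 [set l |
  exists u_ v_ : ('rV[R]_d -> R)^nat,
  [/\ form_approx u_ u, form_approx v_ v & e (u_ n) (v_ n) @[n --> \oo] --> l]].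

End form_closure.

(* graph of the generator, on L^2(V, mu), of the closed form (e, D) *)
Definition form_generator V (D : set ('rV[R]_d -> R))
    (e : ('rV[R]_d -> R) -> ('rV[R]_d -> R) -> R) u f : Prop :=
  [/\ D u, Lp mu 2%:E V f &
      forall v, D v -> e u v = - \int[mu]_x (f x * v x)].

Variable A : 'rV[R]_d -> 'M[R]_d.

Definition energy (gu gv : 'rV[R]_d -> 'rV[R]_d) : R :=
  2^-1 * \int[mu]_x bilin (A x) (gu x) (gv x).

Definition E0 u v : R := energy (cgrad u) (cgrad v).

Definition L0 : ('rV[R]_d -> R) -> ('rV[R]_d -> R) -> Prop :=
  form_generator setT (closure_dom (test_fun setT) E0)
                      (closure_form (test_fun setT) E0).

Definition D_L0 : set ('rV[R]_d -> R) := [set u | exists f, L0 u f].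

Definition L0V V : ('rV[R]_d -> R) -> ('rV[R]_d -> R) -> Prop :=
  form_generator V (H0 mu V) (fun u v => energy (wgrad mu u) (wgrad mu v)).

Variable B : 'rV[R]_d -> 'rV[R]_d.

(* graph in L^1(R^d, mu) of L u = L^0 u + <B, nabla u>, u in D(L^0)_{0,b};
   Lp mu 1 setT w only forces w to be a measurable representative *)
Definition L_op u w : Prop :=
  [/\ bounded0 mu D_L0 u, Lp mu 1 setT w & exists2 f, L0 u f &
    w = (fun x => f x + dot (B x) (wgrad mu u x)) %[ae mu]].

(* graph in L^1(V, mu) of L^{0,V} u + <B, nabla u>, u in D(L^{0,V})_b *)
Definition LV_op V u w : Prop :=
  [/\ ess_bounded mu u, Lp mu 1 V w & exists2 f, L0V V u f &
    w = (fun x => f x + dot (B x) (wgrad mu u x)) %[ae mu]].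

End forms.

Section semigroups.
Context {R : realType} {d : nat} (mu : {measure set 'rV[R]_d -> \bar R}).
Implicit Types (u v f g w : 'rV[R]_d -> R) (V : set 'rV[R]_d).
Implicit Types (S G : R -> ('rV[R]_d -> R) -> ('rV[R]_d -> R))
  (op : ('rV[R]_d -> R) -> ('rV[R]_d -> R) -> Prop).

Record C0_semigroup V S : Prop := {
  C0_stable : forall t f, 0 < t -> Lp mu 1 V f -> Lp mu 1 V (S t f) ;
  C0_linear : forall t (a : R) f g, 0 < t -> Lp mu 1 V f -> Lp mu 1 V g ->
    S t (fun x => a * f x + g x) = (fun x => a * S t f x + S t g x) %[ae mu] ;
  C0_bounded : forall t, 0 < t -> exists C : R, forall f, Lp mu 1 V f ->
    ('N[mu]_1[EFin \o S t f] <= C%:E * 'N[mu]_1[EFin \o f])%E ;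
  C0_semigroupD : forall s t f, 0 < s -> 0 < t -> Lp mu 1 V f ->
    S (s + t) f = S s (S t f) %[ae mu] ;
  C0_continuous : forall f, Lp mu 1 V f ->
    'N[mu]_1[EFin \o (S t f \- f)%R]%E @[t --> 0^'+] --> 0%E }.

Definition contractive V S : Prop := forall t f, 0 < t -> Lp mu 1 V f ->
  ('N[mu]_1[EFin \o S t f] <= 'N[mu]_1[EFin \o f])%E.

Definition sub_Markovian V S : Prop := forall t f, 0 < t -> Lp mu 1 V f ->
  {ae mu, forall x, 0 <= f x <= 1} -> {ae mu, forall x, 0 <= S t f x <= 1}.

Definition sg_generator V S u w : Prop :=
  [/\ Lp mu 1 V u, Lp mu 1 V w &
      'N[mu]_1[EFin \o (fun x => t^-1 * (S t u x - u x) - w x)%R]%E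
        @[t --> 0^'+] --> 0%E].

(* G_alpha = (alpha - op)^{-1} for all alpha > 0 *)
Definition is_resolvent V op G : Prop :=
  forall alpha f, 0 < alpha -> Lp mu 1 V f -> Lp mu 1 V (G alpha f) /\
  forall u, Lp mu 1 V u ->
    (u = G alpha f %[ae mu] <-> op u (fun x => alpha * u x - f x)).

(* closure on L^1(V, mu) *)
Definition op_closure V op u w : Prop :=
  [/\ Lp mu 1 V u, Lp mu 1 V w & exists u_ w_ : ('rV[R]_d -> R)^nat,
    [/\ forall n, op (u_ n) (w_ n), cvg_Lp mu 1 u_ u & cvg_Lp mu 1 w_ w]].

Definition extends op op' : Prop := forall u w, op u w -> op' u w.

Definition L1_unique op : Prop := exists! op' : _ -> _ -> Prop,
  extends op op' /\
  exists2 S, C0_semigroup setT S & op' = sg_generator setT S.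

Definition invariant_measure S : Prop := forall t f, 0 < t -> Lp mu 1 setT f ->
  ess_bounded mu f -> {ae mu, forall x, 0 <= f x} ->
  \int[mu]_x S t f x = \int[mu]_x f x.

Variables (A : 'rV[R]_d -> 'M[R]_d) (B : 'rV[R]_d -> 'rV[R]_d).

Definition is_GV V G : Prop := exists S,
  [/\ C0_semigroup V S, contractive V S, sub_Markovian V S,
      forall u w, op_closure V (LV_op mu A B V) u w <-> sg_generator V S u w &
      is_resolvent V (sg_generator V S) G].

Definition exhaustion (V_ : (set 'rV[R]_d)^nat) : Prop :=
  [/\ forall n, open (V_ n) /\ relatively_compact (V_ n),
      forall n, V_ n `<=` V_ n.+1 & \bigcup_n V_ n = setT].

(* T is the semigroup (\overline{T}_t)_{t>0}: its resolvent G is the limit of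
   the resolvents GV V on L^1(V, mu) along any exhaustion of R^d. *)
Definition is_Tbar S : Prop :=
  [/\ C0_semigroup setT S, contractive setT S, sub_Markovian setT S,
      extends (L_op mu A B) (sg_generator setT S) &
      exists G GV,
      [/\ is_resolvent setT (sg_generator setT S) G,
          forall V, open V -> relatively_compact V -> is_GV V (GV V) &
          forall (V_ : (set 'rV[R]_d)^nat) alpha f,
            exhaustion V_ -> 0 < alpha -> Lp mu 1 setT f ->
            cvg_Lp mu 1 (fun n => GV (V_ n) alpha (f \* \1_(V_ n)))
                        (G alpha f)]].

End semigroups.

Section data.
Context {R : realType} {d : nat} (mu : {measure set 'rV[R]_d -> \bar R}).
Implicit Types (rho : 'rV[R]_d -> R) (A : 'rV[R]_d -> 'M[R]_d)
  (G B : 'rV[R]_d -> 'rV[R]_d).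

Definition has_density rho : Prop := forall U, measurable U ->
  mu U = (\int[lebesgue_rV d]_(x in U) (rho x)%:E)%E.

Definition locally_strictly_elliptic A : Prop :=
  forall V : set 'rV[R]_d, relatively_compact V ->
  exists2 nu : R, 0 < nu & forall xi x, V x ->
    nu^-1 * dot xi xi <= bilin (A x) xi xi <= nu * dot xi xi.

Definition L2loc G : Prop :=
  (forall j, measurable_fun setT (fun x => G x ord0 j)) /\
  forall K, compact K -> (\int[mu]_(x in K) (dot (G x) (G x))%:E < +oo)%E.

Definition infinitesimally_invariant A G : Prop :=
  forall u, test_fun setT u ->
  \int[mu]_x (2^-1 * (\sum_i \sum_j A x i j * partial i (partial j u) x)
              + dot (G x) (cgrad u x)) = 0.

Definition log_drift rho A : 'rV[R]_d -> 'rV[R]_d := fun x =>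
  \row_i (2^-1 * \sum_j (wgrad mu (fun y => A y i j) x ord0 j
                         + A x i j * (weak_partial j rho x / rho x))).

End data.

(* Main.v *)
Require Import Defs.
From HB Require Import structures.
From mathcomp Require Import all_boot all_order all_algebra.
From mathcomp Require Import all_classical all_reals all_analysis.
From mathcomp Require Import measurable_realfun ring lra.
Import Order.TTheory GRing.Theory Num.Theory.
Import numFieldNormedType.Exports.
Local Open Scope classical_set_scope.
Local Open Scope ring_scope.

(* (i) => (ii).  If [mu] is not invariant, the mass lost by the semigroup can be fed back: for a suitable profile [y] the
   map [u |-> L u + (lost mass of u) y] yields a second dissipative extension of [L], and the implicit Euler scheme
   turns it into a second semigroup.
   (ii) => (iii).  [h_n := (1 - L_{V_n}^* )^{-1} 1] lies in the form domain of [V_n] by weak regularity, its extension by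
   zero is a subsolution on the whole space, and [chi_n := 1 - h_n] tends to [0] because no mass is lost.
   (iii) => (i).  A bounded [h] that annihilates [(alpha - L) D] belongs locally to [H^{1,2}], and comparison with
   [|h|_oo chi_n] gives [h = 0].  By Hahn-Banach [(alpha - L) D] is dense, so the generator of [Tbar] is the closure of
   [L]; every other generator extending [L] contains it, and [lambda - L'] is injective for large [lambda]. *)
Set Implicit Arguments.
Unset Strict Implicit.
Unset Printing Implicit Defensive.

(** The analysis rests on two facts about the measure: the partial integration of [ibp_measure],
    which makes gradients unique, and the vanishing mean of [<B, grad v>] for compactly supported
    [v], which makes the drift antisymmetric ([drift_anti]), so that it disappears when a function
    is tested against itself. The obstacle in both (ii) => (iii) and (iii) => (i) is that dual
    objects are merely bounded measurable functions, to which neither form nor drift applies;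
    [weak_regularity] identifies them with Riesz representatives in the form domain. Across the
    boundary of [V_n] the equation of [h_n] breaks down, and only an inequality survives; this is
    why (iii) speaks of supersolutions. In (i) => (ii) the perturbation is invisible on the domain
    of [L] because [L u] has integral 0 there. In (iii) => (i) the competing semigroup is not
    assumed contractive, so a bound near time 0 is first extracted from uniform boundedness. *)

Lemma eq_lerW (dd : Order.disp_t) (E : porderType dd) (x y : E) : x = y -> (x <= y)%O.
Proof. by move=> ->. Qed.

Local Notation meas := (measurable_fun setT).

(** * Convergence in mean, square integrable functions and completeness *)

Section L1_convergence.
Context {R : realType} d0 {X : measurableType d0} (mu : {measure set X -> \bar R}).
Implicit Types (f g h : X -> R) (p q : nat -> X -> R).

Definition Ig f := mu.-integrable setT (EFin \o f).

(** The integral stays in the extended reals: finitely many terms may have infinite integral, as in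
    the convergence of the norms ['N[mu]_p]. *)
Definition Cv0 q : Prop := (forall n, meas (q n)) /\
  (\int[mu]_x `|q n x|%:E)%E @[n --> \oo] --> 0%E.

Lemma mf_abs f : meas f -> meas (EFin \o (fun x => `|f x|)).
Proof. by move=> mf; apply/measurable_EFinP; exact: measurableT_comp. Qed.

Lemma mf_E f : meas f -> meas (EFin \o f).
Proof. by move=> mf; apply/measurable_EFinP. Qed.

Lemma IgP f : Ig f <-> meas f /\ (\int[mu]_x `|f x|%:E < +oo)%E.
Proof.
split=> [/integrableP[/measurable_EFinP mf fi]|[mf fi]]; first by split.
by apply/integrableP; split=> //; exact/measurable_EFinP.
Qed.

Lemma Ig_mf f : Ig f -> meas f. Proof. by case/IgP. Qed.

Lemma IgD f g : Ig f -> Ig g -> Ig (fun x => f x + g x).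
Proof. by move=> hf hg; exact: (integrableD measurableT hf hg). Qed.

Lemma IgB f g : Ig f -> Ig g -> Ig (fun x => f x - g x).
Proof. by move=> hf hg; exact: (integrableB measurableT hf hg). Qed.

Lemma IgZ c f : Ig f -> Ig (fun x => c * f x).
Proof. by move=> hf; exact: (integrableZl measurableT c hf). Qed.

Lemma IgN f : Ig f -> Ig (fun x => - f x).
Proof.
move=> /(IgZ (-1)); congr Ig; apply/funext => x; exact: mulN1r.
Qed.

Lemma Ig0 : Ig (fun=> 0). Proof. exact: integrable0. Qed.

Lemma Ig_abs f : Ig f -> Ig (fun x => `|f x|).
Proof. by move=> hf; exact: (integrable_norm hf). Qed.

Lemma Ig_le f g : meas f -> Ig g ->
  {ae mu, forall x, `|f x| <= `|g x|} -> Ig f.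
Proof.
move=> mf /IgP[mg gi] fg; apply/IgP; split=> //; apply: le_lt_trans gi.
apply: ae_ge0_le_integral => //.
- exact: mf_abs.
- exact: mf_abs.
- by apply: filterS fg => x + _; rewrite lee_fin.
Qed.

Lemma Ig_sum (I : Type) (s : seq I) (F : I -> X -> R) :
  (forall i, Ig (F i)) -> Ig (fun x => \sum_(i <- s) F i x).
Proof.
move=> hF; elim: s => [|i s IH].
  by under eq_fun do rewrite big_nil; exact: Ig0.
by under eq_fun do rewrite big_cons; exact: IgD.
Qed.

Lemma RintD f g : Ig f -> Ig g ->
  \int[mu]_x (f x + g x) = \int[mu]_x f x + \int[mu]_x g x.
Proof. by move=> *; exact: RintegralD. Qed.

Lemma RintB f g : Ig f -> Ig g ->
  \int[mu]_x (f x - g x) = \int[mu]_x f x - \int[mu]_x g x.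
Proof. by move=> *; exact: RintegralB. Qed.

Lemma RintZ c f : Ig f -> \int[mu]_x (c * f x) = c * \int[mu]_x f x.
Proof. by move=> *; exact: RintegralZl. Qed.

Lemma RintN f : Ig f -> \int[mu]_x (- f x) = - \int[mu]_x f x.
Proof.
by move=> hf; under eq_Rintegral do rewrite -mulN1r; rewrite RintZ// mulN1r.
Qed.

Lemma Rint0 : \int[mu]_x (0 : R) = 0.
Proof. by rewrite /Rintegral integral0_eq. Qed.

Lemma Rint_sum (I : Type) (s : seq I) (F : I -> X -> R) :
  (forall i, Ig (F i)) ->
  \int[mu]_x (\sum_(i <- s) F i x) = \sum_(i <- s) \int[mu]_x F i x.
Proof.
move=> hF; elim: s => [|i s IH].
  by under eq_Rintegral do rewrite big_nil; rewrite Rint0 big_nil.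
under eq_Rintegral do rewrite big_cons.
by rewrite RintD ?IH ?big_cons//; exact: Ig_sum.
Qed.

Lemma ae_Rint f g : meas f -> meas g ->
  f = g %[ae mu] -> \int[mu]_x f x = \int[mu]_x g x.
Proof.
move=> mf mg fg; congr fine; apply: ae_eq_integral => //; try exact: mf_E.
by apply: filterS fg => x /= + _ => ->.
Qed.

Lemma Rint_le f g : Ig f -> Ig g -> {ae mu, forall x, f x <= g x} ->
  \int[mu]_x f x <= \int[mu]_x g x.
Proof.
move=> hf hg fg; rewrite -subr_ge0 -RintB//.
set k := fun x => g x - f x.
have mk : meas k by apply: measurable_funB; exact: Ig_mf.
have ak : k = (fun x => `|k x|) %[ae mu].
  by apply: filterS fg => x + _ /=; rewrite /k => xk; rewrite ger0_norm// subr_ge0.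
rewrite (ae_Rint mk _ ak); last exact: measurableT_comp.
exact: Rintegral_ge0.
Qed.

Lemma Rint_ge0 f : {ae mu, forall x, 0 <= f x} -> meas f ->
  0 <= \int[mu]_x f x.
Proof.
move=> f0 mf; have ak : f = (fun x => `|f x|) %[ae mu].
  by apply: filterS f0 => x + _ /=; rewrite /= => xk; rewrite ger0_norm.
rewrite (ae_Rint mf _ ak); last exact: measurableT_comp.
exact: Rintegral_ge0.
Qed.

Lemma Rint_fineE f : Ig f -> (\int[mu]_x `|f x|%:E)%E = (\int[mu]_x `|f x|)%:E.
Proof.
move=> hf; rewrite /Rintegral fineK//.
exact: (integrable_fin_num measurableT (Ig_abs hf)).
Qed.

Lemma Rint_abs_le f : Ig f -> `|\int[mu]_x f x| <= \int[mu]_x `|f x|.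
Proof. by move=> hf; exact: le_normr_Rintegral. Qed.

Lemma Rint_abs_eq0 f : Ig f -> \int[mu]_x `|f x| = 0 -> f = (fun=> 0) %[ae mu].
Proof.
move=> hf f0; have: (\int[mu]_x `|(EFin \o f) x| = 0)%E.
  by rewrite (Rint_fineE hf) f0.
move/ae_eq_integral_abs => /(_ measurableT (mf_E (Ig_mf hf))).
by apply: filterS => x /(_ I)[fx] _.
Qed.

Lemma Rint_ge0_eq0 f : Ig f -> {ae mu, forall x, 0 <= f x} ->
  \int[mu]_x f x <= 0 -> f = (fun=> 0) %[ae mu].
Proof.
move=> hf f0 h; apply: Rint_abs_eq0 => //; apply/eqP; rewrite eq_le; apply/andP; split.
  apply: le_trans h; apply: eq_lerW; apply: ae_Rint.
  - by apply: measurableT_comp => //; exact: Ig_mf.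
  - exact: Ig_mf.
  - by apply: filterS f0 => x + _ /= => ?; rewrite ger0_norm.
by apply: Rintegral_ge0.
Qed.

Lemma Cv0_mf q n : Cv0 q -> meas (q n). Proof. by case. Qed.

Lemma Cv0_lim q : Cv0 q -> forall e : R, 0 < e ->
  exists N, forall n, (N <= n)%N -> (\int[mu]_x `|q n x|%:E < e%:E)%E.
Proof.
case=> _ + e e0; move/fine_cvgP => [[N1 _ h1] /cvgrPdist_lt /(_ e e0) [N2 _ h2]].
exists (maxn N1 N2) => n; rewrite geq_max => /andP[n1 n2].
have /= := h2 n n2; rewrite sub0r normrN -(fineK (h1 n n1)) lte_fin.
by apply: le_lt_trans; exact: ler_norm.
Qed.

Lemma Cv0P q : (forall n, meas (q n)) ->
  (forall e : R, 0 < e ->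
    exists N, forall n, (N <= n)%N -> (\int[mu]_x `|q n x|%:E <= e%:E)%E) -> Cv0 q.
Proof.
move=> mq h; split=> //.
have i0 n : (0 <= \int[mu]_x `|q n x|%:E)%E by exact: integral_ge0.
apply/fine_cvgP; split.
  have [N hN] := h 1 ltr01; exists N => // n /= /hN hn.
  by rewrite ge0_fin_numE// (le_lt_trans hn)// ltry.
apply/cvgrPdist_le => e e0; have [N hN] := h e e0.
exists N => // n /= /hN hn; rewrite sub0r normrN ger0_norm ?fine_ge0//.
by rewrite -lee_fin fineK// ge0_fin_numE// (le_lt_trans hn)// ltry.
Qed.

Lemma Cv0_le p q C : Cv0 p -> (forall n, meas (q n)) ->
  (forall n, {ae mu, forall x, `|q n x| <= C * `|p n x|}) -> Cv0 q.
Proof.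
move=> hp mq pq; apply: Cv0P => // e e0.
have e1 : 0 < e / (`|C| + 1) by rewrite divr_gt0// ltr_wpDl.
have [N hN] := Cv0_lim hp e1; exists N => n /hN hn.
apply: (@le_trans _ _ (\int[mu]_x ((`|C| + 1)%:E * `|p n x|%:E))%E).
  apply: ae_ge0_le_integral => //.
  - exact: mf_abs.
  - by apply: measurable_funeM; exact/mf_abs/Cv0_mf.
  - apply: filterS (pq n) => x h _; rewrite lee_fin (le_trans h)//.
    by apply: ler_wpM2r => //; rewrite (le_trans (ler_norm _))// lerDl.
rewrite ge0_integralZl//; last exact/mf_abs/Cv0_mf.
rewrite (le_trans (lee_wpmul2l _ (ltW hn)))//.
by rewrite -EFinM mulrC divfK// gt_eqF// ltr_wpDl.
Qed.

Lemma Cv0D p q : Cv0 p -> Cv0 q -> Cv0 (fun n x => p n x + q n x).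
Proof.
move=> hp hq; apply: Cv0P => [n|e e0].
  by apply: measurable_funD; exact: Cv0_mf.
have e2 : 0 < e / 2 by rewrite divr_gt0.
have [N hN] := Cv0_lim hp e2; have [M hM] := Cv0_lim hq e2.
exists (maxn N M) => n; rewrite geq_max => /andP[/hN hn /hM hm].
apply: (@le_trans _ _ (\int[mu]_x (`|p n x|%:E + `|q n x|%:E))%E).
  apply: ge0_le_integral => //.
  - by apply: mf_abs; apply: measurable_funD; exact: Cv0_mf.
  - by apply: emeasurable_funD; apply/mf_abs/Cv0_mf.
  - by move=> x _; rewrite -EFinD lee_fin ler_normD.
rewrite ge0_integralD//; try exact/mf_abs/Cv0_mf.
apply: (le_trans (leeD (ltW hn) (ltW hm))).
by rewrite -EFinD -splitr.
Qed.

Lemma Cv0_le2 p r q C : Cv0 p -> Cv0 r -> (forall n, meas (q n)) ->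
  (forall n, {ae mu, forall x, `|q n x| <= C * (`|p n x| + `|r n x|)}) -> Cv0 q.
Proof.
move=> hp hr mq h.
have hp' : Cv0 (fun n x => `|p n x|).
  apply: (@Cv0_le p _ 1) => // [n|n]; first by apply: measurableT_comp => //; exact: Cv0_mf.
  by apply: aeW => x; rewrite normr_id mul1r.
have hr' : Cv0 (fun n x => `|r n x|).
  apply: (@Cv0_le r _ 1) => // [n|n]; first by apply: measurableT_comp => //; exact: Cv0_mf.
  by apply: aeW => x; rewrite normr_id mul1r.
apply: (@Cv0_le _ _ C (Cv0D hp' hr')) => // n.
by apply: filterS (h n) => x; rewrite (@ger0_norm _ (_ + _))// addr_ge0.
Qed.

Lemma Cv0_eq p q : Cv0 p -> (forall n, meas (q n)) ->
  (forall n, {ae mu, forall x, q n x = p n x}) -> Cv0 q.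
Proof.
move=> hp mq h; apply: (@Cv0_le _ _ 1 hp) => // n.
by apply: filterS (h n) => x ->; rewrite mul1r.
Qed.

Lemma Cv0Z c q : Cv0 q -> Cv0 (fun n x => c * q n x).
Proof.
move=> hq; apply: (@Cv0_le _ _ `|c| hq) => [n|n].
  by apply: measurable_funM => //; exact: Cv0_mf.
by apply: aeW => x; rewrite normrM.
Qed.

Lemma Cv0_sub q (s : nat -> nat) : (forall n, (n <= s n)%N) -> Cv0 q ->
  Cv0 (fun n => q (s n)).
Proof.
move=> hs hq; apply: Cv0P => [n|e e0]; first exact: Cv0_mf.
have [N hN] := Cv0_lim hq e0; exists N => n Nn.
by apply/ltW/hN; exact: leq_trans (hs n).
Qed.

(** Borel-Cantelli in summed form: the functions [4 ^+ k * |q k|] have integrals at most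
    [2^-1 ^+ k], so their sum is integrable, hence finite almost everywhere, and its terms tend to 0
    there. *)
Lemma fast_ae q : (forall n, meas (q n)) ->
  (forall k, (\int[mu]_x `|q k x|%:E <= (8^-1 ^+ k)%:E)%E) ->
  {ae mu, forall x, \forall k \near \oo, `|q k x| <= 4^-1 ^+ k}.
Proof.
move=> mq hq.
pose w k x := ((4 ^+ k)%:E * `|q k x|%:E)%E.
have w0 k x : (0 <= w k x)%E by rewrite mule_ge0// lee_fin exprn_ge0.
have mw k : meas (w k) by apply: measurable_funeM; exact: mf_abs.
have iw k : (\int[mu]_x w k x <= (2^-1 ^+ k)%:E)%E.
  rewrite ge0_integralZl//; last exact: mf_abs.
  apply: (le_trans (lee_wpmul2l _ (hq k))); first by rewrite lee_fin exprn_ge0.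
  by rewrite -EFinM lee_fin -exprMn (_ : 4 * 8^-1 = 2^-1 :> R)//; lra.
have sw : (\int[mu]_x (\sum_(k <oo) w k x) < +oo)%E.
  rewrite integral_nneseries//.
  apply: (@le_lt_trans _ _ 2%:E); last exact: ltry.
  have h := @epsilon_trick0 R 2 xpredT (ler0n _ 2).
  apply: (le_trans _ h); apply: lee_nneseries => [k *|k *].
    exact: integral_ge0.
  apply: (le_trans (iw k)); rewrite lee_fin natrX exprS invfM.
  by rewrite exprVn mulrA divff// mul1r.
have : {ae mu, forall x, (\sum_(k <oo) w k x < +oo)%E}.
  have i1 : mu.-integrable setT (fun x => \sum_(k <oo) w k x)%E.
    apply/integrableP; split.
      exact: ge0_emeasurable_sum.
    rewrite (eq_integral (fun x => \sum_(k <oo) w k x)%E)// => x _.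
    by rewrite gee0_abs// nneseries_ge0.
  have := integrable_ae measurableT i1; apply: filterS => x /(_ I).
  by rewrite fin_numE -ltey => /andP[].
apply: filterS => x sx.
have : (w k x @[k --> \oo] --> 0)%E.
  have h0 : forall k, (0 <= w k x)%E by [].
  have t0 := nneseries_tail_cvg sx (fun k _ => h0 k).
  apply: (squeeze_cvge _ (cvg_cst _) t0); apply: nearW => k; rewrite h0/=.
  have := @nneseries_lim_ge R (fun k => w k x) xpredT k k.+1 (fun n _ _ => h0 n).
  by rewrite big_nat1.
move/fine_cvgP => [_ /cvgrPdist_le /(_ 1 ltr01)]; apply: filterS => k.
rewrite sub0r normrN /w /= normrM normr_id ger0_norm ?exprn_ge0// => h.
by rewrite exprVn -[leRHS]div1r ler_pdivlMr ?exprn_gt0// mulrC.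
Qed.

Lemma Cv0_fast q : Cv0 q -> exists s : nat -> nat, (forall n, (n <= s n)%N) /\
  {ae mu, forall x, \forall k \near \oo, `|q (s k) x| <= 4^-1 ^+ k}.
Proof.
move=> hq.
have /choice[s hs] : forall k, exists s, (k <= s)%N /\
    (\int[mu]_x `|q s x|%:E <= (8^-1 ^+ k)%:E)%E.
  move=> k; have e0 : 0 < 8^-1 ^+ k :> R by rewrite exprn_gt0.
  have [N hN] := Cv0_lim hq e0; exists (maxn k N); rewrite leq_maxl; split=> //.
  by apply/ltW/hN; exact: leq_maxr.
exists s; split=> [n|]; first by case: (hs n).
apply: (@fast_ae (fun k => q (s k))) => k; first exact: Cv0_mf.
by case: (hs k).
Qed.

Lemma Cv0_ae q : Cv0 q -> exists s : nat -> nat, (forall n, (n <= s n)%N) /\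
  {ae mu, forall x, q (s k) x @[k --> \oo] --> 0}.
Proof.
move=> /Cv0_fast[s [hs h]]; exists s; split=> //; apply: filterS h => x h.
apply/norm_cvg0P; apply: (squeeze_cvgr _ (cvg_cst _)); last first.
  by apply: (@cvg_expr _ 4^-1); rewrite ger0_norm//; lra.
by apply: filterS h => k; rewrite normr_ge0.
Qed.

Lemma Cv0_dct q h : (forall n, meas (q n)) -> Ig h ->
  (forall n, {ae mu, forall x, `|q n x| <= h x}) ->
  {ae mu, forall x, q n x @[n --> \oo] --> 0} -> Cv0 q.
Proof.
move=> mq hh qh q0; split=> //.
have := @dominated_convergence _ _ _ mu setT measurableT (fun n x => (q n x)%:E)
  (fun=> 0%E) (EFin \o h).
case.
- by move=> n; exact: mf_E.
- exact: measurable_cst.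
- by apply: filterS q0 => x hx _; apply/cvg_EFin; [exact: nearW|exact: hx].
- exact: hh.
- by apply: (filterS _ (ae_foralln qh)) => x hx n _; rewrite /= lee_fin hx.
move=> _ + _; apply: cvg_trans; apply: near_eq_cvg; apply: nearW => n.
by apply: eq_integral => x _; rewrite sube0.
Qed.

Lemma Cv0_Rint (f_ : nat -> X -> R) f : (forall n, Ig (f_ n)) -> Ig f ->
  Cv0 (fun n x => f_ n x - f x) ->
  \int[mu]_x f_ n x @[n --> \oo] --> \int[mu]_x f x.
Proof.
move=> hf_ hf h; apply/cvgrPdist_le => e e0; have [N hN] := Cv0_lim h e0.
exists N => // n /= /hN hn; rewrite distrC -RintB//.
apply: (le_trans (Rint_abs_le (IgB (hf_ n) hf))).
by move: (ltW hn); rewrite (Rint_fineE (IgB (hf_ n) hf)) lee_fin.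
Qed.

Lemma Cv0_ge0 q : (forall n, meas (q n)) ->
  (forall n, (\int[mu]_x `|q n x|%:E <= (n.+1%:R^-1)%:E)%E) -> Cv0 q.
Proof.
move=> mq h; apply: Cv0P => // e e0.
exists (Num.bound e^-1) => n Nn; apply: (le_trans (h n)).
rewrite lee_fin -[leRHS]invrK lef_pV2 ?posrE ?invr_gt0//.
apply/ltW/(lt_le_trans (archi_boundP _)); first by rewrite invr_ge0 ltW.
by rewrite ler_nat (leq_trans Nn).
Qed.

Lemma Cv0_small q e : Cv0 q -> 0 < e -> exists N, forall n, (N <= n)%N ->
  Ig (q n) /\ \int[mu]_x `|q n x| < e.
Proof.
move=> hq e0; have [N hN] := Cv0_lim hq e0; exists N => n /hN hn.
have i : Ig (q n).
  by apply/IgP; split; [exact: Cv0_mf|rewrite (lt_trans hn)// ltry].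
by split=> //; rewrite -lte_fin -Rint_fineE.
Qed.

Definition L2 f := meas f /\ Ig (fun x => f x ^+ 2).

Lemma L2_mul f g : L2 f -> L2 g -> Ig (fun x => f x * g x).
Proof.
move=> [mf f2] [mg g2]; apply: (Ig_le _ (IgD f2 g2)).
  exact: measurable_funM.
apply: aeW => x; rewrite (@ger0_norm _ (_ + _)) ?addr_ge0 ?sqr_ge0//.
rewrite ler_norml; have := sqr_ge0 (f x - g x); have := sqr_ge0 (f x + g x).
by have := sqr_ge0 (f x); have := sqr_ge0 (g x); nra.
Qed.

Lemma L2_le f g : meas f -> L2 g ->
  {ae mu, forall x, `|f x| <= `|g x|} -> L2 f.
Proof.
move=> mf [mg g2] fg; split=> //; apply: (Ig_le _ g2).
  exact: measurable_funX.
by apply: filterS fg => x h; rewrite !normrX lerXn2r// nnegrE.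
Qed.

Lemma L2D f g : L2 f -> L2 g -> L2 (fun x => f x + g x).
Proof.
move=> hf hg; split; first by apply: measurable_funD; [case: hf|case: hg].
under [fun x => (_ + _) ^+ _]eq_fun do rewrite sqrrD.
apply: IgD; last by case: hg.
apply: IgD; first by case: hf.
by under [fun x => _ *+ _]eq_fun do rewrite -mulr_natl; apply: IgZ; exact: L2_mul.
Qed.

Lemma L2Z c f : L2 f -> L2 (fun x => c * f x).
Proof.
move=> [mf f2]; split; first exact: measurable_funM.
by under eq_fun do rewrite exprMn; exact: IgZ.
Qed.

Lemma L2N f : L2 f -> L2 (fun x => - f x).
Proof. by move=> /(L2Z (-1)); congr L2; apply/funext => x; exact: mulN1r. Qed.

Lemma L2B f g : L2 f -> L2 g -> L2 (fun x => f x - g x).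
Proof. by move=> hf /L2N; exact: L2D. Qed.

Lemma Cv0_sqD (f_ g_ : nat -> X -> R) :
  Cv0 (fun n x => f_ n x ^+ 2) -> Cv0 (fun n x => g_ n x ^+ 2) ->
  (forall n, meas (f_ n)) -> (forall n, meas (g_ n)) ->
  Cv0 (fun n x => (f_ n x + g_ n x) ^+ 2).
Proof.
move=> hf hg mf mg; apply: (@Cv0_le2 _ _ _ 2 hf hg) => [n|n].
  exact/measurable_funX/measurable_funD.
apply: aeW => x; rewrite !normrX !real_normK ?num_real//.
by have := sqr_ge0 (f_ n x - g_ n x); nra.
Qed.

Lemma Cv0_mulL2 (f_ : nat -> X -> R) g : Cv0 (fun n x => f_ n x ^+ 2) ->
  (forall n, meas (f_ n)) -> L2 g -> Cv0 (fun n x => f_ n x * g x).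
Proof.
move=> hf mf [mg g2]; apply: Cv0P => [n|e e0]; first exact: measurable_funM.
pose c := \int[mu]_x (g x ^+ 2) + 1.
have c0 : 0 < c by rewrite ltr_wpDl//; apply: Rintegral_ge0 => x _; exact: sqr_ge0.
(* Weight of Young's inequality [a b <= (a^2 / t + t b^2) / 2]: the choice of [c] gives
   [t * int g^2 <= e], and [int f_n^2 / t <= e] once [int f_n^2 < t e]. *)
pose t := e / c; have t0 : 0 < t by rewrite divr_gt0.
have [N hN] := Cv0_small hf (mulr_gt0 t0 e0); exists N => n /hN[i1 h1].
have i2 : Ig (fun x => f_ n x * g x) by apply: L2_mul => //; split.
rewrite Rint_fineE// lee_fin.
apply: (@le_trans _ _ (\int[mu]_x (2^-1 * (t^-1 * `|f_ n x ^+ 2| + t * (g x ^+ 2))))).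
  apply: Rint_le; first exact: Ig_abs.
    by apply: IgZ; apply: IgD; apply: IgZ => //; exact: Ig_abs.
  apply: aeW => x; rewrite (ger0_norm (sqr_ge0 (f_ n x))) normrM.
  rewrite -(real_normK (num_real (f_ n x))) -(real_normK (num_real (g x))).
  set a := `|f_ n x|; set b := `|g x|.
  have -> : a * b = 2^-1 * (t^-1 * a ^+ 2 + t * b ^+ 2 - t^-1 * (a - t * b) ^+ 2).
    by field; rewrite gt_eqF.
  rewrite ler_pM2l ?invr_gt0// gerBl mulr_ge0 ?sqr_ge0// invr_ge0; exact: ltW.
rewrite RintZ; last by apply: IgD; apply: IgZ => //; exact: Ig_abs.
rewrite RintD; [|by apply: IgZ; exact: Ig_abs|exact: IgZ].
rewrite !RintZ//; last exact: Ig_abs.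
have h2 : t^-1 * \int[mu]_x `|f_ n x ^+ 2| <= e.
  by rewrite mulrC ler_pdivrMr// mulrC; exact: ltW.
have h3 : t * \int[mu]_x (g x ^+ 2) <= e.
  by rewrite /t mulrAC ler_pdivrMr// ler_pM2l// lerDl.
lra.
Qed.

Lemma Cv0_mul (f_ g_ : nat -> X -> R) f g :
  Cv0 (fun n x => (f_ n x - f x) ^+ 2) -> Cv0 (fun n x => (g_ n x - g x) ^+ 2) ->
  (forall n, meas (f_ n)) -> (forall n, meas (g_ n)) ->
  L2 f -> L2 g -> Cv0 (fun n x => f_ n x * g_ n x - f x * g x).
Proof.
move=> hf hg mf mg Lf Lg.
have mf' n : meas (fun x => f_ n x - f x).
  by apply: measurable_funB => //; case: Lf.
have mg' n : meas (fun x => g_ n x - g x).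
  by apply: measurable_funB => //; case: Lg.
have h1 := Cv0_mulL2 hf mf' Lg; have h2 := Cv0_mulL2 hg mg' Lf.
have h3 : Cv0 (fun n x => (f_ n x - f x) * (g_ n x - g x)).
  apply: (@Cv0_le2 _ _ _ 1 hf hg) => [n|n]; first exact: measurable_funM.
  apply: aeW => x; rewrite !normrX mul1r normrM.
  by have := sqr_ge0 (`|f_ n x - f x| - `|g_ n x - g x|);
     have := sqr_ge0 (`|f_ n x - f x| + `|g_ n x - g x|); nra.
apply: (Cv0_eq (Cv0D (Cv0D h1 h2) h3)) => [n|n].
  by apply: measurable_funB; apply: measurable_funM => //; [case: Lf|case: Lg].
by apply: aeW => x; ring.
Qed.

Lemma geometric_increments_cvg (a : nat -> R) (C : R) :
  (\forall k \near \oo, `|a k.+1 - a k| <= C * 2^-1 ^+ k) -> cvgn a.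
Proof.
move=> [N _ hN].
suff : cvgn (fun k => a (k + N)%N) by move/cvg_ex => [l]; rewrite cvg_shiftn => /cvgP.
pose b k := a (k.+1 + N)%N - a (k + N)%N.
have -> : (fun k => a (k + N)%N) = (fun k => series b k + a N).
  apply/funext => k; rewrite /series /= /b.
  rewrite (@telescope_sumr _ 0%N k (fun k => a (k + N)%N))// add0n.
  by rewrite subrK.
apply: is_cvgD; last exact: is_cvg_cst.
apply: normed_cvg.
have C0 : 0 <= C.
  have := hN N (leqnn N); move/(le_trans (normr_ge0 _)).
  by rewrite pmulr_lge0// exprn_gt0.
apply: (@series_le_cvg _ _ (geometric C 2^-1)) => [k|k|k|].
- exact: normr_ge0.
- by rewrite /= mulr_ge0// exprn_ge0.
- apply: (le_trans (hN (k + N)%N (leq_addl _ _))) => /=.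
  rewrite ler_wpM2l// exprD ler_piMr ?exprn_ge0// exprn_ile1//; lra.
- by apply: is_cvg_geometric_series; rewrite ger0_norm//; lra.
Qed.

(** Completeness for a mean error [int Q x (F n x - G x)], used with [|xi|], [xi ^+ 2] and the
    energy density [bilin (A x) xi xi]. The bound [4^-1 ^+ k] on [Q] against [2^-1 ^+ k] on the
    coordinates reflects quadratic growth. A subsequence with errors [8^-1 ^+ k] converges almost
    everywhere, and Fatou's lemma carries the Cauchy bound over to the limit. *)
Lemma riesz_fischer (I : finType) (F : nat -> X -> I -> R)
    (Q : X -> (I -> R) -> R) :
  (forall n i, meas (fun x => F n x i)) ->
  (forall x xi, 0 <= Q x xi) ->
  (forall H : X -> I -> R, (forall i, meas (fun x => H x i)) ->
    meas (fun x => Q x (H x))) ->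
  (forall x, exists C : R, forall xi k i, Q x xi <= 4^-1 ^+ k ->
    `|xi i| <= C * 2^-1 ^+ k) ->
  (forall x (xi : nat -> I -> R) xi0, (forall i, xi n i @[n --> \oo] --> xi0 i) ->
    Q x (xi n) @[n --> \oo] --> Q x xi0) ->
  (forall e : R, 0 < e -> exists N, forall n m, (N <= n)%N -> (N <= m)%N ->
    (\int[mu]_x (Q x (fun i => F n x i - F m x i))%:E <= e%:E)%E) ->
  exists G : X -> I -> R, (forall i, meas (fun x => G x i)) /\
    Cv0 (fun n x => Q x (fun i => F n x i - G x i)).
Proof.
move=> mF Q0 mQ hQ cQ cauchy.
have /choice[s0 hs0] : forall k, exists N, forall n m, (N <= n)%N -> (N <= m)%N ->
    (\int[mu]_x (Q x (fun i => F n x i - F m x i))%:E <= (8^-1 ^+ k)%:E)%E.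
  by move=> k; apply: cauchy; rewrite exprn_gt0.
(* Summing the ranks makes [s] monotone, so that [s k] and [s k.+1] are both at least [s0 k]; the
   summand [k] makes [s] unbounded. *)
pose s k := (\sum_(i < k.+1) s0 i + k)%N.
have sS k : (s k <= s k.+1)%N by rewrite /s [in leqRHS]big_ord_recr/= -addnA leq_add2l addnS leqW// leq_addl.
have s0s k : (s0 k <= s k)%N by rewrite /s big_ord_recr/= addnAC leq_addl.
have ks k : (k <= s k)%N by exact: leq_addl.
have mFB n m i : meas (fun x => F n x i - F m x i).
  exact: measurable_funB.
have mQF n m : meas (fun x => Q x (fun i => F n x i - F m x i)).
  by apply: (mQ (fun x i => F n x i - F m x i)).
have [N0 [mN0 muN0 hN0]] : {ae mu, forall x, forall i, cvgn (fun k => F (s k) x i)}.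
  have := @fast_ae (fun k x => Q x (fun i => F (s k.+1) x i - F (s k) x i)) (fun=> mQF _ _).
  case.
    move=> k; under eq_integral do rewrite ger0_norm//.
    by apply: hs0 => //; exact: leq_trans (sS k).
  move=> Z hZ; suff : {ae mu, forall x, forall i, cvgn (fun k => F (s k) x i)} by [].
  have : {ae mu, forall x, \forall k \near \oo,
      `|Q x (fun i => F (s k.+1) x i - F (s k) x i)| <= 4^-1 ^+ k} by exists Z.
  apply: filterS => x hx i; have [C hC] := hQ x.
  apply: (@geometric_increments_cvg _ C); apply: filterS hx => k.
  by rewrite ger0_norm// => /hC.
have cvgF x : (~` N0) x -> forall i, cvgn (fun k => F (s k) x i).
  by move=> Nx; apply/not_notP => h; apply: Nx; exact: hN0.
(* Killing the sequence on the null set makes it converge at every point, so that the limit is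
   measurable. *)
pose F' k x i := F (s k) x i * \1_(~` N0) x.
have mF' k i : meas (fun x => F' k x i).
  by apply: measurable_funM => //; apply: measurable_indic; exact: measurableC.
pose G x i := limn (fun k => F' k x i).
have FG x i : F' k x i @[k --> \oo] --> G x i.
  suff : cvgn (fun k => F' k x i) by [].
  have [Nx|Nx] := pselect (N0 x).
    rewrite /F'; under eq_fun do rewrite indicE memNset ?mulr0//=.
    exact: is_cvg_cst.
  rewrite /F'; under eq_fun do rewrite indicE mem_set ?mulr1//=.
  exact: cvgF.
have mG i : meas (fun x => G x i).
  by apply: (@measurable_fun_cvg _ _ _ setT (fun k x => F' k x i)) => // x _; exact: FG.
exists G; split=> //.
have mQG n : meas (fun x => Q x (fun i => F n x i - G x i)).
  by apply: (mQ (fun x i => F n x i - G x i)) => i; exact: measurable_funB.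
apply: Cv0P => // e e0; have [N hN] := cauchy _ e0; exists N => n Nn.
under eq_integral do rewrite ger0_norm//.
have aeN : {ae mu, forall x, (~` N0) x}.
  by exists N0; split=> // x /=; rewrite not_notP.
pose w k x : \bar R := (Q x (fun i => F n x i - F (s k) x i) * \1_(~` N0) x)%:E.
have m1 : meas (\1_(~` N0) : X -> R).
  by apply: measurable_indic; exact: measurableC.
have ind0 x : 0 <= \1_(~` N0) x :> R by rewrite indicE.
have -> : (\int[mu]_x (Q x (fun i => F n x i - G x i))%:E = \int[mu]_x limn_einf (w^~ x))%E.
  transitivity (\int[mu]_x (Q x (fun i => F n x i - G x i) * \1_(~` N0) x)%:E)%E.
    apply: ae_eq_integral => //; [exact: mf_E|by apply: mf_E; exact: measurable_funM|].
    by apply: filterS aeN => x Nx _; rewrite indicE mem_set// mulr1.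
  apply: eq_integral => x _; apply/esym.
  suff h : w k x @[k --> \oo] --> (Q x (fun i => F n x i - G x i) * \1_(~` N0) x)%:E.
    by rewrite is_cvg_limn_einfE; [exact/cvg_lim|apply/cvg_ex; eexists; exact: h].
  apply/cvg_EFin; first exact: nearW.
  rewrite [X in X @ _ --> _](_ : _ = (fun k => Q x (fun i => F n x i - F (s k) x i) * \1_(~` N0) x))//.
  rewrite indicE; have [Nx|Nx] := boolP (x \in ~` N0); last first.
    by rewrite mulr0; under eq_fun do rewrite mulr0; exact: cvg_cst.
  rewrite mulr1; under eq_fun do rewrite mulr1.
  apply: cQ => i; apply: cvgB; first exact: cvg_cst.
  have := FG x i; rewrite /F'; under eq_fun do rewrite indicE Nx mulr1.
  exact.
have mw k : meas (w k) by apply: mf_E; exact: measurable_funM.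
have w0 k x : (0 <= w k x)%E by rewrite lee_fin mulr_ge0.
apply: (le_trans (@fatou _ _ _ mu setT measurableT w mw (fun k x _ => w0 k x))).
rewrite limn_einf_lim; apply: lime_le; first exact: is_cvg_einfs.
apply: nearW => m; apply: (@le_trans _ _ (\int[mu]_x w (maxn m N) x)%E).
  by apply: ereal_inf_lbound => /=; exists (maxn m N) => //=; exact: leq_maxl.
apply: (@le_trans _ _ (\int[mu]_x (Q x (fun i => F n x i - F (s (maxn m N)) x i))%:E)%E).
  apply: ge0_le_integral => // [|x _]; first exact: mf_E.
  by rewrite lee_fin ler_piMr// indicE lern1; case: (_ \in _).
by apply: hN => //; apply: leq_trans (ks _); exact: leq_maxr.
Qed.

End L1_convergence.

(** * Cubes, measurability and continuity on ['rV[R]_d] *)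

Section rV_topology.
Context {R : realType} {d : nat}.
Local Notation T := 'rV[R]_d.
Implicit Types (f : T -> R) (U V : set T) (x y : T).

Definition cube (r : R) : set T := [set x | forall i, `|x ord0 i| < r].

Lemma norm_rV_lt x (r : R) : 0 < r -> (`|x| < r) = [forall i, `|x ord0 i| < r].
Proof.
move=> r0; apply/idP/forallP => [xr i|xr].
  apply: le_lt_trans xr; rewrite /Num.norm/= mx_normrE.
  by apply: le_trans (le_bigmax _ _ (ord0, i)).
rewrite /Num.norm/= mx_normrE; apply/bigmax_ltP; split=> // -[i j] _ /=.
by rewrite (ord1 i).
Qed.

Lemma ball_rVE x (r : R) : 0 < r ->
  ball x r = [set y | forall i, `|x ord0 i - y ord0 i| < r].
Proof.
move=> r0; rewrite -ball_normE /ball_ /=; apply/seteqP; split=> y /=.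
  by rewrite norm_rV_lt// => /forallP h i; have := h i; rewrite !mxE.
by move=> h; rewrite norm_rV_lt//; apply/forallP => i; have := h i; rewrite !mxE.
Qed.

Lemma cubeE (r : R) : 0 < r -> cube r = ball 0 r.
Proof.
move=> r0; rewrite ball_rVE//; apply/seteqP; split=> y /= h i; have := h i;
by rewrite mxE sub0r normrN.
Qed.

Lemma open_cube r : 0 < r -> open (cube r).
Proof. by move=> r0; rewrite cubeE//; exact: ball_open. Qed.

Lemma cubeS r s : r <= s -> cube r `<=` cube s.
Proof. by move=> rs x xr i; exact: lt_le_trans rs. Qed.

Lemma mem_cube x : exists n : nat, cube n%:R x.
Proof.
exists (Num.bound `|x|) => i.
have n0 : 0 < (Num.bound `|x|)%:R :> R.
  exact: le_lt_trans (archi_boundP (normr_ge0 x)).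
by have := archi_boundP (normr_ge0 x); rewrite norm_rV_lt// => /forallP.
Qed.

Lemma measurable_ball_rV x r : 0 < r -> measurable (ball x r).
Proof.
move=> r0.
have -> : ball x r = \bigcap_(i in [set: 'I_d]) [set y : T | `|x ord0 i - y ord0 i| < r].
  by rewrite ball_rVE//; apply/seteqP; split=> y /= h i => [_|]; exact: h.
apply: fin_bigcap_measurable => // i _.
rewrite -[X in measurable X]setTI.
have mi : measurable_fun [set: T] (fun y : T => `|x ord0 i - y ord0 i|).
  by apply: measurableT_comp => //; apply: measurable_funB => //; exact: measurable_coord.
have := mi measurableT _ (measurable_itv `]-oo, r[).
by congr (measurable (_ `&` _)); apply/seteqP; split=> y /=; rewrite in_itv.
Qed.

Lemma measurable_cube r : 0 < r -> measurable (cube r).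
Proof. by move=> r0; rewrite cubeE//; exact: measurable_ball_rV. Qed.

(** The countable family consists of the balls with rational centre and radius [m.+1%:R^-1],
    enumerated by [unpickle]; balls without the property are replaced by the empty set. As [P] is
    hereditary, a small rational ball inside a good neighbourhood is good. *)
Lemma lindelof_rV (P : set T -> Prop) (U : set T) :
  (forall V W, V `<=` W -> P W -> P V) -> P set0 ->
  (forall x, U x -> exists V, [/\ open V, V x & P V]) ->
  exists B : nat -> set T,
    (forall k, [/\ open (B k), measurable (B k) & P (B k)]) /\ U `<=` \bigcup_k B k.
Proof.
move=> Pmono P0 hU.
pose pt (q : {ffun 'I_d -> rat}) : T := \row_i ratr (q i).
pose B k : set T :=
  if @unpickle ({ffun 'I_d -> rat} * nat)%type k is Some (q, m)
  then if pselect (P (ball (pt q) m.+1%:R^-1)) then ball (pt q) m.+1%:R^-1 else set0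
  else set0.
have m0 m : 0 < m.+1%:R^-1 :> R by rewrite invr_gt0.
exists B; split=> [k|x Ux].
  rewrite /B; case: unpickle => [[q m]|]; last by split=> //; exact: open0.
  case: pselect => h /=; last by split=> //; exact: open0.
  by split=> //; [exact: ball_open|exact: measurable_ball_rV].
have [V [oV Vx PV]] := hU x Ux.
have /nbhs_ballP[e /= e0 xV] : nbhs x V by exact: open_nbhs_nbhs.
pose m := Num.bound (e / 2)^-1.
have me : m.+1%:R^-1 < e / 2.
  rewrite -[ltRHS]invrK ltf_pV2 ?posrE ?invr_gt0 ?divr_gt0//.
  apply: lt_le_trans (archi_boundP _) _; first by rewrite invr_ge0 divr_ge0 ?ltW.
  by rewrite ler_nat.
have /choice[q hq] : forall i, exists q : rat, `|x ord0 i - ratr q| < m.+1%:R^-1.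
  move=> i; have [q] := @rat_in_itvoo R (x ord0 i - m.+1%:R^-1) (x ord0 i + m.+1%:R^-1) ltac:(by rewrite ltrBlDr -addrA ltrDl addr_gt0).
  by rewrite in_itv/= => h; exists q; rewrite distrC ltr_distl.
pose q' : {ffun 'I_d -> rat} := [ffun i => q i].
exists (pickle (q', m)) => //; rewrite /B pickleK.
have qx : ball (pt q') m.+1%:R^-1 x.
  by rewrite ball_rVE// => i; rewrite mxE ffunE distrC.
case: pselect => // -[]; apply: (Pmono _ _ _ PV).
move=> y qy; apply: xV; apply: (@le_ball _ _ _ (m.+1%:R^-1 + m.+1%:R^-1)).
  by rewrite (splitr e) lerD// ltW.
exact: ball_triangle (ball_sym qx) qy.
Qed.

Lemma open_measurable_rV U : open U -> measurable U.
Proof.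
move=> oU.
have [|||B [hB UB]] := @lindelof_rV (fun V => V `<=` U) U.
- by move=> V W VW WU; exact: subset_trans WU.
- exact: sub0set.
- by move=> x Ux; exists U; split.
suff -> : U = \bigcup_k B k by apply: bigcup_measurable => k _; case: (hB k).
by apply/seteqP; split=> // x [k _]; case: (hB k) => _ _; exact.
Qed.

Lemma continuous_measurable_rV f : continuous f -> meas f.
Proof.
move=> /continuousP cf; apply: (measurability _ (RGenOpens.measurableE R)).
move=> _ [_ [a [b ->]] <-]; rewrite setTI; apply: open_measurable_rV.
by apply: cf; exact: interval_open.
Qed.

Lemma compact_measurable_rV (K : set T) : compact K -> measurable K.
Proof.
move=> /(compact_closed (@norm_hausdorff _ _)) cK.
by rewrite -[K]setCK; apply: measurableC; apply: open_measurable_rV; exact: closed_openC.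
Qed.

Lemma compact_cube (K : set T) : compact K -> exists n : nat, K `<=` cube n.+1%:R.
Proof.
move=> /compact_bounded[M [_ hM]].
exists (Num.bound (`|M| + 1)) => x Kx i.
suff : `|x| < (Num.bound (`|M| + 1)).+1%:R by rewrite norm_rV_lt// => /forallP.
have M1 : M < `|M| + 1 by rewrite ltr_pwDr// ler_norm.
apply: (le_lt_trans (hM _ M1 x Kx)).
apply: lt_le_trans (archi_boundP _) _; first by rewrite addr_ge0.
by rewrite ler_nat.
Qed.

Lemma closed_cube_compact (r : R) : compact [set x : T | forall i, `|x ord0 i| <= r].
Proof.
have -> : [set x : T | forall i, `|x ord0 i| <= r] =
    [set x : T | forall i, `[(- r), r]%classic (x ord0 i)].
  by apply/seteqP; split=> x /= h i; have := h i; rewrite /= in_itv/= ler_norml.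
by apply: (@rV_compact _ _ (fun=> `[- r, r]%classic)) => i; exact: segment_compact.
Qed.

Lemma closure_cube (r : R) : closure (cube r) `<=` [set x : T | forall i, `|x ord0 i| <= r].
Proof.
have := compact_closed (@norm_hausdorff _ _) (@closed_cube_compact r).
move=> /closure_id ->; apply: closureS => x h i; exact: ltW.
Qed.

Lemma cube_relatively_compact (r : R) : relatively_compact (cube r).
Proof.
apply: (subclosed_compact _ (@closed_cube_compact r)); first exact: closed_closure.
exact: closure_cube.
Qed.

Lemma continuous_bounded_cube f (r : R) : continuous f ->
  exists M : R, forall x, cube r x -> `|f x| <= M.
Proof.
move=> cf; have [r0|r0] := ltP r 0.
  case: (pselect (exists i : 'I_d, True)) => [[i _]|h].
    by exists 0 => x /(_ i) h; move: (le_lt_trans (normr_ge0 _) h); rewrite ltNge ltW.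
  exists `|f 0| => x _; suff -> : x = 0 by [].
  by apply/rowP => i; exfalso; apply: h; exists i.
have [|||c _ hc] := @EVT_max_rV R d (fun x => `|f x|) [set x | forall i, `|x ord0 i| <= r].
- by exists 0 => i; rewrite mxE normr0.
- exact: closed_cube_compact.
- by apply: continuous_subspaceT => x; apply: continuous_comp; [exact: cf|exact: norm_continuous].
by exists `|f c| => x xr; apply: hc; rewrite inE => i; exact: ltW.
Qed.

Lemma Ig_continuous (mu : {measure set T -> \bar R}) f (r : R) : 0 < r ->
  continuous f -> (forall x, ~ cube r x -> f x = 0) -> (mu (cube r) < +oo)%E ->
  Ig mu f.
Proof.
move=> r0 cf f0 mr; have [M hM] := continuous_bounded_cube r cf.
have mf := continuous_measurable_rV cf.
have mc := measurable_cube r0.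
apply/IgP; split=> //; apply: (@le_lt_trans _ _ (\int[mu]_x (`|M|%:E * (\1_(cube r) x)%:E))%E).
  apply: ge0_le_integral => //.
  - exact: mf_abs.
  - by apply: measurable_funeM; apply: mf_E; exact: measurable_indic.
  - move=> x _; rewrite lee_fin indicE; have [xr|xr] := boolP (x \in cube r).
      by rewrite mulr1 (le_trans (hM x _) (ler_norm _))//; exact: set_mem.
    by rewrite f0 ?normr0 ?mulr0//; move: xr; rewrite notin_setE.
rewrite ge0_integralZl//; last by apply: mf_E; exact: measurable_indic.
by rewrite integral_indic// setIT lte_mul_pinfty.
Qed.

Lemma is_derive_line f x (v : T) (t : R) : derivable f (x + t *: v) v ->
  is_derive t 1 (fun s => f (x + s *: v)) ('D_v f (x + t *: v)).
Proof.
have E : (fun h : R => h^-1 *: (((fun s => f (x + s *: v)) \o shift t) (h *: (1 : R)) - f (x + t *: v)))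
  = (fun h => h^-1 *: ((f \o shift (x + t *: v)) (h *: v) - f (x + t *: v))).
  apply/funext => h; congr (_ *: (_ - _)) => /=; congr f.
  by rewrite /shift /= scalerDl -[h%:A]/(h * 1) mulr1 addrCA.
by move=> df; split; rewrite /derivable /derive E.
Qed.

Lemma partial_near0 j f U : open U -> (forall x, U x -> f x = 0) ->
  forall x, U x -> partial j f x = 0.
Proof.
move=> oU f0 x Ux; rewrite /partial (near_eq_derive (g := cst 0)) ?derive_cst//.
by apply: filterS (open_nbhs_nbhs (conj oU Ux)) => y /f0.
Qed.

End rV_topology.

(** * Lebesgue measure on ['rV[R]_d] and integrals of partial derivatives *)

Section lebesgue_finite.
Context {R : realType}.

Lemma lebesgue_rV_cube d (r : R) : 0 < r -> (lebesgue_rV d (cube r) < +oo)%E.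
Proof.
move=> r0; elim: d => [|d IH].
  by rewrite /= diracE ltry.
have mc := @measurable_cube R d.+1 _ r0.
rewrite /= /lebesgue_cons /pushforward.
pose I : set (measurableTypeR R) := `](- r), r[%classic.
apply: (@le_lt_trans _ _ ((lebesgue_rV d \x lebesgue_measure)%E (cube r `*` I))).
  apply: le_measure; rewrite ?inE//.
  - rewrite -[X in measurable X]setTI; exact: measurable_rV_cons.
  - by apply: measurableX; [exact: measurable_cube|exact: measurable_itv].
  - move=> [p t] /= h; split=> /=; last first.
      by have := h ord0; rewrite mxE unlift_none /I/= in_itv/= ltr_norml.
    by move=> i; have := h (lift ord0 i); rewrite mxE liftK.
rewrite product_measure1E; [|exact: measurable_cube|exact: measurable_itv].
rewrite lte_mul_pinfty//; first by rewrite ge0_fin_numE.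
have h (a b : R) : (@lebesgue_measure R `]a, b[%classic < +oo)%E.
  by rewrite lebesgue_measure_itv/=; case: ifP => _; rewrite -?EFinD ltry.
exact: h.
Qed.

Lemma lebesgue_rV_sigma_finite d : sigma_finite setT (@lebesgue_rV R d).
Proof.
exists (fun n => cube n.+1%:R) => [|n].
  apply/esym/seteqP; split=> // x _; have [n hn] := mem_cube x.
  by exists n => //; apply: cubeS hn; rewrite ler_nat.
by split; [exact: measurable_cube|exact: lebesgue_rV_cube].
Qed.

(* The measure lebesgue_rV d is a bundled record; a function is needed as a key
   for the sigma-finite instance used by Fubini's theorem. *)
Definition lebesgue_sf d (U : set 'rV[R]_d) : \bar R := lebesgue_rV d U.

HB.instance Definition _ d := isMeasure.Build _ _ _ (@lebesgue_sf d)
  (measure0 (lebesgue_rV d)) (measure_ge0 (lebesgue_rV d))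
  (@measure_semi_sigma_additive _ _ _ (lebesgue_rV d)).

HB.instance Definition _ d :=
  Measure_isSigmaFinite.Build _ _ _ (@lebesgue_sf d) (lebesgue_rV_sigma_finite d).

Lemma Rint_lebesgueS d (f : 'rV[R]_d.+1 -> R) : Ig (lebesgue_rV d.+1) f ->
  Ig (@lebesgue_sf d \x lebesgue_measure)%E (f \o @rV_cons R d) /\
  \int[lebesgue_rV d.+1]_x f x =
  \int[(@lebesgue_sf d \x lebesgue_measure)%E]_p f (@rV_cons R d p).
Proof.
move=> /integrableP[mf fi].
have mc := @measurable_rV_cons R d.
have i1 : Ig (@lebesgue_sf d \x lebesgue_measure)%E (f \o @rV_cons R d).
  apply/integrableP; split; first exact: measurableT_comp mf mc.
  move: fi; rewrite ge0_integral_pushforward// ?preimage_setT//.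
  exact: measurableT_comp.
split=> //; congr fine; rewrite integral_pushforward// preimage_setT//.
Qed.

Lemma Rint_derive_compact (h : R -> R) (r : R) : 0 < r ->
  (forall t, derivable h t 1) -> continuous (fun t => 'D_1 h t) ->
  (forall t, r <= `|t| -> h t = 0) -> (forall t, r < `|t| -> 'D_1 h t = 0) ->
  (\int[lebesgue_measure]_t ('D_1 h t)%:E = 0)%E.
Proof.
move=> r0 dh ch h0 dh0.
have rr : - r < r by rewrite -subr_gt0 opprK addr_gt0.
have cth : continuous h.
  by move=> t; exact/differentiable_continuous/derivable1_diffP.
have hr : h r = 0 by apply: h0; rewrite ger0_norm// ltW.
have hnr : h (- r) = 0 by apply: h0; rewrite normrN ger0_norm// ltW.
have := @continuous_FTC2 R (fun t => 'D_1 h t) h (- r) r rr.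
rewrite hr hnr sube0.
move=> ftc; rewrite -[RHS]/(0%:E) -ftc.
- rewrite [RHS]integral_mkcond; apply: eq_integral => t _.
  rewrite patchE; case: ifPn => //; rewrite notin_setE/= in_itv/= => /negP.
  by rewrite -ler_norml -ltNge => /dh0 ->.
- exact: continuous_subspaceT.
- by split=> [t _|//|//]; [exact: dh|exact/cvg_at_right_filter/cth|exact/cvg_at_left_filter/cth].
- by move=> t _; rewrite derive1E.
Qed.

Lemma rV_consD d (p : 'rV[R]_d) (t s : R) :
  rV_cons (p, t + s : measurableTypeR R) =
  rV_cons (p, t : measurableTypeR R) + s *: delta_mx ord0 ord0.
Proof.
apply/rowP => i; rewrite !mxE /=; case: unliftP => [j ->|->] /=.
  by rewrite mulr0 addr0.
by rewrite mulr1.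
Qed.

Lemma rV_consDl d (p : 'rV[R]_d) (t s : R) (j : 'I_d) :
  rV_cons (p + s *: delta_mx ord0 j, t : measurableTypeR R) =
  rV_cons (p, t : measurableTypeR R) + s *: delta_mx ord0 (lift ord0 j).
Proof.
apply/rowP => i; rewrite !mxE /=; case: unliftP => [k ->|->] /=.
  by rewrite !mxE/= (inj_eq (@lift_inj _ _)).
by rewrite mulr0 addr0.
Qed.

Lemma continuous_rV_cons1 d (t : measurableTypeR R) :
  continuous (fun p : 'rV[R]_d => rV_cons (p, t)).
Proof.
move=> z V /nbhs_ballP[e /= e0 eV]; apply/nbhs_ballP; exists e => // w wz; apply: eV.
rewrite ball_rVE// => i; rewrite !mxE/=; case: unliftP => [j _|_] /=.
  by have := wz; rewrite ball_rVE// => /(_ j).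
by rewrite subrr normr0.
Qed.

Lemma continuous_rV_cons2 d (p : 'rV[R]_d) :
  continuous (fun t : R => rV_cons (p, t : measurableTypeR R)).
Proof.
move=> z V /nbhs_ballP[e /= e0 eV]; apply/nbhs_ballP; exists e => // w wz; apply: eV.
rewrite ball_rVE// => i; rewrite !mxE/=; case: unliftP => [j _|_] //=.
by rewrite subrr normr0.
Qed.

(** Induction on the dimension by Fubini, with the order of integration chosen by the direction: the
    added coordinate has index [ord0], so for [j = ord0] the inner integral vanishes by the
    fundamental theorem of calculus, and otherwise the slices fall under the induction
    hypothesis. *)
Lemma Rint_lebesgue_partial d (j : 'I_d) (f : 'rV[R]_d -> R) (r : R) : 0 < r ->
  continuous f -> (forall x, derivable f x (delta_mx ord0 j)) ->
  continuous (partial j f) -> (forall x, ~ cube r x -> f x = 0) ->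
  \int[lebesgue_rV d]_x partial j f x = 0.
Proof.
move=> r0; elim: d j f => [[]//|d IH] j f cf df cpf f0.
(* The margin 1 leaves a whole ball around [x] on which [f] vanishes, hence a zero derivative. *)
have pf0 x : ~ cube (r + 1) x -> partial j f x = 0.
  move=> xr; apply: (@partial_near0 _ _ j f (ball x 1)).
  - exact: ball_open.
  - move=> y; rewrite ball_rVE// => xy; apply: f0 => yr; apply: xr => i.
    rewrite -(subrK (y ord0 i) (x ord0 i)) (le_lt_trans (ler_normD _ _))//.
    by rewrite addrC ltrD.
  - exact: ballxx.
have r1 : 0 < r + 1 by rewrite addr_gt0.
have ig : Ig (lebesgue_rV d.+1) (partial j f).
  by apply: Ig_continuous cpf pf0 _ => //; exact: lebesgue_rV_cube.
have [ig2 ->] := Rint_lebesgueS ig.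
case: (unliftP ord0 j) => [k jk|j0].
- rewrite /Rintegral -integral21_prod_meas1// integral0_eq// => t _.
  set h := fun p : 'rV[R]_d => f (rV_cons (p, t)).
  have dE p : (fun s : R => s^-1 *: ((f \o shift (rV_cons (p, t))) (s *: delta_mx ord0 j) - f (rV_cons (p, t)))) =
      (fun s => s^-1 *: ((h \o shift p) (s *: delta_mx ord0 k) - h p)).
    apply/funext => s /=.
    by rewrite /h /shift /= jk [s *: _ + p]addrC rV_consDl [s *: _ + _]addrC.
  have hE p : partial j f (rV_cons (p, t)) = partial k h p.
    by rewrite /partial /derive dE.
  have cc : continuous (fun p : 'rV[R]_d => rV_cons (p, t)) := @continuous_rV_cons1 d t.
  have h0 : \int[lebesgue_rV d]_p partial k h p = 0.
    apply: IH.
    + by move=> p; apply: continuous_comp; [exact: cc|exact: cf].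
    + by move=> p; have := df (rV_cons (p, t)); rewrite /derivable dE.
    + rewrite (_ : partial k h = (fun p => partial j f (rV_cons (p, t)))); last first.
        by apply/funext => p; rewrite hE.
      by move=> p; apply: continuous_comp; [exact: cc|exact: cpf].
    + move=> p pr; apply: f0 => h0; apply: pr => i.
      by have := h0 (lift ord0 i); rewrite mxE liftK.
  have ik : Ig (lebesgue_rV d) (partial k h).
    apply: (@Ig_continuous _ _ _ _ (r + 1)) => //; last exact: lebesgue_rV_cube.
      rewrite (_ : partial k h = (fun p => partial j f (rV_cons (p, t)))); last first.
        by apply/funext => p; rewrite hE.
      by move=> p; apply: continuous_comp; [exact: cc|exact: cpf].
    move=> p pr; rewrite -hE; apply: pf0 => h1; apply: pr => i.
    by have := h1 (lift ord0 i); rewrite mxE liftK.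
  move: h0; rewrite /Rintegral => /eqP.
  rewrite fine_eq0 ?(integrable_fin_num _ ik)// => /eqP h0.
  by rewrite -[RHS]h0; apply: eq_integral => p _ /=; rewrite hE.
- rewrite /Rintegral -integral12_prod_meas1// integral0_eq// => p _.
  set h := fun t : R => f (rV_cons (p, t : measurableTypeR R)).
  pose X0 := rV_cons (p, 0 : measurableTypeR R).
  have hline (t : R) : rV_cons (p, t : measurableTypeR R) = X0 + t *: delta_mx ord0 j.
    by rewrite j0 /X0 -rV_consD add0r.
  have dhE (t : R) : is_derive t 1 h (partial j f (rV_cons (p, t : measurableTypeR R))).
    have hE : h = (fun s => f (X0 + s *: delta_mx ord0 j)).
      by apply/funext => s; rewrite /h hline.
    by rewrite hE /partial hline; apply: is_derive_line; exact: df.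
  have cc := @continuous_rV_cons2 d p.
  have E : (fun t => 'D_1 h t) = (fun t => partial j f (rV_cons (p, t : measurableTypeR R))).
    by apply/funext => t; have [_ ->] := dhE t.
  have dh t : 'D_1 h t = partial j f (rV_cons (p, t : measurableTypeR R)).
    by have [_ ->] := dhE t.
  have z : (\int[lebesgue_measure]_t ('D_1 h t)%:E = 0)%E.
    apply: (@Rint_derive_compact h (r + 1)) => //.
    + by rewrite E => t; apply: continuous_comp; [exact: cc|exact: cpf].
    + move=> t tr; apply: f0 => /(_ ord0); rewrite mxE unlift_none ltNge.
      by rewrite (le_trans _ tr)// lerDl.
    + move=> t tr; rewrite dh; apply: pf0 => /(_ ord0).
      by rewrite mxE unlift_none ltNge ltW.
  by rewrite -[RHS]z; apply: eq_integral => t _; rewrite dh.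
Qed.

End lebesgue_finite.

(** * Smoothness along a family of directions *)

Section directional.
Context {R : realType} {V : normedModType R}.
Implicit Types (f : V -> R) (F : R -> R) (x v : V).

Lemma derivable_lineP f x v :
  derivable f x v <-> derivable (fun t : R => f (x + t *: v)) 0 1.
Proof.
rewrite /derivable.
have -> : (fun h : R => h^-1 *: ((f \o shift x) (h *: v) - f x)) =
  (fun h => h^-1 *: (((fun t : R => f (x + t *: v)) \o shift 0) (h *: (1 : R)) - f (x + 0 *: v))).
  apply/funext => h /=; rewrite /shift /= scale0r addr0 addr0 -[h%:A]/(h * 1) mulr1.
  by rewrite [h *: v + x]addrC.
by [].
Qed.

Lemma derive_lineE f x v : 'D_v f x = 'D_1 (fun t : R => f (x + t *: v)) 0.
Proof.
rewrite /derive.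
have -> : (fun h : R => h^-1 *: ((f \o shift x) (h *: v) - f x)) =
  (fun h => h^-1 *: (((fun t : R => f (x + t *: v)) \o shift 0) (h *: (1 : R)) - f (x + 0 *: v))).
  apply/funext => h /=; rewrite /shift /= scale0r addr0 addr0 -[h%:A]/(h * 1) mulr1.
  by rewrite [h *: v + x]addrC.
by [].
Qed.

Lemma is_derive_comp F f x v : derivable f x v -> derivable F (f x) 1 ->
  is_derive x v (F \o f) ('D_1 F (f x) * 'D_v f x).
Proof.
move=> df dF.
have /derivableP h1 := (derivable_lineP f x v).1 df.
have h2 : is_derive ((fun t : R => f (x + t *: v)) 0) 1 F ('D_1 F (f x)).
  by rewrite scale0r addr0; exact/derivableP.
have [h3 h4] := @is_derive1_comp _ F (fun t : R => f (x + t *: v)) 0 _ _ h2 h1.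
split; first exact/derivable_lineP.
by rewrite derive_lineE h4 -derive_lineE.
Qed.

Variables (I : Type) (e : I -> V).

(** [smooth] with an arbitrary family of directions: the coordinate vectors give back [smooth], and
    a single direction indexed by [unit] gives the smooth functions on the line. *)
Definition dsmooth f : Prop := forall s : seq I,
  continuous (foldr (fun j g x => 'D_(e j) g x) f s) /\
  forall (j : I) x, derivable (foldr (fun j g x => 'D_(e j) g x) f s) x (e j).

Lemma dsmooth_coind (P : set (V -> R)) :
  (forall f, P f -> [/\ continuous f, forall j x, derivable f x (e j) &
     forall j, P (fun x => 'D_(e j) f x)]) -> forall f, P f -> dsmooth f.
Proof.
move=> h f Pf s; have : P (foldr (fun j g x => 'D_(e j) g x) f s).
  by elim: s => //= j s /h[_ _]; exact.
by move/h => [? ? _].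
Qed.

Lemma dsmooth_derive j f : dsmooth f -> dsmooth (fun x => 'D_(e j) f x).
Proof. by move=> h s; have := h (rcons s j); rewrite foldr_rcons. Qed.

(** Derivatives of products, inverses and compositions are polynomial expressions in functions
    already at hand. Closing a class under sums and products therefore yields a class stable under
    differentiation, which is what [dsmooth_coind] asks for. *)
Inductive ring_closure (B : set (V -> R)) : set (V -> R) :=
| rc_base f of B f : ring_closure B f
| rc_cst (c : R) : ring_closure B (fun=> c)
| rc_add f g of ring_closure B f & ring_closure B g : ring_closure B (fun x => f x + g x)
| rc_mul f g of ring_closure B f & ring_closure B g : ring_closure B (fun x => f x * g x).

Lemma rc_eq (B : set (V -> R)) f g : ring_closure B f -> f =1 g -> ring_closure B g.
Proof. by move=> Bf /funext <-. Qed.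

Lemma dsmooth_ring_closure (B : set (V -> R)) :
  (forall f, B f -> [/\ continuous f, forall j x, derivable f x (e j) &
     forall j, ring_closure B (fun x => 'D_(e j) f x)]) ->
  forall f, ring_closure B f -> dsmooth f.
Proof.
move=> h; apply: dsmooth_coind => f; elim=> {f} [f /h//|c|f g _ [cf df hf] _ [cg dg hg]|f g Bf [cf df hf] Bg [cg dg hg]].
- split; [by move=> x; exact: cvg_cst|by move=> j x; exact: derivable_cst|].
  by move=> j; under eq_fun do rewrite derive_cst; exact: rc_cst.
- split.
  + by move=> x; apply: cvgD; [exact: cf|exact: cg].
  + by move=> j x; apply: derivableD.
  + move=> j; rewrite (_ : (fun _ => _) = (fun x => 'D_(e j) f x + 'D_(e j) g x)).
      exact: rc_add.
    by apply/funext => x; exact: deriveD.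
- split.
  + by move=> x; apply: cvgM; [exact: cf|exact: cg].
  + by move=> j x; apply: derivableM.
  + move=> j; rewrite (_ : (fun _ => _) = (fun x => f x * 'D_(e j) g x + g x * 'D_(e j) f x)).
      by apply: rc_add; exact: rc_mul.
    by apply/funext => x; exact: deriveM.
Qed.

Lemma dsmooth_cont f : dsmooth f -> continuous f. Proof. by move=> /(_ [::])[]. Qed.

Lemma dsmooth_der f j x : dsmooth f -> derivable f x (e j).
Proof. by move=> /(_ [::])[_]. Qed.

Lemma dsmoothP f : dsmooth f -> [/\ continuous f, forall j x, derivable f x (e j) &
  forall j, ring_closure dsmooth (fun x => 'D_(e j) f x)].
Proof.
move=> hf; split; [exact: dsmooth_cont|by move=> *; exact: dsmooth_der|].
by move=> j; apply: rc_base; exact: dsmooth_derive.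
Qed.

Lemma dsmooth_cst c : dsmooth (fun=> c).
Proof. by apply: dsmooth_ring_closure dsmoothP _ _; exact: rc_cst. Qed.

Lemma dsmoothD f g : dsmooth f -> dsmooth g -> dsmooth (fun x => f x + g x).
Proof. by move=> *; apply: dsmooth_ring_closure dsmoothP _ _; apply: rc_add; exact: rc_base. Qed.

Lemma dsmoothM f g : dsmooth f -> dsmooth g -> dsmooth (fun x => f x * g x).
Proof. by move=> *; apply: dsmooth_ring_closure dsmoothP _ _; apply: rc_mul; exact: rc_base. Qed.

Lemma dsmoothV f : dsmooth f -> (forall x, f x != 0) -> dsmooth (fun x => (f x)^-1).
Proof.
move=> hf f0.
(* The derivative of [f^-1] is [- f^-1 * f^-1 * f'], a polynomial in [f^-1] and smooth functions. *)
pose B : set (V -> R) := [set g | dsmooth g \/ g = (fun x => (f x)^-1)].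
apply: (@dsmooth_ring_closure B); last by apply: rc_base; right.
move=> g [hg|->].
  have [h1 h2 _] := dsmoothP hg.
  by split=> // j; apply: rc_base; left; exact: dsmooth_derive.
split.
- by move=> x; apply: cvgV => //; exact: dsmooth_cont.
- by move=> j x; apply: derivableV => //; exact: dsmooth_der.
- move=> j; rewrite (_ : (fun _ => _) =
     (fun x => -1 * (((f x)^-1 * (f x)^-1) * 'D_(e j) f x))).
    apply: rc_mul; first exact: rc_cst.
    apply: rc_mul; last by apply: rc_base; left; exact: dsmooth_derive.
    by apply: rc_mul; apply: rc_base; right.
  apply/funext => x; rewrite deriveV//; last exact: dsmooth_der.
  by rewrite mulN1r -expr2 exprVn -scaleNr.
Qed.

End directional.

(** * Smooth functions of one variable *)

Section smooth1.
Context {R : realType}.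
Implicit Types (F G : R -> R).

Definition smooth1 F := dsmooth (fun _ : unit => 1 : R) F.

Lemma smooth1_der F x : smooth1 F -> derivable F x 1.
Proof. by move=> /(_ [::])[_ /(_ tt x)]. Qed.

Lemma smooth1_derive F : smooth1 F -> smooth1 (fun x => 'D_1 F x).
Proof. exact: (dsmooth_derive tt). Qed.

Lemma dsmooth_comp (V : normedModType R) (I : Type) (e : I -> V) F f :
  smooth1 F -> dsmooth e f -> dsmooth e (fun x => F (f x)).
Proof.
move=> hF hf.
pose B : set (V -> R) := [set g | dsmooth e g \/ exists2 H, smooth1 H & g = (fun x => H (f x))].
apply: (@dsmooth_ring_closure _ _ _ e B); last by apply: rc_base; right; exists F.
move=> g [hg|[H hH ->]].
  have [h1 h2 _] := dsmoothP hg.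
  by split=> // j; apply: rc_base; left; exact: dsmooth_derive.
have dH x : derivable H x 1 by exact: smooth1_der.
have df j x : derivable f x (e j) by exact: dsmooth_der.
split.
- move=> x; apply: continuous_comp; first exact: (dsmooth_cont hf).
  exact: (dsmooth_cont hH).
- by move=> j x; have [] := is_derive_comp (df j x) (dH (f x)).
- move=> j; rewrite (_ : (fun _ => _) = (fun x => (fun y => 'D_1 H y) (f x) * 'D_(e j) f x)).
    apply: rc_mul; apply: rc_base; last by left; exact: dsmooth_derive.
    by right; exists (fun y => 'D_1 H y); [exact: smooth1_derive|].
  by apply/funext => x; have [_ ->] := is_derive_comp (df j x) (dH (f x)).
Qed.

Lemma smooth1_id : smooth1 id.
Proof.
pose B : set (R -> R) := [set id].
apply: (@dsmooth_ring_closure _ _ _ (fun _ : unit => 1 : R) B); last exact: rc_base.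
move=> _ ->; split; [by move=> x; exact: cvg_id|by move=> _ x; exact: derivable_id|].
by move=> _; apply: (rc_eq (rc_cst B 1)) => x; rewrite derive_id.
Qed.

(* The functions x^-n exp(-1/x) extended by 0 to x <= 0; their span is stable
   under differentiation. *)
Definition flat n (x : R) : R := if 0 < x then x^-1 ^+ n * expR (- x^-1) else 0.

Lemma flat_ge0 n x : 0 <= flat n x.
Proof.
rewrite /flat; case: ifPn => // x0.
by rewrite mulr_ge0 ?expR_ge0// exprn_ge0// invr_ge0 ltW.
Qed.

(** The term of order [n.+2] of the exponential series at [x^-1] absorbs [x^-1 ^+ n] and leaves a
    factor [x ^+ 2], so that the difference quotient at 0 tends to 0. *)
Lemma flat_le n (x : R) : `|flat n x| <= n.+2`!%:R * x ^+ 2.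
Proof.
rewrite ger0_norm ?flat_ge0// /flat; case: ifPn => x0; last first.
  by rewrite mulr_ge0// sqr_ge0.
set y := x^-1; have y0 : 0 < y by rewrite invr_gt0.
have -> : x = y^-1 by rewrite invrK.
have := @expR_ge1Dxn R y n.+1 (ltW y0).
have f0 : 0 < n.+2`!%:R :> R by rewrite ltr0n fact_gt0.
move=> h; have {}h : y ^+ n.+2 / n.+2`!%:R <= expR y by apply: le_trans h; rewrite lerDr.
rewrite expRN -[leLHS]mulrC ler_pdivrMl ?expR_gt0//.
rewrite mulrA -ler_pdivrMr ?exprn_gt0 ?invr_gt0//.
rewrite [y^-1 ^+ 2]exprVn invrK -exprD addn2 -ler_pdivrMr//.
Qed.

Lemma flat_derive (n : nat) (x : R) :
  is_derive x 1 (flat n) (- n%:R * flat n.+1 x + flat n.+2 x).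
Proof.
have [x0|x0|->] := ltgtP x 0.
- apply: (@near_eq_is_derive _ _ _ (cst 0)) => //.
    have : \forall y \near x, y < 0 by exact: lt_nbhsl.
    by apply: filterS => y y0; rewrite /flat ltNge (ltW y0).
  by apply: is_derive_eq; rewrite /flat ltNge (ltW x0)/= mulr0 addr0.
- apply: (@near_eq_is_derive _ _ _ (fun y : R => y^-1 ^+ n * expR (- y^-1))).
    have : \forall y \near x, 0 < y by exact: lt_nbhsr.
    by apply: filterS => y y0; rewrite /flat y0.
  have xn0 : x != 0 by rewrite gt_eqF.
  have iV : is_derive x 1 (fun y : R => y^-1) (- x ^- 2).
    by split; [exact: derivableV|rewrite deriveV// derive_id -[RHS]mulr1].
  have iE : is_derive x 1 (fun y : R => expR (- y^-1)) (expR (- x^-1) * x ^- 2).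
    apply: (@is_derive1_comp _ expR (fun y : R => - y^-1)).
    by rewrite -[x ^- 2]opprK; exact: is_deriveN.
  have iX : is_derive x 1 (fun y : R => y^-1 ^+ n) (n%:R * x^-1 ^+ n.-1 * - x ^- 2).
    apply: (@is_derive1_comp _ (fun z : R => z ^+ n) (fun y : R => y^-1)).
    split; first exact: exprn_derivable.
    by rewrite exp_derive -[RHS]mulr1.
  have [X1 X2] := iX; have [E1 E2] := iE.
  split; first exact: (derivableM X1 E1).
  have -> := deriveM X1 E1; rewrite X2 E2.
  clear iX X1 X2 iE E1 E2; rewrite /flat x0 /= -!exprVn /GRing.scale/=.
  by case: n => [|n]; rewrite /= ?expr0 ?exprS; ring.
- rewrite /flat ltxx mulr0 addr0.
  have fl : h^-1 *: ((flat n \o shift 0) (h *: (1 : R)) - flat n 0) @[h --> 0^'] --> (0 : R).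
    apply/norm_cvg0P; apply: (@squeeze_cvgr _ _ _ _ (fun=> 0) (fun h => n.+2`!%:R * `|h|)).
    - near=> h; rewrite normr_ge0/= /shift/= addr0 -[h%:A]/(h * 1) mulr1.
      rewrite [X in _ - X](_ : _ = 0) ?subr0; last by rewrite /flat ltxx.
      rewrite normrM normfV; have h0 : h != 0 by near: h; exact: nbhs_dnbhs_neq.
      rewrite ler_pdivrMl ?normr_gt0// (le_trans (flat_le n h))//.
      by rewrite [leRHS]mulrCA -[`|h| * `|h|]expr2 real_normK ?num_real.
    - exact: cvg_cst.
    - rewrite -[X in _ --> X](mulr0 n.+2`!%:R); apply: cvgM; first exact: cvg_cst.
      apply/norm_cvg0P; exact: nbhs_dnbhs.
  split; first by apply/cvg_ex; exists 0.
  by apply/cvg_lim => //; exact: fl.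
Unshelve. all: by end_near. Qed.

Lemma flat_smooth n : smooth1 (flat n).
Proof.
pose B : set (R -> R) := [set g | exists m, g = flat m].
apply: (@dsmooth_ring_closure _ _ _ (fun _ : unit => 1 : R) B); last by apply: rc_base; exists n.
move=> g [m ->]; have df x : derivable (flat m) x 1 by have [] := flat_derive m x.
split=> //.
- by move=> x; exact/differentiable_continuous/derivable1_diffP.
- move=> _; rewrite (_ : (fun _ => _) = (fun x => - m%:R * flat m.+1 x + flat m.+2 x)).
    apply: rc_add; last by apply: rc_base; exists m.+2.
    by apply: rc_mul; [exact: rc_cst|apply: rc_base; exists m.+1].
  by apply/funext => x; have [_ ->] := flat_derive m x.
Qed.

Lemma flat0_gt0 (x : R) : 0 < x -> 0 < flat 0 x.
Proof. by move=> x0; rewrite /flat x0 expr0 mul1r expR_gt0. Qed.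

Lemma flat0_le0 n (x : R) : x <= 0 -> flat n x = 0.
Proof. by move=> x0; rewrite /flat ltNge x0. Qed.

Lemma smooth1D F G : smooth1 F -> smooth1 G -> smooth1 (fun x => F x + G x).
Proof. exact: dsmoothD. Qed.
Lemma smooth1M F G : smooth1 F -> smooth1 G -> smooth1 (fun x => F x * G x).
Proof. exact: dsmoothM. Qed.
Lemma smooth1_cst c : smooth1 (fun=> c).
Proof. exact: dsmooth_cst. Qed.
Lemma smooth1V F : smooth1 F -> (forall x, F x != 0) -> smooth1 (fun x => (F x)^-1).
Proof. exact: dsmoothV. Qed.
Lemma smooth1_comp F G : smooth1 F -> smooth1 G -> smooth1 (fun x => F (G x)).
Proof. exact: dsmooth_comp. Qed.
Lemma smooth1_affine a b : smooth1 (fun x => a * x + b).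
Proof.
by apply: smooth1D; [apply: smooth1M; [exact: smooth1_cst|exact: smooth1_id]|exact: smooth1_cst].
Qed.

Definition step (x : R) : R := flat 0 x / (flat 0 x + flat 0 (1 - x)).

Lemma step_den (x : R) : 0 < flat 0 x + flat 0 (1 - x).
Proof.
have [x0|x0] := ltP 0 x; first exact: ltr_pwDl (flat0_gt0 x0) (flat_ge0 _ _).
apply: ltr_wpDl (flat_ge0 _ _) (flat0_gt0 _).
by rewrite subr_gt0 (le_lt_trans x0).
Qed.

Lemma step_smooth : smooth1 step.
Proof.
have h : smooth1 (fun x => flat 0 (1 - x)).
  have := smooth1_comp (flat_smooth 0) (smooth1_affine (-1) 1).
  by congr smooth1; apply/funext => x; congr flat; ring.
apply: smooth1M; first exact: flat_smooth.
apply: smooth1V; first by apply: smooth1D; [exact: flat_smooth|exact: h].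
by move=> x; rewrite gt_eqF// step_den.
Qed.

Lemma step_ge0 x : 0 <= step x.
Proof. by rewrite divr_ge0 ?flat_ge0// ltW// step_den. Qed.

Lemma step_le1 x : step x <= 1.
Proof. by rewrite ler_pdivrMr ?step_den// mul1r lerDl flat_ge0. Qed.

Lemma step_le0 x : x <= 0 -> step x = 0.
Proof. by move=> x0; rewrite /step flat0_le0// mul0r. Qed.

Lemma step_ge1 x : 1 <= x -> step x = 1.
Proof.
move=> x1; rewrite /step [flat 0 (1 - x)]flat0_le0 ?addr0 ?divff//; last by rewrite subr_le0.
by rewrite gt_eqF// flat0_gt0//; exact: lt_le_trans x1.
Qed.

End smooth1.

(** * Test functions, bumps and cut-offs *)

Section test_functions.
Context {R : realType} {d : nat}.
Local Notation T := 'rV[R]_d.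
Implicit Types (f g : T -> R) (V : set T).

Local Notation ev := (fun j : 'I_d => delta_mx ord0 j : T).

Lemma smooth_cont f : smooth f -> continuous f.
Proof. exact: (@dsmooth_cont _ _ _ ev). Qed.
Lemma smooth_der f j x : smooth f -> derivable f x (delta_mx ord0 j).
Proof. exact: (@dsmooth_der _ _ _ ev). Qed.
Lemma smooth_partial f j : smooth f -> smooth (partial j f).
Proof. exact: (@dsmooth_derive _ _ _ ev). Qed.
Lemma smoothD f g : smooth f -> smooth g -> smooth (fun x => f x + g x).
Proof. exact: (@dsmoothD _ _ _ ev). Qed.
Lemma smoothM f g : smooth f -> smooth g -> smooth (fun x => f x * g x).
Proof. exact: (@dsmoothM _ _ _ ev). Qed.
Lemma smooth_cst (c : R) : smooth (fun _ : T => c).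
Proof. exact: (@dsmooth_cst _ _ _ ev). Qed.
Lemma smooth_comp F f : smooth1 F -> smooth f -> smooth (fun x => F (f x)).
Proof. exact: (@dsmooth_comp _ _ _ ev). Qed.

Lemma partialD j f g x : smooth f -> smooth g ->
  partial j (fun x => f x + g x) x = partial j f x + partial j g x.
Proof. by move=> hf hg; apply: deriveD; exact: smooth_der. Qed.

Lemma partialM j f g x : smooth f -> smooth g ->
  partial j (fun x => f x * g x) x = f x * partial j g x + g x * partial j f x.
Proof. by move=> hf hg; apply: deriveM; exact: smooth_der. Qed.

Lemma partial_cst j (c : R) (x : T) : partial j (fun _ : T => c) x = 0.
Proof. exact: derive_cst. Qed.

Lemma partialZ j c f x : smooth f ->
  partial j (fun x => c * f x) x = c * partial j f x.
Proof.
move=> hf; rewrite partialM//; last exact: smooth_cst.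
by rewrite partial_cst mulr0 addr0.
Qed.

Lemma partial_comp j F f x : smooth1 F -> smooth f ->
  partial j (fun x => F (f x)) x = 'D_1 F (f x) * partial j f x.
Proof.
move=> hF hf.
by have [_ h] := is_derive_comp (@smooth_der f j x hf) (@smooth1_der _ F (f x) hF); exact: h.
Qed.

Lemma coord_derive (i : 'I_d) (x v : T) :
  is_derive x v (fun y : T => y ord0 i) (v ord0 i).
Proof.
have E : (fun t : R => (x + t *: v) ord0 i) = (fun t => v ord0 i * t + x ord0 i).
  by apply/funext => t; rewrite !mxE addrC mulrC.
have h : is_derive (0 : R) 1 (fun t : R => v ord0 i * t + x ord0 i) (v ord0 i).
  apply: is_derive_eq; rewrite addr0; exact: mulr1.
have [h1 h2] := h.
split; first by apply/derivable_lineP; rewrite E.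
by rewrite derive_lineE E h2.
Qed.

Lemma smooth_coord (i : 'I_d) : smooth (fun x : T => x ord0 i).
Proof.
pose B : set (T -> R) := [set (fun x : T => x ord0 i)].
apply: (@dsmooth_ring_closure _ _ _ ev B); last exact: rc_base.
move=> _ ->; split.
- exact: coord_continuous.
- by move=> j x; have [] := coord_derive i x (ev j).
- move=> j; apply: (rc_eq (rc_cst B (ev j ord0 i))) => x.
  by have [_ ->] := coord_derive i x (ev j).
Qed.

Lemma smooth_prod (I : Type) (s : seq I) (F : I -> T -> R) :
  (forall i, smooth (F i)) -> smooth (fun x => \prod_(i <- s) F i x).
Proof.
move=> hF; elim: s => [|i s IH].
  by under eq_fun do rewrite big_nil; exact: smooth_cst.
by under eq_fun do rewrite big_cons; exact: smoothM.
Qed.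

Definition box (a b : T) : set T := [set x | forall i, a ord0 i < x ord0 i < b ord0 i].

(** [c] is a slope: the value is 1 at distance at least [c^-1] from every face of the box, and the
    functions tend to the indicator of the box as [c] grows. [cutoff] is the case of slope 1. *)
Definition bump (c : R) (a b x : T) : R :=
  \prod_i (step (c * x ord0 i + (- c * a ord0 i)) * step (- c * x ord0 i + c * b ord0 i)).

Lemma bump_smooth c a b : smooth (bump c a b).
Proof.
apply: smooth_prod => i; apply: smoothM.
  apply: (@smooth_comp _ (fun x : T => c * x ord0 i + (- c * a ord0 i))); first exact: step_smooth.
  apply: smoothD; last exact: smooth_cst.
  by apply: smoothM; [exact: smooth_cst|exact: smooth_coord].
apply: (@smooth_comp _ (fun x : T => - c * x ord0 i + c * b ord0 i)); first exact: step_smooth.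
apply: smoothD; last exact: smooth_cst.
by apply: smoothM; [exact: smooth_cst|exact: smooth_coord].
Qed.

Lemma bump_ge0 c a b x : 0 <= bump c a b x.
Proof. by apply: prodr_ge0 => i _; rewrite mulr_ge0 ?step_ge0. Qed.

Lemma bump_le1 c a b x : bump c a b x <= 1.
Proof.
by apply: prodr_ile1 => i _; rewrite mulr_ge0 ?step_ge0//= mulr_ile1 ?step_ge0 ?step_le1.
Qed.

Lemma bump_out c a b x : 0 <= c -> ~ box a b x -> bump c a b x = 0.
Proof.
move=> c0 /existsNP[i /negP]; rewrite negb_and -!leNgt => h.
rewrite /bump (bigD1 i)//=.
suff -> : step (c * x ord0 i + (- c * a ord0 i)) * step (- c * x ord0 i + c * b ord0 i) = 0.
  by rewrite mul0r.
case/orP: h => h; [rewrite step_le0 ?mul0r//|rewrite [X in _ * X]step_le0 ?mulr0//].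
  by rewrite mulNr -mulrBr mulr_ge0_le0// subr_le0.
by rewrite mulNr addrC -mulrBr mulr_ge0_le0// subr_le0.
Qed.

Lemma bump_in (c : R) (a b x : T) : (forall i, 1 <= c * (x ord0 i - a ord0 i) /\ 1 <= c * (b ord0 i - x ord0 i)) ->
  bump c a b x = 1.
Proof.
move=> h; rewrite /bump big1// => i _; have [h1 h2] := h i.
by rewrite !step_ge1 ?mulr1// mulNr ?[- _ + _]addrC -mulrBr.
Qed.

Lemma bump_cvg (a b x : T) : bump n%:R a b x @[n --> \oo] --> (\1_(box a b) x : R).
Proof.
have [xb|xb] := pselect (box a b x); last first.
  rewrite indicE memNset//; under eq_fun do rewrite bump_out//.
  exact: cvg_cst.
rewrite indicE mem_set//; apply: cvg_near_cst.
have /choice[N hN] : forall i, exists N, forall n, (N <= n)%N ->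
   1 <= n%:R * (x ord0 i - a ord0 i) /\ 1 <= n%:R * (b ord0 i - x ord0 i).
  move=> i; have /andP[ax xbi] := xb i.
  have p1 : 0 < x ord0 i - a ord0 i by rewrite subr_gt0.
  have p2 : 0 < b ord0 i - x ord0 i by rewrite subr_gt0.
  exists (maxn (Num.bound (x ord0 i - a ord0 i)^-1) (Num.bound (b ord0 i - x ord0 i)^-1)).
  move=> n; rewrite geq_max => /andP[n1 n2]; rewrite -!ler_pdivrMr// !div1r; split.
    apply/ltW/(lt_le_trans (archi_boundP _)); first by rewrite invr_ge0 ltW.
    by rewrite ler_nat.
  apply/ltW/(lt_le_trans (archi_boundP _)); first by rewrite invr_ge0 ltW.
  by rewrite ler_nat.
exists (\max_i N i)%N => // n /= Nn; apply: bump_in => i; apply: hN.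
by apply: leq_trans Nn; exact: leq_bigmax.
Qed.

Lemma test_smooth V f : test_fun V f -> smooth f. Proof. by case. Qed.

Lemma test_supp V f g : test_fun V g -> smooth f ->
  [set x | f x != 0] `<=` closure [set x | g x != 0] -> test_fun V f.
Proof.
move=> [_ cg gV] sf fg.
have h : closure [set x | f x != 0] `<=` closure [set x | g x != 0].
  rewrite [X in _ `<=` X](closure_id _).1; last exact: closed_closure.
  exact: closureS.
split=> //; last exact: subset_trans gV.
by apply: subclosed_compact h => //; exact: closed_closure.
Qed.

Lemma test_partial V f j : test_fun V f -> test_fun V (partial j f).
Proof.
move=> hf; apply: (test_supp hf); first exact/smooth_partial/test_smooth/hf.
move=> x /eqP h; apply: contrapT => xf; apply: h.
apply: (@partial_near0 _ _ _ _ (~` closure [set x | f x != 0])) => //.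
  exact/closed_openC/closed_closure.
move=> y /= yf; apply/eqP/negPn/negP => fy; apply: yf.
exact: subset_closure.
Qed.

Lemma testMl V f g : smooth f -> test_fun V g -> test_fun V (fun x => f x * g x).
Proof.
move=> sf hg; apply: (test_supp hg); first by apply: smoothM => //; exact: test_smooth hg.
by move=> x /= fg; apply: subset_closure => /=; apply: contraNneq fg => ->; rewrite mulr0.
Qed.

Lemma testMr V f g : smooth f -> test_fun V g -> test_fun V (fun x => g x * f x).
Proof. by move=> sf hg; under eq_fun do rewrite mulrC; exact: testMl. Qed.

Lemma testZ V c g : test_fun V g -> test_fun V (fun x => c * g x).
Proof. by apply: testMl; exact: smooth_cst. Qed.

Lemma testD V f g : test_fun V f -> test_fun V g -> test_fun V (fun x => f x + g x).
Proof.
move=> [sf cf fV] [sg cg gV]; split; first exact: smoothD.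
  apply: (@subclosed_compact _ _ (closure [set x | f x != 0] `|` closure [set x | g x != 0])).
  - exact: closed_closure.
  - exact: compactU.
  - rewrite -closureU; apply: closureS => x /= h; apply/orP.
    by rewrite -negb_and; apply: contraNN h => /andP[/eqP -> /eqP ->]; rewrite addr0.
apply: (@subset_trans _ (closure [set x | f x != 0] `|` closure [set x | g x != 0])).
  rewrite -closureU; apply: closureS => x /= h; apply/orP.
  by rewrite -negb_and; apply: contraNN h => /andP[/eqP -> /eqP ->]; rewrite addr0.
by rewrite subUset.
Qed.

Lemma test_comp V F f : smooth1 F -> F 0 = 0 -> test_fun V f -> test_fun V (fun x => F (f x)).
Proof.
move=> sF F0 hf; apply: (test_supp hf); first by apply: smooth_comp => //; exact: test_smooth hf.
by move=> x /= fg; apply: subset_closure => /=; apply: contraNneq fg => ->; rewrite F0.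
Qed.

Lemma testS V W f : V `<=` W -> test_fun V f -> test_fun W f.
Proof. by move=> VW [? ? ?]; split=> //; exact: subset_trans VW. Qed.

Lemma test_cubeP V f : test_fun V f ->
  exists n : nat, forall x, ~ cube n.+1%:R x -> f x = 0.
Proof.
move=> [_ cf _]; have [n hn] := compact_cube cf; exists n => x xn.
by apply/eqP/negPn/negP => fx; apply: xn; apply: hn; exact: subset_closure.
Qed.

Lemma test_of_cube V f r : smooth f -> (forall x, ~ cube r x -> f x = 0) ->
  [set x : T | forall i, `|x ord0 i| <= r] `<=` V -> test_fun V f.
Proof.
move=> sf f0 rV.
have h : closure [set x | f x != 0] `<=` [set x : T | forall i, `|x ord0 i| <= r].
  apply: subset_trans (@closure_cube _ _ r); apply: closureS => x /= /eqP fx.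
  by apply: contrapT => /f0.
split=> //; last exact: subset_trans rV.
by apply: subclosed_compact h; [exact: closed_closure|exact: closed_cube_compact].
Qed.

Definition cutoff (r : R) : T -> R := bump 1 (const_mx (- (r + 1))) (const_mx (r + 1)).

Lemma box_cube (r : R) : box (const_mx (- r)) (const_mx r) = cube r.
Proof.
by apply/seteqP; split=> x h i; have := h i; rewrite !mxE ltr_norml.
Qed.

Lemma cutoff_test (r : R) : test_fun setT (cutoff r).
Proof.
apply: (@test_of_cube _ _ (r + 1)) => //; first exact: bump_smooth.
by move=> x; rewrite -box_cube => xr; apply: bump_out.
Qed.

Lemma cutoff1 (r : R) (x : T) : (forall i, `|x ord0 i| <= r) -> cutoff r x = 1.
Proof.
move=> h; apply: bump_in => i; rewrite !mul1r !mxE.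
by have := h i; rewrite ler_norml => /andP[h1 h2]; split; lra.
Qed.

Lemma cutoff_ge0 r x : 0 <= cutoff r x. Proof. exact: bump_ge0. Qed.
Lemma cutoff_le1 r x : cutoff r x <= 1. Proof. exact: bump_le1. Qed.

Lemma cutoff_out (r : R) x : ~ cube (r + 1) x -> cutoff r x = 0.
Proof. by rewrite -box_cube => h; exact: bump_out. Qed.

Lemma test_bounded V f : test_fun V f -> exists M : R, forall x, `|f x| <= M.
Proof.
move=> hf; have [n hn] := test_cubeP hf.
have [M hM] := continuous_bounded_cube n.+1%:R (smooth_cont (test_smooth hf)).
exists (`|M|) => x; have [xn|xn] := pselect (cube n.+1%:R x).
  by rewrite (le_trans (hM x xn))// ler_norm.
by rewrite hn// normr0.
Qed.

Lemma test_mf V f : test_fun V f -> meas f.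
Proof. by move=> hf; apply: continuous_measurable_rV; exact/smooth_cont/test_smooth/hf. Qed.

(** Open boxes are stable under intersection and their indicators are limits of bumps, which makes
    them the right pi-system for [test_separates]. A coordinate slab is the union over [n] of the
    boxes bounded by [n] in the other directions. *)
Lemma measurable_rV_box :
  @measurable _ T = <<s [set B | exists a b : T, B = box a b] >>.
Proof.
apply/seteqP; split.
  apply: smallest_sub; first exact: smallest_sigma_algebra.
  rewrite -bigcup_seq; apply: bigcup_sub => i _ _ [Y mY <-].
  rewrite setTI; set G := [set B | _].
  have sG : sigma_algebra setT <<s G >> by exact: smallest_sigma_algebra.
  pose M : set (set R) := [set Y | <<s G >> ((fun x : T => x ord0 i) @^-1` Y)].
  suff : (@measurable _ (measurableTypeR R)) `<=` M by exact.
  rewrite -/(@measurable _ R) (RGenOpens.measurableE R).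
  apply: smallest_sub.
    have [s0 sC sU] := sG.
    split=> [|Z MZ|F MF].
    - by rewrite /M/= preimage_set0.
    - exact: (sC _ MZ).
    - by rewrite /M/= preimage_bigcup; apply: sU.
  move=> _ [a [b ->]]; rewrite /M/=.
  pose lo (n : nat) : T := \row_j if j == i then a else - n%:R.
  pose hi (n : nat) : T := \row_j if j == i then b else n%:R.
  have -> : (fun x : T => x ord0 i) @^-1` `]a, b[ = \bigcup_n box (lo n) (hi n).
    apply/seteqP; split=> x /=.
      rewrite in_itv/= => xab; have [n xn] := mem_cube x; exists n => // j.
      by rewrite !mxE; case: eqVneq => [->//|_]; have := xn j; rewrite ltr_norml.
    by move=> [n _ /(_ i)]; rewrite !mxE eqxx in_itv.
  have [_ _ sU] := sG; apply: sU => n.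
  by apply: sub_sigma_algebra; exists (lo n), (hi n).
apply: smallest_sub; first exact: sigma_algebra_measurable.
move=> _ [a [b ->]].
have -> : box a b = \bigcap_(i in [set: 'I_d]) [set y : T | a ord0 i < y ord0 i < b ord0 i].
  by apply/seteqP; split=> y /= h i => [_|]; exact: h.
apply: fin_bigcap_measurable => // i _.
have := measurable_coord i measurableT (measurable_itv `](a ord0 i), (b ord0 i)[).
by rewrite setTI; congr measurable; apply/seteqP; split=> y /=; rewrite in_itv.
Qed.

End test_functions.

(** * Test functions separate locally integrable functions *)

Section separation.
Context {R : realType} {d : nat} (mu : {measure set 'rV[R]_d -> \bar R}).
Local Notation T := 'rV[R]_d.

(** Bumps converge to the indicators of boxes, so the localized function [g * cutoff r] has integral
    0 over every box. The sets with this property form a lambda-system, hence all measurable sets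
    have it, in particular the sets where the function is nonnegative and where it is negative. *)
Lemma test_separates (g : T -> R) : meas g ->
  (forall r, Ig mu (fun x => g x * cutoff r x)) ->
  (forall eta, test_fun setT eta -> \int[mu]_x (g x * eta x) = 0) ->
  g = (fun=> 0) %[ae mu].
Proof.
move=> mg ig hg.
suff h (r : R) : (fun x => g x * cutoff r x) = (fun=> 0) %[ae mu].
  have := ae_foralln (fun n : nat => h n%:R).
  apply: filterS => x hx _; have [n xn] := mem_cube x.
  by have := hx n I; rewrite cutoff1 ?mulr1// => i; exact: ltW.
set k := fun x => g x * cutoff r x.
have ik : Ig mu k := ig r.
have mk : meas k := Ig_mf ik.
have ikA A : measurable A -> Ig mu (fun x => k x * \1_A x).
  move=> mA; apply: (Ig_le _ ik); first by apply: measurable_funM => //; exact: measurable_indic.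
  by apply: aeW => x; rewrite normrM ler_piMr// indicE; case: (_ \in _); rewrite ?normr0 ?normr1.
pose H : set (set T) := [set A | measurable A /\ \int[mu]_x (k x * \1_A x) = 0].
have lim0 (A : set T) (f_ : nat -> T -> R) : measurable A ->
    (forall n, meas (f_ n)) -> (forall n x, `|f_ n x| <= 1) ->
    (forall x, f_ n x @[n --> \oo] --> (\1_A x : R)) ->
    (forall n, \int[mu]_x (k x * f_ n x) = 0) -> \int[mu]_x (k x * \1_A x) = 0.
  move=> mA mf f1 fA f0.
  have mkf n : meas (fun x => k x * f_ n x) by exact: measurable_funM.
  have ikf n : Ig mu (fun x => k x * f_ n x).
    apply: (Ig_le (mkf n) ik); apply: aeW => x.
    by rewrite normrM ler_piMr.
  have := @Cv0_Rint _ _ _ mu (fun n x => k x * f_ n x) (fun x => k x * \1_A x) ikf (ikA A mA).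
  move=> h; have {}h : \int[mu]_x (k x * f_ n x) @[n --> \oo] --> \int[mu]_x (k x * \1_A x).
    apply: h; apply: (@Cv0_dct _ _ _ mu _ (fun x => 2 * `|k x|)).
    - by move=> n; apply: measurable_funB => //; apply: measurable_funM => //; exact: measurable_indic.
    - by apply: IgZ; exact: Ig_abs.
    - move=> n; apply: aeW => x; rewrite -mulrBr normrM mulrC ler_wpM2r//.
      rewrite (le_trans (ler_normB _ _))// (_ : 2 = 1 + 1)// lerD//.
      by rewrite indicE; case: (_ \in _); rewrite ?normr0 ?normr1.
    - apply: aeW => x; rewrite -(subrr (k x * \1_A x)).
      by apply: cvgB; [apply: cvgM; [exact: cvg_cst|exact: fA]|exact: cvg_cst].
  have e0 : (fun n => \int[mu]_x (k x * f_ n x)) = cst 0 by apply/funext => n; exact: f0.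
  by move: h; rewrite e0 => h; apply/esym; exact: (cvg_unique _ (@cvg_cst _ _ _ _ _) h).
have mbox (a b : T) : measurable (box a b).
  by rewrite measurable_rV_box; apply: sub_sigma_algebra; exists a, b.
have Hbox (a b : T) : H (box a b).
  split=> //; apply: (@lim0 _ (fun n x => bump n%:R a b x)) => //.
  - by move=> n; apply: continuous_measurable_rV; apply: smooth_cont; exact: bump_smooth.
  - by move=> n x; rewrite ger0_norm ?bump_ge0// bump_le1.
  - by move=> x; exact: bump_cvg.
  - move=> n; rewrite -[RHS](hg (fun x => bump n%:R a b x * cutoff r x)).
      by apply: eq_Rintegral => x _; rewrite /k -mulrA [cutoff r x * _]mulrC.
    by apply: testMl; [exact: bump_smooth|exact: cutoff_test].
have HT : H setT.
  split=> //; apply: (@lim0 _ (fun n x => \1_(cube n.+1%:R) x)) => //.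
  - by move=> n; apply: measurable_indic; exact: measurable_cube.
  - by move=> n x; rewrite indicE; case: (_ \in _); rewrite ?normr0 ?normr1.
  - move=> x; apply: cvg_near_cst; have [N xN] := mem_cube x; exists N => // n /= Nn.
    rewrite !indicE !mem_set//; apply: cubeS xN.
    by rewrite ler_nat (leq_trans Nn).
  - by move=> n; have [_] := Hbox (const_mx (- n.+1%:R)) (const_mx n.+1%:R); rewrite box_cube.
have Hall A : measurable A -> H A.
  rewrite measurable_rV_box; apply: lambda_system_subset => //.
  - move=> _ _ [a [b ->]] [a' [b' ->]].
    exists (\row_i Num.max (a ord0 i) (a' ord0 i)), (\row_i Num.min (b ord0 i) (b' ord0 i)).
    apply/seteqP; split=> x /=.
      by move=> [h1 h2] i; rewrite !mxE gt_max lt_min; have /andP[-> ->] := h1 i; have /andP[-> ->] := h2 i.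
    by move=> h; split=> i; have := h i; rewrite !mxE gt_max lt_min => /andP[/andP[? ?] /andP[? ?]]; apply/andP; split.
  - split=> //.
    + move=> A1 B1 BA [mA hA] [mB hB]; split; first exact: measurableD.
      transitivity (\int[mu]_x (k x * \1_A1 x - k x * \1_B1 x)).
        apply: eq_Rintegral => x _; rewrite -mulrBr; congr (_ * _).
        rewrite !indicE in_setD.
        have [xB|xB] := boolP (x \in B1); last by rewrite andbT subr0.
        by rewrite (mem_set (BA _ (set_mem xB))) andbF subrr.
      by rewrite RintB ?hA ?hB ?subrr//; exact: ikA.
    + move=> F nF hF; split; first by apply: bigcup_measurable => n _; case: (hF n).
      apply: (@lim0 _ (fun n x => \1_(F n) x)).
      * by apply: bigcup_measurable => n _; case: (hF n).
      * by move=> n; apply: measurable_indic; case: (hF n).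
      * by move=> n x; rewrite indicE; case: (_ \in _); rewrite ?normr0 ?normr1.
      * move=> x; have [[N _ xN]|xF] := pselect ((\bigcup_i F i) x).
          apply: cvg_near_cst; exists N => // n /= Nn.
          rewrite !indicE !mem_set//; first by exists N.
          by have /subsetPset := nF _ _ Nn; exact.
        rewrite indicE memNset//; apply: cvg_near_cst; apply: nearW => n.
        by rewrite indicE memNset// => xn; apply: xF; exists n.
      * by move=> n; case: (hF n).
  - by move=> _ [a [b ->]].
pose P := [set x | 0 <= k x]; have mP : measurable P.
  rewrite -[P]setTI; have := mk measurableT _ (measurable_itv `[0, +oo[).
  by congr measurable; apply/seteqP; split=> x /=; rewrite in_itv/= andbT.
have hP A : measurable A -> {ae mu, forall x, 0 <= k x * \1_A x} -> (fun x => k x * \1_A x) = (fun=> 0) %[ae mu].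
  move=> mA kA; apply: Rint_ge0_eq0; [exact: ikA|exact: kA|].
  by have [_ ->] := Hall A mA.
have h1 : (fun x => k x * \1_P x) = (fun=> 0) %[ae mu].
  apply: hP => //; apply: aeW => x; rewrite indicE; have [xP|xP] := boolP (x \in P).
    by rewrite mulr1; exact: set_mem xP.
  by rewrite mulr0.
have ikn : Ig mu (fun x => - (k x * \1_(~` P) x)) by apply: IgN; apply: ikA; exact: measurableC.
have h2 : (fun x => - (k x * \1_(~` P) x)) = (fun=> 0) %[ae mu].
  apply: Rint_ge0_eq0 => //.
    apply: aeW => x; rewrite indicE; have [xP|xP] := boolP (x \in ~` P).
      by rewrite mulr1 oppr_ge0 ltW// ltNge; apply/negP; exact: set_mem xP.
    by rewrite mulr0 oppr0.
  rewrite RintN; last by apply: ikA; exact: measurableC.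
  by have [_ ->] := Hall _ (measurableC mP); rewrite oppr0.
apply: filterS2 h1 h2 => x h1 h2 _; have := h1 I; have /eqP := h2 I.
rewrite !indicE in_setC oppr_eq0 => /eqP.
by case: (_ \in _); rewrite /= ?mulr1 ?mulr0.
Qed.

End separation.

(** * The bilinear form of a matrix and vector fields *)

Section bilinear.
Context {R : realType} {d : nat}.
Implicit Types (M : 'M[R]_d) (x y z : 'rV[R]_d).

Lemma dotE x y : dot x y = \sum_i x ord0 i * y ord0 i.
Proof. by rewrite /dot mxE; apply: eq_bigr => i _; rewrite mxE. Qed.

Lemma bilinE M x y : bilin M x y = \sum_i \sum_j y ord0 i * M i j * x ord0 j.
Proof.
rewrite /bilin mxE exchange_big/=; apply: eq_bigr => i _.
by rewrite mxE mulr_suml; apply: eq_bigr => j _; rewrite mxE.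
Qed.

Lemma bilinDl M x y z : bilin M (x + y) z = bilin M x z + bilin M y z.
Proof. by rewrite /bilin linearD mulmxDr mxE. Qed.
Lemma bilinDr M x y z : bilin M x (y + z) = bilin M x y + bilin M x z.
Proof. by rewrite /bilin !mulmxDl mxE. Qed.
Lemma bilinZl M c x y : bilin M (c *: x) y = c * bilin M x y.
Proof. by rewrite /bilin linearZ/= -scalemxAr mxE. Qed.
Lemma bilinZr M c x y : bilin M x (c *: y) = c * bilin M x y.
Proof. by rewrite /bilin -!scalemxAl mxE. Qed.
Lemma bilinNl M x y : bilin M (- x) y = - bilin M x y.
Proof. by rewrite -scaleN1r bilinZl mulN1r. Qed.
Lemma bilinNr M x y : bilin M x (- y) = - bilin M x y.
Proof. by rewrite -scaleN1r bilinZr mulN1r. Qed.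
Lemma bilin0l M y : bilin M 0 y = 0.
Proof. by rewrite -(scale0r 0) bilinZl mul0r. Qed.
Lemma bilin0r M y : bilin M y 0 = 0.
Proof. by rewrite -(scale0r 0) bilinZr mul0r. Qed.
Lemma bilinC M x y : (forall i j, M j i = M i j) -> bilin M x y = bilin M y x.
Proof.
move=> sM; rewrite !bilinE exchange_big/=; apply: eq_bigr => i _; apply: eq_bigr => j _.
by rewrite sM; ring.
Qed.
Lemma bilin1 x y : bilin 1%:M x y = dot y x.
Proof. by rewrite /bilin mulmx1. Qed.

Lemma dotC x y : dot x y = dot y x.
Proof. by rewrite !dotE; apply: eq_bigr => i _; rewrite mulrC. Qed.
Lemma dotDr x y z : dot x (y + z) = dot x y + dot x z.
Proof. by rewrite /dot linearD mulmxDr mxE. Qed.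
Lemma dotZr c x y : dot x (c *: y) = c * dot x y.
Proof. by rewrite /dot linearZ/= -scalemxAr mxE. Qed.
Lemma dotNr x y : dot x (- y) = - dot x y.
Proof. by rewrite -scaleN1r dotZr mulN1r. Qed.
Lemma dot0r x : dot x 0 = 0.
Proof. by rewrite -(scale0r 0) dotZr mul0r. Qed.
Lemma dot_ge0 x : 0 <= dot x x.
Proof. by rewrite dotE; apply: sumr_ge0 => i _; rewrite -expr2 sqr_ge0. Qed.
Lemma sqr_coord_le x i : x ord0 i ^+ 2 <= dot x x.
Proof.
rewrite dotE (bigD1 i)//= expr2 lerDl; apply: sumr_ge0 => j _.
by rewrite -expr2 sqr_ge0.
Qed.
End bilinear.

Section fields.
Context {R : realType} {d : nat}.
Local Notation T := 'rV[R]_d.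
Implicit Types (g h : T -> T) (u v : T -> R).

Definition mfield g := forall j, measurable_fun [set: T] (fun x => g x ord0 j).

Lemma mfieldD g h : mfield g -> mfield h -> mfield (fun x => g x + h x).
Proof. by move=> mg mh j; under eq_fun do rewrite mxE; exact: measurable_funD. Qed.
Lemma mfieldZ u g : meas u -> mfield g -> mfield (fun x => u x *: g x).
Proof. by move=> mu mg j; under eq_fun do rewrite mxE; exact: measurable_funM. Qed.
Lemma mfieldZc c g : mfield g -> mfield (fun x => c *: g x).
Proof. by move=> mg; apply: (@mfieldZ (fun=> c)). Qed.
Lemma mfieldN g : mfield g -> mfield (fun x => - g x).
Proof. by move=> /(mfieldZc (-1)) h j; have := h j; congr measurable_fun; apply/funext => x; rewrite !mxE mulN1r. Qed.
Lemma mfieldB g h : mfield g -> mfield h -> mfield (fun x => g x - h x).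
Proof. by move=> mg /mfieldN; exact: mfieldD. Qed.
Lemma mfield0 : mfield (fun=> 0).
Proof. by move=> j; under eq_fun do rewrite mxE; exact: measurable_cst. Qed.
Lemma mfield_cgrad V u : test_fun V u -> mfield (cgrad u).
Proof. by move=> hu j; under eq_fun do rewrite mxE; apply: (@test_mf _ _ V); exact: test_partial. Qed.

Lemma mf_dot g h : mfield g -> mfield h -> meas (fun x => dot (g x) (h x)).
Proof.
move=> mg mh; under eq_fun do rewrite dotE.
by apply: measurable_sum => i; exact: measurable_funM.
Qed.

Lemma mf_bilin (A : T -> 'M[R]_d) g h :
  (forall i j, measurable_fun [set: T] (fun x => A x i j)) -> mfield g -> mfield h ->
  meas (fun x => bilin (A x) (g x) (h x)).
Proof.
move=> mA mg mh; under eq_fun do rewrite bilinE.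
apply: measurable_sum => i; apply: measurable_sum => j.
by apply: measurable_funM => //; exact: measurable_funM.
Qed.

Lemma cgradD u v x : smooth u -> smooth v ->
  cgrad (fun x => u x + v x) x = cgrad u x + cgrad v x.
Proof. by move=> su sv; apply/rowP => j; rewrite !mxE partialD. Qed.
Lemma cgradM u v x : smooth u -> smooth v ->
  cgrad (fun x => u x * v x) x = u x *: cgrad v x + v x *: cgrad u x.
Proof. by move=> su sv; apply/rowP => j; rewrite !mxE partialM. Qed.
Lemma cgradZ c u x : smooth u -> cgrad (fun x => c * u x) x = c *: cgrad u x.
Proof. by move=> su; apply/rowP => j; rewrite !mxE partialZ. Qed.
Lemma cgrad_comp F u x : smooth1 F -> smooth u ->
  cgrad (fun x => F (u x)) x = 'D_1 F (u x) *: cgrad u x.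
Proof. by move=> sF su; apply/rowP => j; rewrite !mxE partial_comp. Qed.
Lemma cgrad_near0 u U x : open U -> (forall x, U x -> u x = 0) -> U x -> cgrad u x = 0.
Proof. by move=> oU u0 Ux; apply/rowP => j; rewrite !mxE; exact: partial_near0 u0 _ Ux. Qed.

End fields.

(** Sobolev calculus is developed for such a matrix field because it is needed twice: for [A], which
    defines the form, and for the identity, which defines [H0] and [Hloc]. *)
Record elliptic {R : realType} {d : nat} (A : 'rV[R]_d -> 'M[R]_d) : Prop := {
  ell_mf : forall i j, measurable_fun [set: 'rV[R]_d] (fun x => A x i j) ;
  ell_sym : forall x i j, A x j i = A x i j ;
  ell_loc : locally_strictly_elliptic A }.

(** * Pointwise inequalities for an elliptic matrix field *)

Section ellipticity.
Context {R : realType} {d : nat} (A : 'rV[R]_d -> 'M[R]_d) (eA : elliptic A).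
Local Notation T := 'rV[R]_d.
Local Notation q x xi := (bilin (A x) xi xi).

Lemma ell_cube (r : R) : exists2 nu : R, 0 < nu & forall x xi, cube r x ->
  dot xi xi <= nu * q x xi /\ q x xi <= nu * dot xi xi.
Proof.
have [nu nu0 h] := ell_loc eA (@cube_relatively_compact R d r).
exists nu => // x xi xr; have /andP[h1 h2] := h xi x xr; split=> //.
by rewrite -ler_pdivrMl.
Qed.

Lemma ell_pt (x : T) : exists2 nu : R, 0 < nu & forall xi,
  dot xi xi <= nu * q x xi /\ q x xi <= nu * dot xi xi.
Proof.
have [n xn] := mem_cube x; have [nu nu0 h] := ell_cube n%:R.
by exists nu => // xi; exact: h.
Qed.

Lemma q_ge0 x xi : 0 <= q x xi.
Proof.
have [nu nu0 h] := ell_pt x; rewrite -(pmulr_rge0 _ nu0).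
by apply: le_trans (h xi).1; exact: dot_ge0.
Qed.

Lemma q_eq0 x xi : q x xi = 0 -> xi = 0.
Proof.
have [nu nu0 h] := ell_pt x => q0; apply/rowP => i; rewrite mxE.
have := (h xi).1; rewrite q0 mulr0 => d0.
have := le_trans (sqr_coord_le xi i) d0.
by move=> s0; apply/eqP; rewrite -sqrf_eq0 eq_le s0 sqr_ge0.
Qed.

Lemma qC x xi eta : bilin (A x) xi eta = bilin (A x) eta xi.
Proof. by apply: bilinC => i j; exact: ell_sym. Qed.

Lemma qD_le x xi eta : q x (xi + eta) <= 2 * (q x xi + q x eta).
Proof.
have := q_ge0 x (xi - eta).
rewrite !bilinDl !bilinDr !bilinNl !bilinNr (qC x eta xi) => h; lra.
Qed.

Lemma qN x xi : q x (- xi) = q x xi.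
Proof. by rewrite bilinNl bilinNr opprK. Qed.

Lemma qZ x c xi : q x (c *: xi) = c ^+ 2 * q x xi.
Proof. by rewrite bilinZl bilinZr mulrA. Qed.

Lemma bilin_le x xi eta (t : R) : 0 < t ->
  `|bilin (A x) xi eta| <= 2^-1 * (t * q x xi + t^-1 * q x eta).
Proof.
move=> t0.
have h1 := q_ge0 x (t *: xi - eta); have h2 := q_ge0 x (t *: xi + eta).
have tn : t != 0 by rewrite gt_eqF.
have e1 : q x (t *: xi - eta) = t * (2 * (2^-1 * (t * q x xi + t^-1 * q x eta) - bilin (A x) xi eta)).
  rewrite !bilinDl !bilinDr !bilinNl !bilinNr !bilinZl !bilinZr (qC x eta xi).
  by field.
have e2 : q x (t *: xi + eta) = t * (2 * (2^-1 * (t * q x xi + t^-1 * q x eta) + bilin (A x) xi eta)).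
  rewrite !bilinDl !bilinDr !bilinZl !bilinZr (qC x eta xi).
  by field.
move: h1 h2; rewrite e1 e2 !pmulr_rge0// => h1 h2.
by rewrite ler_norml; apply/andP; split; lra.
Qed.

Lemma q_cvg (x : T) (xi : nat -> T) (xi0 : T) :
  (forall i, xi n ord0 i @[n --> \oo] --> xi0 ord0 i) ->
  q x (xi n) @[n --> \oo] --> q x xi0.
Proof.
have csum (F : 'I_d -> nat -> R) (l : 'I_d -> R) :
    (forall i, F i n @[n --> \oo] --> l i) -> \sum_i F i n @[n --> \oo] --> \sum_i l i.
  move=> hF; elim: (index_enum _) => [|i s IH].
    by under eq_fun do rewrite big_nil; rewrite big_nil; exact: cvg_cst.
  by under eq_fun do rewrite big_cons; rewrite big_cons; exact: cvgD.
move=> h; under eq_fun do rewrite bilinE; rewrite bilinE.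
apply: (csum _ _) => i; apply: (csum _ _) => j.
by apply: cvgM => //; apply: cvgM => //; exact: cvg_cst.
Qed.

End ellipticity.

(** A measure with logarithmic derivative [b], that is [b = grad rho / rho] for a density [rho]. The
    instances are Lebesgue measure with [b = 0] and the measure of the theorem, whose [b] is locally
    square integrable. *)
Record ibp_measure {R : realType} {d : nat}
    (mu : {measure set 'rV[R]_d -> \bar R}) (b : 'rV[R]_d -> 'rV[R]_d) : Prop := {
  ibp_fin : forall r : R, 0 < r -> (mu (cube r) < +oo)%E ;
  ibp_L2 : forall j (r : R), L2 mu (fun x => b x ord0 j * cutoff r x) ;
  ibp_mf : mfield b ;
  ibp_int : forall j eta, test_fun setT eta ->
    \int[mu]_x partial j eta x = - \int[mu]_x (eta x * b x ord0 j) }.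

(** * Closure of the test functions in the energy norm *)

Section sobolev.
Context {R : realType} {d : nat} (mu : {measure set 'rV[R]_d -> \bar R})
  (b : 'rV[R]_d -> 'rV[R]_d) (hmu : ibp_measure mu b).
Local Notation T := 'rV[R]_d.
Implicit Types (u v f : T -> R) (g h : T -> T) (V W : set T) (A : T -> 'M[R]_d).
Local Notation q A x xi := (bilin (A x) xi xi).

(* u lies in the closure of C_0^oo(V) for the A-energy norm, with gradient g. *)
Definition happrox A V (u_ : nat -> T -> R) u g : Prop :=
  [/\ forall n, test_fun V (u_ n), Cv0 mu (fun n x => (u_ n x - u x) ^+ 2) &
      Cv0 mu (fun n x => q A x (cgrad (u_ n) x - g x))].

Definition HA A V u g : Prop :=
  [/\ meas u, mfield g &
    exists u_ : nat -> T -> R, happrox A V u_ u g].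

Lemma Ig_test V f : test_fun V f -> Ig mu f.
Proof.
move=> hf; have [n hn] := test_cubeP hf.
apply: (@Ig_continuous _ _ mu f n.+1%:R) => //.
  exact/smooth_cont/test_smooth/hf.
exact: ibp_fin hmu _ _.
Qed.

Lemma L2_test V f : test_fun V f -> L2 mu f.
Proof.
move=> hf; split; first exact: test_mf hf.
by apply: (@Ig_test V); apply: testMl => //; exact: test_smooth hf.
Qed.

Lemma L2_mul_bounded f u (K : R) : meas f -> (forall x, `|f x| <= K) ->
  L2 mu u -> L2 mu (fun x => f x * u x).
Proof.
move=> mf fK hu; apply: (L2_le _ (L2Z K hu)).
  by apply: measurable_funM => //; case: hu.
by apply: aeW => x; rewrite !normrM ler_wpM2r// (le_trans (fK x))// ler_norm.
Qed.

Lemma Ig_mul_bounded f u (K : R) : meas f -> (forall x, `|f x| <= K) ->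
  Ig mu u -> Ig mu (fun x => f x * u x).
Proof.
move=> mf fK hu; apply: (Ig_le _ (IgZ K hu)).
  by apply: measurable_funM => //; exact: Ig_mf hu.
by apply: aeW => x; rewrite !normrM ler_wpM2r// (le_trans (fK x))// ler_norm.
Qed.

Section one_matrix.
Variables (A : T -> 'M[R]_d) (eA : elliptic A).

Lemma mf_q g : mfield g -> meas (fun x => q A x (g x)).
Proof. by move=> mg; apply: mf_bilin => //; exact: ell_mf eA. Qed.

Lemma Ig_q_test V f : test_fun V f -> Ig mu (fun x => q A x (cgrad f x)).
Proof.
move=> hf; have [n hn] := test_cubeP hf.
have [nu nu0 hnu] := ell_cube eA (n.+1%:R + 1).
have i1 : Ig mu (fun x => nu * dot (cgrad f x) (cgrad f x)).
  apply: IgZ; rewrite (_ : (fun _ => _) = (fun x => \sum_i partial i f x * partial i f x)).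
    apply: Ig_sum => i; apply: (@Ig_test V); apply: testMl; last exact: test_partial.
    exact/smooth_partial/test_smooth/hf.
  by apply/funext => x; rewrite dotE; apply: eq_bigr => i _; rewrite !mxE.
apply: (Ig_le _ i1); first by apply: mf_q; exact: mfield_cgrad hf.
apply: aeW => x; rewrite !ger0_norm ?(q_ge0 eA)//; last first.
  by rewrite mulr_ge0 ?dot_ge0// ltW.
have [xn|xn] := pselect (cube (n.+1%:R + 1) x); first exact: (hnu x _ xn).2.
suff -> : cgrad f x = 0 by rewrite bilin0l dot0r mulr0.
apply: (@cgrad_near0 _ _ f (~` [set x : T | forall i, `|x ord0 i| <= n.+1%:R])).
- apply: closed_openC; exact: compact_closed (@norm_hausdorff _ _) (@closed_cube_compact _ _ _).
- by move=> y /= yn; apply: hn => h; apply: yn => i; exact: ltW.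
- by move=> h; apply: xn => i; rewrite (le_lt_trans (h i))// ltrDl.
Qed.

Lemma HA_L2 V u g : HA A V u g -> L2 mu u.
Proof.
move=> [mu_ mg [u_ [tu cu _]]].
have [N hN] := Cv0_small cu ltr01; have [i1 _] := hN N (leqnn _).
have l1 : L2 mu (fun x => u_ N x - u x).
  by split=> //; apply: measurable_funB => //; exact: test_mf (tu N).
have := L2B (L2_test (tu N)) l1; congr L2; apply/funext => x /=; ring.
Qed.

Lemma HA_Ig_q V u g : HA A V u g -> Ig mu (fun x => q A x (g x)).
Proof.
move=> [mu_ mg [u_ [tu _ cg]]].
have [N hN] := Cv0_small cg ltr01; have [i1 _] := hN N (leqnn _).
apply: (@Ig_le _ _ _ mu _ (fun x => 2 * (q A x (cgrad (u_ N) x) + q A x (cgrad (u_ N) x - g x)))).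
- exact: mf_q.
- by apply: IgZ; apply: IgD => //; exact: Ig_q_test (tu N).
- apply: aeW => x; rewrite !ger0_norm ?mulr_ge0 ?addr_ge0 ?(q_ge0 eA)//.
  rewrite [in leLHS](_ : g x = cgrad (u_ N) x + - (cgrad (u_ N) x - g x)).
    by rewrite -[X in _ <= 2 * (_ + X)](qN A); exact: qD_le.
  by rewrite opprB addrC subrK.
Qed.

Lemma Ig_bilin g h : mfield g -> mfield h -> Ig mu (fun x => q A x (g x)) ->
  Ig mu (fun x => q A x (h x)) -> Ig mu (fun x => bilin (A x) (g x) (h x)).
Proof.
move=> mg mh ig ih; apply: (@Ig_le _ _ _ mu _ (fun x => 2^-1 * (1 * q A x (g x) + 1^-1 * q A x (h x)))).
- by apply: mf_bilin => //; exact: ell_mf eA.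
- by apply: IgZ; apply: IgD; exact: IgZ.
- apply: aeW => x; rewrite [leRHS]ger0_norm; first exact: bilin_le.
  by rewrite mulr_ge0// addr_ge0// mulr_ge0 ?invr_ge0 ?(q_ge0 eA).
Qed.

Lemma Cv0_qD (g_ h_ : nat -> T -> T) : (forall n, mfield (g_ n)) -> (forall n, mfield (h_ n)) ->
  Cv0 mu (fun n x => q A x (g_ n x)) -> Cv0 mu (fun n x => q A x (h_ n x)) ->
  Cv0 mu (fun n x => q A x (g_ n x + h_ n x)).
Proof.
move=> mg mh cg ch; apply: (Cv0_le2 (C := 2) cg ch) => [n|n].
  by apply: mf_q; exact: mfieldD.
by apply: aeW => x; rewrite !ger0_norm ?(q_ge0 eA)// qD_le.
Qed.

Lemma HA_ext V u g u' g' : HA A V u g -> meas u' -> mfield g' ->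
  {ae mu, forall x, u x = u' x} -> {ae mu, forall x, g x = g' x} -> HA A V u' g'.
Proof.
move=> [mu_ mg [u_ [tu cu cg]]] mu' mg' uu' gg'; split=> //.
have mB n : mfield (fun x => cgrad (u_ n) x - g' x).
  by apply: mfieldB => //; exact: mfield_cgrad (tu n).
exists u_; split; first exact: tu.
- apply: (Cv0_eq cu) => [n|n].
    by apply: measurable_funX; apply: measurable_funB => //; exact: test_mf (tu n).
  by apply: filterS uu' => x ->.
- apply: (Cv0_eq cg) => [n|n]; first exact: (mf_q (mB n)).
  by apply: filterS gg' => x ->.
Qed.

Lemma HAD V u g v h : HA A V u g -> HA A V v h ->
  HA A V (fun x => u x + v x) (fun x => g x + h x).
Proof.
move=> [mu_ mg [u_ [tu cu cg]]] [mv mh [v_ [tv cv ch]]]; split.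
- exact: measurable_funD.
- exact: mfieldD.
have mgB n : mfield (fun x => cgrad (u_ n) x - g x).
  by apply: mfieldB => //; exact: mfield_cgrad (tu n).
have mhB n : mfield (fun x => cgrad (v_ n) x - h x).
  by apply: mfieldB => //; exact: mfield_cgrad (tv n).
exists (fun n x => u_ n x + v_ n x); split.
- by move=> n; exact: testD.
- have mf1 n : meas (fun x => u_ n x - u x).
    by apply: measurable_funB => //; exact: test_mf (tu n).
  have mf2 n : meas (fun x => v_ n x - v x).
    by apply: measurable_funB => //; exact: test_mf (tv n).
  have := Cv0_sqD cu cv mf1 mf2.
  by congr (Cv0 _ _); apply/funext => n; apply/funext => x; congr (_ ^+ 2); ring.
- have := Cv0_qD mgB mhB cg ch.
  congr (Cv0 _ _); apply/funext => n; apply/funext => x.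
  rewrite (cgradD x (test_smooth (tu n)) (test_smooth (tv n))).
  by rewrite opprD addrACA.
Qed.

Lemma HAZ V c u g : HA A V u g -> HA A V (fun x => c * u x) (fun x => c *: g x).
Proof.
move=> [mu_ mg [u_ [tu cu cg]]]; split.
- exact: measurable_funM.
- exact: mfieldZc.
exists (fun n x => c * u_ n x); split.
- by move=> n; exact: testZ.
- have := Cv0Z (c ^+ 2) cu.
  by congr (Cv0 _ _); apply/funext => n; apply/funext => x; ring.
- have := Cv0Z (c ^+ 2) cg.
  congr (Cv0 _ _); apply/funext => n; apply/funext => x.
  by rewrite (cgradZ c x (test_smooth (tu n))) -scalerBr qZ.
Qed.

Lemma HAN V u g : HA A V u g -> HA A V (fun x => - u x) (fun x => - g x).
Proof.
move=> /(HAZ (-1)); congr (HA A V _ _); apply/funext => x; first exact: mulN1r.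
exact: scaleN1r.
Qed.

Lemma HAB V u g v h : HA A V u g -> HA A V v h ->
  HA A V (fun x => u x - v x) (fun x => g x - h x).
Proof. by move=> hu /HAN; exact: HAD. Qed.

Lemma HA_test V f : test_fun V f -> HA A V f (cgrad f).
Proof.
move=> hf; split; [exact: test_mf hf|exact: mfield_cgrad hf|].
have z : Cv0 mu (fun (_ : nat) (_ : T) => 0 : R).
  apply: Cv0_ge0 => [n|n]; first exact: measurable_cst.
  by rewrite (eq_integral (fun=> 0%E)) ?integral0 ?lee_fin ?invr_ge0// => x _; rewrite normr0.
exists (fun=> f); split=> //.
  by move: z; congr (Cv0 _ _); apply/funext => n; apply/funext => x; rewrite subrr expr0n.
by move: z; congr (Cv0 _ _); apply/funext => n; apply/funext => x; rewrite subrr bilin0l.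
Qed.

Lemma HA_zero V : HA A V (fun=> 0) (fun=> 0).
Proof.
have ht : test_fun V (fun _ : T => 0 : R).
  have e : [set x : T | (0 : R) != 0] = set0 by apply/seteqP; split=> x //=; rewrite eqxx.
  split; [exact: smooth_cst| |]; rewrite e closure0//; exact: compact0.
have := HA_test ht; congr (HA _ _ _ _); apply/funext => x; apply/rowP => j.
by rewrite !mxE partial_cst.
Qed.

Lemma HA_closed V (u_ : nat -> T -> R) (g_ : nat -> T -> T) u g :
  (forall n, HA A V (u_ n) (g_ n)) -> meas u -> mfield g ->
  Cv0 mu (fun n x => (u_ n x - u x) ^+ 2) -> Cv0 mu (fun n x => q A x (g_ n x - g x)) ->
  HA A V u g.
Proof.
move=> hu mfu mg cu cg; split=> //.
have /choice[w hw] : forall n, exists w, [/\ test_fun V w,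
    (\int[mu]_x `|(w x - u_ n x) ^+ 2|%:E <= (n.+1%:R^-1)%:E)%E &
    (\int[mu]_x `|q A x (cgrad w x - g_ n x)|%:E <= (n.+1%:R^-1)%:E)%E].
  move=> n; have [_ _ [w [tw cw cgw]]] := hu n.
  have n0 : 0 < n.+1%:R^-1 :> R by rewrite invr_gt0.
  have [N1 h1] := Cv0_lim cw n0; have [N2 h2] := Cv0_lim cgw n0.
  exists (w (maxn N1 N2)); split=> //.
    by apply/ltW/h1; exact: leq_maxl.
  by apply/ltW/h2; exact: leq_maxr.
have mu_ n : meas (u_ n) by case: (hu n).
have mg_ n : mfield (g_ n) by case: (hu n).
have tw n : test_fun V (w n) by case: (hw n).
have mB n : mfield (fun x => cgrad (w n) x - g_ n x).
  by apply: mfieldB => //; exact: mfield_cgrad (tw n).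
have mB2 n : meas (fun x => w n x - u_ n x).
  by apply: measurable_funB => //; exact: test_mf (tw n).
have c1 : Cv0 mu (fun n x => (w n x - u_ n x) ^+ 2).
  by apply: Cv0_ge0 => [n|n]; [exact: measurable_funX|case: (hw n)].
have c2 : Cv0 mu (fun n x => q A x (cgrad (w n) x - g_ n x)).
  by apply: Cv0_ge0 => [n|n]; [exact: (mf_q (mB n))|case: (hw n)].
exists w; split; first exact: tw.
- have mB3 n : meas (fun x => u_ n x - u x) by exact: measurable_funB.
  have := Cv0_sqD c1 cu mB2 mB3.
  by congr (Cv0 _ _); apply/funext => n; apply/funext => x; congr (_ ^+ 2); ring.
- have mB3 n : mfield (fun x => g_ n x - g x) by exact: mfieldB.
  have := Cv0_qD mB mB3 c2 cg.
  by congr (Cv0 _ _); apply/funext => n; apply/funext => x; rewrite addrA subrK.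
Qed.

End one_matrix.
End sobolev.

Section smooth1_facts.
Context {R : realType}.

Lemma smooth1_cont (F : R -> R) : smooth1 F -> continuous F.
Proof. by move=> /(_ [::])[]. Qed.

Lemma smooth1_lip (F : R -> R) (C : R) : smooth1 F -> (forall s, `|'D_1 F s| <= C) ->
  forall a b, `|F a - F b| <= C * `|a - b|.
Proof.
move=> sF dF; suff h (a b : R) : a <= b -> `|F b - F a| <= C * `|b - a|.
  move=> a b; have [/h|/ltW /h] := leP b a; first by [].
  by rewrite distrC [`|b - a|]distrC.
move=> ab; have [||c _ ->] := @MVT_segment R F (fun x => 'D_1 F x) a b ab.
- by move=> x _; apply/derivableP; exact: smooth1_der.
- by apply: continuous_subspaceT => x; exact: smooth1_cont.
- by rewrite normrM ler_wpM2r.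
Qed.

Lemma cvg_norm_le (a_ : nat -> R) (l C : R) : a_ n @[n --> \oo] --> l ->
  (forall n, `|a_ n| <= C) -> `|l| <= C.
Proof.
move=> al aC; have c : `|a_ n| @[n --> \oo] --> `|l| by exact: cvg_norm.
rewrite -(cvg_lim (@Rhausdorff R) c); apply: limr_le; first by apply/cvg_ex; exists `|l|.
by apply: nearW => k; exact: aC.
Qed.

End smooth1_facts.

(** * Uniqueness of gradients, completeness and chain rule *)

Section sobolev_calculus.
Context {R : realType} {d : nat} (mu : {measure set 'rV[R]_d -> \bar R})
  (b : 'rV[R]_d -> 'rV[R]_d) (hmu : ibp_measure mu b).
Local Notation T := 'rV[R]_d.
Implicit Types (u v f : T -> R) (g h : T -> T) (V W : set T) (A : T -> 'M[R]_d).
Local Notation q A x xi := (bilin (A x) xi xi).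

(** The admissible multipliers: neither [b] nor the gradient of an energy function need be globally
    square integrable, but their products with such functions are ([bcs_b], [bcs_comp]). *)
Definition bcs f : Prop := [/\ meas f, exists K : R, forall x, `|f x| <= K &
  exists2 r : R, 0 < r & forall x, ~ cube r x -> f x = 0].

Lemma bcs_test V f : test_fun V f -> bcs f.
Proof.
move=> hf; split; [exact: test_mf hf|exact: test_bounded hf|].
by have [n hn] := test_cubeP hf; exists n.+1%:R.
Qed.

Lemma bcs_mul f u (K : R) : bcs f -> meas u -> (forall x, `|u x| <= K) ->
  bcs (fun x => f x * u x).
Proof.
move=> [mf [L fL] [r r0 fr]] mu_ uK; split; first exact: measurable_funM.
  by exists (L * K) => x; rewrite normrM ler_pM.
by exists r => // x /fr ->; rewrite mul0r.
Qed.

Lemma Ig_bcs f : bcs f -> Ig mu f.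
Proof.
move=> [mf [K fK] [r r0 fr]].
apply: (Ig_le mf (IgZ K (Ig_test hmu (cutoff_test r)))); apply: aeW => x.
have [xr|xr] := pselect (cube r x).
  by rewrite cutoff1 ?mulr1 ?(le_trans (fK x)) ?ler_norm// => i; exact: ltW.
by rewrite fr// normr0.
Qed.

Lemma L2_bcs f : bcs f -> L2 mu f.
Proof.
move=> hf; have [mf [K fK] _] := hf; split=> //.
by apply: Ig_bcs; rewrite (_ : (fun _ => _) = (fun x => f x * f x)); [exact: bcs_mul|].
Qed.

Lemma bcs_cut f r : bcs f -> (forall x, ~ cube r x -> f x = 0) ->
  forall x, f x * cutoff r x = f x.
Proof.
move=> hf fr x; have [xr|/fr ->] := pselect (cube r x); last by rewrite mul0r.
by rewrite cutoff1 ?mulr1// => i; exact: ltW.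
Qed.

Lemma bcs_b f j : bcs f -> L2 mu (fun x => f x * b x ord0 j).
Proof.
move=> hf; have [mf [K fK] [r r0 fr]] := hf.
have := L2_mul_bounded mf fK (ibp_L2 hmu j r); congr L2; apply/funext => x.
by rewrite mulrCA (bcs_cut hf fr) mulrC.
Qed.

Lemma Cv0_mul_bounded (p : nat -> T -> R) f (K : R) : Cv0 mu p ->
  meas f -> (forall x, `|f x| <= K) -> Cv0 mu (fun n x => f x * p n x).
Proof.
move=> cp mf fK; apply: (Cv0_le (C := K) cp) => [n|n].
  by apply: measurable_funM => //; exact: Cv0_mf cp.
by apply: aeW => x; rewrite normrM ler_wpM2r.
Qed.

Section one_matrix.
Variables (A : T -> 'M[R]_d) (eA : elliptic A).

(** On the cube that carries [f], ellipticity holds with one constant, and the energy density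
    controls Euclidean length. *)
Lemma bcs_dom f : bcs f -> exists2 C : R, 0 <= C &
  forall x xi, f x ^+ 2 * dot xi xi <= C * q A x xi.
Proof.
move=> [mf [K fK] [r r0 fr]]; have [nu nu0 hnu] := ell_cube eA r.
exists (K ^+ 2 * nu) => [|x xi]; first by rewrite mulr_ge0 ?sqr_ge0// ltW.
have [xr|/fr ->] := pselect (cube r x); last first.
  by rewrite expr0n mul0r mulr_ge0 ?(q_ge0 eA)// mulr_ge0 ?sqr_ge0// ltW.
rewrite -mulrA; apply: ler_pM; rewrite ?sqr_ge0 ?dot_ge0//; last exact: (hnu x xi xr).1.
rewrite -(real_normK (num_real (f x))) -(real_normK (num_real K)).
by rewrite lerXn2r ?nnegrE// (le_trans (fK x))// ler_norm.
Qed.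

Lemma bcs_comp f g j : bcs f -> mfield g -> Ig mu (fun x => q A x (g x)) ->
  L2 mu (fun x => f x * g x ord0 j).
Proof.
move=> hf mg ig; have [C C0 hC] := bcs_dom hf; have [mf _ _] := hf.
split; first exact: measurable_funM.
apply: (Ig_le _ (IgZ C ig)); first by apply: measurable_funX; exact: measurable_funM.
apply: aeW => x; rewrite !ger0_norm ?sqr_ge0 ?mulr_ge0 ?(q_ge0 eA)//.
rewrite exprMn (le_trans _ (hC x (g x)))// ler_wpM2l ?sqr_ge0//; exact: sqr_coord_le.
Qed.

Lemma Cv0_bcs f (h_ : nat -> T -> T) j : bcs f -> (forall n, mfield (h_ n)) ->
  Cv0 mu (fun n x => q A x (h_ n x)) ->
  Cv0 mu (fun n x => (f x * h_ n x ord0 j) ^+ 2).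
Proof.
move=> hf mh ch; have [C C0 hC] := bcs_dom hf; have [mf _ _] := hf.
apply: (Cv0_le (C := C) ch) => [n|n].
  by apply: measurable_funX; apply: measurable_funM => //; exact: mh.
apply: aeW => x; rewrite !ger0_norm ?sqr_ge0 ?(q_ge0 eA)//.
rewrite exprMn (le_trans _ (hC x (h_ n x)))// ler_wpM2l ?sqr_ge0//; exact: sqr_coord_le.
Qed.

Lemma approx_mB V (u_ : nat -> T -> R) u g n : happrox mu A V u_ u g -> mfield g ->
  mfield (fun x => cgrad (u_ n) x - g x).
Proof. by move=> [tu _ _] mg; apply: mfieldB => //; exact: mfield_cgrad (tu n). Qed.

Lemma approx_mB0 V (u_ : nat -> T -> R) u g n : happrox mu A V u_ u g -> meas u ->
  meas (fun x => u_ n x - u x).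
Proof. by move=> [tu _ _] mg; apply: measurable_funB => //; exact: test_mf (tu n). Qed.

(** Partial integration for the test functions [u_ n * eta], in the limit: the coordinates of the
    gradients converge after multiplication by [eta], and [eta * b] is square integrable. The
    right-hand side no longer contains [g]. *)
Lemma HA_ibp V u g j eta : HA mu A V u g -> test_fun setT eta ->
  \int[mu]_x (g x ord0 j * eta x) =
  - \int[mu]_x (u x * (partial j eta x + eta x * b x ord0 j)).
Proof.
move=> hu te; have L2u := HA_L2 hmu hu; have iq := HA_Ig_q hmu eA hu.
have [mfu mg [u_ hu_]] := hu; have [tu cu cg] := hu_.
pose psi x := partial j eta x + eta x * b x ord0 j.
have L2p : L2 mu psi.
  by apply: L2D; [exact: (L2_test hmu (test_partial j te))|exact: (bcs_b j (bcs_test te))].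
have be := bcs_test te; have L2e := L2_test hmu te.
have Ln n : \int[mu]_x (partial j (u_ n) x * eta x) = - \int[mu]_x (u_ n x * psi x).
  have su := test_smooth (tu n); have se := test_smooth te.
  have := ibp_int hmu j (testMl su te).
  under eq_Rintegral do rewrite (partialM j _ su se) [eta _ * _]mulrC.
  have i1 : Ig mu (fun x => u_ n x * partial j eta x).
    by apply: L2_mul; [exact: (L2_test hmu (tu n))|exact: (L2_test hmu (test_partial j te))].
  have i2 : Ig mu (fun x => partial j (u_ n) x * eta x).
    by apply: L2_mul; [exact: (L2_test hmu (test_partial j (tu n)))|].
  have i3 : Ig mu (fun x => u_ n x * eta x * b x ord0 j).
    under eq_fun do rewrite -mulrA.
    by apply: L2_mul; [exact: (L2_test hmu (tu n))|exact: bcs_b].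
  rewrite RintD// => e.
  have -> : \int[mu]_x (u_ n x * psi x) =
    \int[mu]_x (u_ n x * partial j eta x) + \int[mu]_x (u_ n x * eta x * b x ord0 j).
    by rewrite -RintD//; apply: eq_Rintegral => x _; rewrite /psi mulrDr mulrA.
  by move: e; lra.
have l1 : \int[mu]_x (partial j (u_ n) x * eta x) @[n --> \oo] --> \int[mu]_x (g x ord0 j * eta x).
  apply: Cv0_Rint => [n||].
  - by apply: L2_mul => //; exact: (L2_test hmu (test_partial j (tu n))).
  - have [n hn] := test_cubeP te.
    have := L2_mul (bcs_comp j (bcs_test (cutoff_test n.+1%:R)) mg iq) L2e.
    congr Ig; apply/funext => x.
    by rewrite [cutoff _ _ * _]mulrC -mulrA [cutoff _ _ * _]mulrC (bcs_cut be hn).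
  - have [n0 hn0] := test_cubeP te.
    have h1 := Cv0_bcs j (bcs_test (cutoff_test n0.+1%:R)) (fun n => approx_mB n hu_ mg) cg.
    have h2 := Cv0_mulL2 h1 (fun n => measurable_funM (test_mf (cutoff_test n0.+1%:R)) (approx_mB n hu_ mg j)) L2e.
    move: h2; congr (Cv0 _ _); apply/funext => n; apply/funext => x.
    by rewrite mulrAC [cutoff _ _ * _]mulrC (bcs_cut be hn0) !mxE mulrBr mulrC [eta x * g x _ _]mulrC.
have l2 : (fun n => - \int[mu]_x (u_ n x * psi x)) @ \oo --> (- \int[mu]_x (u x * psi x) : R).
  apply: cvgN; apply: Cv0_Rint => [n||].
  - by apply: L2_mul => //; exact: (L2_test hmu (tu n)).
  - exact: L2_mul.
  - have := Cv0_mulL2 cu (fun n => approx_mB0 n hu_ mfu) L2p.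
    by congr (Cv0 _ _); apply/funext => n; apply/funext => x; rewrite mulrBl.
have e : (fun n => \int[mu]_x (partial j (u_ n) x * eta x)) = (fun n => - \int[mu]_x (u_ n x * psi x)).
  by apply/funext => n; exact: Ln.
by move: l1; rewrite e => l1; apply: (cvg_unique _ l1 l2).
Qed.

Lemma HA_complete V (u_ : nat -> T -> R) (g_ : nat -> T -> T) :
  (forall n, HA mu A V (u_ n) (g_ n)) ->
  (forall e : R, 0 < e -> exists N, forall n m, (N <= n)%N -> (N <= m)%N ->
    \int[mu]_x ((u_ n x - u_ m x) ^+ 2) <= e /\
    \int[mu]_x q A x (g_ n x - g_ m x) <= e) ->
  exists u g, [/\ HA mu A V u g, Cv0 mu (fun n x => (u_ n x - u x) ^+ 2) &
    Cv0 mu (fun n x => q A x (g_ n x - g x))].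
Proof.
move=> hu cau.
have mu_ n : meas (u_ n) by case: (hu n).
have mg n : mfield (g_ n) by case: (hu n).
have fineE (f : T -> R) : (forall x, 0 <= f x) -> Ig mu f ->
    (\int[mu]_x (f x)%:E)%E = (\int[mu]_x f x)%:E.
  by move=> f0 fi; rewrite /Rintegral fineK// (integrable_fin_num measurableT fi).
have ex : forall x : R, 0 <= x -> forall k : nat, x ^+ 2 <= 4^-1 ^+ k -> x <= 1 * 2^-1 ^+ k.
  move=> x x0 k h; rewrite mul1r -(@ler_pXn2r _ 2)// ?nnegrE ?exprn_ge0//.
  by rewrite (le_trans h)// -exprM mulnC exprM expr2 -invfM (_ : 2 * 2 = 4 :> R)//; lra.
have [U [mU cU]] : exists U : T -> unit -> R, (forall i, meas (fun x => U x i)) /\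
    Cv0 mu (fun n x => (u_ n x - U x tt) ^+ 2).
  apply: (@riesz_fischer R _ T mu unit (fun n x _ => u_ n x) (fun x xi => xi tt ^+ 2)).
  - by move=> n _.
  - by move=> x xi; exact: sqr_ge0.
  - by move=> H mH; apply: measurable_funX.
  - move=> x; exists 1 => xi k []; rewrite -(real_normK (num_real _)); exact: ex.
  - by move=> x xi xi0 h; rewrite expr2; under eq_fun do rewrite expr2; apply: cvgM; exact: h.
  - move=> e /cau[N hN]; exists N => n m Nn Nm; have [h _] := hN n m Nn Nm.
    rewrite fineE ?lee_fin// => [x|]; first exact: sqr_ge0.
    by have [] := L2B (HA_L2 hmu (hu n)) (HA_L2 hmu (hu m)).
pose Q x (xi : 'I_d -> R) := q A x (\row_i xi i).
have [G [mG cG]] : exists G : T -> 'I_d -> R, (forall i, meas (fun x => G x i)) /\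
    Cv0 mu (fun n x => Q x (fun i => g_ n x ord0 i - G x i)).
  apply: (@riesz_fischer R _ T mu _ (fun n x i => g_ n x ord0 i) Q).
  - by move=> n i; exact: mg.
  - by move=> x xi; exact: (q_ge0 eA).
  - move=> H mH; have mH' : mfield (fun x => \row_i H x i).
      by move=> i; under eq_fun do rewrite mxE; exact: mH.
    exact: (mf_q eA mH').
  - move=> x; have [nu nu0 hnu] := ell_pt eA x; exists (Num.sqrt nu) => xi k i h.
    rewrite -(@ler_pXn2r _ 2)// ?nnegrE ?mulr_ge0 ?exprn_ge0 ?sqrtr_ge0 ?invr_ge0//.
    rewrite exprMn sqr_sqrtr ?(ltW nu0)// real_normK ?num_real//.
    have := sqr_coord_le (\row_i xi i) i; rewrite mxE => h0; apply: (le_trans h0).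
    apply: (le_trans (hnu _).1); rewrite ler_wpM2l ?(ltW nu0)//; apply: (le_trans h).
    by rewrite -exprM mulnC exprM expr2 -invfM (_ : 2 * 2 = 4 :> R)//; lra.
  - move=> x xi xi0 h; apply: (q_cvg (A := A) (x := x)) => i; under eq_fun do rewrite mxE.
    by rewrite mxE; exact: h.
  - move=> e /cau[N hN]; exists N => n m Nn Nm; have [_ h] := hN n m Nn Nm.
    have E x : Q x (fun i => g_ n x ord0 i - g_ m x ord0 i) = q A x (g_ n x - g_ m x).
      by rewrite /Q; congr bilin; apply/rowP => i; rewrite !mxE.
    rewrite fineE ?lee_fin.
    + by under eq_Rintegral do rewrite E.
    + by move=> x; exact: (q_ge0 eA).
    + under eq_fun do rewrite E; exact: (HA_Ig_q hmu eA (HAB eA (hu n) (hu m))).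
pose g x : T := \row_i G x i.
have cG' : Cv0 mu (fun n x => q A x (g_ n x - g x)).
  move: cG; congr (Cv0 _ _); apply/funext => n; apply/funext => x.
  by rewrite /Q; congr bilin; apply/rowP => i; rewrite !mxE.
have mg' : mfield g by move=> i; under eq_fun do rewrite mxE; exact: mG.
exists (fun x => U x tt), g; split; [|exact: cU|exact: cG'].
exact: (HA_closed eA hu (mU tt) mg' cU cG').
Qed.

End one_matrix.

(** By [HA_ibp] the mean of the gradient against a test function depends on the function alone, and
    test functions separate. This is closability of the form; allowing two matrices and two domains
    identifies all gradients that occur. *)
Lemma HA_grad_unique A A' V V' u u' g g' : elliptic A -> elliptic A' ->
  HA mu A V u g -> HA mu A' V' u' g' -> {ae mu, forall x, u x = u' x} ->
  {ae mu, forall x, g x = g' x}.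
Proof.
move=> eA eA' hu hu' uu'.
have [mfu mg _] := hu; have [mfu' mg' _] := hu'.
suff h j : {ae mu, forall x, g x ord0 j - g' x ord0 j = 0}.
  have h2 := @filter_forall _ _ _ _ (ae_filter_ringOfSetsType mu) h; apply: filterS h2 => x hx.
  by apply/rowP => j; apply/eqP; rewrite -subr_eq0 hx.
have L2c (f : T -> R) (B : T -> 'M[R]_d) (W : set T) k : elliptic B -> HA mu B W f k -> forall r : R,
    L2 mu (fun x => cutoff r x * k x ord0 j).
  move=> eB hf r; have [_ mk _] := hf.
  exact: (bcs_comp eB j (bcs_test (cutoff_test r)) mk (HA_Ig_q hmu eB hf)).
have sep := @test_separates _ _ mu (fun x => g x ord0 j - g' x ord0 j).
have : (fun x => g x ord0 j - g' x ord0 j) = (fun=> 0) %[ae mu].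
  apply: sep => [|r|eta te].
  - by apply: measurable_funB; [exact: mg|exact: mg'].
  - have r1 : forall x : T, ~ cube (r + 1) x -> cutoff r x = 0 by move=> x; exact: cutoff_out.
    have bc := bcs_test (cutoff_test r : test_fun setT (cutoff (d := d) r)).
    have Lc := L2_test hmu (cutoff_test (r + 1)).
    have Lr := L2B (L2c _ _ _ _ eA hu r) (L2c _ _ _ _ eA' hu' r).
    have := L2_mul Lr Lc; congr Ig; apply/funext => x.
    by rewrite -mulrBr mulrAC (bcs_cut bc r1) mulrC.
  - have ie (f : T -> R) (B : T -> 'M[R]_d) (W : set T) k : elliptic B -> HA mu B W f k ->
        Ig mu (fun x => k x ord0 j * eta x).
      move=> eB hf; have [n hn] := test_cubeP te.
      have := L2_mul (L2c _ _ _ _ eB hf n.+1%:R) (L2_test hmu te); congr Ig; apply/funext => x.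
      by rewrite mulrAC mulrC [cutoff _ _ * _]mulrC (bcs_cut (bcs_test te) hn).
    under eq_Rintegral do rewrite mulrBl.
    rewrite RintB ?(HA_ibp eA j hu te) ?(HA_ibp eA' j hu' te); [|exact: ie eA hu|exact: ie eA' hu'].
    apply/eqP; rewrite subr_eq0; apply/eqP; congr (- _).
    have mp : meas (fun x => partial j eta x + eta x * b x ord0 j).
      apply: measurable_funD; first exact: test_mf (test_partial j te).
      by apply: measurable_funM; [exact: test_mf te|exact: (ibp_mf hmu)].
    apply: ae_Rint; [exact: measurable_funM|exact: measurable_funM|].
    by apply: filterS uu' => x ->.
by apply: filterS => x; exact.
Qed.


Lemma HA_mono A V W u g : V `<=` W -> HA mu A V u g -> HA mu A W u g.
Proof.
move=> VW [mfu mg [u_ [tu cu cg]]]; split=> //; exists u_; split; [|exact: cu|exact: cg].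
by move=> n; exact: testS (tu n).
Qed.

Lemma q_cgrad_bounded A W chi : elliptic A -> test_fun W chi ->
  exists K : R, forall x, q A x (cgrad chi x) <= K.
Proof.
move=> eA' tc; have bc := bcs_test tc.
have [_ _ [r r0 cr]] := bc; have [nu nu0 hnu] := ell_cube eA' (r + 1).
have /choice[K hK] : forall i, exists K : R, forall x, `|partial i chi x| <= K.
  by move=> i; exact: test_bounded (test_partial i tc).
exists (nu * \sum_i K i ^+ 2) => x; have [xr|xr] := pselect (cube (r + 1) x).
  apply: (le_trans (hnu x _ xr).2); apply: ler_wpM2l; first exact: ltW.
  rewrite dotE; apply: ler_sum => i _.
  by rewrite !mxE -expr2 -(real_normK (num_real (partial i chi x))) lerXn2r// nnegrE// (le_trans _ (hK i x)).
rewrite (@cgrad_near0 _ _ chi (~` [set x : T | forall i, `|x ord0 i| <= r])).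
- by rewrite bilin0l mulr_ge0 ?(ltW nu0)//; apply: sumr_ge0 => i _; exact: sqr_ge0.
- apply: closed_openC; exact: compact_closed (@norm_hausdorff _ _) (@closed_cube_compact _ _ _).
- by move=> y /= yn; apply: cr => h; apply: yn => i; exact: ltW.
- by move=> h; apply: xr => i; rewrite (le_lt_trans (h i))// ltrDl.
Qed.

(* Multiplication by a test function also allows to change the matrix, since
   all elliptic matrices are locally comparable. *)
Lemma HA_cut A A' V W u g chi : elliptic A -> elliptic A' -> HA mu A V u g ->
  test_fun W chi -> HA mu A' W (fun x => chi x * u x) (fun x => chi x *: g x + u x *: cgrad chi x).
Proof.
move=> eA eA' [mfu mg [u_ hu_]] tc; have [tu cu cg] := hu_.
have mc := test_mf tc; have bc := bcs_test tc; have sc := test_smooth tc.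
split.
- exact: measurable_funM.
- by apply: mfieldD; apply: mfieldZ => //; exact: mfield_cgrad tc.
have mB n := approx_mB n hu_ mg; have mB0 n := approx_mB0 n hu_ mfu.
exists (fun n x => chi x * u_ n x); split.
- by move=> n; apply: testMr => //; exact: test_smooth (tu n).
- have [K hK] := test_bounded tc.
  apply: (Cv0_le (C := K ^+ 2) cu) => [n|n].
    by apply: measurable_funX; apply: measurable_funB; apply: measurable_funM => //; exact: test_mf (tu n).
  apply: aeW => x; rewrite -mulrBr exprMn normrM ler_wpM2r//.
  by rewrite normrX lerXn2r// nnegrE// (le_trans _ (hK x)).
- have e n x : cgrad (fun x => chi x * u_ n x) x - (chi x *: g x + u x *: cgrad chi x) =
     chi x *: (cgrad (u_ n) x - g x) + (u_ n x - u x) *: cgrad chi x.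
    rewrite (cgradM x sc (test_smooth (tu n))) scalerBr scalerBl.
    by rewrite opprD addrACA.
  under [X in Cv0 _ X]eq_fun do under eq_fun do rewrite e.
  apply: (Cv0_qD eA').
  + by move=> n; exact: mfieldZ.
  + by move=> n; apply: mfieldZ => //; exact: mfield_cgrad tc.
  + have [C C0 hC] := bcs_dom eA bc.
    have [_ _ [r r0 cr]] := bc; have [nu nu0 hnu] := ell_cube eA' r.
    apply: (Cv0_le (C := nu * C) cg) => [n|n]; first by apply: (mf_q eA'); exact: mfieldZ.
    apply: aeW => x; rewrite !ger0_norm ?(q_ge0 eA) ?(q_ge0 eA')// qZ -[leRHS]mulrA.
    have [xr|/cr ->] := pselect (cube r x); last first.
      by rewrite expr0n mul0r !mulr_ge0 ?(q_ge0 eA)// ltW.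
    apply: (@le_trans _ _ (chi x ^+ 2 * (nu * dot (cgrad (u_ n) x - g x) (cgrad (u_ n) x - g x)))).
      by rewrite ler_wpM2l ?sqr_ge0//; exact: (hnu x _ xr).2.
    by rewrite mulrCA ler_wpM2l ?hC// ltW.
  + have [K hK] := q_cgrad_bounded eA' tc.
    apply: (Cv0_le (C := K) cu) => [n|n].
      by apply: (mf_q eA'); apply: mfieldZ => //; exact: mfield_cgrad tc.
    apply: aeW => x; rewrite !ger0_norm ?(q_ge0 eA') ?sqr_ge0// qZ mulrC.
    by rewrite ler_wpM2r ?sqr_ge0.
Qed.

Lemma happrox_sub A V (u_ : nat -> T -> R) u g (s : nat -> nat) :
  (forall n, (n <= s n)%N) -> happrox mu A V u_ u g -> happrox mu A V (fun n => u_ (s n)) u g.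
Proof.
move=> hs [tu cu cg]; split; first by move=> n; exact: tu.
  exact: (Cv0_sub hs cu).
exact: (Cv0_sub hs cg).
Qed.

Lemma HA_approx_ae A V u g : HA mu A V u g -> exists u_ : nat -> T -> R,
  happrox mu A V u_ u g /\ {ae mu, forall x, u_ n x @[n --> \oo] --> u x}.
Proof.
move=> [mfu mg [u_ hu_]]; have [tu cu cg] := hu_.
have [s [hs cs]] := Cv0_ae cu; exists (fun n => u_ (s n)); split; first exact: happrox_sub.
apply: filterS cs => x h.
have h2 : `|u_ (s k) x - u x| @[k --> \oo] --> 0.
  have : Num.sqrt ((u_ (s k) x - u x) ^+ 2) @[k --> \oo] --> Num.sqrt 0.
    by apply: continuous_cvg => //; exact: sqrt_continuous.
  by rewrite sqrtr0; under eq_fun do rewrite sqrtr_sqr.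
apply/subr_cvg0; exact/norm_cvg0P.
Qed.

Section chain.
Variables (A : T -> 'M[R]_d) (eA : elliptic A) (V : set T).

Lemma Cv0_dct_q (a_ : nat -> T -> R) (K : R) g : mfield g -> Ig mu (fun x => q A x (g x)) ->
  (forall n, meas (a_ n)) -> (forall n, {ae mu, forall x, `|a_ n x| <= K}) ->
  {ae mu, forall x, a_ n x @[n --> \oo] --> 0} ->
  Cv0 mu (fun n x => q A x (a_ n x *: g x)).
Proof.
move=> mg ig ma aK a0; apply: (Cv0_dct (h := fun x => K ^+ 2 * q A x (g x))).
- by move=> n; apply: (mf_q eA); exact: mfieldZ.
- exact: IgZ.
- move=> n; apply: filterS (aK n) => x h; rewrite ger0_norm ?(q_ge0 eA)// qZ.
  rewrite ler_wpM2r ?(q_ge0 eA)// -(real_normK (num_real (a_ n x))) lerXn2r// nnegrE//.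
  exact: le_trans h.
- apply: filterS a0 => x h; under eq_fun do rewrite qZ.
  rewrite -(mul0r (q A x (g x))); apply: cvgM; last exact: cvg_cst.
  under eq_fun do rewrite expr2; rewrite -(mulr0 0); exact: cvgM.
Qed.

Lemma Cv0_dct_sq (a_ : nat -> T -> R) (K : R) u : L2 mu u ->
  (forall n, meas (a_ n)) -> (forall n, {ae mu, forall x, `|a_ n x| <= K * `|u x|}) ->
  {ae mu, forall x, a_ n x @[n --> \oo] --> 0} ->
  Cv0 mu (fun n x => a_ n x ^+ 2).
Proof.
move=> [mfu iu] ma aK a0; apply: (Cv0_dct (h := fun x => K ^+ 2 * (u x ^+ 2))).
- by move=> n; exact: measurable_funX.
- exact: IgZ.
- move=> n; apply: filterS (aK n) => x h; rewrite ger0_norm ?sqr_ge0// -exprMn.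
  rewrite -(real_normK (num_real (a_ n x))) -[leRHS](real_normK (num_real _)) lerXn2r// ?nnegrE//.
  by rewrite normrM (le_trans h)// ler_wpM2r// ler_norm.
- apply: filterS a0 => x h.
  under eq_fun do rewrite expr2; rewrite -(mulr0 0); exact: cvgM.
Qed.

(** The gradient error splits into [F'(u_n) (grad u_n - g)], small because [F'] is bounded, and
    [(F'(u_n) - F'(u)) g], small by dominated convergence along the almost everywhere convergent
    sequence. *)
Lemma happrox_smooth (u_ : nat -> T -> R) u g (F : R -> R) (C : R) :
  HA mu A V u g -> happrox mu A V u_ u g -> {ae mu, forall x, u_ n x @[n --> \oo] --> u x} ->
  smooth1 F -> F 0 = 0 -> (forall s, `|'D_1 F s| <= C) ->
  happrox mu A V (fun n x => F (u_ n x)) (fun x => F (u x)) (fun x => 'D_1 F (u x) *: g x).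
Proof.
move=> hu hu_ ua sF F0 dF; have [mfu mg _] := hu; have [tu cu cg] := hu_.
have iq := HA_Ig_q hmu eA hu.
have lipF := smooth1_lip sF dF.
have mF f : meas f -> meas (fun x => F (f x)).
  by apply: measurableT_comp; apply: continuous_measurable_fun; exact: smooth1_cont.
have cdF : continuous (fun s => 'D_1 F s) by exact/smooth1_cont/smooth1_derive.
have mdF f : meas f -> meas (fun x => 'D_1 F (f x)).
  by move=> mf'; apply: (measurableT_comp (f := fun s => 'D_1 F s)) mf'; exact: continuous_measurable_fun.
have mun n := test_mf (tu n).
split.
- by move=> n; exact: test_comp.
- apply: (Cv0_le (C := C ^+ 2) cu) => [n|n].
    by apply: measurable_funX; apply: measurable_funB; exact: mF.
  apply: aeW => x; rewrite !ger0_norm ?sqr_ge0// -exprMn.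
  rewrite -(real_normK (num_real (_ - _))) -[leRHS](real_normK (num_real _)) lerXn2r// ?nnegrE//.
  by rewrite normrM (le_trans (lipF _ _))// ler_wpM2r// ler_norm.
- have e n x : cgrad (fun x => F (u_ n x)) x - 'D_1 F (u x) *: g x =
    'D_1 F (u_ n x) *: (cgrad (u_ n) x - g x) + ('D_1 F (u_ n x) - 'D_1 F (u x)) *: g x.
    rewrite (cgrad_comp x sF (test_smooth (tu n))) scalerBr scalerBl.
    by rewrite addrA subrK.
  under [X in Cv0 _ X]eq_fun do under eq_fun do rewrite e.
  have mB n := approx_mB n hu_ mg.
  apply: (Cv0_qD eA).
  + by move=> n; apply: mfieldZ; [exact: mdF|exact: mB].
  + by move=> n; apply: mfieldZ => //; apply: measurable_funB; exact: mdF.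
  + apply: (Cv0_le (C := C ^+ 2) cg) => [n|n].
      by apply: (mf_q eA); apply: mfieldZ; [exact: mdF|exact: mB].
    apply: aeW => x; rewrite !ger0_norm ?(q_ge0 eA)// qZ ler_wpM2r ?(q_ge0 eA)//.
    by rewrite -(real_normK (num_real ('D_1 F _))) lerXn2r// nnegrE// (le_trans _ (dF 0)).
  + apply: (Cv0_dct_q (K := C + C)) => //.
    * by move=> n; apply: measurable_funB; exact: mdF.
    * by move=> n; apply: aeW => x; rewrite (le_trans (ler_normB _ _))// lerD.
    * apply: filterS ua => x h; apply/subr_cvg0.
      by apply: (continuous_cvg _ (cdF (u x))).
Qed.

Lemma HA_smooth u g (F : R -> R) (C : R) : HA mu A V u g ->
  smooth1 F -> F 0 = 0 -> (forall s, `|'D_1 F s| <= C) ->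
  HA mu A V (fun x => F (u x)) (fun x => 'D_1 F (u x) *: g x).
Proof.
move=> hu sF F0 dF; have [u_ [hu_ ua]] := HA_approx_ae hu.
have [mfu mg _] := hu.
split; last by exists (fun n x => F (u_ n x)); exact: (happrox_smooth hu hu_ ua sF F0 dF).
- by apply: measurableT_comp mfu; apply: continuous_measurable_fun; exact: smooth1_cont.
- apply: mfieldZ => //; apply: (measurableT_comp (f := fun s => 'D_1 F s)) => //.
  by apply: continuous_measurable_fun; exact/smooth1_cont/smooth1_derive.
Qed.

(** The everywhere defined limit [G] of the derivatives takes the place of [F'], so that [F] may
    have kinks; the values of [G] at a kink decide which version of the gradient results. *)
Lemma HA_chain u g (F_ : nat -> R -> R) (F G : R -> R) (C : R) : HA mu A V u g ->
  (forall k, smooth1 (F_ k)) -> (forall k, F_ k 0 = 0) -> (forall k s, `|'D_1 (F_ k) s| <= C) ->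
  (forall s, F_ k s @[k --> \oo] --> F s) -> (forall s, 'D_1 (F_ k) s @[k --> \oo] --> G s) ->
  HA mu A V (fun x => F (u x)) (fun x => G (u x) *: g x).
Proof.
move=> hu sF F0 dF cF cG; have [mfu mg _] := hu.
have L2u := HA_L2 hmu hu; have iq := HA_Ig_q hmu eA hu.
have mF_ k : meas (F_ k) by apply: continuous_measurable_fun; exact: smooth1_cont.
have mdF_ k : meas (fun s => 'D_1 (F_ k) s).
  by apply: continuous_measurable_fun; exact/smooth1_cont/smooth1_derive.
have mF : meas F by apply: (measurable_fun_cvg mF_) => s _; exact: cF.
have mG : meas G by apply: (measurable_fun_cvg mdF_) => s _; exact: cG.
have Fb k s : `|F_ k s| <= C * `|s|.
  by have := smooth1_lip (sF k) (dF k) s 0; rewrite F0 !subr0.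
have Fb' s : `|F s| <= C * `|s|.
  exact: (cvg_norm_le (cF s) (Fb^~ s)).
have Gb s : `|G s| <= C.
  exact: (cvg_norm_le (cG s) (dF^~ s)).
apply: (HA_closed eA (u_ := fun k x => F_ k (u x)) (g_ := fun k x => 'D_1 (F_ k) (u x) *: g x)).
- by move=> k; exact: (HA_smooth hu).
- exact: measurableT_comp mF mfu.
- by apply: mfieldZ => //; exact: measurableT_comp mG mfu.
- apply: (Cv0_dct_sq (K := C + C) L2u).
  + by move=> n; apply: measurable_funB; [exact: measurableT_comp (mF_ n) mfu|exact: measurableT_comp mF mfu].
  + by move=> n; apply: aeW => x; rewrite (le_trans (ler_normB _ _))// mulrDl lerD.
  + by apply: aeW => x; apply/subr_cvg0; exact: cF.
- have e k x : 'D_1 (F_ k) (u x) *: g x - G (u x) *: g x = ('D_1 (F_ k) (u x) - G (u x)) *: g x.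
    by rewrite scalerBl.
  under [X in Cv0 _ X]eq_fun do under eq_fun do rewrite e.
  apply: (Cv0_dct_q (K := C + C)) => //.
  + move=> n; apply: measurable_funB; last exact: measurableT_comp mG mfu.
    exact: (measurableT_comp (mdF_ n) mfu).
  + by move=> n; apply: aeW => x; rewrite (le_trans (ler_normB _ _))// lerD.
  + by apply: aeW => x; apply/subr_cvg0; exact: cG.
Qed.

End chain.

End sobolev_calculus.

(** * Smooth approximations of the positive part and of truncation *)

Section smooth1_truncation.
Context {R : realType}.
Implicit Types (F : R -> R) (s r c : R).

Lemma derive_const_near F (U : set R) c s : open U -> (forall t, U t -> F t = c) -> U s ->
  'D_1 F s = 0.
Proof.
move=> oU Fc Us; rewrite (near_eq_derive (g := cst c)) ?derive_cst//.
by apply: filterS (open_nbhs_nbhs (conj oU Us)) => y /Fc.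
Qed.

Lemma smooth1_bounded F r : smooth1 F -> (forall s, r < `|s| -> F s = 0) ->
  exists2 C : R, 0 <= C & forall s, `|F s| <= C.
Proof.
move=> sF F0; have [||c _ hc] := @EVT_max R (fun s => `|F s|) (- `|r|) `|r|.
- by rewrite ge0_cp.
- apply: continuous_subspaceT => x; apply: (@continuous_comp _ _ _ F (fun t : R => `|t|)).
    exact: smooth1_cont.
  exact: norm_continuous.
exists `|F c|; first exact: normr_ge0.
move=> s; have [sr|sr] := leP `|s| `|r|.
  by apply: hc; rewrite in_itv/= -ler_norml.
by rewrite F0 ?normr0// (le_lt_trans (ler_norm _)).
Qed.

Lemma smooth1_derive_out F r : (forall s, r < `|s| -> F s = 0) ->
  forall s, r < `|s| -> 'D_1 F s = 0.
Proof.
move=> F0 s sr; apply: (@derive_const_near F [set t | r < `|t|] 0) => //.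
apply: (@open_comp _ _ (fun t : R => `|t|) [set t | r < t]); last exact: open_gt.
by move=> x _; exact: norm_continuous.
Qed.

Lemma step_derive_out s : s < 0 \/ 1 < s -> 'D_1 (@step R) s = 0.
Proof.
case=> s0.
- apply: (@derive_const_near _ [set t | t < 0] 0); [exact: open_lt| |exact: s0].
  by move=> t /= /ltW/step_le0.
- apply: (@derive_const_near _ [set t | 1 < t] 1); [exact: open_gt| |exact: s0].
  by move=> t /= /ltW/step_ge1.
Qed.

Lemma step_derive_le0 s : s <= 0 -> s * 'D_1 (@step R) s = 0.
Proof.
rewrite le_eqVlt => /orP[/eqP ->|s0]; first by rewrite mul0r.
by rewrite step_derive_out ?mulr0//; left.
Qed.

(** In [ramp_derive] the steepness [k] enters only through [t] and [t * step'(t)] with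
    [t = k (s - c)], multiplied by no power of [k]; this bound is therefore uniform in [k], as
    [HA_chain] requires. *)
Lemma step_derive_bounded : exists2 K : R, 0 <= K & forall s, `|s * 'D_1 (@step R) s| <= K.
Proof.
apply: (@smooth1_bounded _ 1).
  by apply: smooth1M; [exact: smooth1_id|exact/smooth1_derive/step_smooth].
move=> s; rewrite ltr_normr => /orP[s1|s1]; first by rewrite step_derive_out ?mulr0//; right.
by rewrite step_derive_le0//; lra.
Qed.

Definition ramp (k : nat) (c s : R) := (s - c) * step (k%:R * s - k%:R * c).

Lemma ramp_smooth k c : smooth1 (ramp k c).
Proof.
apply: smooth1M.
  by have := smooth1_affine 1 (- c); under eq_fun do rewrite mul1r.
by apply: (smooth1_comp step_smooth); exact: smooth1_affine.
Qed.

Lemma ramp_derive k c s : 'D_1 (ramp k c) s = step (k%:R * s - k%:R * c) +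
  (k%:R * s - k%:R * c) * 'D_1 (@step R) (k%:R * s - k%:R * c).
Proof.
have aff (a b : R) : is_derive s 1 (fun s : R => a * s + b) a.
  by apply: is_derive_eq; rewrite addr0; exact: mulr1.
have h1 : is_derive s 1 (fun s : R => s - c) 1.
  by have := aff 1 (- c); under eq_fun do rewrite mul1r.
have h2 := aff k%:R (- (k%:R * c)).
have d2 := @ex_derive _ _ _ _ _ _ _ h2.
have h3 := is_derive_comp d2 (smooth1_der (x := k%:R * s - k%:R * c) (@step_smooth R)).
have := is_deriveM h1 h3 => h4; rewrite [LHS](derive_val (is_derive := h4)).
rewrite /= (derive_val (is_derive := h2)) /GRing.scale /= mulr1.
by rewrite addrC; congr (_ + _); ring.
Qed.

Lemma ramp_le k c s : s <= c -> ramp k c s = 0.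
Proof.
move=> sc; rewrite /ramp step_le0 ?mulr0// -mulrBr.
by rewrite mulr_ge0_le0 ?ler0n// subr_le0.
Qed.

Lemma ramp_far c s : c < s -> \forall k \near \oo, 1 < k%:R * s - k%:R * c.
Proof.
move=> cs; have sc0 : 0 < s - c by rewrite subr_gt0.
exists (Num.bound (s - c)^-1) => // k /= hk; rewrite -mulrBr -ltr_pdivrMr// mul1r.
by rewrite (lt_le_trans (archi_boundP _)) ?ler_nat// invr_ge0 ltW.
Qed.

Lemma ramp_cvg c s : ramp k c s @[k --> \oo] --> Num.max (s - c) 0.
Proof.
have [sc|cs] := leP s c.
  rewrite max_r ?subr_le0//; under eq_fun do rewrite ramp_le//; exact: cvg_cst.
rewrite max_l ?subr_ge0 1?ltW//; apply: cvg_near_cst.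
by apply: filterS (ramp_far cs) => k h; rewrite /ramp step_ge1 ?mulr1// ltW.
Qed.

Lemma ramp_derive_cvg c s : 'D_1 (ramp k c) s @[k --> \oo] --> (if c < s then 1 else 0 : R).
Proof.
apply: cvg_near_cst; have [cs|sc] := ltP c s.
  apply: filterS (ramp_far cs) => k h.
  by rewrite ramp_derive step_ge1 ?(ltW h)// step_derive_out ?mulr0 ?addr0//; right.
apply: nearW => k; have h : k%:R * s - k%:R * c <= 0.
  by rewrite -mulrBr mulr_ge0_le0 ?ler0n// subr_le0.
by rewrite ramp_derive step_le0// step_derive_le0// addr0.
Qed.

(** A truncation at height [M] that maps test functions to test functions: the identity for
    [|s| <= M + 1], one unit beyond [M] so that the derivative is 1 on [|s| <= M], and 0 for
    [|s| > M + 2]. *)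
Definition trunc (M s : R) := s * (step (M + 2 - s) * step (M + 2 + s)).

Lemma trunc_smooth M : smooth1 (trunc M).
Proof.
apply: smooth1M; first exact: smooth1_id.
apply: smooth1M; apply: (smooth1_comp step_smooth).
  by have := smooth1_affine (-1) (M + 2); under eq_fun do rewrite mulN1r addrC.
by have := smooth1_affine 1 (M + 2); under eq_fun do rewrite mul1r addrC.
Qed.

Lemma trunc_id M s : `|s| <= M + 1 -> trunc M s = s.
Proof. by rewrite ler_norml => /andP[h1 h2]; rewrite /trunc !step_ge1 ?mulr1//; lra. Qed.

Lemma trunc_out M s : M + 2 < `|s| -> trunc M s = 0.
Proof.
rewrite ltr_normr => /orP[h|h]; rewrite /trunc.
  by rewrite [step (_ - _)]step_le0 ?mul0r ?mulr0//; lra.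
by rewrite [step (_ + s)]step_le0 ?mulr0//; lra.
Qed.

Lemma trunc_le_abs M s : `|trunc M s| <= `|s|.
Proof.
have s0 := @step_ge0 R; have s1 := @step_le1 R.
rewrite normrM ler_piMr// ger0_norm; last by apply: mulr_ge0; exact: s0.
by apply: mulr_ile1; rewrite ?s0 ?s1.
Qed.

Lemma trunc_le M s : 0 <= M -> `|trunc M s| <= M + 2.
Proof.
move=> M0; have [sM|/trunc_out ->] := leP `|s| (M + 2); last by rewrite normr0; lra.
exact: (le_trans (trunc_le_abs _ _) sM).
Qed.

Lemma trunc0 (M : R) : trunc M 0 = 0. Proof. by rewrite /trunc mul0r. Qed.

Lemma trunc_derive M s : `|s| <= M -> 'D_1 (trunc M) s = 1.
Proof.
move=> sM; rewrite (near_eq_derive (g := id)) ?derive_id//.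
exists 1 => //= t; rewrite /ball /= => st; apply: trunc_id.
by rewrite -(subrK s t) (le_trans (ler_normD _ _))// addrC lerD// distrC ltW.
Qed.

Lemma trunc_derive_bounded M : exists2 C : R, 0 <= C & forall s, `|'D_1 (trunc M) s| <= C.
Proof.
apply: (@smooth1_bounded _ (M + 2)); first exact/smooth1_derive/trunc_smooth.
by apply: smooth1_derive_out; exact: trunc_out.
Qed.

End smooth1_truncation.

(** * Positive parts, bounded approximation and products *)

Section sobolev_lattice.
Context {R : realType} {d : nat} (mu : {measure set 'rV[R]_d -> \bar R})
  (b : 'rV[R]_d -> 'rV[R]_d) (hmu : ibp_measure mu b).
Local Notation T := 'rV[R]_d.
Implicit Types (u v f : T -> R) (g h : T -> T) (V W : set T).
Variables (A : T -> 'M[R]_d) (eA : elliptic A).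
Local Notation q x xi := (bilin (A x) xi xi).

Lemma HA_pos V u g (c : R) : 0 <= c -> HA mu A V u g ->
  HA mu A V (fun x => Num.max (u x - c) 0) (fun x => (if c < u x then 1 else 0) *: g x).
Proof.
move=> c0 hu; have [K K0 hK] := @step_derive_bounded R.
apply: (@HA_chain _ _ _ _ hmu _ eA V u g (fun k => ramp k c) (fun s => Num.max (s - c) 0)
  (fun s => if c < s then 1 else 0) (1 + K)).
- exact: hu.
- by move=> k; exact: ramp_smooth.
- by move=> k; exact: ramp_le.
- move=> k s; rewrite ramp_derive (le_trans (ler_normD _ _))// lerD//.
  by rewrite ger0_norm ?step_ge0// step_le1.
- exact: ramp_cvg.
- exact: ramp_derive_cvg.
Qed.

(** The positive parts of [u] and [- u] have gradient 0 where [u = 0], because [HA_pos] comes with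
    the strict inequality [c < u x]; their difference is [u], and gradients are unique. *)
Lemma HA_grad0 V u g : HA mu A V u g -> {ae mu, forall x, u x = 0 -> g x = 0}.
Proof.
move=> hu; have h1 := HA_pos (lexx 0) hu; have h2 := HA_pos (lexx 0) (HAN hu).
have h3 := HAB eA h1 h2.
have hx : {ae mu, forall x, u x = Num.max (u x - 0) 0 - Num.max (- u x - 0) 0}.
  apply: aeW => x /=; rewrite !subr0; have [u0|u0] := leP (u x) 0.
    by rewrite max_l ?oppr_ge0// opprK add0r.
  by rewrite max_r ?subr0// oppr_le0 ltW.
by apply: filterS (HA_grad_unique hmu eA eA hu h3 hx) => x -> /= ux; rewrite ux oppr0 ltxx !scale0r subr0.
Qed.

Lemma HA_approx_bounded V u g (M : R) : HA mu A V u g -> {ae mu, forall x, `|u x| <= M} -> 0 <= M ->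
  exists u_ : nat -> T -> R, [/\ happrox mu A V u_ u g,
    {ae mu, forall x, u_ n x @[n --> \oo] --> u x} & forall n x, `|u_ n x| <= M + 2].
Proof.
move=> hu uM M0; have [u_ [hu_ ua]] := HA_approx_ae hu; have [C C0 hC] := trunc_derive_bounded M.
have [mfu mg _] := hu.
have [t1 t2 t3] := happrox_smooth hmu eA hu hu_ ua (trunc_smooth M) (trunc0 M) hC.
have tM x : `|u x| <= M -> trunc M (u x) = u x by move=> h; rewrite trunc_id// (le_trans h)// lerDl.
exists (fun n x => trunc M (u_ n x)); split.
- split; first exact: t1.
    apply: (Cv0_eq t2) => [n|n].
      by apply: measurable_funX; apply: measurable_funB => //; exact: test_mf (t1 n).
    by apply: filterS uM => x h; rewrite tM.
  apply: (Cv0_eq t3) => [n|n].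
    by apply: (mf_q eA); apply: mfieldB => //; exact: mfield_cgrad (t1 n).
  by apply: filterS uM => x h; rewrite trunc_derive// scale1r.
- apply: filterS2 ua uM => x h1 h2; rewrite -[X in _ --> X](tM x h2).
  by apply: (cvg_comp _ _ h1); exact: (smooth1_cont (trunc_smooth M)).
- by move=> n x; exact: trunc_le.
Qed.

(** Only the first factor is approximated by test functions, so the product stays in the domain [V]
    of that factor, whatever [W] is. *)
Lemma HA_mul V W u g v h : HA mu A V u g -> HA mu A W v h -> ess_bounded mu u -> ess_bounded mu v ->
  HA mu A V (fun x => u x * v x) (fun x => u x *: h x + v x *: g x).
Proof.
move=> hu hv [M0 uM0] [N0 vN0].
have [M [M0' uM]] : exists M : R, 0 <= M /\ {ae mu, forall x, `|u x| <= M}.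
  by exists `|M0|; split=> //; apply: filterS uM0 => x /le_trans; apply; exact: ler_norm.
have [N [N0' vN]] : exists M : R, 0 <= M /\ {ae mu, forall x, `|v x| <= M}.
  by exists `|N0|; split=> //; apply: filterS vN0 => x /le_trans; apply; exact: ler_norm.
have [u_ [hu_ ua ub]] := HA_approx_bounded hu uM M0'; have [tu cu cg] := hu_.
have [mfu mg _] := hu; have [mfv mh _] := hv.
apply: (HA_closed eA (u_ := fun n x => u_ n x * v x)
  (g_ := fun n x => u_ n x *: h x + v x *: cgrad (u_ n) x)).
- by move=> n; exact: (HA_cut eA eA hv (tu n)).
- exact: measurable_funM.
- by apply: mfieldD; exact: mfieldZ.
- apply: (Cv0_le (C := N ^+ 2) cu) => [n|n].
    apply: measurable_funX; apply: measurable_funB; apply: measurable_funM => //.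
    exact: test_mf (tu n).
  apply: filterS vN => x hx; rewrite -mulrBl exprMn normrM mulrC ler_wpM2r//.
  by rewrite normrX lerXn2r// nnegrE.
- have e n x : u_ n x *: h x + v x *: cgrad (u_ n) x - (u x *: h x + v x *: g x) =
     (u_ n x - u x) *: h x + v x *: (cgrad (u_ n) x - g x).
    by rewrite scalerBl scalerBr opprD addrACA.
  under [X in Cv0 _ X]eq_fun do under eq_fun do rewrite e.
  have mB n : mfield (fun x => cgrad (u_ n) x - g x) by exact: approx_mB hu_ mg.
  have mB0 n : meas (fun x => u_ n x - u x) by exact: approx_mB0 hu_ mfu.
  apply: (Cv0_qD eA).
  + by move=> n; exact: mfieldZ.
  + by move=> n; apply: mfieldZ.
  + apply: (Cv0_dct_q eA (K := M + 2 + M)).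
    * exact: mh.
    * exact: (HA_Ig_q hmu eA hv).
    * exact: mB0.
    * by move=> n; apply: filterS uM => x hx; rewrite (le_trans (ler_normB _ _))// lerD.
    * by apply: filterS ua => x hx; apply/subr_cvg0.
  + apply: (Cv0_le (C := N ^+ 2) cg) => [n|n].
      by apply: (mf_q eA); exact: mfieldZ.
    apply: filterS vN => x hx; rewrite !ger0_norm ?(q_ge0 eA)// qZ ler_wpM2r ?(q_ge0 eA)//.
    by rewrite -(real_normK (num_real (v x))) lerXn2r// nnegrE.
Qed.

End sobolev_lattice.

(** * From [Lfun] and [Lnorm] to integrals *)

Section lnorm.
Context {R : realType} d (X : measurableType d) (mu : {measure set X -> \bar R}).
Implicit Types f g : X -> R.

Lemma ecvg0P (a : nat -> \bar R) : (forall n, 0 <= a n)%E ->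
  a n @[n --> \oo] --> 0%E <->
  forall e : R, 0 < e -> exists N, forall n, (N <= n)%N -> (a n <= e%:E)%E.
Proof.
move=> a0; split=> [+ e e0|h].
  move/fine_cvgP => [[N1 _ h1] /cvgrPdist_lt /(_ e e0) [N2 _ h2]].
  exists (maxn N1 N2) => n; rewrite geq_max => /andP[n1 n2].
  have := h2 n n2; rewrite /= sub0r normrN => h3.
  by rewrite -(fineK (h1 n n1)) lee_fin (le_trans (ler_norm _))// ltW.
apply/fine_cvgP; split.
  have [N hN] := h 1 ltr01; exists N => // n /= /hN hn.
  by rewrite ge0_fin_numE// (le_lt_trans hn)// ltry.
apply/cvgrPdist_le => e e0; have [N hN] := h e e0; exists N => // n /= /hN hn.
rewrite sub0r normrN ger0_norm ?fine_ge0// -lee_fin fineK//.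
by rewrite ge0_fin_numE// (le_lt_trans hn)// ltry.
Qed.

Lemma Lnorm2E f : 'N[mu]_(2%:E)[EFin \o f]%E = ((\int[mu]_x `|f x ^+ 2|%:E) `^ 2^-1)%E.
Proof.
rewrite unlock; congr (_ `^ _)%E; apply: eq_integral => x _ /=.
by rewrite powR_mulrn// normrX.
Qed.

Lemma sqrte_le (x : \bar R) (e : R) : (0 <= x)%E -> 0 < e ->
  (x `^ 2^-1 <= e%:E)%E = (x <= (e ^+ 2)%:E)%E.
Proof.
move=> x0 e0; case: x x0 => [x|_|//]; last first.
  by rewrite poweRyr ?gt_eqF ?invr_gt0// !leye_eq.
rewrite !lee_fin => x0; rewrite powR12_sqrt//.
by rewrite -[LHS](@ler_pXn2r _ 2)// ?nnegrE ?sqrtr_ge0 ?(ltW e0)// sqr_sqrtr.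
Qed.

Lemma Lfun2P f : f \in Lfun mu 2%:E <-> L2 mu f.
Proof.
split=> [hf|[mf i2]].
  split; last exact: Lfun2_integrable_sqr.
  by move: hf; rewrite inE => /andP[]; rewrite inE.
rewrite inE; apply/andP; split; rewrite inE//= /finite_norm Lnorm2E poweR_lty//.
by have /IgP[] := i2.
Qed.

Lemma Lfun1P f : f \in Lfun mu 1 <-> Ig mu f.
Proof. exact: Lfun1_integrable. Qed.

Lemma cvg_Lp2P (u_ : nat -> X -> R) u : (forall n, meas (u_ n)) ->
  meas u ->
  'N[mu]_(2%:E)[EFin \o (u_ n \- u)%R]%E @[n --> \oo] --> 0%E <->
  Cv0 mu (fun n x => (u_ n x - u x) ^+ 2).
Proof.
move=> mu_ mfu; have N0 n : (0 <= 'N[mu]_(2%:E)[EFin \o (u_ n \- u)%R])%E by exact: Lnorm_ge0.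
have i0 n : (0 <= \int[mu]_x `|(u_ n x - u x) ^+ 2|%:E)%E by exact: integral_ge0.
split=> [/(ecvg0P N0) h|[_ /(ecvg0P i0) h]].
  split; first by move=> n; apply: measurable_funX; exact: measurable_funB.
  apply/(ecvg0P i0) => e e0; have [|N hN] := h (Num.sqrt e); first by rewrite sqrtr_gt0.
  exists N => n /hN; rewrite Lnorm2E sqrte_le ?sqrtr_gt0//; last exact: i0.
  by rewrite sqr_sqrtr// ltW.
apply/(ecvg0P N0) => e e0; have [|N hN] := h (e ^+ 2); first by rewrite exprn_gt0.
by exists N => n /hN; rewrite Lnorm2E sqrte_le//; exact: i0.
Qed.

Lemma cvg_Lp1P (u_ : nat -> X -> R) u : (forall n, meas (u_ n)) ->
  meas u ->
  'N[mu]_1[EFin \o (u_ n \- u)%R]%E @[n --> \oo] --> 0%E <->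
  Cv0 mu (fun n x => u_ n x - u x).
Proof.
move=> mu_ mfu; rewrite /Cv0; under [X in X @ _]eq_fun do rewrite Lnorm1.
by split=> [h|[]//]; split=> // n; exact: measurable_funB.
Qed.

Lemma cvg_const_eq (a : nat -> R) (l c : R) : a n @[n --> \oo] --> l ->
  (forall n, a n = c) -> l = c.
Proof.
move=> al ac; apply: (cvg_unique (@Rhausdorff R) al).
by under [X in X @ _]eq_fun do rewrite ac; exact: cvg_cst.
Qed.

Lemma Cv0_sum (I : Type) (s : seq I) (q_ : I -> nat -> X -> R) :
  (forall i, Cv0 mu (q_ i)) -> Cv0 mu (fun n x => \sum_(i <- s) q_ i n x).
Proof.
move=> h; elim: s => [|i s IH].
  under eq_fun do under eq_fun do rewrite big_nil.
  apply: Cv0_ge0 => [n|n]; first exact: measurable_cst.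
  by under eq_integral do rewrite normr0; rewrite integral0 lee_fin invr_ge0.
by under eq_fun do under eq_fun do rewrite big_cons; exact: Cv0D.
Qed.

End lnorm.

(** * The spaces [H0] and [Hloc] in terms of energy closures *)

Section sobolev_interface.
Context {R : realType} {d : nat} (mu : {measure set 'rV[R]_d -> \bar R})
  (b : 'rV[R]_d -> 'rV[R]_d) (hmu : ibp_measure mu b).
Local Notation T := 'rV[R]_d.
Local Notation id1 := (fun _ : T => 1%:M : 'M[R]_d).
Implicit Types (u v f : T -> R) (g h : T -> T) (V W : set T) (A : T -> 'M[R]_d).
Local Notation q A x xi := (bilin (A x) xi xi).

Lemma elliptic1 : elliptic id1.
Proof.
split; first by move=> i j; exact: measurable_cst.
- by move=> x i j; rewrite !mxE eq_sym.
- by move=> V _; exists 1 => // xi x _; rewrite bilin1 invr1 mul1r lexx.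
Qed.

Lemma H0_gradP V u g : H0_grad mu V u g <-> HA mu id1 V u g.
Proof.
have E (xi : T) : bilin 1%:M xi xi = \sum_i xi ord0 i ^+ 2.
  by rewrite bilin1 dotE; apply: eq_bigr => i _; rewrite expr2.
split=> [[/Lfun2P[mfu iu] hg [u_ [tu cu cg]]]|hu].
  have mg : mfield g by move=> j; case: (Lfun2P mu (fun x => g x ord0 j)).1.
  have mtu n : meas (u_ n) := test_mf (tu n).
  split=> //; exists u_; split; [exact: tu|exact/cvg_Lp2P|].
  under [X in Cv0 _ X]eq_fun do under eq_fun do rewrite E.
  apply: Cv0_sum => j; have := (cvg_Lp2P mu (fun n => test_mf (test_partial j (tu n))) (mg j)).1 (cg j).
  by congr (Cv0 _ _); apply/funext => n; apply/funext => x; rewrite !mxE.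
have [mfu mg [u_ hu_]] := hu; have [tu cu cg] := hu_.
have L2g j : L2 mu (fun x => g x ord0 j).
  split; first exact: mg.
  apply: (Ig_le _ (HA_Ig_q hmu elliptic1 hu)); first by apply: measurable_funX; exact: mg.
  apply: aeW => x; rewrite !ger0_norm ?sqr_ge0 ?(q_ge0 elliptic1)// bilin1; exact: sqr_coord_le.
split; first by apply/Lfun2P; exact: (HA_L2 hmu hu).
  by move=> j; exact/Lfun2P.
exists u_; split; [exact: tu|apply/cvg_Lp2P => // n; exact: test_mf (tu n)|].
move=> j; apply/(cvg_Lp2P mu (fun n => test_mf (test_partial j (tu n))) (mg j)).
apply: (Cv0_le (C := 1) cg) => [n|n].
  by apply: measurable_funX; apply: measurable_funB; [exact: test_mf (test_partial j (tu n))|exact: mg].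
apply: aeW => x; rewrite mul1r !ger0_norm ?sqr_ge0 ?(q_ge0 elliptic1)// bilin1.
by have := sqr_coord_le (cgrad (u_ n) x - g x) j; rewrite !mxE.
Qed.

Lemma HA_supp A V u g (r : R) : elliptic A -> closure V `<=` cube r -> HA mu A V u g ->
  {ae mu, forall x, ~ closure V x -> u x = 0 /\ g x = 0}.
Proof.
move=> eA Vr hu; have [u_ [hu_ ua]] := HA_approx_ae hu; have [tu cu cg] := hu_.
have [s [hs cs]] := Cv0_ae cg.
apply: filterS2 ua cs => x h1 h2 Vx.
have oV : open (~` closure V) by apply: closed_openC; exact: closed_closure.
have u0 n (y : T) : ~ closure V y -> u_ n y = 0.
  move=> Vy; apply: contrapT => /eqP h; apply: Vy; apply: subset_closure.
  by have [_ _] := tu n; apply; apply: subset_closure.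
split.
  by apply: (cvg_const_eq h1) => n; exact: u0.
apply: (q_eq0 eA (x := x)); symmetry; apply: (cvg_const_eq h2) => k.
by rewrite (@cgrad_near0 _ _ _ (~` closure V) x oV (u0 _) Vx) sub0r qN.
Qed.

Lemma HA_out A V u g : HA mu A V u g -> {ae mu, forall x, ~ V x -> u x = 0}.
Proof.
move=> hu; have [u_ [[tu _ _] ua]] := HA_approx_ae hu; apply: filterS ua => x h Vx.
apply: (cvg_const_eq h) => n.
apply: contrapT => /eqP h0; apply: Vx; have [_ _] := tu n; apply; exact: subset_closure.
Qed.

(** A function of the closure and its gradient vanish off the compact set [closure V], on which any
    two elliptic matrix fields are comparable. *)
Lemma HA_change A A' V u g : elliptic A -> elliptic A' -> relatively_compact V ->
  HA mu A V u g -> HA mu A' V u g.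
Proof.
move=> eA eA' cV hu; have [n Vn] := compact_cube cV.
have s0 := HA_supp eA Vn hu; have [mfu mg [u_ hu_]] := hu; have [tu cu cg] := hu_.
split=> //; exists u_; split; [exact: tu|exact: cu|].
have [nu nu0 hnu] := ell_cube eA n.+1%:R; have [nu' nu0' hnu'] := ell_cube eA' n.+1%:R.
apply: (Cv0_le (C := nu' * nu) cg) => [k|k]; first exact: (mf_q eA' (approx_mB k hu_ mg)).
have oV : open (~` closure V) by apply: closed_openC; exact: closed_closure.
have u0 (y : T) : ~ closure V y -> u_ k y = 0.
  move=> Vy; apply: contrapT => /eqP h; apply: Vy; apply: subset_closure.
  by have [_ _] := tu k; apply; apply: subset_closure.
apply: filterS s0 => x hx; rewrite !ger0_norm ?(q_ge0 eA) ?(q_ge0 eA')//.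
have [Vx|Vx] := pselect (closure V x); last first.
  rewrite (@cgrad_near0 _ _ _ (~` closure V) x oV u0 Vx) (hx Vx).2 subr0 !bilin0l.
  by rewrite mulr0.
apply: (le_trans (hnu' x _ (Vn x Vx)).2); rewrite -mulrA ler_wpM2l ?(ltW nu0')//.
exact: (hnu x _ (Vn x Vx)).1.
Qed.

(* g is the gradient of u in the sense of H^{1,2}_loc *)
Definition locgrad u g : Prop := [/\ meas u, mfield g &
  forall chi, test_fun setT chi ->
  HA mu id1 setT (fun x => chi x * u x) (fun x => chi x *: g x + u x *: cgrad chi x)].

Local Notation cut n := (@cutoff R d n%:R).

Lemma cgrad_near_cst u (c : R) (U : set T) x : smooth u -> open U -> (forall y, U y -> u y = c) ->
  U x -> cgrad u x = 0.
Proof.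
move=> su oU uc Ux; have := @cgrad_near0 _ _ (fun y => u y + (- c)) U x oU.
rewrite (cgradD x su (smooth_cst _)).
rewrite (_ : cgrad (fun=> - c) x = 0) ?addr0; last by apply/rowP => i; rewrite !mxE partial_cst.
by apply=> // y /uc ->; rewrite subrr.
Qed.

Lemma test_cut (V : set T) chi : test_fun V chi -> exists n : nat, forall m : nat, (n <= m)%N -> forall x,
  [/\ chi x * cut m x = chi x, chi x *: cgrad (cut m) x = 0 &
   cut m x *: cgrad chi x = cgrad chi x].
Proof.
move=> tc; have [n hn] := test_cubeP tc; exists n.+2 => m nm x.
have cE (y : T) : cube (n.+1%:R + 1) y -> cut m y = 1.
  move=> yn; apply: cutoff1 => i; apply: ltW; apply: (lt_le_trans (yn i)).
  by rewrite natr1 ler_nat.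
have n0 : (0 : R) < n.+1%:R + 1 by rewrite ltr_wpDl.
have e1 (y : T) : chi y * cut m y = chi y.
  have [yn|yn] := pselect (cube n.+1%:R y); last by rewrite hn// mul0r.
  by rewrite cE ?mulr1//; apply: cubeS yn; rewrite lerDl.
have sc := test_smooth tc; have sm := test_smooth (@cutoff_test R d m%:R).
have e2 : chi x *: cgrad (cut m) x = 0.
  have [xn|xn] := pselect (cube n.+1%:R x); last by rewrite hn// scale0r.
  rewrite (cgrad_near_cst sm (open_cube n0) cE) ?scaler0//.
  by apply: cubeS xn; rewrite lerDl.
split=> //; move: (cgradM x sc sm); rewrite e2 add0r => <-.
by congr (cgrad _ x); apply/funext => y; rewrite e1.
Qed.

Lemma locgradP A W u g chi : elliptic A -> locgrad u g -> test_fun W chi ->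
  HA mu A W (fun x => chi x * u x) (fun x => chi x *: g x + u x *: cgrad chi x).
Proof.
move=> eA [mfu mg hg] tc; have [n hn] := test_cut tc.
have := HA_cut elliptic1 eA (hg _ (cutoff_test n%:R)) tc.
congr (HA _ _ _ _); apply/funext => x; have [e1 e2 e3] := hn n (leqnn n) x.
  by rewrite mulrA e1.
have z : chi x *: (u x *: cgrad (cut n) x) = 0 by rewrite scalerA mulrC -scalerA e2 scaler0.
have w : (cut n x * u x) *: cgrad chi x = u x *: cgrad chi x by rewrite mulrC -scalerA e3.
by rewrite scalerDr scalerA e1 z w addr0.
Qed.

Lemma HA_locgrad A V u g : elliptic A -> HA mu A V u g -> locgrad u g.
Proof.
move=> eA hu; have [mfu mg _] := hu; split; [exact: mfu|exact: mg|move=> chi tc].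
exact: (HA_cut eA elliptic1 hu tc).
Qed.

Lemma ae_cubes (P : T -> Prop) : (forall n : nat, {ae mu, forall x, cube n.+1%:R x -> P x}) ->
  {ae mu, forall x, P x}.
Proof.
move=> /ae_foralln h; apply: filterS h => x hx; have [n xn] := mem_cube x; apply: (hx n).
by apply: cubeS xn; rewrite ler_nat.
Qed.

Lemma locgrad_is_wgrad u g : locgrad u g -> is_wgrad mu u g.
Proof.
move=> hu; have [mfu mg hg] := hu; split=> // chi h U tc /H0_gradP hc oU U1.
have e : (u \* chi) = (fun x => chi x * u x) by apply/funext => x; rewrite /= mulrC.
rewrite e in hc; have := HA_grad_unique hmu elliptic1 elliptic1 hc (hg _ tc) (aeW _ (fun x => erefl _)).
apply: filterS => x -> Ux.
by rewrite (U1 x Ux) scale1r (cgrad_near_cst (test_smooth tc) oU U1 Ux) scaler0 addr0.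
Qed.

Lemma is_wgrad_unique u g g' : Hloc mu u -> is_wgrad mu u g -> is_wgrad mu u g' ->
  {ae mu, forall x, g x = g' x}.
Proof.
move=> hu [mg h1] [mg' h2]; apply: ae_cubes => n.
have tc : test_fun setT (cut n.+1) := @cutoff_test R d n.+1%:R.
have [h hc] := hu _ tc; have oc : open (cube n.+1%:R : set T) by exact: open_cube.
have c1 (x : T) : cube n.+1%:R x -> cut n.+1 x = 1 by move=> xn; apply: cutoff1 => i; exact: ltW.
have := h2 _ _ _ tc hc oc c1; have := h1 _ _ _ tc hc oc c1; apply: filterS2 => x e1 e2 xn.
by rewrite e1// e2.
Qed.

End sobolev_interface.

(** * Existence of local gradients; compact supports *)

Section wgrad_facts.
Context {R : realType} {d : nat} (mu : {measure set 'rV[R]_d -> \bar R})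
  (b : 'rV[R]_d -> 'rV[R]_d) (hmu : ibp_measure mu b).
Local Notation T := 'rV[R]_d.
Local Notation id1 := (fun _ : T => 1%:M : 'M[R]_d).
Implicit Types (u v f : T -> R) (g h : T -> T) (V W : set T) (A : T -> 'M[R]_d).
Local Notation q A x xi := (bilin (A x) xi xi).
Local Notation cut n := (@cutoff R d n%:R).
Local Notation C n := (@cube R d n.+1%:R).

Lemma open_C n : open (C n). Proof. exact: open_cube. Qed.

Lemma cut1 n x : C n x -> cut n.+1 x = 1.
Proof. by move=> xn; apply: cutoff1 => i; exact: ltW. Qed.

Lemma HA_local A u v g h (U : set T) : elliptic A -> HA mu A setT u g -> HA mu A setT v h ->
  (forall x, U x -> u x = v x) -> {ae mu, forall x, U x -> g x = h x}.
Proof.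
move=> eA hu hv uv; have := HA_grad0 hmu eA (HAB eA hu hv); apply: filterS => x hx Ux.
by apply/eqP; rewrite -subr_eq0 hx// uv// subrr.
Qed.

(** Gluing is done pointwise: [a n.+1] agrees with [a n] on the whole of [C n], not just almost
    everywhere, so [a n x] is eventually constant at every point and the limit is measurable. *)
Lemma cubes_patch (h : nat -> T -> R) : (forall n, meas (h n)) ->
  (forall n, {ae mu, forall x, C n x -> h n x = h n.+1 x}) ->
  exists g : T -> R, meas g /\ forall n, {ae mu, forall x, C n x -> g x = h n x}.
Proof.
move=> mh hh.
pose a := fix a n x := if n is m.+1 then \1_(C m) x * a m x + \1_(~` C m) x * h n x else h 0%N x.
have ain n x : C n x -> a n.+1 x = a n x.
  by move=> xn; rewrite /= !indicE mem_set// memNset ?mul1r ?mul0r ?addr0//; exact.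
have aout n x : ~ C n x -> a n.+1 x = h n.+1 x.
  by move=> xn; rewrite /= !indicE memNset// mem_set// mul1r mul0r add0r.
have mC n : measurable (C n) by exact: measurable_cube.
have ma n : meas (a n).
  elim: n => [|n IH]; first exact: mh.
  apply: measurable_funD; apply: measurable_funM; [|exact: IH| |exact: mh].
    by apply: measurable_indic.
  by apply: measurable_indic; exact: measurableC.
have CS n m : (n <= m)%N -> C n `<=` C m by move=> nm; apply: cubeS; rewrite ler_nat.
have ale n m x : (n <= m)%N -> C n x -> a m x = a n x.
  move=> /subnK <-; elim: (m - n)%N => [//|k IH] xn.
  by rewrite addSn ain ?IH//; apply: CS xn; rewrite leq_addl.
have ah n : {ae mu, forall x, C n x -> a n x = h n x}.
  elim: n => [|n IH]; first by apply: aeW.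
  apply: filterS2 IH (hh n) => x h1 h2 xn1; have [xn|xn] := pselect (C n x).
    by rewrite ain// h1// h2.
  by rewrite aout.
have /choice[N hN] : forall x : T, exists n, C n x.
  by move=> x; have [n xn] := mem_cube x; exists n; apply: cubeS xn; rewrite ler_nat.
have ga n x : C n x -> a (N x) x = a n x.
  by move=> xn; have [Nn|/ltnW nN] := leqP (N x) n; [symmetry|]; exact: ale.
exists (fun x => a (N x) x); split.
  apply: (measurable_fun_cvg ma) => x _.
  by apply: cvg_near_cst; exists (N x) => // n /= Nn; rewrite (ale _ _ _ Nn (hN x)).
by move=> n; apply: filterS (ah n) => x h1 xn; rewrite (ga n)// h1.
Qed.

Lemma is_wgrad_exists u : Hloc mu u -> exists g, is_wgrad mu u g.
Proof.
move=> hu; have /choice[h hh] : forall n : nat, exists h, HA mu id1 setT (u \* cut n.+1) h.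
  by move=> n; have [h /(H0_gradP hmu) hc] := hu _ (@cutoff_test R d n.+1%:R); exists h.
have hl n : {ae mu, forall x, C n x -> h n x = h n.+1 x}.
  apply: (HA_local elliptic1 (hh n) (hh n.+1)) => x xn /=.
  by rewrite !cut1//; apply: cubeS xn; rewrite ler_nat.
have /choice[g hg] : forall j : 'I_d, exists g : T -> R, meas g /\
    forall n, {ae mu, forall x, C n x -> g x = h n x ord0 j}.
  move=> j; apply: cubes_patch => n; first by case: (hh n).
  by apply: filterS (hl n) => x e /e ->.
exists (fun x => \row_j g j x); split.
  by move=> j; under eq_fun do rewrite mxE; exact: (hg j).1.
move=> chi k U tc /(H0_gradP hmu) hk oU U1; apply: ae_cubes => n.
have hl' : {ae mu, forall x, (U `&` C n) x -> h n x = k x}.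
  by apply: (HA_local elliptic1 (hh n) hk) => x [Ux xn] /=; rewrite cut1// U1.
have := @filter_forall _ _ _ _ (ae_filter_ringOfSetsType mu) (fun j => (hg j).2 n).
move: hl'; apply: filterS2 => x h2 h1 xn Ux; rewrite -h2//.
by apply/rowP => j; rewrite mxE h1.
Qed.

Lemma is_wgrad_wgrad u : Hloc mu u -> is_wgrad mu u (wgrad mu u).
Proof. by move=> /is_wgrad_exists[g hg]; rewrite /wgrad; apply: xgetPex; exists g. Qed.

Lemma Hloc_mf u : Hloc mu u -> meas u.
Proof.
move=> hu; have mc n : meas (u \* cut n.+1).
  by have [h /(H0_gradP hmu)[]] := hu _ (@cutoff_test R d n.+1%:R).
apply: (measurable_fun_cvg mc) => x _; apply: cvg_near_cst; have [n xn] := mem_cube x.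
exists n => // m /= nm; rewrite cut1 ?mulr1//; apply: cubeS xn.
by rewrite ler_nat (leq_trans nm).
Qed.

Lemma Hloc_locgrad u : Hloc mu u -> locgrad mu u (wgrad mu u).
Proof.
move=> hu; have [mw hw] := is_wgrad_wgrad hu; have mfu := Hloc_mf hu.
split; [exact: mfu|exact: mw|move=> chi tc].
have [n hn] := test_cut tc; have [n' hn'] := test_cubeP tc.
pose m := maxn n n'; have [h /[dup] hc /(H0_gradP hmu) hh] := hu _ (@cutoff_test R d m.+1%:R).
apply: (HA_ext elliptic1 (HA_cut elliptic1 elliptic1 hh tc)).
- by apply: measurable_funM => //; exact: test_mf tc.
- apply: mfieldD; apply: mfieldZ => //; [exact: test_mf tc|exact: mfield_cgrad tc].
- apply: aeW => x /=; have [|e1 _ _] := hn m.+1 _ x; first by rewrite leqW// leq_maxl.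
  by rewrite mulrCA e1 mulrC.
- have := hw _ _ _ (@cutoff_test R d m.+1%:R) hc (@open_C m) (@cut1 m).
  apply: filterS => x hx; have [|_ _ e3] := hn m.+1 _ x; first by rewrite leqW// leq_maxl.
  rewrite -scalerA e3; congr (_ + _); have [xn|xn] := pselect (C n' x); last first.
    by rewrite hn'// !scale0r.
  by rewrite hx//; apply: cubeS xn; rewrite ler_nat ltnS leq_maxr.
Qed.

Lemma locgrad_Hloc u g : locgrad mu u g -> Hloc mu u.
Proof.
move=> [_ _ hu] chi tc; have := hu _ tc; move=> /(H0_gradP hmu) h; eexists.
by move: h; congr (H0_grad _ _ _ _); apply/funext => x; rewrite /= mulrC.
Qed.

Lemma locgrad_wgrad u g : locgrad mu u g -> {ae mu, forall x, g x = wgrad mu u x}.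
Proof.
move=> hu; have hl := locgrad_Hloc hu.
exact: (is_wgrad_unique hl (locgrad_is_wgrad hmu hu) (is_wgrad_wgrad hl)).
Qed.

Lemma HA_wgrad A V u g : elliptic A -> HA mu A V u g -> {ae mu, forall x, g x = wgrad mu u x}.
Proof. by move=> eA hu; exact: (locgrad_wgrad (HA_locgrad eA hu)). Qed.

Lemma locgradD u g v h : locgrad mu u g -> locgrad mu v h ->
  locgrad mu (fun x => u x + v x) (fun x => g x + h x).
Proof.
move=> [mfu mg hu] [mv mh hv]; split; [exact: measurable_funD|exact: mfieldD|move=> chi tc].
have := HAD elliptic1 (hu _ tc) (hv _ tc); congr (HA _ _ _ _); apply/funext => x.
  by rewrite mulrDr.
by rewrite scalerDr scalerDl addrACA.
Qed.

Lemma locgradZ c u g : locgrad mu u g -> locgrad mu (fun x => c * u x) (fun x => c *: g x).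
Proof.
move=> [mfu mg hu]; split; [exact: measurable_funM|exact: mfieldZc|move=> chi tc].
have := HAZ c (hu _ tc); congr (HA _ _ _ _); apply/funext => x.
  by rewrite mulrCA.
by rewrite scalerDr !scalerA mulrC.
Qed.

Lemma locgrad_L2 u g eta : locgrad mu u g -> test_fun setT eta -> L2 mu (fun x => u x * eta x).
Proof.
move=> [_ _ hc] te; have := HA_L2 hmu (hc _ te).
by congr L2; apply/funext => x; rewrite mulrC.
Qed.

Lemma locgrad_gradL2 u g eta j : locgrad mu u g -> test_fun setT eta ->
  L2 mu (fun x => g x ord0 j * eta x).
Proof.
move=> [_ _ hc] te; have [n hn] := test_cut te.
have hu := hc _ (@cutoff_test R d n%:R); have [_ mg _] := hu.
have := bcs_comp elliptic1 j (bcs_test te) mg (HA_Ig_q hmu elliptic1 hu).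
congr L2; apply/funext => x; rewrite !mxE.
have [e1 /rowP/(_ j) e2 _] := hn n (leqnn n) x; rewrite !mxE in e2.
by rewrite mulrDr mulrA e1 mulrCA e2 mulr0 addr0 mulrC.
Qed.

(** The complement of the support is a union of open sets of measure 0 for [|u| mu]; a countable
    subcover, by [lindelof_rV], shows that [u] vanishes almost everywhere on it. *)
Lemma compact_suppP u : meas u ->
  compact_supp mu u <-> exists n : nat, {ae mu, forall x, ~ C n x -> u x = 0}.
Proof.
move=> mfu; have mE : meas (EFin \o u) by exact: mf_E.
have aeI (W : set T) : measurable W -> (\int[mu]_(x in W) `|u x|%:E = 0)%E <->
    {ae mu, forall x, W x -> u x = 0}.
  move=> mW; have mW' : measurable_fun W (EFin \o u) by exact: measurable_funTS.
  have [h1 h2] := ae_eq_integral_abs mu mW mW'.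
  split=> [/h1|h]; first by apply: filterS => x h /h[].
  by apply: h2; apply: filterS h => x h /h /= ->.
split=> [cu|[n hn]].
  have [n hn] := compact_cube cu; exists n.
  (* The measurable envelope [W] makes the property hereditary for arbitrary subsets, as
     [lindelof_rV] demands. *)
  pose P V := exists W : set T, [/\ V `<=` W, measurable W & (\int[mu]_(x in W) `|u x|%:E = 0)%E].
  have [|||B [hB UB]] := @lindelof_rV R d P (~` C n).
  - by move=> V W VW [W' [h1 h2 h3]]; exists W'; split=> //; exact: subset_trans h1.
  - by exists set0; split=> //; rewrite integral_set0.
  - move=> x xn; have xs : ~ msupp (fun U => \int[mu]_(x in U) `|u x|%:E)%E x by move=> /hn.
    have : exists U : set T, [/\ open U, U x & ~ (0 < \int[mu]_(x in U) `|u x|%:E)%E].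
      apply: contrapT => h; apply: xs => U oU Ux; apply: contrapT => h2; apply: h.
      by exists U.
    move=> [U [oU Ux /negP]]; rewrite -leNgt => h; exists U; split=> //; exists U; split=> //.
      exact: open_measurable_rV.
    by apply/eqP; rewrite eq_le h/=; exact: integral_ge0.
  have /ae_foralln h : forall k, {ae mu, forall x, B k x -> u x = 0}.
    move=> k; have [_ _ [W [BW mW /(aeI _ mW)]]] := hB k.
    by apply: filterS => x hx /BW.
  by apply: filterS h => x hx /UB[k _ /hx].
have cl : closed (msupp (fun U => \int[mu]_(x in U) `|u x|%:E)%E).
  move=> x xc U oU Ux; have [y [hy Uy]] := xc U (open_nbhs_nbhs (conj oU Ux)).
  exact: hy.
apply: (subclosed_compact cl (@closed_cube_compact R d n.+1%:R)) => x xs i.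
apply: contrapT => /negP; rewrite -ltNge => xi.
pose U := ~` [set x : T | forall i, `|x ord0 i| <= n.+1%:R].
have oU : open U.
  apply: closed_openC; exact: compact_closed (@norm_hausdorff _ _) (@closed_cube_compact _ _ _).
have Ux : U x by move=> /(_ i); rewrite leNgt xi.
have := xs U oU Ux; suff -> : (\int[mu]_(x in U) `|u x|%:E = 0)%E by rewrite ltxx.
apply/aeI; first exact: open_measurable_rV.
by apply: filterS hn => y hy Uy; apply: hy => yn; apply: Uy => k; exact: ltW.
Qed.

End wgrad_facts.

(** * The closed form and its generators *)

Section form_closure_facts.
Context {R : realType} {d : nat} (mu : {measure set 'rV[R]_d -> \bar R})
  (b : 'rV[R]_d -> 'rV[R]_d) (hmu : ibp_measure mu b).
Local Notation T := 'rV[R]_d.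
Implicit Types (u v f : T -> R) (g h : T -> T) (V W : set T).
Variables (A : T -> 'M[R]_d) (eA : elliptic A).
Local Notation q x xi := (bilin (A x) xi xi).

Lemma bilin_CS x xi eta :
  `|bilin (A x) xi eta| <= Num.sqrt (q x xi) * Num.sqrt (q x eta).
Proof.
have [-> |e0] := eqVneq eta 0; first by rewrite bilin0r normr0 mulr_ge0 ?sqrtr_ge0.
have [-> |x0] := eqVneq xi 0; first by rewrite bilin0l normr0 mulr_ge0 ?sqrtr_ge0.
have p1 : 0 < Num.sqrt (q x xi).
  by rewrite sqrtr_gt0 lt_def (q_ge0 eA) andbT; apply: contraNneq x0 => /(q_eq0 eA) ->.
have p2 : 0 < Num.sqrt (q x eta).
  by rewrite sqrtr_gt0 lt_def (q_ge0 eA) andbT; apply: contraNneq e0 => /(q_eq0 eA) ->.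
(* The weight that makes the two terms of [bilin_le] equal. *)
have t0 : 0 < Num.sqrt (q x eta) / Num.sqrt (q x xi) by rewrite divr_gt0.
apply: (le_trans (bilin_le eA x xi eta t0)).
rewrite -{2}[q x xi]sqr_sqrtr ?(q_ge0 eA)// -{3}[q x eta]sqr_sqrtr ?(q_ge0 eA)//.
apply: eq_lerW; field.
by rewrite !gt_eqF.
Qed.

Lemma Cv0_bilin (a_ c_ : nat -> T -> T) a c : (forall n, mfield (a_ n)) -> (forall n, mfield (c_ n)) ->
  mfield a -> mfield c -> Ig mu (fun x => q x (a x)) -> Ig mu (fun x => q x (c x)) ->
  Cv0 mu (fun n x => q x (a_ n x - a x)) -> Cv0 mu (fun n x => q x (c_ n x - c x)) ->
  Cv0 mu (fun n x => bilin (A x) (a_ n x) (c_ n x) - bilin (A x) (a x) (c x)).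
Proof.
move=> ma_ mc_ ma mc ia ic ca cc.
have mS g : mfield g -> meas (fun x => Num.sqrt (q x (g x))).
  move=> mg; apply: (measurableT_comp (f := @Num.sqrt R)); last exact: (mf_q eA).
  by apply: continuous_measurable_fun; exact: sqrt_continuous.
have Sq g : mfield g -> Ig mu (fun x => q x (g x)) -> L2 mu (fun x => Num.sqrt (q x (g x))).
  move=> mg ig; split; first exact: mS.
  by under eq_fun do rewrite sqr_sqrtr ?(q_ge0 eA)//.
have key (e_ : nat -> T -> T) e : (forall n, mfield (e_ n)) -> mfield e -> Ig mu (fun x => q x (e x)) ->
    Cv0 mu (fun n x => q x (e_ n x)) -> Cv0 mu (fun n x => bilin (A x) (e_ n x) (e x)).
  move=> me_ me ie ce.
  have c1 : Cv0 mu (fun n x => Num.sqrt (q x (e_ n x)) ^+ 2).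
    by under [X in Cv0 _ X]eq_fun do under eq_fun do rewrite sqr_sqrtr ?(q_ge0 eA)//.
  apply: (Cv0_le (C := 1) (Cv0_mulL2 c1 (fun n => mS _ (me_ n)) (Sq _ me ie))) => [n|n].
    by apply: mf_bilin => //; exact: ell_mf eA.
  apply: aeW => x; rewrite mul1r [leRHS]ger0_norm ?mulr_ge0 ?sqrtr_ge0//; exact: bilin_CS.
have mab n : mfield (fun x => a_ n x - a x) by exact: mfieldB.
have mcb n : mfield (fun x => c_ n x - c x) by exact: mfieldB.
have c1 : Cv0 mu (fun n x => bilin (A x) (a_ n x - a x) (c_ n x - c x)).
  apply: (Cv0_le2 (C := 1) ca cc) => [n|n].
    by apply: mf_bilin => //; exact: ell_mf eA.
  apply: aeW => x; rewrite mul1r !(ger0_norm (q_ge0 eA _ _)).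
  apply: (le_trans (bilin_le eA x _ _ ltr01)); rewrite invr1 !mul1r.
  have := q_ge0 eA x (a_ n x - a x); have := q_ge0 eA x (c_ n x - c x); lra.
have c2 := key _ _ mab mc ic ca; have c3 := key _ _ mcb ma ia cc.
apply: (Cv0_eq (Cv0D c1 (Cv0D c2 c3))) => [n|n].
  by apply: measurable_funB; apply: mf_bilin => //; exact: ell_mf eA.
apply: aeW => x; rewrite (qC eA x (c_ n x - c x)) !bilinDl !bilinDr !bilinNl !bilinNr.
by lra.
Qed.

Lemma energy_ae g g' h h' : mfield g -> mfield g' -> mfield h -> mfield h' ->
  {ae mu, forall x, g x = g' x} -> {ae mu, forall x, h x = h' x} ->
  energy mu A g h = energy mu A g' h'.
Proof.
move=> mg mg' mh mh' gg hh; congr (_ * _); apply: ae_Rint.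
- by apply: mf_bilin => //; exact: ell_mf eA.
- by apply: mf_bilin => //; exact: ell_mf eA.
- by apply: filterS2 gg hh => x -> ->.
Qed.

Lemma cgradB V W u v x : test_fun V u -> test_fun W v -> cgrad (u \- v) x = cgrad u x - cgrad v x.
Proof.
move=> /test_smooth su /test_smooth sv; apply/rowP => j; rewrite !mxE.
by apply: deriveB; exact: smooth_der.
Qed.

Lemma happrox_form (u_ : nat -> T -> R) u g : HA mu A setT u g -> happrox mu A setT u_ u g ->
  form_approx mu (test_fun setT) (E0 mu A) u_ u.
Proof.
move=> [mfu mg _] hu_; have [tu cu cg] := hu_; split; [exact: tu| |].
  by apply/cvg_Lp2P => // n; exact: test_mf (tu n).
move=> e e0; have e2 : 0 < e / 2 by rewrite divr_gt0.
have [N hN] := Cv0_small cg e2.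
exists N => m n Nm Nn; have [i1 h1] := hN m Nm; have [i2 h2] := hN n Nn.
apply: (@le_lt_trans _ _ (\int[mu]_x (q x (cgrad (u_ m) x - g x) + q x (cgrad (u_ n) x - g x)))).
  rewrite /E0 /energy.
  rewrite ler_pdivrMl// -(RintZ 2 (IgD i1 i2)).
  have mm k : mfield (cgrad (u_ k)) by exact: mfield_cgrad (tu k).
  have E x : cgrad (u_ m \- u_ n) x = (cgrad (u_ m) x - g x) + - (cgrad (u_ n) x - g x).
    by rewrite (cgradB x (tu m) (tu n)) opprB addrA subrK.
  have le x : q x (cgrad (u_ m \- u_ n) x) <= 2 * (q x (cgrad (u_ m) x - g x) + q x (cgrad (u_ n) x - g x)).
    by rewrite E (le_trans (qD_le eA _ _ _))// qN.
  have mq' : meas (fun x => q x (cgrad (u_ m \- u_ n) x)).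
    by apply: (mf_q eA) => j; under eq_fun do rewrite (cgradB _ (tu m) (tu n)); exact: mfieldB.
  apply: Rint_le; [|exact/IgZ/IgD|exact: aeW].
  apply: (Ig_le mq' (IgZ 2 (IgD i1 i2))); apply: aeW => x.
  by rewrite !ger0_norm ?le ?mulr_ge0 ?addr_ge0 ?(q_ge0 eA).
rewrite (RintD i1 i2).
have E k : \int[mu]_x `|q x (cgrad (u_ k) x - g x)| = \int[mu]_x q x (cgrad (u_ k) x - g x).
  by apply: eq_Rintegral => x _; rewrite ger0_norm// (q_ge0 eA).
by rewrite (E m) in h1; rewrite (E n) in h2; rewrite (splitr e); exact: (ltrD h1 h2).
Qed.

(** An [E0]-Cauchy sequence has a limiting gradient by completeness, and the limit function is [u]
    because both are limits in mean square. So the abstract closure and [HA] describe the same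
    domain. *)
Lemma form_happrox (u_ : nat -> T -> R) u : meas u ->
  form_approx mu (test_fun setT) (E0 mu A) u_ u ->
  exists g, HA mu A setT u g /\ happrox mu A setT u_ u g.
Proof.
move=> mfu [tu /cvg_Lp2P cu cE]; have {}cu := cu (fun n => test_mf (tu n)) mfu.
have hu n := HA_test mu A (tu n : test_fun setT (u_ n)).
have cau : forall e : R, 0 < e -> exists N, forall n m, (N <= n)%N -> (N <= m)%N ->
    \int[mu]_x ((u_ n x - u_ m x) ^+ 2) <= e /\
    \int[mu]_x q x (cgrad (u_ n) x - cgrad (u_ m) x) <= e.
  move=> e e0; have e4 : 0 < e / 4 by rewrite divr_gt0.
  have [N hN] := Cv0_small cu e4.
  have [|M hM] := cE (e / 2); first by rewrite divr_gt0.
  exists (maxn N M) => n m; rewrite !geq_max => /andP[Nn Mn] /andP[Nm Mm].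
  have [i1 h1] := hN n Nn; have [i2 h2] := hN m Nm; split.
    have L := L2B (HA_L2 hmu (hu n)) (HA_L2 hmu (hu m)).
    apply: (@le_trans _ _ (\int[mu]_x (2 * ((u_ n x - u x) ^+ 2 + (u_ m x - u x) ^+ 2)))).
      apply: Rint_le; [by case: L|exact/IgZ/IgD|apply: aeW => x].
      by have := sqr_ge0 (u_ n x - u x + (u_ m x - u x)); nra.
    rewrite RintZ ?RintD//; last exact: IgD.
    under eq_Rintegral do rewrite -[_ ^+ 2](ger0_norm (sqr_ge0 _)).
    under [X in _ + X]eq_Rintegral do rewrite -[_ ^+ 2](ger0_norm (sqr_ge0 _)).
    lra.
  have := hM n m Mn Mm; rewrite /E0 /energy.
  under eq_Rintegral do rewrite (cgradB _ (tu n) (tu m)).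
  by rewrite ltr_pdivrMl// => /ltW /le_trans; apply; lra.
have [u' [g [hug cu' cg']]] := HA_complete hmu eA hu cau.
have uu' : {ae mu, forall x, u' x = u x}.
  have [mu' _ _] := hug.
  have z : Cv0 mu (fun (_ : nat) x => (u' x - u x) ^+ 2).
    have cN : Cv0 mu (fun n x => (- (u_ n x - u' x)) ^+ 2) by under [X in Cv0 _ X]eq_fun do under eq_fun do rewrite sqrrN.
    have := Cv0_sqD cN cu (fun n => measurable_funN (measurable_funB (test_mf (tu n)) mu')) (fun n => measurable_funB (test_mf (tu n)) mfu).
    by congr (Cv0 _ _); apply/funext => n; apply/funext => x; congr (_ ^+ 2); lra.
  have [s [_]] := Cv0_ae z; apply: filterS => x h.
  have /eqP := cvg_const_eq h (fun=> erefl); rewrite eq_sym sqrf_eq0 subr_eq0 => /eqP; exact.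
have [_ mg _] := hug.
exists g; split; first exact: (HA_ext eA hug mfu mg uu' (aeW _ (fun x => erefl _))).
by split.
Qed.

Lemma closure_domP u : closure_dom mu (test_fun setT) (E0 mu A) u <-> exists g, HA mu A setT u g.
Proof.
split=> [[/Lfun2P[mfu _] [u_ hu_]]|[g hu]].
  by have [g [hg _]] := form_happrox mfu hu_; exists g.
split; first by apply/Lfun2P; exact: (HA_L2 hmu hu).
by have [_ _ [u_ hu_]] := hu; exists u_; exact: happrox_form hu hu_.
Qed.

(** All pairs of approximating sequences give the same limit, since gradients are unique; the value
    picked by [xget] is therefore the energy of the gradients. *)
Lemma closure_formE u g v h : HA mu A setT u g -> HA mu A setT v h ->
  closure_form mu (test_fun setT) (E0 mu A) u v = energy mu A g h.
Proof.
move=> hu hv; have [mfu mg [u_ hu_]] := hu; have [mfv mh [v_ hv_]] := hv.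
have lim (a_ c_ : nat -> T -> R) : form_approx mu (test_fun setT) (E0 mu A) a_ u ->
    form_approx mu (test_fun setT) (E0 mu A) c_ v -> E0 mu A (a_ n) (c_ n) @[n --> \oo] --> energy mu A g h.
  move=> /(form_happrox mfu)[g' [hg' [ta _ ca]]] /(form_happrox mfv)[h' [hh' [tc _ cc]]].
  have [_ mg' _] := hg'; have [_ mh' _] := hh'.
  have -> : energy mu A g h = energy mu A g' h'.
    apply: energy_ae => //.
      exact: (HA_grad_unique hmu eA eA hu hg' (aeW _ (fun x => erefl _))).
    exact: (HA_grad_unique hmu eA eA hv hh' (aeW _ (fun x => erefl _))).
  apply: cvgM; first exact: cvg_cst.
  have iq' := HA_Ig_q hmu eA hg'; have iqh := HA_Ig_q hmu eA hh'.
  apply: Cv0_Rint => [n||].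
  - apply: Ig_bilin => //; [exact: mfield_cgrad (ta n)|exact: mfield_cgrad (tc n)|
      exact: (Ig_q_test hmu eA (ta n))|exact: (Ig_q_test hmu eA (tc n))].
  - exact: Ig_bilin.
  - by apply: Cv0_bilin => // n; [exact: mfield_cgrad (ta n)|exact: mfield_cgrad (tc n)].
rewrite /closure_form; case: xgetP => [l _ [a_ [c_ [ha hc hl]]]|/(_ (energy mu A g h))[]].
  exact: (cvg_unique (@Rhausdorff R) hl (lim _ _ ha hc)).
exists u_, v_; split; [exact: happrox_form hu hu_|exact: happrox_form hv hv_|].
by apply: lim; [exact: happrox_form hu hu_|exact: happrox_form hv hv_].
Qed.

(* f = L u for the generator L of the energy form on H^{1,2}_0(V), g being the
   gradient of u *)
Definition gen V u g f : Prop := [/\ HA mu A V u g, L2 mu f &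
  forall v h, HA mu A V v h -> energy mu A g h = - \int[mu]_x (f x * v x)].

Lemma gen_of_test V u g f : HA mu A V u g -> L2 mu f ->
  (forall v, test_fun V v -> energy mu A g (cgrad v) = - \int[mu]_x (f x * v x)) -> gen V u g f.
Proof.
move=> hu hf hgen; split; [exact: hu|exact: hf|move=> v h hv].
have [mfv mh [v_ [tv cv ch]]] := hv; have [_ mg _] := hu.
have L2v := HA_L2 hmu hv; have iq := HA_Ig_q hmu eA hv; have iqg := HA_Ig_q hmu eA hu.
have l1 : (fun n => 2^-1 * \int[mu]_x bilin (A x) (g x) (cgrad (v_ n) x)) @ \oo -->
    (energy mu A g h : R).
  apply: cvgM; first exact: cvg_cst.
  have mvn n := mfield_cgrad (tv n).
  apply: Cv0_Rint => [n||]; [exact: (Ig_bilin eA mg (mvn n) iqg (Ig_q_test hmu eA (tv n)))|exact: (Ig_bilin eA mg mh iqg iq)|].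
  apply: (Cv0_bilin (fun=> mg) mvn mg mh iqg iq); last exact: ch.
  under [X in Cv0 _ X]eq_fun do under eq_fun do rewrite subrr bilin0l.
  apply: Cv0_ge0 => [n|n]; first exact: measurable_cst.
  by under eq_integral do rewrite normr0; rewrite integral0 lee_fin invr_ge0.
have l2 : (fun n => - \int[mu]_x (f x * v_ n x)) @ \oo --> (- \int[mu]_x (f x * v x) : R).
  apply: cvgN; apply: Cv0_Rint => [n||].
  - by apply: L2_mul => //; exact: (L2_test hmu (tv n)).
  - exact: L2_mul.
  - have := Cv0_mulL2 cv (fun n => measurable_funB (test_mf (tv n)) mfv) hf.
    by congr (Cv0 _ _); apply/funext => n; apply/funext => x; rewrite mulrBl ![f _ * _]mulrC.
apply: (cvg_unique (@Rhausdorff R) l1).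
by rewrite (funext (fun n => hgen _ (tv n))).
Qed.

Lemma L0P u f : L0 mu A u f <-> exists g, gen setT u g f.
Proof.
split=> [[/closure_domP[g hu] [/Lfun2P hf _] he]|[g [hu hf he]]].
  exists g; split=> // v h hv; rewrite -(closure_formE hu hv); apply: he.
  by apply/closure_domP; exists h.
split; first by apply/closure_domP; exists g.
  by split; [exact/Lfun2P|apply: aeW => x /(_ I)].
by move=> v /closure_domP[h hv]; rewrite (closure_formE hu hv); exact: he.
Qed.

(** For relatively compact [V] the space [H0 mu V], defined with the identity matrix, is also the
    closure for [A], and [wgrad] agrees with the gradients there. *)
Lemma L0VP V u f : relatively_compact V -> L0V mu A V u f <->
  (exists g, gen V u g f) /\ {ae mu, forall x, ~ V x -> f x = 0}.
Proof.
move=> cV; have H0P v : H0 mu V v <-> exists h, HA mu A V v h.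
  split=> [[h /(H0_gradP hmu) hh]|[h hh]]; exists h; first exact: (HA_change elliptic1 eA cV hh).
  by apply/(H0_gradP hmu); exact: (HA_change eA elliptic1 cV hh).
have wE v h v' h' : HA mu A V v h -> HA mu A V v' h' ->
    energy mu A (wgrad mu v) (wgrad mu v') = energy mu A h h'.
  have mw w k : HA mu A V w k -> mfield (wgrad mu w).
    by move=> /(HA_locgrad eA)/(locgrad_Hloc hmu)/(Hloc_locgrad hmu)[].
  move=> hv hv'; have [_ mh _] := hv; have [_ mh' _] := hv'; symmetry.
  apply: energy_ae; [exact: mh|exact: mw hv|exact: mh'|exact: mw hv'| |].
    exact: (HA_wgrad hmu eA hv).
  exact: (HA_wgrad hmu eA hv').
split=> [[/H0P[g hu] [/Lfun2P hf f0] he]|[[g [hu hf he]] f0]].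
  split; last exact: f0.
  exists g; split=> // v h hv; rewrite -(wE _ _ _ _ hu hv); apply: he.
  by apply/H0P; exists h.
split; first by apply/H0P; exists g.
  by split; [exact/Lfun2P|].
by move=> v /H0P[h hv]; rewrite (wE _ _ _ _ hu hv); exact: he.
Qed.

End form_closure_facts.

(** * Integration against a measure with a density *)

Section density.
(** The functions [s / (s^2 + n.+1%:R^-1)] are smooth and converge everywhere to [s^-1], also at 0,
    where inverse and limit are both 0. *)
Lemma measurable_fun_invr {R : realType} d (X : measurableType d) (f : X -> R) :
  meas f -> meas (fun x => (f x)^-1).
Proof.
move=> mf; suff mi : meas (fun s : R => s^-1) by exact: (measurableT_comp mi mf).
pose k n (s : R) := s * (s * s + n.+1%:R^-1)^-1.
have sk n : smooth1 (k n).
  apply: smooth1M; first exact: smooth1_id.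
  apply: smooth1V => [|s]; last by rewrite gt_eqF// ltr_wpDl ?invr_gt0// -expr2 sqr_ge0.
  by apply: smooth1D; [apply: smooth1M; exact: smooth1_id|exact: smooth1_cst].
apply: (@measurable_fun_cvg _ _ R setT k) => [n|s _].
  by apply: continuous_measurable_fun; exact: smooth1_cont.
rewrite /k; have [-> |s0] := eqVneq s 0.
  by rewrite invr0; under eq_fun do rewrite mul0r; exact: cvg_cst.
have -> : s^-1 = s * (s * s + 0)^-1 by rewrite addr0; field.
apply: cvgM; first exact: cvg_cst.
apply: cvgV; first by rewrite addr0 mulf_neq0.
by apply: cvgD; [exact: cvg_cst|exact: cvg_harmonic].
Qed.

Lemma int_sub_le {R : realType} d (X : measurableType d) (mu : {measure set X -> \bar R})
    (K : set X) (p g : X -> R) : measurable K -> meas p -> meas g ->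
  (forall x, K x -> `|p x| <= `|g x|) ->
  (\int[mu]_(x in K) `|p x|%:E <= \int[mu]_x `|g x|%:E)%E.
Proof.
move=> mK mp mg pg; apply: (@le_trans _ _ (\int[mu]_(x in K) `|g x|%:E)%E).
  apply: ge0_le_integral => //.
  - by apply: measurable_funTS; exact: mf_abs.
  - by apply: measurable_funTS; exact: mf_abs.
by apply: ge0_subset_integral => //; exact: mf_abs.
Qed.

Context {R : realType} d (X : measurableType d) (mu dx : {measure set X -> \bar R}).
Variable rho : X -> R.
Hypotheses (rho0 : forall x, 0 <= rho x) (mrho : meas rho)
  (hmu : forall U, measurable U -> mu U = (\int[dx]_(x in U) (rho x)%:E)%E).
Implicit Types f g : X -> R.

Import HBNNSimple.

Lemma density_ge0 f : (forall x, 0 <= f x) -> meas f ->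
  (\int[mu]_x (f x)%:E = \int[dx]_x (f x * rho x)%:E)%E.
Proof.
move=> f0 mf; have mE : meas (EFin \o f) by exact: mf_E.
pose h := nnsfun_approx measurableT mE.
have hf x : (h n x)%:E @[n --> \oo] --> (f x)%:E.
  by apply: (cvg_nnsfun_approx measurableT mE) => //= y _; rewrite lee_fin.
have hmono x : {homo (fun n => (h n x)%:E) : a b / (a <= b)%N >-> (a <= b)%E}.
  by move=> a b ab; rewrite lee_fin; exact/lefP/nd_nnsfun_approx.
have -> : (\int[mu]_x (f x)%:E = lim (\int[mu]_x (h n x)%:E @[n --> \oo]))%E.
  under eq_integral do rewrite -(cvg_lim _ (hf _))//.
  apply: monotone_convergence => //.
  - by move=> n; apply/measurable_EFinP; exact/measurable_funP.
  by move=> n x _; rewrite lee_fin.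
have -> : (\int[dx]_x (f x * rho x)%:E = lim (\int[dx]_x ((h n x)%:E * (rho x)%:E) @[n --> \oo]))%E.
  have hf' x : ((h n x)%:E * (rho x)%:E)%E @[n --> \oo] --> (f x * rho x)%:E.
    by rewrite EFinM; apply: cvgeZr.
  under eq_integral do rewrite -(cvg_lim _ (hf' _))//.
  apply: monotone_convergence => //.
  - by move=> n; apply/emeasurable_funM; apply/measurable_EFinP => //; exact/measurable_funP.
  - by move=> n x _; rewrite mule_ge0 ?lee_fin.
  - by move=> x _ a c ac; rewrite lee_wpmul2r ?lee_fin//; exact: hmono.
suff -> : (fun n => \int[mu]_x (h n x)%:E)%E = (fun n => \int[dx]_x ((h n x)%:E * (rho x)%:E))%E by [].
apply/funext => n.
transitivity (\int[mu]_x (\sum_(y \in range (h n)) (y * \1_(h n @^-1` [set y]) x)%:E)%E)%E.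
  by apply: eq_integral => t _; rewrite /= fimfunE -fsumEFin.
have indich r : meas (fun x => (r * \1_(h n @^-1` [set r]) x)%:E).
  by apply/measurable_EFinP; exact: measurable_funM.
have ge r x : (0 <= (r * \1_(h n @^-1` [set r]) x)%:E)%E by exact: nnfun_muleindic_ge0.
rewrite ge0_integral_fsum//.
transitivity (\int[dx]_x (\sum_(y \in range (h n)) (y * \1_(h n @^-1` [set y]) x)%:E * (rho x)%:E)%E)%E; last first.
  apply: eq_integral => x _; rewrite -ge0_mule_fsuml => [|y]; last exact: ge.
  by rewrite fsumEFin // -(fimfunE _ x).
rewrite ge0_integral_fsum//; last 2 first.
  - by move=> y; apply: emeasurable_funM => //; exact/measurable_EFinP.
  - by move=> m y _; apply: mule_ge0; rewrite ?lee_fin//; exact: ge.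
apply: eq_fsbigr => r rhn; have [x _ hr] := set_mem rhn.
have r0 : 0 <= r by rewrite -hr.
have mH : measurable (h n @^-1` [set r]) by rewrite -[X in measurable X]setTI; exact: measurable_funP.
under eq_integral do rewrite EFinM.
rewrite ge0_integralZl ?lee_fin//; last first.
  exact/measurable_EFinP/measurable_indic.
rewrite integral_indic// setIT hmu//.
under [RHS]eq_integral do rewrite EFinM -muleA.
rewrite ge0_integralZl ?lee_fin//; last 2 first.
- by apply: emeasurable_funM; apply/measurable_EFinP => //; exact: measurable_indic.
- by move=> y _; rewrite mule_ge0 ?lee_fin.
congr (_ * _)%E; rewrite integral_mkcond; apply: eq_integral => y _.
rewrite patchE indicE; have [yH|yH] := pselect ((h n @^-1` [set r]) y).
  by rewrite mem_set// mul1e.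
by rewrite memNset// mul0e.
Qed.

Lemma density_Ig f : meas f -> Ig mu f <-> Ig dx (fun x => f x * rho x).
Proof.
move=> mf; have mfr : meas (fun x => f x * rho x) by exact: measurable_funM.
have E : (\int[mu]_x `|f x|%:E = \int[dx]_x `|f x * rho x|%:E)%E.
  rewrite density_ge0//; last exact: measurableT_comp.
  by apply: eq_integral => x _; rewrite normrM (ger0_norm (rho0 x)).
by split=> /IgP[_ h]; apply/IgP; split=> //; [rewrite -E|rewrite E].
Qed.

Lemma density_Rint f : Ig mu f -> \int[mu]_x f x = \int[dx]_x (f x * rho x).
Proof.
move=> hf; have mf := Ig_mf hf.
pose p x := Num.max (f x) 0; pose m x := Num.max (- f x) 0.
have pm x : f x = p x - m x.
  rewrite /p /m; have [u0|u0] := leP (f x) 0.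
    by rewrite max_l ?oppr_ge0// opprK add0r.
  by rewrite max_r ?subr0// oppr_le0 ltW.
have mp : meas p by apply: measurable_maxr.
have mm : meas m by apply: measurable_maxr => //; exact: measurable_funN.
have p0 x : 0 <= p x by rewrite /p le_max lexx orbT.
have m0 x : 0 <= m x by rewrite /m le_max lexx orbT.
have le_ (k : X -> R) : (forall x, 0 <= k x) -> meas k -> (forall x, k x <= `|f x|) ->
   Ig mu k.
  by move=> k0 mk kf; apply: (Ig_le mk hf); apply: aeW => x; rewrite ger0_norm.
have ip : Ig mu p by apply: le_ => // x; rewrite /p ge_max ler_norm normr_ge0.
have im : Ig mu m by apply: le_ => // x; rewrite /m ge_max ler_normr lexx orbT normr_ge0.
have R0 k : (forall x, 0 <= k x) -> Ig mu k -> \int[mu]_x k x = \int[dx]_x (k x * rho x).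
  by move=> k0 ik; rewrite /Rintegral (density_ge0 k0 (Ig_mf ik)).
under eq_Rintegral do rewrite pm; under [RHS]eq_Rintegral do rewrite pm mulrBl.
rewrite !RintB ?R0//; exact/density_Ig.
Qed.

End density.

(** * The measure with density [phi ^+ 2] and its logarithmic derivative *)

Section weighted_measure.
Context {R : realType} {d : nat}.
Local Notation T := 'rV[R]_d.
Local Notation id1 := (fun _ : T => 1%:M : 'M[R]_d).
Local Notation dx := (@lebesgue_rV R d).
Local Notation cut n := (@cutoff R d n%:R).
Implicit Types (u v f : T -> R) (g h : T -> T).

Lemma lebesgue_ibp : ibp_measure dx (fun=> 0 : T).
Proof.
split.
- by move=> r r0; exact: lebesgue_rV_cube.
- move=> j r; under eq_fun do rewrite mxE mul0r.
  by split; [exact: measurable_cst|under eq_fun do rewrite expr0n; exact: Ig0].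
- by move=> j; under eq_fun do rewrite mxE; exact: measurable_cst.
- move=> j eta te; under [in RHS]eq_Rintegral do rewrite mxE mulr0.
  rewrite Rint0 oppr0; have [n hn] := test_cubeP te; have se := test_smooth te.
  apply: (@Rint_lebesgue_partial _ _ j eta n.+1%:R) => //.
  + exact: smooth_cont.
  + by move=> x; exact: smooth_der.
  + exact/smooth_cont/smooth_partial.
Qed.

Lemma weak_partial_unique j (f g g' : T -> R) : is_weak_partial j f g -> is_weak_partial j f g' ->
  {ae dx, forall x, g x = g' x}.
Proof.
move=> [mg cg hg] [mg' cg' hg'].
have ic (k : T -> R) eta : meas k ->
    (forall K, compact K -> (\int[dx]_(x in K) `|k x|%:E < +oo)%E) -> test_fun setT eta ->
    Ig dx (fun x => k x * eta x).
  move=> mk ck te; have me := test_mf te; apply/IgP; split; first exact: measurable_funM.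
  have [n hn] := test_cubeP te; have [M hM] := test_bounded te.
  pose K := [set x : T | forall i, `|x ord0 i| <= n.+1%:R].
  have cK : compact K by exact: closed_cube_compact.
  have mK : measurable K by exact: compact_measurable_rV.
  have mkK : measurable_fun K (EFin \o (fun x => `|k x|)).
    by apply: measurable_funTS; exact: mf_abs.
  have -> : (\int[dx]_x `|k x * eta x|%:E = \int[dx]_(x in K) `|k x * eta x|%:E)%E.
    rewrite [RHS]integral_mkcond; apply: eq_integral => x _; rewrite /patch.
    case: ifPn => // /negP xK; rewrite hn ?mulr0 ?normr0// => xn; apply: xK; rewrite inE => i.
    exact: ltW.
  apply: (@le_lt_trans _ _ (\int[dx]_(x in K) `|M * k x|%:E)%E).
    apply: ge0_le_integral => //.
    - by apply: measurable_funTS; apply: mf_abs; exact: measurable_funM.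
    - by apply: measurable_funTS; apply: mf_abs; exact: measurable_funM.
    - move=> x _; rewrite lee_fin !normrM mulrC ler_wpM2r// (le_trans (hM x))//.
      exact: ler_norm.
  under eq_integral do rewrite normrM EFinM.
  rewrite ge0_integralZl//.
  by rewrite lte_mul_pinfty// ck.
suff : (fun x => g x - g' x) = (fun=> 0) %[ae dx].
  by apply: filterS => x /(_ I) /eqP; rewrite subr_eq0 => /eqP.
apply: test_separates.
- exact: measurable_funB.
- move=> r; under eq_fun do rewrite mulrBl.
  by apply: IgB; apply: ic => //; exact: cutoff_test.
- move=> eta te; under eq_Rintegral do rewrite mulrBl.
  rewrite RintB; [|exact: ic|exact: ic].
  by apply/eqP; rewrite subr_eq0; apply/eqP/oppr_inj; rewrite -hg// -hg'.
Qed.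

Variables (phi : T -> R) (mu : {measure set T -> \bar R}).
Let rho x := phi x ^+ 2.
Hypotheses (hphi : Hloc dx phi) (hmu : has_density mu rho).

Let h := wgrad dx phi.
Let lphi : locgrad dx phi h. Proof. exact: (Hloc_locgrad lebesgue_ibp hphi). Qed.
Let mphi : meas phi. Proof. by case: lphi. Qed.
Let mh : mfield h. Proof. by case: lphi. Qed.
Let mrho : meas rho. Proof. exact: measurable_funX. Qed.
Let rho0 x : 0 <= rho x. Proof. exact: sqr_ge0. Qed.

Lemma L2_phi_test eta : test_fun setT eta -> L2 dx (fun x => phi x * eta x).
Proof. exact: (locgrad_L2 lebesgue_ibp lphi). Qed.

Lemma L2_hphi_test eta j : test_fun setT eta -> L2 dx (fun x => h x ord0 j * eta x).
Proof. exact: (locgrad_gradL2 lebesgue_ibp j lphi). Qed.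

(** The product rule [d_j (u_k^2) = 2 u_k d_j u_k] for test functions [u_k] approximating
    [cut n * phi], in the limit. Against [eta] the cut-off acts as 1 and its gradient as 0. *)
Lemma sqr_weak_partial j : is_weak_partial j rho (fun x => 2 * phi x * h x ord0 j).
Proof.
have mg : meas (fun x => 2 * phi x * h x ord0 j).
  by apply: measurable_funM; [exact: measurable_funM|exact: mh].
split=> //.
- move=> K cK; have [n Kn] := compact_cube cK.
  have ig := L2_mul (L2_phi_test (@cutoff_test R d n.+1%:R)) (L2_hphi_test j (@cutoff_test R d n.+1%:R)).
  have /IgP[_] := IgZ 2 ig; apply: le_lt_trans.
  have mK := compact_measurable_rV cK.
  apply: (@int_sub_le R _ _ dx K _ _ mK mg (Ig_mf (IgZ 2 ig))) => x /Kn xn.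
  by rewrite (cutoff1 (x := x)) ?mulr1 ?mulrA// => i; exact: ltW.
- move=> eta te; have [n hn] := test_cut te; have [_ _ hc] := lphi.
  have hu := hc _ (@cutoff_test R d n%:R).
  have [mfu mgu [u_ hu_]] := hu; have [tu cu cg] := hu_.
  have L2u := HA_L2 lebesgue_ibp hu; have iq := HA_Ig_q lebesgue_ibp (@elliptic1 R d) hu.
  set u := fun x => cut n x * phi x in hu mfu hu_ cu L2u.
  set g := fun x => cut n x *: h x + phi x *: cgrad (cut n) x in hu mgu hu_ cg iq.
  have be := bcs_test te; have bpe := bcs_test (test_partial j te).
  have mtu k := test_mf (tu k).
  have Lg : L2 dx (fun x => g x ord0 j).
    split; first exact: mgu.
    apply: (Ig_le _ iq); first by apply: measurable_funX; exact: mgu.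
    apply: aeW => x; rewrite !ger0_norm ?sqr_ge0 ?(q_ge0 (@elliptic1 R d))// bilin1; exact: sqr_coord_le.
  have cgj : Cv0 dx (fun k x => (partial j (u_ k) x - g x ord0 j) ^+ 2).
    apply: (Cv0_le (C := 1) cg) => [k|k].
      by apply: measurable_funX; apply: measurable_funB; [exact: test_mf (test_partial j (tu k))|exact: mgu].
    apply: aeW => x; rewrite mul1r !ger0_norm ?sqr_ge0 ?(q_ge0 (@elliptic1 R d))// bilin1.
    by have := sqr_coord_le (cgrad (u_ k) x - g x) j; rewrite !mxE.
  have [Ke hKe] := test_bounded te; have [Kp hKp] := test_bounded (test_partial j te).
  have c1 := Cv0_mul cu cu mtu mtu L2u L2u.
  have c2 := Cv0_mul cu cgj mtu (fun k => test_mf (test_partial j (tu k))) L2u Lg.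
  have Iuu k := L2_mul (L2_test lebesgue_ibp (tu k)) (L2_test lebesgue_ibp (tu k)).
  have Iug k := L2_mul (L2_test lebesgue_ibp (tu k)) (L2_test lebesgue_ibp (test_partial j (tu k))).
  have I2 := L2_mul L2u Lg; have I1 := L2_mul L2u L2u.
  have mI k (w : T -> R) : Ig dx w -> Ig dx (fun x => eta x * w x).
    by move=> iw; exact: (Ig_mul_bounded (test_mf te) hKe iw).
  have pI k (w : T -> R) : Ig dx w -> Ig dx (fun x => partial j eta x * w x).
    by move=> iw; exact: (Ig_mul_bounded (test_mf (test_partial j te)) hKp iw).
  have l1 : (fun k => \int[dx]_x (partial j eta x * (u_ k x * u_ k x))) @ \oo -->
      (\int[dx]_x (partial j eta x * (u x * u x)) : R).
    apply: Cv0_Rint => [k||]; [exact: pI|exact: pI|].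
    have := Cv0_mul_bounded c1 (test_mf (test_partial j te)) hKp.
    by congr (Cv0 _ _); apply/funext => k; apply/funext => x; rewrite mulrBr.
  have l2 : (fun k => \int[dx]_x (eta x * (u_ k x * partial j (u_ k) x))) @ \oo -->
      (\int[dx]_x (eta x * (u x * g x ord0 j)) : R).
    apply: Cv0_Rint => [k||]; [exact: mI|exact: mI|].
    have := Cv0_mul_bounded c2 (test_mf te) hKe.
    by congr (Cv0 _ _); apply/funext => k; apply/funext => x; rewrite mulrBr.
  have E k : \int[dx]_x (partial j eta x * (u_ k x * u_ k x)) =
      - 2 * \int[dx]_x (eta x * (u_ k x * partial j (u_ k) x)).
    have sk := test_smooth (tu k); have se := test_smooth te.
    have := ibp_int lebesgue_ibp j (testMl (smoothM sk sk) te).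
    under [in RHS]eq_Rintegral do rewrite mxE mulr0.
    rewrite Rint0 oppr0 => /esym.
    under eq_Rintegral do rewrite (partialM j _ (smoothM sk sk) se) (partialM j _ sk sk).
    have -> : \int[dx]_x (u_ k x * u_ k x * partial j eta x +
        eta x * (u_ k x * partial j (u_ k) x + u_ k x * partial j (u_ k) x)) =
      \int[dx]_x (partial j eta x * (u_ k x * u_ k x) + 2 * (eta x * (u_ k x * partial j (u_ k) x))).
      by apply: eq_Rintegral => x _; ring.
    rewrite RintD; [|exact: pI|exact/IgZ/mI]; rewrite RintZ; last exact: mI.
    by move=> e; apply/eqP; rewrite mulNr -addr_eq0 -e.
  have e : \int[dx]_x (partial j eta x * (u x * u x)) = - 2 * \int[dx]_x (eta x * (u x * g x ord0 j)).
    apply: (cvg_unique (@Rhausdorff R) l1).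
    by rewrite (funext E); apply: cvgM => //; exact: cvg_cst.
  have cutE x : cut n x * eta x = eta x by rewrite mulrC; have [] := hn n (leqnn n) x.
  have cutE' x : cut n x * partial j eta x = partial j eta x.
    have [_ _ /rowP/(_ j)] := hn n (leqnn n) x; by rewrite !mxE.
  have cutE'' x : eta x * partial j (cut n) x = 0.
    have [_ /rowP/(_ j) + _] := hn n (leqnn n) x; by rewrite !mxE.
  have -> : \int[dx]_x (rho x * partial j eta x) = \int[dx]_x (partial j eta x * (u x * u x)).
    apply: eq_Rintegral => x _; rewrite /rho /u.
    transitivity (phi x ^+ 2 * (cut n x * (cut n x * partial j eta x))); first by rewrite !cutE'.
    by ring.
  rewrite e mulNr -RintZ; last exact: mI.
  congr (- _); apply: eq_Rintegral => x _; rewrite /u /g !mxE.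
  have -> : 2 * (eta x * (cut n x * phi x * (cut n x * h x ord0 j + phi x * partial j (cut n) x))) =
    2 * (cut n x * (cut n x * eta x)) * (phi x * h x ord0 j) + 2 * cut n x * phi x ^+ 2 * (eta x * partial j (cut n) x).
    by ring.
  by rewrite cutE'' mulr0 addr0 !cutE; ring.
Qed.

Definition logder x : T := \row_j (weak_partial j rho x / rho x).

Lemma weak_partialE j : {ae dx, forall x, weak_partial j rho x = 2 * phi x * h x ord0 j}.
Proof.
apply: (weak_partial_unique _ (sqr_weak_partial j)).
by rewrite /weak_partial; apply: xgetPex; exists (fun x => 2 * phi x * h x ord0 j); exact: sqr_weak_partial.
Qed.

Lemma weighted_ibp : ibp_measure mu logder.
Proof.
have wP j : is_weak_partial j rho (weak_partial j rho).
  by rewrite /weak_partial; apply: xgetPex; exists (fun x => 2 * phi x * h x ord0 j); exact: sqr_weak_partial.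
have mw j : meas (weak_partial j rho) by case: (wP j).
have mb : mfield logder.
  move=> j; under eq_fun do rewrite mxE; apply: measurable_funM; first exact: mw.
  exact: measurable_fun_invr.
have mur U : measurable U -> mu U = (\int[dx]_(x in U) (rho x)%:E)%E .
  exact: hmu.
split.
- move=> r r0; rewrite hmu; last exact: measurable_cube.
  have /IgP[_] := (L2_phi_test (cutoff_test r)).2; apply: le_lt_trans.
  have mc := @measurable_cube R d _ r0.
  rewrite (_ : (\int[dx]_(x in cube r) (rho x)%:E = \int[dx]_(x in cube r) `|rho x|%:E)%E); last first.
    by apply: eq_integral => x _; rewrite (ger0_norm (rho0 x)).
  apply: (@int_sub_le R _ _ dx _ _ _ mc mrho (Ig_mf (L2_phi_test (cutoff_test r)).2)) => x xr.
  by rewrite (cutoff1 (x := x)) ?mulr1// => i; exact: ltW.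
- move=> j r; have mc : meas (cutoff (d := d) r) := test_mf (cutoff_test r).
  have mm : meas (fun x => logder x ord0 j * cutoff r x) by exact: measurable_funM.
  split=> //; apply/(density_Ig rho0 mrho mur); first exact: measurable_funX.
  have [mk ik] := L2_hphi_test j (cutoff_test r).
  (* Here the square in [rho = phi ^+ 2] counts: [(d_j rho / rho)^2 rho = 4 (d_j phi)^2] off the
     zeros of [phi]. *)
  apply: (Ig_le _ (IgZ 4 ik)).
    by apply: measurable_funM; [exact: measurable_funX|].
  apply: filterS (weak_partialE j) => x e.
  rewrite (ger0_norm (mulr_ge0 (sqr_ge0 _) (rho0 x))) [leRHS]ger0_norm; last by rewrite pmulr_rge0 ?sqr_ge0.
  rewrite !exprMn mulrAC [X in _ <= X]mulrA; apply: ler_wpM2r; first exact: sqr_ge0.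
  rewrite mxE e /rho; have [-> |p0] := eqVneq (phi x) 0.
    by rewrite !(mulr0, mul0r, expr0n)/= mulr_ge0 ?sqr_ge0.
  by apply: eq_lerW; field.
- exact: mb.
- move=> j eta te.
  have ip := Ig_test; have me := test_mf te; have mpe := test_mf (test_partial j te).
  (* On the zeros of [rho] the quotient in [logder] is 0 by convention, and the weak derivative
     [2 phi d_j phi] vanishes there as well. *)
  have bE : {ae dx, forall x, logder x ord0 j * rho x = weak_partial j rho x}.
    apply: filterS (weak_partialE j) => x e; rewrite mxE.
    have [p0|p0] := eqVneq (rho x) 0; last by rewrite divfK.
    by rewrite p0 mulr0 e; move/eqP: p0; rewrite /rho sqrf_eq0 => /eqP ->; rewrite mulr0 mul0r.
  have irho z : test_fun setT z -> Ig dx (fun x => z x * rho x).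
    move=> tz; have [n hn] := test_cut tz.
    have := L2_mul (L2_phi_test (@cutoff_test R d n%:R)) (L2_phi_test tz).
    congr Ig; apply/funext => x; have [e1 _ _] := hn n (leqnn n) x.
    by rewrite mulrACA [cut n x * _]mulrC e1 mulrC.
  have iw : Ig dx (fun x => weak_partial j rho x * eta x).
    have [n hn] := test_cut te.
    have := IgZ 2 (L2_mul (L2_phi_test (@cutoff_test R d n%:R)) (L2_hphi_test j te)).
    move=> i2; apply: (Ig_le _ i2); first exact: measurable_funM.
    apply: filterS (weak_partialE j) => x ->; have [e1 _ _] := hn n (leqnn n) x.
    rewrite [X in _ <= `|2 * X|]mulrACA [cut n x * _]mulrC e1.
    by rewrite !mulrA.
  have aeE : {ae dx, forall x, (eta x * logder x ord0 j) * rho x = weak_partial j rho x * eta x}.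
    by apply: filterS bE => x e; rewrite -mulrA e mulrC.
  have mel : meas (fun x => eta x * logder x ord0 j) by exact: measurable_funM.
  have iel : Ig mu (fun x => eta x * logder x ord0 j).
    apply/(density_Ig rho0 mrho mur) => //; apply: (Ig_le _ iw); first exact: measurable_funM.
    by apply: filterS aeE => x ->.
  have ipe : Ig mu (partial j eta) by apply/(density_Ig rho0 mrho mur) => //; exact: irho (test_partial j te).
  rewrite (density_Rint rho0 mrho mur ipe) (density_Rint rho0 mrho mur iel).
  have [_ _ hw] := wP j; have := hw eta te; under eq_Rintegral do rewrite mulrC.
  move=> ->; congr (- _); apply: ae_Rint; [exact: measurable_funM|exact: measurable_funM|].
  by apply: filterS aeE => x ->.
Qed.

End weighted_measure.

(** * Riesz representation in an abstract complete quadratic space *)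

Section riesz_representation.
Context {R : realType} (E : Type) (D : E -> Prop) (comb : R -> E -> E -> E)
  (e : E -> E -> R) (l : E -> R).
Hypotheses (Dcomb : forall a u v, D u -> D v -> D (comb a u v))
  (eC : forall u v, D u -> D v -> e u v = e v u)
  (eL : forall a u v w, D u -> D v -> D w -> e (comb a u v) w = a * e u w + e v w)
  (e0 : forall u, D u -> 0 <= e u u)
  (lL : forall a u v, D u -> D v -> l (comb a u v) = a * l u + l v)
  (D0 : exists u, D u)
  (lb : exists2 C : R, 0 <= C & forall u, D u -> l u ^+ 2 <= C * e u u)
  (ecomplete : forall u_ : nat -> E, (forall n, D (u_ n)) ->
    (forall eps : R, 0 < eps -> exists N, forall n m, (N <= n)%N -> (N <= m)%N ->
      e (comb (-1) (u_ m) (u_ n)) (comb (-1) (u_ m) (u_ n)) <= eps) ->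
    exists2 w, D w & forall eps : R, 0 < eps -> exists N, forall n, (N <= n)%N ->
      e (comb (-1) w (u_ n)) (comb (-1) w (u_ n)) <= eps).

Let eR a u v w : D u -> D v -> D w -> e w (comb a u v) = a * e w u + e w v.
Proof. by move=> Du Dv Dw; rewrite eC ?eL// 1?(eC Du)// ?(eC Dv)//; exact: Dcomb. Qed.

Let e_comb a u v : D u -> D v ->
  e (comb a u v) (comb a u v) = a ^+ 2 * e u u + 2 * a * e u v + e v v.
Proof.
move=> Du Dv; have Dc := Dcomb a Du Dv.
rewrite eL// !eR// (eC Dv Du); ring.
Qed.

(* Minimize the quadratic functional e u u - 2 l u: minimizing sequences are
   Cauchy by the parallelogram identity. *)
Lemma riesz : exists2 w, D w & forall v, D v -> e w v = l v.
Proof.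
have [C C0 hC] := lb; pose J u := e u u - 2 * l u.
have Jlb u : D u -> - C <= J u.
  move=> Du; have h := hC u Du; have h0 := e0 Du.
  have : 2 * l u <= e u u + C.
    have [lu|lu] := leP (2 * l u) 0; first by rewrite (le_trans lu)// addr_ge0.
    rewrite -(@ler_pXn2r _ 2)// ?nnegrE ?(ltW lu) ?addr_ge0//.
    by have := sqr_ge0 (e u u - C); nra.
  by rewrite /J; lra.
pose S := [set J u | u in D].
have hS : has_inf S.
  split; first by have [u Du] := D0; exists (J u); exists u.
  by exists (- C) => _ [u Du <-]; exact: Jlb.
pose m := inf S.
have mJ u : D u -> m <= J u by move=> Du; apply: ge_inf; [case: hS|exists u].
have /choice[u_ hu] : forall n : nat, exists u, D u /\ J u < m + n.+1%:R^-1.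
  move=> n; have [|_ [u Du <-] h] := @inf_adherent _ S n.+1%:R^-1 _ hS; first by rewrite invr_gt0.
  by exists u.
have Du n : D (u_ n) := (hu n).1; have Ju n : J (u_ n) < m + n.+1%:R^-1 := (hu n).2.
have par n k : e (comb (-1) (u_ k) (u_ n)) (comb (-1) (u_ k) (u_ n)) <=
    2 * n.+1%:R^-1 + 2 * k.+1%:R^-1.
  have Dm : D (comb 1 (u_ k) (u_ n)) by exact: Dcomb.
  (* [comb (-1) u u] serves as the zero vector, so that [Dh] concerns the midpoint of [u_ n] and
     [u_ k]. *)
  have Dz : D (comb (-1) (u_ n) (u_ n)) by exact: Dcomb.
  have Dh : D (comb 2^-1 (comb 1 (u_ k) (u_ n)) (comb (-1) (u_ n) (u_ n))) by exact: Dcomb.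
  have := mJ _ Dh; have := Ju n; have := Ju k; rewrite /J.
  rewrite (e_comb _ Dm Dz) (e_comb _ (Du k) (Du n)) (e_comb _ (Du n) (Du n)) (e_comb _ (Du k) (Du n)).
  rewrite (eL 1 (Du k) (Du n) Dz) (eR _ (Du n) (Du n) (Du k)) (eR _ (Du n) (Du n) (Du n)).
  rewrite (lL _ Dm Dz) (lL _ (Du k) (Du n)) (lL _ (Du n) (Du n)).
  set x := e (u_ k) (u_ k); set y := e (u_ k) (u_ n); set z := e (u_ n) (u_ n).
  set p := l (u_ k); set r := l (u_ n).
  set i1 := k.+1%:R^-1; set i2 := n.+1%:R^-1 => h1 h2 h3.
  have {}h3 : m <= 4^-1 * (x + 2 * y + z) - (p + r) by apply: (le_trans h3); apply: eq_lerW; field.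
  rewrite [leLHS](_ : _ = x - 2 * y + z); last by ring.
  by move: h1 h2 h3; lra.
have small : forall eps : R, 0 < eps -> exists N : nat, forall n, (N <= n)%N -> n.+1%:R^-1 <= eps.
  move=> eps eps0; exists (Num.bound eps^-1) => n Nn.
  rewrite -[eps]invrK lef_pV2 ?posrE ?invr_gt0//.
  by rewrite (le_trans (ltW (archi_boundP _)))// ?invr_ge0 ?(ltW eps0)// ler_nat leqW.
have [|w Dw hw] := ecomplete Du.
  move=> eps eps0; have [|N hN] := small (eps / 4); first by rewrite divr_gt0.
  exists N => n k Nn Nk; apply: (le_trans (par n k)).
  by move: (hN n Nn) (hN k Nk); set i1 := n.+1%:R^-1; set i2 := k.+1%:R^-1; lra.
exists w => // v Dv; apply/eqP; rewrite -subr_eq0 -normr_eq0 eq_le normr_ge0 andbT.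
have ev0 := e0 Dv; set a := e w v - l v.
(* First variation: comparing [u_ n] with [u_ n + s v] for [s = t] and [s = - t], near-minimality
   bounds the derivative in direction [v] by a multiple of [t * e v v] up to errors that vanish with
   [n]. *)
have key (t : R) : 0 < t -> `|a| <= t * e v v.
  move=> t0; apply/ler_addgt0Pr => eps eps0.
  have et : 0 < eps * t by rewrite mulr_gt0.
  have [N1 hN1] := small _ et; have [N2 hN2] := hw _ et.
  pose n := maxn N1 N2; have h1 := hN1 n (leq_maxl _ _); have h2 := hN2 n (leq_maxr _ _).
  have J1 (s : R) : - (n.+1%:R^-1) <= 2 * s * (e (u_ n) v - l v) + s ^+ 2 * e v v.
    have Ds := Dcomb s Dv (Du n); have := mJ _ Ds; have := Ju n.
    rewrite /J (e_comb _ Dv (Du n)) lL// (eC Dv (Du n)); set i := n.+1%:R^-1; nra.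
  have dw : forall s : R, 0 <= e (comb (-1) w (u_ n)) (comb (-1) w (u_ n)) +
      2 * s * (e (u_ n) v - e w v) + s ^+ 2 * e v v.
    move=> s; have Dd := Dcomb (-1) Dw (Du n); have := e0 (Dcomb s Dv Dd).
    by rewrite (e_comb _ Dv Dd) eR// (eC Dv Dw) (eC Dv (Du n)); nra.
  have := J1 t; have := J1 (- t); have := dw t; have := dw (- t).
  move: h1 h2; rewrite /a; set q := e (comb _ _ _) _; set i := n.+1%:R^-1; set p := e (u_ n) v.
  move=> h1 h2 k1 k2 k3 k4; rewrite ler_norml; apply/andP; split.
    rewrite -(ler_pM2l (mulr_gt0 (ltr0n R 2) t0)); nra.
  by rewrite -(ler_pM2l (mulr_gt0 (ltr0n R 2) t0)); nra.
apply/ler_addgt0Pr => eps eps0; rewrite add0r.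
have v1 : 0 < e v v + 1 by rewrite ltr_wpDl.
apply: (le_trans (key (eps / (e v v + 1)) _)); first by rewrite divr_gt0.
by rewrite -mulrAC ler_pdivrMr// ler_pM2l// lerDl.
Qed.

End riesz_representation.

(** * The Cauchy-Schwarz inequality by discriminants *)

Section cauchy_schwarz.
Context {R : realType} d (X : measurableType d) (mu : {measure set X -> \bar R}).

Lemma quadratic_ge0 (a b c : R) : (forall t, 0 <= t ^+ 2 * a + 2 * t * b + c) -> b ^+ 2 <= a * c.
Proof.
move=> h; have c0 : 0 <= c by have := h 0; rewrite expr0n /= !mul0r mulr0 mul0r !add0r.
have [a0|a0] := ltP 0 a.
  have := h (- b / a); rewrite -(pmulr_rge0 _ a0).
  have -> : a * ((- b / a) ^+ 2 * a + 2 * (- b / a) * b + c) = a * c - b ^+ 2 by field; rewrite gt_eqF.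
  by rewrite subr_ge0.
have [b0|b0] := eqVneq b 0.
  rewrite b0 expr0n; have [->|an] := eqVneq a 0; first by rewrite mul0r.
  have {}a0 : a < 0 by rewrite lt_neqAle an.
  exfalso; have := h ((c + 1) / (- a) + 1); rewrite b0 mulr0 addr0 leNgt => /negP; apply.
  have t1 : 1 <= (c + 1) / (- a) + 1 by rewrite lerDr divr_ge0 ?addr_ge0 ?oppr_ge0 ?(ltW a0).
  apply: (@le_lt_trans _ _ (((c + 1) / (- a) + 1) * a + c)).
    by rewrite lerD2r ler_wnM2r ?(ltW a0)// expr2 ler_peMl ?(le_trans ler01).
  rewrite mulrDl mul1r invrN mulrN mulNr divfK ?lt_eqF//; lra.
have b2 : 0 < b ^+ 2 by rewrite lt_def sqrf_eq0 b0 sqr_ge0.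
exfalso; have := h (- (c + 1) / (2 * b)); rewrite leNgt => /negP; apply.
have -> : 2 * (- (c + 1) / (2 * b)) * b = - (c + 1) by field.
have : ((- (c + 1) / (2 * b)) ^+ 2) * a <= 0 by rewrite mulr_ge0_le0 ?sqr_ge0.
lra.
Qed.

Lemma Rint_CS (f g : X -> R) : L2 mu f -> L2 mu g ->
  (\int[mu]_x (f x * g x)) ^+ 2 <= (\int[mu]_x (f x ^+ 2)) * \int[mu]_x (g x ^+ 2).
Proof.
move=> hf hg; have i1 := L2_mul hf hg; have [mf i2] := hf; have [mg i3] := hg.
apply: quadratic_ge0 => t.
have -> : t ^+ 2 * \int[mu]_x (f x ^+ 2) + 2 * t * \int[mu]_x (f x * g x) + \int[mu]_x (g x ^+ 2) =
    \int[mu]_x (t * f x + g x) ^+ 2.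
  rewrite -(RintZ _ i2) -(RintZ _ i1) -(RintD (IgZ _ i2) (IgZ _ i1)).
  rewrite -(RintD (IgD (IgZ _ i2) (IgZ _ i1)) i3).
  by apply: eq_Rintegral => x _; ring.
apply: Rint_ge0; first by apply: aeW => x; exact: sqr_ge0.
by apply: measurable_funX; apply: measurable_funD => //; exact: measurable_funM.
Qed.

Lemma L2_mul_ess (f u : X -> R) (K : R) : meas f -> {ae mu, forall x, `|f x| <= K} ->
  L2 mu u -> L2 mu (fun x => f x * u x).
Proof.
move=> mf fK hu; apply: (L2_le _ (L2Z K hu)).
  by apply: measurable_funM => //; case: hu.
by apply: filterS fK => x h; rewrite !normrM ler_wpM2r// (le_trans h)// ler_norm.
Qed.

End cauchy_schwarz.

(** * The space L1: completeness, Hahn-Banach, uniform boundedness *)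

Section L1_space.
Context {R : realType} d (X : measurableType d) (mu : {measure set X -> \bar R}).
Implicit Types f g : X -> R.

Definition nrm f : R := \int[mu]_x `|f x|.

Lemma nrm_ge0 f : Ig mu f -> 0 <= nrm f.
Proof. by move=> hf; apply: Rint_ge0; [exact: aeW|exact: measurableT_comp (Ig_mf hf)]. Qed.

Lemma nrmD f g : Ig mu f -> Ig mu g -> nrm (fun x => f x + g x) <= nrm f + nrm g.
Proof.
move=> hf hg; rewrite /nrm -RintD; [|exact: Ig_abs|exact: Ig_abs].
apply: Rint_le; [exact/Ig_abs/IgD|by apply: IgD; exact: Ig_abs|].
by apply: aeW => x; exact: ler_normD.
Qed.

Lemma nrmZ c f : Ig mu f -> nrm (fun x => c * f x) = `|c| * nrm f.
Proof.
move=> hf; rewrite /nrm -RintZ; last exact: Ig_abs.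
by apply: eq_Rintegral => x _; rewrite normrM.
Qed.

Lemma nrmN f : nrm (fun x => - f x) = nrm f.
Proof. by apply: eq_Rintegral => x _; rewrite normrN. Qed.

Lemma nrmB f g : Ig mu f -> Ig mu g -> nrm (fun x => f x - g x) <= nrm f + nrm g.
Proof. by move=> hf hg; apply: (le_trans (nrmD hf (IgN hg))); rewrite nrmN. Qed.

Lemma nrm0 : nrm (fun=> 0) = 0.
Proof. by rewrite /nrm -[RHS](@Rint0 _ _ _ mu); apply: eq_Rintegral => x _; rewrite normr0. Qed.

Lemma nrm_ae f g : Ig mu f -> Ig mu g -> {ae mu, forall x, f x = g x} -> nrm f = nrm g.
Proof.
move=> hf hg fg; apply: ae_Rint.
- by apply: measurableT_comp (Ig_mf hf).
- by apply: measurableT_comp (Ig_mf hg).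
- by apply: filterS fg => x ->.
Qed.

Lemma nrm_distC f g : nrm (fun x => f x - g x) = nrm (fun x => g x - f x).
Proof. by apply: eq_Rintegral => x _; rewrite distrC. Qed.

Lemma nrm_tri f g h : Ig mu f -> Ig mu g -> Ig mu h ->
  nrm (fun x => f x - h x) <= nrm (fun x => f x - g x) + nrm (fun x => g x - h x).
Proof.
move=> hf hg hh; have := nrmD (IgB hf hg) (IgB hg hh).
rewrite (_ : nrm (fun x => f x - g x + (g x - h x)) = nrm (fun x => f x - h x))//.
by apply: eq_Rintegral => x _; rewrite addrA subrK.
Qed.

Lemma nrm_eq0 f : Ig mu f -> nrm f <= 0 -> {ae mu, forall x, f x = 0}.
Proof.
move=> hf f0; have := Rint_abs_eq0 hf; rewrite /nrm => h.
have : \int[mu]_x `|f x| = 0 by apply/eqP; rewrite eq_le f0 nrm_ge0.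
by move=> /h; apply: filterS => x; exact.
Qed.

Lemma Cv0_nrm (q : nat -> X -> R) : (forall n, Ig mu (q n)) ->
  Cv0 mu q <-> forall e : R, 0 < e -> exists N, forall n, (N <= n)%N -> nrm (q n) <= e.
Proof.
move=> hq; split=> [cq e e0|h].
  by have [N hN] := Cv0_small cq e0; exists N => n /hN[_ /ltW].
apply: Cv0P => [n|e /h[N hN]]; first exact: Ig_mf (hq n).
by exists N => n /hN; rewrite Rint_fineE// lee_fin.
Qed.

Lemma L1_complete (f_ : nat -> X -> R) : (forall n, Ig mu (f_ n)) ->
  (forall e : R, 0 < e -> exists N, forall n m, (N <= n)%N -> (N <= m)%N ->
    nrm (fun x => f_ n x - f_ m x) <= e) ->
  exists f, Ig mu f /\ Cv0 mu (fun n x => f_ n x - f x).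
Proof.
move=> hf cau.
have [G [mG cG]] : exists G : X -> unit -> R, (forall i, meas (fun x => G x i)) /\
    Cv0 mu (fun n x => `|f_ n x - G x tt|).
  apply: (@riesz_fischer R _ X mu unit (fun n x _ => f_ n x) (fun x xi => `|xi tt|)).
  - by move=> n _; exact: Ig_mf (hf n).
  - by move=> x xi.
  - by move=> H mH; exact: measurableT_comp.
  - move=> x; exists 1 => xi k [] h; rewrite mul1r (le_trans h)// lerXn2r ?nnegrE ?invr_ge0//.
    by rewrite lef_pV2 ?posrE// ler_nat.
  - by move=> x xi xi0 h; apply: cvg_norm; exact: h.
  - move=> e /cau[N hN]; exists N => n m Nn Nm.
    by rewrite (Rint_fineE (IgB (hf n) (hf m))) lee_fin; exact: hN.
pose g x := G x tt.
have cg : Cv0 mu (fun n x => f_ n x - g x).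
  apply: (Cv0_le (C := 1) cG) => [n|n].
    by apply: measurable_funB; [exact: Ig_mf (hf n)|exact: mG].
  by apply: aeW => x; rewrite normr_id mul1r.
exists g; split=> //; have [N hN] := Cv0_small cg ltr01; have [i _] := hN N (leqnn _).
by have := IgB (hf N) i; congr Ig; apply/funext => x; rewrite opprB addrC subrK.
Qed.

Section hahn_banach.
Variables (W : set (X -> R)) (f0 : X -> R) (delta : R).
Hypotheses (WI : forall w, W w -> Ig mu w) (W0 : exists w, W w)
  (Wcomb : forall a u v, W u -> W v -> W (fun x => a * u x + v x))
  (f0I : Ig mu f0) (delta_ge0 : 0 <= delta)
  (f0W : forall w, W w -> delta <= nrm (fun x => f0 x - w x)).

Let comb a (p r : (X -> R) * R) : (X -> R) * R := ((fun x => a * p.1 x + r.1 x), a * p.2 + r.2).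
Let G0 : set ((X -> R) * R) := [set p | exists w t, W w /\ p = ((fun x => w x + t * f0 x), t * delta)].
Let dom (A : set ((X -> R) * R)) := forall p, A p -> Ig mu p.1 /\ p.2 <= nrm p.1.
Let clo (A : set ((X -> R) * R)) := forall a p r, A p -> A r -> A (comb a p r).
(** The alternative [A = set0] accommodates the empty chain in Zorn's lemma. *)
Let P (A : set ((X -> R) * R)) := [/\ A = set0 \/ G0 `<=` A, dom A & clo A].

Let WZ a w : W w -> W (fun x => a * w x).
Proof.
move=> hw; have h0 := Wcomb (-1) hw hw; have := Wcomb a hw h0.
by congr W; apply/funext => x; rewrite mulN1r addNr addr0.
Qed.

Let PG0 : P G0.
Proof.
split; first by right.
- move=> _ [w [t [hw ->]]]; have hI := IgD (WI hw) (IgZ t f0I); split=> //=.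
  have [t0|t0|->] := ltgtP t 0.
  + by rewrite (le_trans _ (nrm_ge0 hI))// mulr_le0_ge0// ltW.
  + have -> : nrm (fun x => w x + t * f0 x) = t * nrm (fun x => f0 x - (- t^-1) * w x).
      rewrite -[X in _ = X * _](gtr0_norm t0) -nrmZ; last by apply: IgB => //; exact: IgZ (WI hw).
      by apply: eq_Rintegral => x _; congr `|_|; field; rewrite gt_eqF.
    by rewrite ler_wpM2l ?(ltW t0)//; apply: f0W; exact: WZ.
  + by rewrite mul0r; apply: nrm_ge0; apply: IgD; [exact: WI|exact: IgZ].
- move=> a _ _ [w [t [hw ->]]] [w' [t' [hw' ->]]].
  exists (fun x => a * w x + w' x), (a * t + t'); split; first exact: Wcomb.
  by congr pair; [apply/funext => x /=; ring|rewrite /=; ring].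
Qed.

(** Zorn's lemma on graphs of functionals that are closed under linear combinations and dominated by
    the norm, starting from [G0], the graph of [w + t f0 |-> t delta]. Domination makes such a graph
    single-valued, and a maximal one is total because a missing [f] can be added with a value [c]
    between the bounds of [key]. *)
Lemma hahn_banach : exists l : (X -> R) -> R,
  [/\ forall a f g, Ig mu f -> Ig mu g -> l (fun x => a * f x + g x) = a * l f + l g,
      forall f, Ig mu f -> `|l f| <= nrm f, forall w, W w -> l w = 0 & l f0 = delta].
Proof.
have [A [[A0 dA cA] maxA]] : exists A, P A /\ forall B, A `<` B -> ~ P B.
  apply: Zorn_bigcup => F FP tot; split.
  - have [[B FB BG]|h] := pselect (exists2 B, F B & G0 `<=` B).
      by right => p /BG Bp; exists B.
    left; apply/seteqP; split=> // p [B FB Bp]; have [[B0|BG] _ _] := FP B FB.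
      by rewrite B0 in Bp.
    by exfalso; apply: h; exists B.
  - by move=> p [B FB Bp]; have [_ dB _] := FP B FB; exact: dB.
  - move=> a p r [B FB Bp] [B' FB' Br]; have [BB|BB] := tot B B' FB FB'.
      by exists B' => //; have [_ _ c] := FP B' FB'; apply: c => //; exact: BB.
    by exists B => //; have [_ _ c] := FP B FB; apply: c => //; exact: BB.
have GA : G0 `<=` A.
  case: A0 => // A0; exfalso; apply: (maxA G0); last exact: PG0.
  rewrite A0; split=> // h; by have [w hw] := W0; have := h (_, _) (ex_intro _ w (ex_intro _ 0 (conj hw erefl))).
have A00 : A ((fun=> 0), 0).
  apply: GA; have [w hw] := W0; exists (fun x => 0 * w x), 0; split; first exact: WZ.
  by congr pair; [apply/funext => x; rewrite !mul0r addr0|rewrite mul0r].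
have AZ a p : A p -> A ((fun x => a * p.1 x), a * p.2).
  move=> Ap; have := cA a _ _ Ap A00; congr A; congr pair; last by rewrite /= addr0.
  by apply/funext => x; rewrite /= addr0.
have tot f : Ig mu f -> exists a, A (f, a).
  move=> hf; apply: contrapT => nf.
  pose S := [set p.2 - nrm (fun x => p.1 x - f x) | p in A].
  have key p r : A p -> A r -> p.2 - nrm (fun x => p.1 x - f x) <= nrm (fun x => r.1 x + f x) - r.2.
    move=> Ap Ar; have [Ip _] := dA _ Ap; have [Ir _] := dA _ Ar.
    have [_] := dA _ (cA 1 _ _ Ap Ar); rewrite /comb /= mul1r => h.
    have h2 := nrmD (IgB Ip hf) (IgD Ir hf).
    have E : nrm (fun x => p.1 x - f x + (r.1 x + f x)) = nrm (fun x => 1 * p.1 x + r.1 x).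
      by apply: eq_Rintegral => x _; congr `|_|; ring.
    by rewrite E in h2; lra.
  have hS : has_sup S.
    split; first by exists (0 - nrm (fun x => (fun=> 0) x - f x)), ((fun=> 0), 0).
    by exists (nrm (fun x => (fun=> 0) x + f x) - 0) => _ [p Ap <-]; exact: (key _ _ Ap A00).
  pose c := sup S.
  have c1 p : A p -> p.2 - nrm (fun x => p.1 x - f x) <= c by move=> Ap; apply: ub_le_sup; [case: hS|exists p].
  have c2 r : A r -> c <= nrm (fun x => r.1 x + f x) - r.2.
    by move=> Ar; apply: ge_sup; [case: hS|move=> _ [p Ap <-]; exact: key].
  pose B := [set p | exists r t, A r /\ p = ((fun x => r.1 x + t * f x), r.2 + t * c)].
  have AB : A `<=` B.
    move=> [g a] Ap; exists (g, a), 0; split=> //; congr pair; last by rewrite mul0r addr0.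
    by apply/funext => x; rewrite mul0r addr0.
  apply: (maxA B).
    split=> // BA; apply: nf; exists c; apply: BA; exists ((fun=> 0), 0), 1; split=> //.
    by congr pair; [apply/funext => x; rewrite mul1r add0r|rewrite mul1r add0r].
  split; first by right; exact: subset_trans AB.
  - move=> _ [r [t [Ar ->]]]; have [Ir dr] := dA _ Ar; have hI := IgD Ir (IgZ t hf); split=> //=.
    have [t0|t0|->] := ltgtP t 0.
    + have s0 : 0 < - t by rewrite oppr_gt0.
      have := c1 _ (AZ (- t)^-1 _ Ar); rewrite /=.
      have E : (- t) * nrm (fun x => (- t)^-1 * r.1 x - f x) = nrm (fun x => r.1 x + t * f x).
        rewrite -[X in X * _](gtr0_norm s0) -nrmZ; last by apply: IgB => //; exact: IgZ.
        by apply: eq_Rintegral => x _; congr `|_|; field; rewrite lt_eqF.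
      rewrite -(ler_pM2l s0) mulrBr E mulrA divff ?gt_eqF// mul1r; lra.
    + have := c2 _ (AZ t^-1 _ Ar); rewrite /=.
      have E : t * nrm (fun x => t^-1 * r.1 x + f x) = nrm (fun x => r.1 x + t * f x).
        rewrite -[X in X * _](gtr0_norm t0) -nrmZ; last by apply: IgD => //; exact: IgZ.
        by apply: eq_Rintegral => x _; congr `|_|; field; rewrite gt_eqF.
      rewrite -(ler_pM2l t0) mulrBr E mulrA divff ?gt_eqF// mul1r; lra.
    + rewrite mul0r addr0 (le_trans dr)//; apply: eq_lerW.
      by apply: eq_Rintegral => x _; rewrite mul0r addr0.
  - move=> a _ _ [r [t [Ar ->]]] [r' [t' [Ar' ->]]].
    exists (comb a r r'), (a * t + t'); split; first exact: cA.
    by congr pair; [apply/funext => x /=; ring|rewrite /=; ring].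
have uni f a a' : A (f, a) -> A (f, a') -> a = a'.
  move=> h h'; have d1 := (dA _ (cA (-1) _ _ h h')).2; have d2 := (dA _ (cA (-1) _ _ h' h)).2.
  have z : nrm (fun x => -1 * f x + f x) = 0.
    by rewrite -nrm0; apply: eq_Rintegral => x _; congr `|_|; ring.
  by move: d1 d2; rewrite /= z; lra.
pose l f := xget 0 [set a | A (f, a)].
have lA f : Ig mu f -> A (f, l f) by move=> /tot h; exact: (xgetPex 0 h).
have lE f a : A (f, a) -> l f = a.
  by move=> h; have [hf _] := dA _ h; exact: uni (lA f hf) h.
exists l; split.
- by move=> a f g hf hg; apply: lE; exact: (cA a _ _ (lA f hf) (lA g hg)).
- move=> f hf; have h1 := (dA _ (lA f hf)).2; have h2 := (dA _ (AZ (-1) _ (lA f hf))).2.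
  rewrite ler_norml h1 andbT lerNl -mulN1r (le_trans h2)// nrmZ//= normrN1 mul1r//.
- move=> w hw; apply: lE; apply: GA; exists w, 0; split=> //.
  by congr pair; [apply/funext => x; rewrite mul0r addr0|rewrite mul0r].
- apply: lE; apply: GA; have [w hw] := W0; exists (fun x => 0 * w x), 1; split; first exact: WZ.
  by congr pair; [apply/funext => x; rewrite mul0r mul1r add0r|rewrite mul1r].
Qed.

End hahn_banach.

Lemma op_nrmZ (S : (X -> R) -> (X -> R)) : (forall f, Ig mu f -> Ig mu (S f)) ->
  (forall a f g, Ig mu f -> Ig mu g ->
    {ae mu, forall x, S (fun x => a * f x + g x) x = a * S f x + S g x}) ->
  forall c f, Ig mu f -> nrm (S (fun x => c * f x)) = `|c| * nrm (S f).
Proof.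
move=> SI SL c f hf; have hz := IgD (IgZ (-1) hf) hf.
rewrite -nrmZ; last exact: SI.
apply: nrm_ae; [exact/SI/IgZ|exact/IgZ/SI|].
apply: filterS2 (SL (-1) _ _ hf hf) (SL c _ _ hf hz) => x e1 e2.
have <- : (fun x => c * f x + (-1 * f x + f x)) = (fun x => c * f x).
  by apply/funext => y; rewrite mulN1r addNr addr0.
by rewrite e2 e1; ring.
Qed.

(* Uniform boundedness by the elementary argument of Sokal: replace x_n by
   x_n + xi or x_n - xi so that T_n becomes large on it. *)
Lemma uniform_boundedness (T_ : nat -> (X -> R) -> (X -> R)) :
  (forall n f, Ig mu f -> Ig mu (T_ n f)) ->
  (forall n a f g, Ig mu f -> Ig mu g ->
    {ae mu, forall x, T_ n (fun x => a * f x + g x) x = a * T_ n f x + T_ n g x}) ->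
  (forall n, exists C, forall f, Ig mu f -> nrm (T_ n f) <= C * nrm f) ->
  (forall f, Ig mu f -> exists K, forall n, nrm (T_ n f) <= K) ->
  exists2 K, 0 <= K & forall n f, Ig mu f -> nrm (T_ n f) <= K * nrm f.
Proof.
move=> TI TL TB TP; apply: contrapT => hK.
have /choice[c hc] : forall n, exists c, 0 <= c /\ (forall f, Ig mu f -> nrm (T_ n f) <= c * nrm f) /\
    (forall s, s < c -> exists f, [/\ Ig mu f, nrm f <= 1 & s < nrm (T_ n f)]).
  move=> n; have [C hC] := TB n.
  pose S := [set y | exists f, [/\ Ig mu f, nrm f <= 1 & y = nrm (T_ n f)]].
  have hS : has_sup S.
    split; first by exists (nrm (T_ n (fun=> 0))), (fun=> 0); split=> //; [exact: Ig0|rewrite nrm0].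
    exists `|C| => _ [f [hf f1 ->]]; rewrite (le_trans (hC f hf))//.
    rewrite (le_trans (ler_norm _))// normrM (ger0_norm (nrm_ge0 hf)) ler_piMr//.
  exists (sup S); split; [|split].
  - apply: (@le_trans _ _ (nrm (T_ n (fun=> 0)))); first exact/nrm_ge0/TI/Ig0.
    by apply: ub_le_sup; [case: hS|exists (fun=> 0); split=> //; [exact: Ig0|rewrite nrm0]].
  - move=> f hf; have [f0|f0] := eqVneq (nrm f) 0.
      by have := hC f hf; rewrite f0 !mulr0.
    have fp : 0 < nrm f by rewrite lt_def f0 nrm_ge0.
    have TZ : nrm (T_ n (fun x => (nrm f)^-1 * f x)) = (nrm f)^-1 * nrm (T_ n f).
      by rewrite (op_nrmZ (TI n) (TL n))// ger0_norm// invr_ge0 ltW.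
    have : nrm (T_ n (fun x => (nrm f)^-1 * f x)) <= sup S.
      apply: ub_le_sup; first by case: hS.
      exists (fun x => (nrm f)^-1 * f x); split=> //; first exact: IgZ.
      by rewrite nrmZ// ger0_norm ?invr_ge0 ?(ltW fp)// mulVf.
    by rewrite TZ mulrC ler_pdivrMr.
  - move=> s sS; have [_ [f [hf f1 ->]] h] := sup_gt hS.1 sS.
    by exists f.
have /choice[s hs] : forall k : nat, exists n, 4 ^+ k < c n.
  move=> k; apply: contrapT => h; apply: hK; exists (4 ^+ k) => // n f hf.
  rewrite (le_trans ((hc n).2.1 f hf))// ler_wpM2r ?nrm_ge0// leNgt; apply/negP => h2.
  by apply: h; exists n.
(* Perturbations of size [3^-1 ^+ k] on which [T_ (s k)] reaches two thirds of its norm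
   [c (s k) > 4 ^+ k]. All later perturbations together amount to at most half of [3^-1 ^+ k], so
   the fraction [2/3 - 1/2 = 1/6] survives. *)
have /choice[xi hxi] : forall k : nat, exists f, [/\ Ig mu f, nrm f <= 3^-1 ^+ k &
    2 / 3 * c (s k) * 3^-1 ^+ k <= nrm (T_ (s k) f)].
  move=> k; have c0 : 0 < c (s k) by rewrite (le_lt_trans _ (hs k)).
  have [|f [hf f1 h]] := (hc (s k)).2.2 (2 / 3 * c (s k)); first by lra.
  have p0 : (0 : R) <= 3^-1 ^+ k by rewrite exprn_ge0.
  exists (fun x => 3^-1 ^+ k * f x); split; first exact: IgZ.
    by rewrite nrmZ// ger0_norm// ler_piMr.
  by rewrite (op_nrmZ (TI (s k)) (TL (s k)))// ger0_norm// mulrC ler_wpM2l// ltW.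
pose step_ k (f : X -> R) := if nrm (T_ (s k) (xi k)) <= nrm (T_ (s k) (fun x => 1 * xi k x + f x))
  then (fun x => 1 * xi k x + f x) else (fun x => -1 * xi k x + f x).
pose x_ := fix x_ n := if n is k.+1 then step_ k (x_ k) else (fun=> 0).
have xI n : Ig mu (x_ n).
  elim: n => [|k IH]; first exact: Ig0.
  by rewrite /= /step_; have [h _ _] := hxi k; case: ifP => _; apply: IgD => //; exact: IgZ.
have sg k : exists2 e : R, `|e| = 1 & step_ k (x_ k) = (fun x => e * xi k x + x_ k x).
  by rewrite /step_; case: ifP => _; [exists 1|exists (-1)]; rewrite ?normrN1 ?normr1.
have xd k : nrm (fun x => x_ k.+1 x - x_ k x) <= 3^-1 ^+ k.
  have [h h1 _] := hxi k; rewrite (le_trans _ h1)//; have [e e1 /= ->] := sg k.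
  have -> : nrm (fun x => e * xi k x + x_ k x - x_ k x) = nrm (fun x => e * xi k x).
    by apply: eq_Rintegral => x _; rewrite addrK.
  by rewrite nrmZ// e1 mul1r.
have xbig k : nrm (T_ (s k) (xi k)) <= nrm (T_ (s k) (x_ k.+1)).
  have [h _ _] := hxi k; rewrite /= /step_; case: ifP => [//|/negbT]; rewrite -ltNge => lt1.
  have I1 := IgD (IgZ 1 h) (xI k); have I2 := IgD (IgZ (-1) h) (xI k).
  have E : nrm (fun x => 2 * T_ (s k) (xi k) x) = nrm (fun x =>
      T_ (s k) (fun x => 1 * xi k x + x_ k x) x - T_ (s k) (fun x => -1 * xi k x + x_ k x) x).
    apply: nrm_ae; [exact/IgZ/TI|by apply: IgB; exact: TI|].
    by apply: filterS2 (TL (s k) 1 _ _ h (xI k)) (TL (s k) (-1) _ _ h (xI k)) => x -> ->; ring.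
  have := nrmB (TI (s k) _ I1) (TI (s k) _ I2); rewrite -E nrmZ; last exact: TI.
  rewrite ger0_norm//; lra.
have p3 k : 0 < (3^-1 : R) ^+ k by rewrite exprn_gt0.
have xt n j : nrm (fun x => x_ (n + j)%N x - x_ n x) <= 3 / 2 * (3^-1 ^+ n - 3^-1 ^+ (n + j)).
  elim: j => [|j IH].
    by rewrite addn0 subrr mulr0 (_ : nrm _ = 0)// -nrm0; apply: eq_Rintegral => x _; rewrite subrr.
  rewrite addnS; apply: (le_trans (nrm_tri (xI _) (xI (n + j)%N) (xI n))).
  apply: (le_trans (lerD (xd _) IH)); rewrite exprS.
  have := p3 (n + j)%N; have := p3 n; lra.
have e0 (e : R) : 0 < e -> exists N : nat, forall n, (N <= n)%N -> 3^-1 ^+ n <= e.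
  move=> ep; exists (Num.bound e^-1) => n Nn; rewrite exprVn -[leRHS]invrK.
  rewrite lef_pV2 ?posrE ?exprn_gt0 ?invr_gt0//.
  apply: (le_trans (ltW (archi_boundP _))); first by rewrite invr_ge0 ltW.
  apply: (@le_trans _ _ n%:R); first by rewrite ler_nat.
  by rewrite -natrX ler_nat ltnW// ltn_expl.
have [|x [hx cx]] := L1_complete xI.
  move=> e ep; have [|N hN] := e0 (e / 3); first by rewrite divr_gt0.
  exists N => n m Nn Nm.
  apply: (le_trans (nrm_tri (xI n) (xI N) (xI m))); rewrite (nrm_distC (x_ N)).
  have := xt N (n - N)%N; have := xt N (m - N)%N; rewrite !subnKC// => h1 h2.
  have := hN N (leqnn N); have := p3 n; have := p3 m; lra.
have xl k : nrm (fun y => x_ k.+1 y - x y) <= 2^-1 * 3^-1 ^+ k.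
  apply/ler_addgt0Pr => e ep.
  have /(Cv0_nrm (fun n => IgB (xI n) hx)) /(_ e ep) [N hN] := cx.
  pose m := maxn N k.+1; have hm := hN m (leq_maxl _ _).
  apply: (le_trans (nrm_tri (xI k.+1) (xI m) hx)); rewrite (nrm_distC (x_ k.+1)) lerD//.
  have := xt k.+1 (m - k.+1)%N; rewrite subnKC ?leq_maxr// => /le_trans; apply.
  have := p3 m; rewrite exprS; lra.
have [K hKx] := TP x hx.
have pow k : 1 + k%:R / 3 <= (4 / 3 : R) ^+ k.
  elim: k => [|k IH]; first by rewrite mul0r addr0 expr0.
  rewrite exprS -natr1; have : (0 : R) <= k%:R by []; move: IH; nra.
(* What survives is at least [(4/3) ^+ k / 6 >= (1 + k / 3) / 6], which exceeds [|K|] as soon as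
   [k > 18 (|K| + 1)]. *)
pose k := Num.bound (18 * (`|K| + 1)).
have hk : 18 * (`|K| + 1) < k%:R by apply: archi_boundP; rewrite mulr_ge0// addr_ge0.
have [_ _ hxk] := hxi k; have := le_trans hxk (xbig k); have := hKx (s k).
have := (hc (s k)).2.1 _ (IgB (xI k.+1) hx); have := xl k; have := hs k; have cpos := (hc (s k)).1.
have tri : nrm (T_ (s k) (x_ k.+1)) <= nrm (T_ (s k) x) + nrm (T_ (s k) (fun y => x_ k.+1 y - x y)).
  rewrite -(nrm_ae (f := fun y => T_ (s k) (fun y => -1 * x y + x_ k.+1 y) y + T_ (s k) x y)).
  - rewrite addrC; have -> : (fun y => x_ k.+1 y - x y) = (fun y => -1 * x y + x_ k.+1 y).
      by apply/funext => y; ring.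
    by apply: nrmD; apply: TI => //; apply: IgD => //; exact: IgZ.
  - by apply: IgD; apply: TI => //; apply: IgD => //; exact: IgZ.
  - exact: TI.
  - by apply: filterS (TL (s k) (-1) _ _ hx (xI k.+1)) => y ->; ring.
have E4 : (4 : R) ^+ k = (4 / 3) ^+ k * 3 ^+ k by rewrite -exprMn divfK.
have E3 : (3 : R) ^+ k * 3^-1 ^+ k = 1 by rewrite exprVn divff// expf_neq0.
have pk := pow k; have := ler_norm K; have := p3 k.
set a := nrm (T_ (s k) (x_ k.+1)); set bb := nrm (T_ (s k) (fun y => _)).
set p := (3^-1 : R) ^+ k; rewrite E4; set D := (4 / 3 : R) ^+ k; set q := (3 : R) ^+ k => p0 Kn c4 h1 h2 h3 h4.
have c4p : D < c (s k) * p.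
  by rewrite -(ltr_pM2r p0) -mulrA E3 mulr1 in c4.
have b1 : bb <= 2^-1 * (c (s k) * p).
  by rewrite (le_trans h2)// mulrCA ler_wpM2l.
move: h4; rewrite -mulrA => h4.
have {}pk : 1 + k%:R / 3 <= D := pow k.
have Kn' : K <= `|K| := ler_norm K.
move: tri pk hk Kn'; rewrite -/a -/bb; set kk : R := k%:R; set aK := `|K|.
move: (c (s k) * p) c4p b1 h4 h3 => cp; lra.
Qed.

End L1_space.

(** * Semigroups on L1 and their generators *)

Section semigroup_basics.
Context {R : realType} {d : nat} (mu : {measure set 'rV[R]_d -> \bar R}).
Local Notation T := 'rV[R]_d.
Local Notation nrm := (nrm mu).
Implicit Types (u v f g w : T -> R).

Lemma right0P (a : R -> \bar R) : (forall t, 0 <= a t)%E ->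
  a t @[t --> 0^'+] --> 0%E <->
  forall e : R, 0 < e -> exists2 del : R, 0 < del & forall t, 0 < t < del -> (a t <= e%:E)%E.
Proof.
move=> a0; split=> [+ e e0|h].
  move/fine_cvgP => [[d1 d10 h1] /cvgrPdist_lt /(_ e e0) [d2 d20 h2]].
  exists (Num.min d1 d2) => [|t /andP[t0]]; first by rewrite lt_min d10.
  rewrite lt_min => /andP[t1 t2].
  have b1 (r : R) : t < r -> ball 0 r t by rewrite /ball /= sub0r normrN gtr0_norm.
  have f1 := h1 t (b1 _ t1) t0; have := h2 t (b1 _ t2) t0; rewrite /= sub0r normrN => f2.
  by rewrite -(fineK f1) lee_fin (le_trans (ler_norm _))// ltW.
have fin e t : (a t <= e%:E)%E -> a t \is a fin_num.
  by move=> h1; rewrite ge0_fin_numE// (le_lt_trans h1)// ltry.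
have ab (r t : R) : ball 0 r t -> 0 < t -> t < r.
  by rewrite /ball /= sub0r normrN => + t0; rewrite gtr0_norm.
apply/fine_cvgP; split.
  have [r r0 hr] := h 1 ltr01; exists r => // t tr t0.
  by apply: (fin 1); apply: hr; rewrite t0/=; exact: ab tr t0.
apply/cvgrPdist_le => e e0; have [r r0 hr] := h e e0; exists r => // t tr t0.
have hh : (a t <= e%:E)%E by apply: hr; rewrite t0/=; exact: ab tr t0.
by rewrite sub0r normrN ger0_norm ?fine_ge0// -lee_fin fineK//; exact: fin hh.
Qed.

Lemma N1E f : Ig mu f -> ('N[mu]_1[EFin \o f] = (nrm f)%:E)%E.
Proof. by move=> hf; rewrite Lnorm1 -Rint_fineE. Qed.

Variable V : set T.
Local Notation P := (Lp mu 1 V).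

Lemma LpP f : P f <-> Ig mu f /\ {ae mu, forall x, ~ V x -> f x = 0}.
Proof. by split=> [[/Lfun1P]|[/Lfun1P]]. Qed.

Lemma Lp_comb a f g : P f -> P g -> P (fun x => a * f x + g x).
Proof.
move=> /LpP[hf f0] /LpP[hg g0]; apply/LpP; split; first exact: (IgD (IgZ a hf) hg).
by apply: filterS2 f0 g0 => x h1 h2 Vx; rewrite h1// h2// mulr0 addr0.
Qed.

Lemma Lp_Ig f : P f -> Ig mu f. Proof. by move=> /LpP[]. Qed.

Lemma LpZ a f : P f -> P (fun x => a * f x).
Proof.
move=> hf; have := Lp_comb (-a) hf (Lp_comb (2 * a - 1) hf hf).
by congr (Lp _ _ _ _); apply/funext => x; ring.
Qed.

Lemma LpD f g : P f -> P g -> P (fun x => f x + g x).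
Proof. by move=> hf hg; have := Lp_comb 1 hf hg; under eq_fun do rewrite mul1r. Qed.

Lemma LpB f g : P f -> P g -> P (fun x => f x - g x).
Proof. by move=> hf /(LpZ (-1)) hg; have := LpD hf hg; under eq_fun do rewrite mulN1r. Qed.

Lemma Lp0 : P (fun=> 0).
Proof. by apply/LpP; split; [exact: Ig0|exact: aeW]. Qed.

Lemma Lp_abs_le f g : P f -> meas g -> {ae mu, forall x, `|g x| <= `|f x|} -> P g.
Proof.
move=> /LpP[hf f0] mg fg; apply/LpP; split; first exact: (Ig_le mg hf).
apply: filterS2 fg f0 => x h1 h2 Vx; apply/eqP; rewrite -normr_eq0 eq_le normr_ge0 andbT.
by rewrite (le_trans h1)// h2// normr0.
Qed.

Section semigroup.
Variables (S : R -> (T -> R) -> (T -> R)) (hS : C0_semigroup mu V S).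

Lemma sg_P t f : 0 < t -> P f -> P (S t f). Proof. exact: (C0_stable hS). Qed.

Lemma sg_I t f : 0 < t -> P f -> Ig mu (S t f).
Proof. by move=> t0 hf; exact: Lp_Ig (sg_P t0 hf). Qed.

Lemma sg_lin t a f g : 0 < t -> P f -> P g ->
  {ae mu, forall x, S t (fun x => a * f x + g x) x = a * S t f x + S t g x}.
Proof. by move=> t0 hf hg; apply: filterS (C0_linear hS a t0 hf hg) => x; exact. Qed.

Lemma sg_bd t : 0 < t -> exists2 C, 0 <= C & forall f, P f -> nrm (S t f) <= C * nrm f.
Proof.
move=> t0; have [C hC] := C0_bounded hS t0; exists `|C| => // f hf.
have := hC f hf; rewrite (N1E (sg_I t0 hf)) (N1E (Lp_Ig hf)) -EFinM lee_fin => /le_trans; apply.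
by rewrite ler_wpM2r ?ler_norm// nrm_ge0//; exact: Lp_Ig.
Qed.

Lemma sg_ae t f g : 0 < t -> P f -> P g -> {ae mu, forall x, f x = g x} ->
  {ae mu, forall x, S t f x = S t g x}.
Proof.
move=> t0 hf hg fg; have [C C0 hC] := sg_bd t0; have hd := Lp_comb (-1) hf hg.
have z : nrm (S t (fun x => -1 * f x + g x)) <= 0.
  rewrite (le_trans (hC _ hd))// (nrm_ae (g := fun=> 0) (Lp_Ig hd) (Ig0 mu)).
    by rewrite nrm0 mulr0.
  by apply: filterS fg => x ->; ring.
apply: filterS2 (nrm_eq0 (sg_I t0 hd) z) (sg_lin (-1) t0 hf hg) => x -> /esym/eqP.
by rewrite mulN1r addrC subr_eq0 => /eqP.
Qed.

Lemma sg_add s t f : 0 < s -> 0 < t -> P f ->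
  {ae mu, forall x, S (s + t) f x = S s (S t f) x}.
Proof. by move=> s0 t0 hf; apply: filterS (C0_semigroupD hS s0 t0 hf) => x; exact. Qed.

Lemma sg_cont f : P f -> forall e : R, 0 < e -> exists2 del : R, 0 < del &
  forall t, 0 < t < del -> nrm (fun x => S t f x - f x) <= e.
Proof.
move=> hf e e0; have /right0P := C0_continuous hS hf.
move=> /(_ (fun t => Lnorm_ge0 _ _ _)) /(_ e e0)[r r0 hr]; exists r => // t tr.
have t0 : 0 < t by case/andP: tr.
by have := hr t tr; rewrite N1E ?lee_fin//; exact: (IgB (sg_I t0 hf) (Lp_Ig hf)).
Qed.

Lemma sg_genP u w : sg_generator mu V S u w <-> [/\ P u, P w &
  forall e : R, 0 < e -> exists2 del : R, 0 < del &
  forall t, 0 < t < del -> nrm (fun x => S t u x - u x - t * w x) <= t * e].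
Proof.
have E t (pu : P u) (pw : P w) : 0 < t ->
    'N[mu]_1[EFin \o (fun x => t^-1 * (S t u x - u x) - w x)%R]%E =
    (t^-1 * nrm (fun x => S t u x - u x - t * w x))%:E.
  move=> t0; have i1 := sg_I t0 pu; have i2 := Lp_Ig pu; have i3 := Lp_Ig pw.
  rewrite N1E; last exact: (IgB (IgZ t^-1 (IgB i1 i2)) i3).
  rewrite -[in RHS](@gtr0_norm _ t^-1) ?invr_gt0// -nrmZ; last exact: (IgB (IgB i1 i2) (IgZ t i3)).
  by congr EFin; apply: eq_Rintegral => x _; congr `|_|; field; rewrite gt_eqF.
split=> [[pu pw /right0P h]|[pu pw h]]; split=> //.
  move=> e e0; have [r r0 hr] := h (fun t => Lnorm_ge0 _ _ _) e e0.
  exists r => // t tr; have t0 : 0 < t by case/andP: tr.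
  by have := hr t tr; rewrite E// lee_fin ler_pdivrMl.
apply/(right0P (fun t => Lnorm_ge0 _ _ _)) => e e0; have [r r0 hr] := h e e0.
exists r => // t tr; have t0 : 0 < t by case/andP: tr.
by rewrite E// lee_fin ler_pdivrMl//; exact: hr.
Qed.

Lemma sg_gen_ext u w u' w' : sg_generator mu V S u w -> P u' -> P w' ->
  {ae mu, forall x, u x = u' x} -> {ae mu, forall x, w x = w' x} -> sg_generator mu V S u' w'.
Proof.
move=> /sg_genP[pu pw h] pu' pw' uu ww; apply/sg_genP; split=> // e e0.
have [r r0 hr] := h e e0; exists r => // t tr; have t0 : 0 < t by case/andP: tr.
rewrite -(nrm_ae (f := fun x => S t u x - u x - t * w x)); first exact: hr.
- by apply: IgB; [exact: (IgB (sg_I t0 pu) (Lp_Ig pu))|exact: (IgZ t (Lp_Ig pw))].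
- by apply: IgB; [exact: (IgB (sg_I t0 pu') (Lp_Ig pu'))|exact: (IgZ t (Lp_Ig pw'))].
- by apply: filterS2 (filterI uu ww) (sg_ae t0 pu pu' uu) => x [-> ->] ->.
Qed.

Lemma sg_gen_comb a u w v z : sg_generator mu V S u w -> sg_generator mu V S v z ->
  sg_generator mu V S (fun x => a * u x + v x) (fun x => a * w x + z x).
Proof.
move=> /sg_genP[pu pw h] /sg_genP[pv pz k]; apply/sg_genP.
split; [exact: Lp_comb|exact: Lp_comb|move=> e e0].
have e1 : 0 < e / (2 * (`|a| + 1)) by rewrite divr_gt0// mulr_gt0// ltr_wpDl.
have e2 : 0 < e / 2 by rewrite divr_gt0.
have [r r0 hr] := h _ e1; have [s s0 hs] := k _ e2.
exists (Num.min r s) => [|t /andP[t0]]; first by rewrite lt_min r0.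
rewrite lt_min => /andP[tr ts].
have d1 := hr t (introT andP (conj t0 tr)); have d2 := hs t (introT andP (conj t0 ts)).
have I1 : Ig mu (fun x => S t u x - u x - t * w x).
  by apply: IgB; [exact: (IgB (sg_I t0 pu) (Lp_Ig pu))|exact: (IgZ t (Lp_Ig pw))].
have I2 : Ig mu (fun x => S t v x - v x - t * z x).
  by apply: IgB; [exact: (IgB (sg_I t0 pv) (Lp_Ig pv))|exact: (IgZ t (Lp_Ig pz))].
rewrite (nrm_ae (g := fun x => a * (S t u x - u x - t * w x) + (S t v x - v x - t * z x))).
- rewrite (le_trans (nrmD (IgZ a I1) I2))// nrmZ//.
  have a1 : `|a| * nrm (fun x => S t u x - u x - t * w x) <= t * (e / 2).
    apply: (le_trans (ler_wpM2l (normr_ge0 a) d1)).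
    rewrite mulrCA ler_wpM2l ?(ltW t0)//.
    have a10 : 0 < `|a| + 1 by rewrite ltr_wpDl.
    have -> : `|a| * (e / (2 * (`|a| + 1))) = (e / 2) * (`|a| / (`|a| + 1)) by field; rewrite gt_eqF.
    by rewrite ler_piMr ?(ltW e2)// ler_pdivrMr// mul1r lerDl.
  rewrite (le_trans (lerD a1 d2))// -mulrDr -splitr//.
- by apply: IgB; [apply: IgB; [exact: (sg_I t0 (Lp_comb a pu pv))|exact: (Lp_Ig (Lp_comb a pu pv))]|exact: (IgZ t (Lp_Ig (Lp_comb a pw pz)))].
- exact: (IgD (IgZ a I1) I2).
- by apply: filterS (sg_lin a t0 pu pv) => x ->; ring.
Qed.

Lemma sg_gen_partition u w t e : sg_generator mu V S u w -> 0 < t -> 0 < e -> exists n h,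
  [/\ 0 < h, n.+1%:R * h = t & nrm (fun x => S h u x - u x - h * w x) <= h * e].
Proof.
move=> /sg_genP[_ _ hg] t0 e0; have [del del0 hdel] := hg _ e0.
pose n := Num.bound (t / del); have n0 : (0 : R) < n.+1%:R by rewrite ltr0n.
have h0 : 0 < t / n.+1%:R by rewrite divr_gt0.
exists n, (t / n.+1%:R); split=> //; first by rewrite mulrC divfK// gt_eqF.
apply: hdel; rewrite h0/= ltr_pdivrMr// mulrC -ltr_pdivrMr//.
by apply: (lt_le_trans (archi_boundP _)); [rewrite divr_ge0 ?ltW|rewrite ler_nat].
Qed.

(** A bound near time 0 in place of contractivity, so that the results apply to the competing
    semigroups of [L1_unique]. *)
Variables (M r : R).
Hypotheses (M1 : 1 <= M) (r0 : 0 < r)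
  (hM : forall t f, 0 < t <= r -> P f -> nrm (S t f) <= M * nrm f).

(** Replaces [S t u - u = int_0^t S s w ds] without vector-valued integrals: the increments over a
    partition of mesh [h] are telescoped, each being [h * S s w] up to [S s] applied to the
    first-order remainder [rr]. *)
Lemma sg_gen_taylor u w t e : sg_generator mu V S u w -> 0 < t <= r -> 0 <= e ->
  (forall s, 0 < s <= t -> nrm (fun x => S s w x - w x) <= e) ->
  nrm (fun x => S t u x - u x - t * w x) <= t * e.
Proof.
move=> gen0 /andP[t0 tr] e0 hw; have [pu pw _] := gen0; apply/ler_addgt0Pr => eps eps0.
have M0 : 0 < M by exact: lt_le_trans M1.
have eta0 : 0 < eps / (t * M) by rewrite divr_gt0// mulr_gt0.
have [n [h [h0 tE hr]]] := sg_gen_partition gen0 t0 eta0; set eta := eps / (t * M) in eta0 hr.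
have I0 := Lp_Ig pu; have J0 := Lp_Ig pw.
pose rr x := S h u x - u x - h * w x.
have prr : P rr by apply: LpB; [exact: (LpB (sg_P h0 pu) pu)|exact: LpZ].
have key k : (k <= n)%N ->
   nrm (fun x => S (k.+1%:R * h) u x - u x - k.+1%:R * h * w x) <= k.+1%:R * h * (M * eta + e).
  elim: k => [_|k IH kn].
    rewrite !mul1r (le_trans hr)// ler_wpM2l ?(ltW h0)//.
    by apply: (le_trans (y := M * eta)); [rewrite ler_peMl// ltW|rewrite lerDl].
  have {}IH := IH (ltnW kn).
  have s0 : 0 < k.+1%:R * h by rewrite mulr_gt0// ltr0n.
  have sr : k.+1%:R * h <= t.
    by rewrite -tE ler_pM2r// ler_nat ltnW.
  have kE : k.+2%:R * h = k.+1%:R * h + h by rewrite -[k.+2%:R]natr1 mulrDl mul1r.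
  set s := k.+1%:R * h in IH s0 sr kE; rewrite kE.
  have Is := sg_I s0 pu; have Isw := sg_I s0 pw; have Isr := sg_I s0 prr.
  rewrite (nrm_ae (g := fun x => (S s u x - u x - s * w x) + (S s rr x + h * (S s w x - w x)))).
  - rewrite (le_trans (nrmD (IgB (IgB Is I0) (IgZ s J0)) (IgD Isr (IgZ h (IgB Isw J0)))))//.
    rewrite [leRHS]mulrDl lerD// (le_trans (nrmD Isr (IgZ h (IgB Isw J0))))//.
    rewrite nrmZ; last exact: IgB.
    rewrite (gtr0_norm h0) mulrDr lerD//; last by rewrite ler_wpM2l ?(ltW h0)// hw// s0.
    rewrite (le_trans (hM _ prr))//; first by rewrite s0 (le_trans sr).
    by rewrite mulrCA ler_wpM2l// ltW.
  - have sh0 : 0 < s + h by rewrite addr_gt0.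
    by apply: IgB; [exact: (IgB (sg_I sh0 pu) I0)|exact: (IgZ (s + h) J0)].
  - exact: (IgD (IgB (IgB Is I0) (IgZ s J0)) (IgD Isr (IgZ h (IgB Isw J0)))).
  - have pc : P (fun x => h * w x + u x) by exact: Lp_comb.
    have e1 : {ae mu, forall x, S s (S h u) x = S s (fun x => 1 * rr x + (h * w x + u x)) x}.
      apply: sg_ae => //; [exact: sg_P|exact: (Lp_comb 1 prr pc)|].
      by apply: aeW => x; rewrite /rr; ring.
    have e2 := sg_lin 1 s0 prr pc; have e3 := sg_lin h s0 pw pu.
    have e4 := sg_add s0 h0 pu.
    by apply: filterS2 (filterI e1 e2) (filterI e3 e4) => x [k1 k2] [k3 k4]; rewrite k4 k1 k2 k3; ring.
have := key n (leqnn _); rewrite tE => /le_trans; apply.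
rewrite mulrDr addrC lerD2l /eta; apply: eq_lerW; field.
by rewrite !gt_eqF.
Qed.

(** The Taylor estimate uses the continuity of [S] at the limit [w] only, transferred to [w_ n] by
    the bound [M]; it is thus uniform along the sequence and passes to the limit. *)
Lemma sg_gen_closed (u_ w_ : nat -> T -> R) u w :
  (forall n, sg_generator mu V S (u_ n) (w_ n)) -> P u -> P w ->
  Cv0 mu (fun n x => u_ n x - u x) -> Cv0 mu (fun n x => w_ n x - w x) ->
  sg_generator mu V S u w.
Proof.
move=> hg pu pw cu cw; apply/sg_genP; split=> // e e0.
have [del del0 hdel] := sg_cont pw e0.
exists (Num.min del r) => [|t /andP[t0]]; first by rewrite lt_min del0.
rewrite lt_min => /andP[td tr].
have M0 : 0 < M by exact: lt_le_trans M1.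
have pun n : P (u_ n) by case: (hg n). have pwn n : P (w_ n) by case: (hg n).
have Iu := Lp_Ig pu; have Iw := Lp_Ig pw; have Iun n := Lp_Ig (pun n); have Iwn n := Lp_Ig (pwn n).
have Su := sg_I t0 pu; have Sun n := sg_I t0 (pun n).
have dS s v v' : 0 < s <= r -> P v -> P v' ->
    nrm (fun x => S s v x - S s v' x) <= M * nrm (fun x => v x - v' x).
  move=> sr pv pv'; have s0 : 0 < s by case/andP: sr.
  rewrite (nrm_ae (g := S s (fun x => -1 * v' x + v x))).
  - rewrite (le_trans (hM sr (Lp_comb (-1) pv' pv)))//; apply: eq_lerW.
    by congr (_ * _); apply: eq_Rintegral => x _; congr `|_|; ring.
  - exact: (IgB (sg_I s0 pv) (sg_I s0 pv')).
  - exact: (sg_I s0 (Lp_comb (-1) pv' pv)).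
  - by apply: filterS (sg_lin (-1) s0 pv' pv) => x ->; ring.
apply/ler_addgt0Pr => eps eps0.
pose K := M + 1 + t * (M + 1) + t + 1.
have K0 : 0 < K by rewrite /K; nra.
have eK : 0 < eps / K by rewrite divr_gt0.
have /(Cv0_nrm (fun n => IgB (Iun n) Iu)) /(_ _ eK) [N1 h1] := cu.
have /(Cv0_nrm (fun n => IgB (Iwn n) Iw)) /(_ _ eK) [N2 h2] := cw.
pose n := maxn N1 N2; have a1 := h1 n (leq_maxl _ _); have a2 := h2 n (leq_maxr _ _).
set eta := eps / K in a1 a2 eK.
have tay : nrm (fun x => S t (u_ n) x - u_ n x - t * w_ n x) <= t * (e + (M + 1) * eta).
  apply: (sg_gen_taylor (hg n)); [by rewrite t0 ltW|by nra|move=> s /andP[s0 st]].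
  have sr : 0 < s <= r by rewrite s0 (le_trans st)// ltW.
  have Ss := sg_I s0 (pwn n); have Ss' := sg_I s0 pw.
  apply: (le_trans (nrm_tri Ss Ss' (Iwn n))).
  have b1 := dS s _ _ sr (pwn n) pw.
  have b2 := nrm_tri Ss' Iw (Iwn n); rewrite (nrm_distC mu w) in b2.
  have b3 := hdel s (introT andP (conj s0 (le_lt_trans st td))).
  have b4 : M * nrm (fun x => w_ n x - w x) <= M * eta by rewrite ler_wpM2l// ltW.
  by move: b1 b2 b3 b4 a2; lra.
have c1 := dS t _ _ (introT andP (conj t0 (ltW tr))) pu (pun n).
rewrite (nrm_distC mu u) in c1.
have E : nrm (fun x => S t u x - u x - t * w x) = nrm (fun x => (S t u x - S t (u_ n) x) +
   ((S t (u_ n) x - u_ n x - t * w_ n x) + ((u_ n x - u x) + t * (w_ n x - w x)))).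
  by apply: eq_Rintegral => x _; congr `|_|; ring.
have J1 := IgB Su (Sun n); have J2 := IgB (IgB (Sun n) (Iun n)) (IgZ t (Iwn n)).
have J3 := IgB (Iun n) Iu; have J4 := IgZ t (IgB (Iwn n) Iw).
rewrite E (le_trans (nrmD J1 (IgD J2 (IgD J3 J4))))//.
have d1 := nrmD J2 (IgD J3 J4); have d2 := nrmD J3 J4.
rewrite (nrmZ t (IgB (Iwn n) Iw)) (gtr0_norm t0) in d2.
have d3 : t * nrm (fun x => w_ n x - w x) <= t * eta by rewrite ler_wpM2l// ltW.
have d4 : M * nrm (fun x => u_ n x - u x) <= M * eta by rewrite ler_wpM2l// ltW.
have KE : eps = (M + 1 + t * (M + 1) + t + 1) * eta by rewrite /eta mulrC divfK// gt_eqF.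
by rewrite KE; move: c1 d1 d2 d3 d4 a1 tay eK; lra.
Qed.

(** An eigenvector for [lam] grows like [exp (lam s)], in discrete form [(1 + lam h) ^+ k], which by
    Bernoulli's inequality is at least [1 + lam r] at time [r]; the bound [M] up to time [r]
    excludes this once [lam r > 2 M]. *)
Lemma sg_gen_injective u lam : 2 * M < lam * r -> sg_generator mu V S u (fun x => lam * u x) ->
  {ae mu, forall x, u x = 0}.
Proof.
move=> lr gen0; have [pu pw _] := gen0; have Iu := Lp_Ig pu; apply: nrm_eq0 => //.
rewrite leNgt; apply/negP => u0.
have M0 : 0 < M by exact: lt_le_trans M1.
have lam0 : 0 < lam by rewrite -(pmulr_lgt0 _ r0) (lt_trans _ lr)// mulr_gt0.
(* Chosen such that the accumulated error is half of [(a ^+ n.+1 - 1) * nrm u]. *)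
pose e := lam * nrm u / (2 * M).
have e0 : 0 < e by rewrite divr_gt0// mulr_gt0.
have [n [h [h0 tE hr]]] := sg_gen_partition gen0 r0 e0.
pose a := 1 + lam * h; pose rr x := S h u x - u x - h * (lam * u x).
have prr : P rr by apply: LpB; [exact: (LpB (sg_P h0 pu) pu)|exact: LpZ].
have a1 : 1 <= a by rewrite lerDl mulr_ge0// ltW.
have key k : (k <= n)%N ->
    nrm (fun x => S (k.+1%:R * h) u x - a ^+ k.+1 * u x) <= (a ^+ k.+1 - 1) / lam * (M * e).
  elim: k => [_|k IH kn].
    rewrite mul1r expr1 (_ : nrm _ = nrm rr); last first.
      by apply: eq_Rintegral => x _; congr `|_|; rewrite /rr /a; ring.
    apply: (le_trans hr).
    have -> : (a - 1) / lam * (M * e) = h * (M * e) by rewrite /a; field; rewrite gt_eqF.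
    by rewrite ler_wpM2l ?(ltW h0)// ler_peMl// ltW.
  have {}IH := IH (ltnW kn).
  have s0 : 0 < k.+1%:R * h by rewrite mulr_gt0// ltr0n.
  have sr : k.+1%:R * h <= r.
    by rewrite -tE ler_pM2r// ler_nat ltnW.
  have kE : k.+2%:R * h = k.+1%:R * h + h by rewrite -[k.+2%:R]natr1 mulrDl mul1r.
  set s := k.+1%:R * h in IH s0 sr kE; rewrite kE.
  have Is := sg_I s0 pu; have Isr := sg_I s0 prr.
  rewrite (nrm_ae (g := fun x => a * (S s u x - a ^+ k.+1 * u x) + S s rr x)).
  - rewrite (le_trans (nrmD (IgZ a (IgB Is (IgZ _ Iu))) Isr))// nrmZ; last exact: (IgB Is (IgZ _ Iu)).
    have b1 := hM (introT andP (conj s0 sr)) prr.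
    have b2 : M * nrm rr <= M * (h * e) by rewrite ler_wpM2l// ltW.
    have b3 : `|a| * nrm (fun x => S s u x - a ^+ k.+1 * u x) <= a * ((a ^+ k.+1 - 1) / lam * (M * e)).
      by rewrite ger0_norm ?(le_trans ler01)// ler_wpM2l ?(le_trans ler01).
    rewrite (le_trans (lerD b3 (le_trans b1 b2)))//; apply: eq_lerW.
    by rewrite [a ^+ k.+2]exprS /a; field; rewrite gt_eqF.
  - have sh0 : 0 < s + h by rewrite addr_gt0.
    exact: (IgB (sg_I sh0 pu) (IgZ _ Iu)).
  - exact: (IgD (IgZ a (IgB Is (IgZ _ Iu))) Isr).
  - have e1 : {ae mu, forall x, S s (S h u) x = S s (fun x => a * u x + rr x) x}.
      apply: sg_ae => //; [exact: sg_P|exact: Lp_comb|].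
      by apply: aeW => x; rewrite /rr /a; ring.
    have e2 := sg_lin a s0 pu prr; have e4 := sg_add s0 h0 pu.
    by apply: filterS2 (filterI e1 e2) e4 => x [k1 k2] k4; rewrite k4 k1 k2 [a ^+ k.+2]exprS; ring.
have := key n (leqnn _); rewrite tE => hk.
have bern m : 1 + m%:R * (lam * h) <= a ^+ m.
  elim: m => [|m IH]; first by rewrite mul0r addr0 expr0.
  rewrite exprS -natr1; have m0 : (0 : R) <= m%:R by [].
  apply: (le_trans _ (ler_wpM2l (le_trans ler01 a1) IH)); rewrite /a.
  by have := mulr_ge0 (ltW lam0) (ltW h0); set q := lam * h => q0; nra.
have := bern n.+1; rewrite mulrCA tE => an.
have rr' : 0 < r <= r by rewrite r0 lexx.
have Sr := sg_I r0 pu; have b1 := hM rr' pu.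
have an0 : 0 <= a ^+ n.+1 by rewrite exprn_ge0// (le_trans ler01).
have tri : a ^+ n.+1 * nrm u <= nrm (S r u) + nrm (fun x => S r u x - a ^+ n.+1 * u x).
  rewrite -[X in X * _ <= _](ger0_norm an0) -nrmZ//.
  have := nrmB Sr (IgB Sr (IgZ (a ^+ n.+1) Iu)).
  rewrite (_ : nrm (fun x => S r u x - (S r u x - a ^+ n.+1 * u x)) = nrm (fun x => a ^+ n.+1 * u x))//.
  by apply: eq_Rintegral => x _; congr `|_|; ring.
have eE : (a ^+ n.+1 - 1) / lam * (M * e) = (a ^+ n.+1 - 1) * nrm u / 2.
  by rewrite /e; field; rewrite !gt_eqF.
rewrite eE in hk; have : (a ^+ n.+1 + 1) * nrm u <= 2 * M * nrm u by move: tri hk b1; lra.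
rewrite ler_pM2r// => h2; move: an h2 lr; lra.
Qed.

End semigroup.
End semigroup_basics.

Definition l1_norm (R : realType) (d : nat) (mu : {measure set 'rV[R]_d -> \bar R})
  (f : 'rV[R]_d -> R) : R := nrm mu f.

(* [lra] would otherwise try to unify the integrals; [l1_norm] makes the types of the
   binders syntactically equal. *)
Ltac nrm_lra d :=
  repeat match goal with H : is_true ?P |- _ =>
    match P with context [@nrm _ _ _ _ _] => clear H end end;
  repeat match goal with |- context [@nrm ?R ?e ?X ?m ?f] =>
    let f' := eval cbv beta in (fun x : 'rV[R]_d => f x) in
    change (@nrm R e X m f) with (@l1_norm R d m f') end;
  repeat match goal with |- context [@l1_norm ?R ?d ?m ?f] =>
    generalize (@l1_norm R d m f); intro end.

(** * Dissipative operators and the implicit Euler scheme *)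

Section dissipative.
Context {R : realType} {d : nat} (mu : {measure set 'rV[R]_d -> \bar R}).
Local Notation T := 'rV[R]_d.
Local Notation nrm := (nrm mu).
Local Notation Ig := (Ig mu).
Implicit Types (u v f g w z : T -> R).

Lemma Cv0_cst f : Cv0 mu (fun=> f) -> {ae mu, forall x, f x = 0}.
Proof.
move=> h; have [/(_ 0%N) mf _] := h; have fI : Ig f.
  by have [N hN] := Cv0_small h ltr01; have [] := hN N (leqnn _).
apply: nrm_eq0 => //; apply/ler_addgt0Pr => e e0; rewrite add0r.
by have /(Cv0_nrm (fun=> fI)) /(_ e e0) [N /(_ N (leqnn _))] := h.
Qed.

Lemma nrm_subrr f : nrm (fun x => f x - f x) = 0.
Proof. by under eq_fun do rewrite subrr; exact: nrm0. Qed.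

Lemma LpT f : Lp mu 1 setT f <-> Ig f.
Proof. by split=> [/LpP[]//|h]; apply/LpP; split=> //; apply: aeW => x []. Qed.

Variable op : (T -> R) -> (T -> R) -> Prop.
Hypotheses (opI : forall u w, op u w -> Ig u /\ Ig w)
  (op_ext : forall u w u' w', op u w -> Ig u' -> Ig w' ->
     {ae mu, forall x, u x = u' x} -> {ae mu, forall x, w x = w' x} -> op u' w')
  (op_comb : forall a u w v z, op u w -> op v z ->
     op (fun x => a * u x + v x) (fun x => a * w x + z x))
  (op_diss : forall u w h, op u w -> 0 < h -> nrm u <= nrm (fun x => u x - h * w x))
  (op_surj : forall f h, Ig f -> 0 < h ->
     exists u w, op u w /\ {ae mu, forall x, f x = u x - h * w x})
  (op_dense : forall f e, Ig f -> 0 < e -> exists u w, op u w /\ nrm (fun x => f x - u x) <= e).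

(** The resolvent [(1 - h op)^-1], with a representative picked by [xget]; dissipativity makes it
    unique almost everywhere and a contraction. *)
Definition implicit_euler h f : T -> R :=
  xget (fun=> 0) [set u | exists w, op u w /\ {ae mu, forall x, f x = u x - h * w x}].
Local Notation J := implicit_euler.

Lemma J_op h f : Ig f -> 0 < h -> exists w, op (J h f) w /\ {ae mu, forall x, f x = J h f x - h * w x}.
Proof.
move=> hf h0; have [u [w uw]] := op_surj hf h0.
by have := @xgetPex _ (fun=> 0) [set u | exists w, op u w /\ {ae mu, forall x, f x = u x - h * w x}]; apply; exists u, w.
Qed.

Lemma J_I h f : Ig f -> 0 < h -> Ig (J h f).
Proof. by move=> hf h0; have [w [/opI[]]] := J_op hf h0. Qed.

Lemma J_uniq h f u w : 0 < h -> Ig f -> op u w -> {ae mu, forall x, f x = u x - h * w x} ->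
  {ae mu, forall x, J h f x = u x}.
Proof.
move=> h0 hf uw fE; have [w' [Jw JE]] := J_op hf h0.
have p := op_comb (-1) uw Jw; have [I1 I2] := opI p.
have : nrm (fun x => -1 * u x + J h f x) <= 0.
  rewrite (le_trans (op_diss p h0))// (nrm_ae (g := fun=> 0)) ?nrm0//; last first.
  - by apply: filterS2 fE JE => x ->; lra.
  - exact: Ig0.
  - exact: (IgB I1 (IgZ h I2)).
by move/(nrm_eq0 I1); apply: filterS => x /eqP; rewrite mulN1r addrC subr_eq0 => /eqP.
Qed.

Lemma J_lin h a f g : 0 < h -> Ig f -> Ig g ->
  {ae mu, forall x, J h (fun x => a * f x + g x) x = a * J h f x + J h g x}.
Proof.
move=> h0 hf hg; have [w [p1 e1]] := J_op hf h0; have [z [p2 e2]] := J_op hg h0.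
apply: (J_uniq h0 (IgD (IgZ a hf) hg) (op_comb a p1 p2)).
by apply: filterS2 e1 e2 => x -> ->; ring.
Qed.

Lemma J_nrm h f : 0 < h -> Ig f -> nrm (J h f) <= nrm f.
Proof.
move=> h0 hf; have [w [p e]] := J_op hf h0; have [I1 I2] := opI p.
rewrite (le_trans (op_diss p h0))// (nrm_ae (g := f))//; first exact: (IgB I1 (IgZ h I2)).
by apply: filterS e => x ->.
Qed.

Lemma J_dist h f g : 0 < h -> Ig f -> Ig g ->
  nrm (fun x => J h f x - J h g x) <= nrm (fun x => f x - g x).
Proof.
move=> h0 hf hg; have I := IgD (IgZ (-1) hg) hf.
rewrite (nrm_ae (g := J h (fun x => -1 * g x + f x))).
- rewrite (le_trans (J_nrm h0 I))//; apply: eq_lerW.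
  by apply: eq_Rintegral => x _; congr `|_|; ring.
- exact: (IgB (J_I hf h0) (J_I hg h0)).
- exact: J_I.
- by apply: filterS (J_lin (-1) h0 hg hf) => x ->; ring.
Qed.

Lemma J_ae h f g : 0 < h -> Ig f -> Ig g -> {ae mu, forall x, f x = g x} ->
  {ae mu, forall x, J h f x = J h g x}.
Proof.
move=> h0 hf hg fg; have [w [p e]] := J_op hg h0.
by apply: (J_uniq h0 hf p); apply: filterS2 fg e => x ->.
Qed.

Lemma J_opE h u w : 0 < h -> op u w -> {ae mu, forall x, J h u x = u x + h * J h w x}.
Proof.
move=> h0 uw; have [I1 I2] := opI uw; have [z [p e]] := J_op I2 h0.
have := op_comb h p uw => o'; have := J_uniq h0 I1 o'.
have E : {ae mu, forall x, u x = h * J h w x + u x - h * (h * z x + w x)}.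
  by apply: filterS e => x ->; ring.
by move=> /(_ E); apply: filterS => x ->; rewrite addrC.
Qed.

Lemma J_opJ h u w : 0 < h -> op u w -> op (J h u) (J h w).
Proof.
move=> h0 uw; have [I1 I2] := opI uw; have [z [p e]] := J_op I2 h0.
have JI := J_I I1 h0; have JI2 := J_I I2 h0.
apply: (op_ext (op_comb h p uw)) => //.
  by apply: filterS (J_opE h0 uw) => x ->; rewrite addrC.
by apply: filterS e => x ->; ring.
Qed.

Lemma J_step h u w : 0 < h -> op u w -> nrm (fun x => J h u x - u x) <= h * nrm w.
Proof.
move=> h0 uw; have [I1 I2] := opI uw; have JI := J_I I1 h0; have JI2 := J_I I2 h0.
rewrite (nrm_ae (g := fun x => h * J h w x)).
- by rewrite nrmZ// gtr0_norm// ler_wpM2l ?(ltW h0)// J_nrm.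
- exact: IgB.
- exact: IgZ.
- by apply: filterS (J_opE h0 uw) => x ->; ring.
Qed.

(* With p = J_h^2 u one has (1 - 2hA)p = u - h^2 A^2 p. *)
Lemma J_halve h u w z : 0 < h -> op u w -> op w z ->
  nrm (fun x => J h (J h u) x - J (h + h) u x) <= h ^+ 2 * nrm z.
Proof.
move=> h0 uw wz; have h2 : 0 < h + h by rewrite addr_gt0.
have [I1 I2] := opI uw; have [_ I3] := opI wz.
have K1 := J_I I1 h0; have K2 := J_I I2 h0; have K3 := J_I I3 h0.
have L1 := J_I K1 h0; have L2 := J_I K2 h0; have L3 := J_I K3 h0.
have e1 := J_opE h0 (J_opJ h0 uw); have e2 := J_opE h0 uw.
have e3 := J_opE h0 (J_opJ h0 wz); have e4 := J_opE h0 wz.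
have I4 := IgD (IgZ (- h ^+ 2) L3) I1.
have E : {ae mu, forall x, J (h + h) (fun x => - h ^+ 2 * J h (J h z) x + u x) x = J h (J h u) x}.
  apply: (J_uniq h2 I4 (J_opJ h0 (J_opJ h0 uw))).
  by apply: filterS2 (filterI e1 e2) (filterI e3 e4) => x [-> ->] [-> ->]; ring.
rewrite (nrm_ae (g := fun x => J (h + h) (fun x => - h ^+ 2 * J h (J h z) x + u x) x - J (h + h) u x)).
- rewrite (le_trans (J_dist h2 I4 I1))//.
  have -> : nrm (fun x => - h ^+ 2 * J h (J h z) x + u x - u x) = nrm (fun x => - h ^+ 2 * J h (J h z) x).
    by apply: eq_Rintegral => x _; congr `|_|; ring.
  rewrite nrmZ// normrN ger0_norm ?sqr_ge0// ler_wpM2l ?sqr_ge0//.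
  by rewrite (le_trans (J_nrm h0 K3))// J_nrm.
- by apply: IgB => //; exact: J_I.
- by apply: IgB; apply: J_I.
- by apply: filterS E => x ->.
Qed.

Lemma iterJ_I h n f : 0 < h -> Ig f -> Ig (iter n (J h) f).
Proof. by move=> h0 hf; elim: n => //= n IH; exact: J_I. Qed.

Lemma iterJ_nrm h n f : 0 < h -> Ig f -> nrm (iter n (J h) f) <= nrm f.
Proof.
by move=> h0 hf; elim: n => //= n IH; rewrite (le_trans (J_nrm h0 (iterJ_I n h0 hf))).
Qed.

Lemma iterJ_dist h n f g : 0 < h -> Ig f -> Ig g ->
  nrm (fun x => iter n (J h) f x - iter n (J h) g x) <= nrm (fun x => f x - g x).
Proof.
move=> h0 hf hg; elim: n => //= n IH.
by rewrite (le_trans (J_dist h0 (iterJ_I n h0 hf) (iterJ_I n h0 hg))).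
Qed.

Lemma iterJ_op h n u w : 0 < h -> op u w -> op (iter n (J h) u) (iter n (J h) w).
Proof. by move=> h0 uw; elim: n => //= n IH; exact: J_opJ. Qed.

Lemma iterJ_lin h n a f g : 0 < h -> Ig f -> Ig g ->
  {ae mu, forall x, iter n (J h) (fun x => a * f x + g x) x = a * iter n (J h) f x + iter n (J h) g x}.
Proof.
move=> h0 hf hg; elim: n => [|n IH] /=; first by apply: aeW.
have I1 := iterJ_I n h0 hf; have I2 := iterJ_I n h0 hg.
have I3 := iterJ_I n h0 (IgD (IgZ a hf) hg).
have e1 := J_ae h0 I3 (IgD (IgZ a I1) I2) IH.
by apply: filterS2 e1 (J_lin a h0 I1 I2) => x -> ->.
Qed.

Lemma iterJ_step h n u w : 0 < h -> op u w ->
  nrm (fun x => iter n (J h) u x - u x) <= n%:R * h * nrm w.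
Proof.
move=> h0 uw; have [I1 I2] := opI uw; elim: n => [|n IH] /=.
  by rewrite !mul0r nrm_subrr.
have In := iterJ_I n h0 I1; have Jn := J_I In h0.
apply: (le_trans (nrm_tri Jn In I1)); rewrite -natr1 !mulrDl mul1r addrC lerD//.
rewrite (le_trans (J_step h0 (iterJ_op n h0 uw)))// ler_wpM2l ?(ltW h0)//.
exact: iterJ_nrm.
Qed.

Lemma iterJ_halve h n u w z : 0 < h -> op u w -> op w z ->
  nrm (fun x => iter n.*2 (J h) u x - iter n (J (h + h)) u x) <= n%:R * h ^+ 2 * nrm z.
Proof.
move=> h0 uw wz; have [I1 I2] := opI uw; have h2 : 0 < h + h by rewrite addr_gt0.
have [_ I3] := opI wz.
elim: n => [|n IH].
  by rewrite !mul0r nrm_subrr.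
rewrite doubleS /=.
have A1 := iterJ_I n.*2 h0 I1; have A2 := iterJ_I n h2 I1.
have B1 := J_I (J_I A1 h0) h0; have B2 := J_I (J_I A2 h0) h0; have B3 := J_I A2 h2.
apply: (le_trans (nrm_tri B1 B2 B3)); rewrite -natr1 !mulrDl mul1r lerD//.
  by rewrite (le_trans (J_dist h0 (J_I A1 h0) (J_I A2 h0)))// (le_trans (J_dist h0 A1 A2)).
rewrite (le_trans (J_halve h0 (iterJ_op n h2 uw) (iterJ_op n h2 wz)))// ler_wpM2l ?sqr_ge0//.
exact: iterJ_nrm.
Qed.

(** [w] may lie outside the domain, where there is no rate for the motion of the iterates. The
    comparison with [w'] from the domain costs [2 * nrm (w - w')], and [w'] itself moves by at most
    [n h * nrm z]. *)
Lemma iterJ_taylor h n u w w' z : 0 < h -> op u w -> op w' z ->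
  nrm (fun x => iter n (J h) u x - u x - n%:R * h * w x)
  <= n%:R * h * (2 * nrm (fun x => w x - w' x) + n%:R * h * nrm z).
Proof.
move=> h0 uw wz; have [I1 I2] := opI uw; have [I3 I4] := opI wz.
have key m : (m <= n)%N -> nrm (fun x => iter m (J h) u x - u x - m%:R * h * w x)
    <= m%:R * h * (2 * nrm (fun x => w x - w' x) + n%:R * h * nrm z).
  elim: m => [|m IH mn].
    by under eq_fun do rewrite !mul0r subr0; rewrite nrm_subrr !mul0r.
  have {}IH := IH (ltnW mn).
  have A1 := iterJ_I m h0 I1; have A2 := iterJ_I m h0 I2; have B1 := J_I A1 h0; have B2 := J_I A2 h0.
  have A3 := iterJ_I m.+1 h0 I3.
  have IT := IgB (IgB A1 I1) (IgZ (m%:R * h) I2).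
  rewrite (nrm_ae (g := fun x => (iter m (J h) u x - u x - m%:R * h * w x)
     + h * (iter m.+1 (J h) w x - w x))).
  - apply: (le_trans (nrmD IT (IgZ h (IgB B2 I2)))).
    rewrite -natr1 [in leRHS]mulrDl [in leRHS]mulrDl mul1r lerD//.
    rewrite (nrmZ h (IgB B2 I2)) gtr0_norm// ler_wpM2l ?(ltW h0)//.
    have t1 := nrm_tri B2 A3 I2; have t2 := nrm_tri A3 I3 I2.
    have t3 := iterJ_dist m.+1 h0 I2 I3; have t4 := iterJ_step m.+1 h0 wz.
    rewrite (nrm_distC mu w' w) in t2.
    have t5 : m.+1%:R * h * nrm z <= n%:R * h * nrm z.
      by rewrite ler_wpM2r ?nrm_ge0// ler_wpM2r ?(ltW h0)// ler_nat.
    move: t1 t2 t3 t4 t5 => /=; lra.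
  - exact: (IgB (IgB B1 I1) (IgZ (m.+1%:R * h) I2)).
  - exact: (IgD IT (IgZ h (IgB B2 I2))).
  - by apply: filterS (J_opE h0 (iterJ_op m h0 uw)) => x /= ->; rewrite -natr1; ring.
exact: key.
Qed.

(** The second-order error estimates need the domain of the square; [J h] maps the domain into it
    and is close to the identity for small [h]. *)
Lemma op2_dense f e : Ig f -> 0 < e ->
  exists u w z, [/\ op u w, op w z & nrm (fun x => f x - u x) <= e].
Proof.
move=> hf e0; have e2 : 0 < e / 2 by rewrite divr_gt0.
have [u [w [uw fu]]] := op_dense hf e2; have [I1 I2] := opI uw.
pose h := e / (2 * (nrm w + 1)); have w0 := nrm_ge0 I2.
have h0 : 0 < h by rewrite divr_gt0// mulr_gt0// ltr_wpDl.
have [z [wz _]] := J_op I2 h0.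
exists (J h u), (J h w), z; split=> //; first exact: J_opJ.
have JI := J_I I1 h0; apply: (le_trans (nrm_tri hf I1 JI)); rewrite [leRHS]splitr lerD//.
rewrite (nrm_distC mu u) (le_trans (J_step h0 uw))//.
have -> : h * nrm w = (e / 2) * (nrm w / (nrm w + 1)) by rewrite /h; field; rewrite gt_eqF ?ltr_wpDl.
by rewrite ler_piMr ?(ltW e2)// ler_pdivrMr ?ltr_wpDl// mul1r lerDl.
Qed.

(** Dyadic steps, so that level [k.+1] halves the steps of level [k] and [J_halve] compares
    consecutive levels. The count is rounded down, which costs at most one extra step under doubling
    ([nstepsS]) and addition ([nstepsD]). *)
Definition nsteps k (t : R) := Num.truncn (t * 2 ^+ k).
Definition dyadic k : R := (2 ^+ k)^-1.
Local Notation h_ := dyadic.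
Local Notation E k t f := (iter (nsteps k t) (J (h_ k)) f).

Lemma h_gt0 k : 0 < h_ k. Proof. by rewrite /dyadic invr_gt0 exprn_gt0. Qed.
Hint Resolve h_gt0 : core.

Lemma nsteps_itv k t : 0 <= t -> (nsteps k t)%:R * h_ k <= t < (nsteps k t)%:R * h_ k + h_ k.
Proof.
move=> t0; have p0 : (0 : R) < 2 ^+ k by rewrite exprn_gt0.
have /andP[a b] := truncn_itv (mulr_ge0 t0 (ltW p0)).
rewrite /dyadic ler_pdivrMr// a/= -[X in _ + X]mul1r -mulrDl ltr_pdivlMr//.
by rewrite -[1]/(1%:R) -natrD addn1.
Qed.

Lemma nsteps_unique k t n : n%:R * h_ k <= t < n%:R * h_ k + h_ k -> nsteps k t = n.
Proof.
have p0 : (0 : R) < 2 ^+ k by rewrite exprn_gt0.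
move=> /andP[a b]; apply: truncn_def; rewrite -ler_pdivrMr// a/=.
by rewrite -ltr_pdivlMr// -natr1 mulrDl mul1r.
Qed.

Lemma h_S k : h_ k = h_ k.+1 + h_ k.+1.
Proof. by rewrite /dyadic exprS; field; rewrite expf_neq0. Qed.

Lemma nstepsS k t : 0 <= t -> exists b : bool, nsteps k.+1 t = (b + (nsteps k t).*2)%N.
Proof.
move=> t0; have /andP[a b] := nsteps_itv k t0; rewrite h_S in a b.
set h := h_ k.+1 in a b; set n := (nsteps k t) in a b *.
have nE : n.*2%:R = n%:R + n%:R :> R by rewrite -addnn natrD.
have [c|c] := ltP t (n.*2%:R * h + h).
  exists false; rewrite add0n; apply: nsteps_unique; rewrite c andbT nE; apply: (le_trans _ a).
  by rewrite mulrDr mulrDl.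
exists true; apply: nsteps_unique; rewrite add1n -natr1 mulrDl mul1r c/=.
by apply: (lt_le_trans b); rewrite nE; apply: eq_lerW; rewrite /h; ring.
Qed.

Lemma nstepsD k s t : 0 <= s -> 0 <= t ->
  exists b : bool, nsteps k (s + t) = (b + (nsteps k s + nsteps k t))%N.
Proof.
move=> s0 t0; have /andP[a b] := nsteps_itv k s0; have /andP[a' b'] := nsteps_itv k t0.
set h := h_ k in a b a' b'; set n := (nsteps k s) in a b *; set m := nsteps k t in a' b' *.
have nE : (n + m)%:R * h = n%:R * h + m%:R * h by rewrite natrD mulrDl.
have [c|c] := ltP (s + t) ((n + m)%:R * h + h).
  by exists false; rewrite add0n; apply: nsteps_unique; rewrite c andbT nE lerD.
exists true; apply: nsteps_unique; rewrite add1n -natr1 mulrDl mul1r c/= -/h.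
by rewrite nE; move: b b'; lra.
Qed.

Lemma h_small (c e : R) : 0 < e -> exists N, forall k, (N <= k)%N -> h_ k * c <= e.
Proof.
move=> e0; pose N := Num.bound (`|c| / e); exists N => k Nk.
have c0 : 0 <= `|c| / e by rewrite divr_ge0// ltW.
have p0 : (0 : R) < 2 ^+ k by rewrite exprn_gt0.
rewrite /dyadic mulrC ler_pdivrMr// (le_trans (ler_norm _))// mulrC -ler_pdivrMr//.
rewrite (le_trans (ltW (archi_boundP c0)))// -/N -natrX ler_nat (leq_trans Nk)//.
exact/ltnW/ltn_expl.
Qed.

Opaque implicit_euler nsteps dyadic.

(** The first term is the sum of the halving errors, the second the possible extra step of
    [nstepsS]; the factor [h_ k] makes the increments summable over [k]. *)
Lemma E_increment u w z k t : 0 <= t -> op u w -> op w z ->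
  nrm (fun x => E k.+1 t u x - E k t u x) <= h_ k * (t * nrm z + nrm w).
Proof.
move=> t0 uw wz; have [I1 I2] := opI uw; have [_ I3] := opI wz.
have [b ->] := nstepsS k t0; have /andP[nt _] := nsteps_itv k t0.
set n := nsteps k t in nt *; have z0 := nrm_ge0 I3; have w0 := nrm_ge0 I2.
have hl := iterJ_halve n (h_gt0 k.+1) uw wz; rewrite -h_S in hl.
have hh : h_ k.+1 <= h_ k by rewrite [leRHS]h_S lerDl ltW.
have hl2 : n%:R * h_ k.+1 ^+ 2 * nrm z <= h_ k * (t * nrm z).
  rewrite [leRHS]mulrA ler_wpM2r// [leRHS]mulrC; apply: (le_trans _ (ler_wpM2r (ltW (h_gt0 k)) nt)).
  apply: (@le_trans _ _ (n%:R * (h_ k * h_ k))); last by rewrite mulrA.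
  by rewrite expr2 ler_wpM2l// ler_pM// (ltW (h_gt0 _)).
have A1 := iterJ_I n.*2 (h_gt0 k.+1) I1; have A2 := iterJ_I n (h_gt0 k) I1.
rewrite mulrDr; case: b => /=; last first.
  by rewrite (le_trans hl)// (le_trans hl2)// lerDl mulr_ge0// ltW.
apply: (le_trans (nrm_tri (J_I A1 (h_gt0 k.+1)) A1 A2)); rewrite addrC lerD ?(le_trans hl hl2)//.
apply: (le_trans (J_step (h_gt0 k.+1) (iterJ_op _ (h_gt0 k.+1) uw))).
apply: ler_pM => //; [exact: ltW|exact: nrm_ge0 (iterJ_I _ (h_gt0 k.+1) I2)|exact: iterJ_nrm].
Qed.

Lemma E_I k t f : Ig f -> Ig (E k t f). Proof. exact: iterJ_I. Qed.

Lemma E_dist k t f g : Ig f -> Ig g ->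
  nrm (fun x => E k t f x - E k t g x) <= nrm (fun x => f x - g x).
Proof. exact: iterJ_dist. Qed.

Lemma E_cauchy t f : 0 <= t -> Ig f -> forall e : R, 0 < e -> exists N, forall n m,
  (N <= n)%N -> (N <= m)%N -> nrm (fun x => E n t f x - E m t f x) <= e.
Proof.
move=> t0 hf e e0; have e8 : 0 < e / 8 by rewrite divr_gt0.
have [u [w [z [uw wz fu]]]] := op2_dense hf e8; have [I1 I2] := opI uw; have [_ I3] := opI wz.
pose c := t * nrm z + nrm w.
have c0 : 0 <= c by rewrite addr_ge0// ?mulr_ge0// nrm_ge0.
(* Geometric sum of the increments, as [h_ k] is twice [h_ k.+1]. *)
have key k m : nrm (fun x => E (k + m) t u x - E k t u x) <= 2 * (h_ k - h_ (k + m)) * c.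
  elim: m => [|m IH]; first by rewrite addn0 subrr mulr0 mul0r nrm_subrr.
  rewrite addnS; have A1 := E_I (k + m).+1 t I1; have A2 := E_I (k + m) t I1.
  apply: (le_trans (nrm_tri A1 A2 (E_I k t I1))).
  apply: (le_trans (lerD (E_increment (k + m) t0 uw wz) IH)).
  rewrite -/c -mulrDl ler_wpM2r// [h_ (k + m)]h_S.
  by move: (h_ _) (h_ _) => p q; nrm_lra d; lra.
have [N hN] := h_small (2 * c) e8; exists N.
have k2 n : (N <= n)%N -> nrm (fun x => E n t u x - E N t u x) <= e / 8.
  move=> Nn; have := key N (n - N)%N; rewrite subnKC// => /le_trans; apply.
  apply: (le_trans _ (hN N (leqnn _))); rewrite mulrCA -mulrA ler_wpM2l// ler_wpM2r//.
  by rewrite gerBl ltW.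
have k3 n : (N <= n)%N -> nrm (fun x => E n t f x - E N t u x) <= e / 4.
  move=> Nn; apply: (le_trans (nrm_tri (E_I n t hf) (E_I n t I1) (E_I N t I1))).
  by have := k2 n Nn; have := E_dist n t hf I1; move: fu; nrm_lra d; lra.
move=> n m Nn Nm; apply: (le_trans (nrm_tri (E_I n t hf) (E_I N t I1) (E_I m t hf))).
have := k3 n Nn; have := k3 m Nm; rewrite (nrm_distC mu (E N t u)); move: e0; nrm_lra d; lra.
Qed.

Definition euler_limit t f : T -> R :=
  xget (fun=> 0) [set g | Ig g /\ Cv0 mu (fun k x => E k t f x - g x)].
Local Notation S := euler_limit.

Lemma SP t f : 0 <= t -> Ig f -> Ig (S t f) /\ Cv0 mu (fun k x => E k t f x - S t f x).
Proof.
move=> t0 hf; have [g hg] := L1_complete (fun k => E_I k t hf) (E_cauchy t0 hf).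
by have := @xgetPex _ (fun=> 0) [set g | Ig g /\ Cv0 mu (fun k x => E k t f x - g x)]; apply; exists g.
Qed.

Lemma S_I t f : 0 <= t -> Ig f -> Ig (S t f).
Proof. by move=> t0 hf; case: (SP t0 hf). Qed.

Opaque euler_limit.

Lemma S_near t f e : 0 <= t -> Ig f -> 0 < e ->
  exists N, forall k, (N <= k)%N -> nrm (fun x => E k t f x - S t f x) <= e.
Proof.
move=> t0 hf e0; have [h1 h2] := SP t0 hf.
by move/(Cv0_nrm (fun k => IgB (E_I k t hf) h1)): h2; apply.
Qed.

Lemma S_bound t f g b c : 0 <= t -> Ig f -> Ig g ->
  (forall k, nrm (fun x => E k t f x - g x) <= b + h_ k * c) -> nrm (fun x => S t f x - g x) <= b.
Proof.
move=> t0 hf hg hb; apply/ler_addgt0Pr => e e0; have e2 : 0 < e / 2 by rewrite divr_gt0.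
have [N hN] := S_near t0 hf e2; have [N' hN'] := h_small c e2.
pose k := maxn N N'; have a1 := hN k (leq_maxl _ _); have a2 := hN' k (leq_maxr _ _).
apply: (le_trans (nrm_tri (S_I t0 hf) (E_I k t hf) hg)); rewrite (nrm_distC mu (S t f)).
by have := hb k; move: a1 a2; nrm_lra d; lra.
Qed.

Lemma S_dist t f g : 0 <= t -> Ig f -> Ig g ->
  nrm (fun x => S t f x - S t g x) <= nrm (fun x => f x - g x).
Proof.
move=> t0 hf hg; have Sg := S_I t0 hg; have Sf := S_I t0 hf; apply/ler_addgt0Pr => e e0.
have e2 : 0 < e / 2 by rewrite divr_gt0.
have [N hN] := S_near t0 hg e2; have [N' hN'] := S_near t0 hf e2.
pose k := maxn N N'; have a1 := hN k (leq_maxl _ _); have a2 := hN' k (leq_maxr _ _).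
apply: (le_trans (nrm_tri Sf (E_I k t hf) Sg)).
have := nrm_tri (E_I k t hf) (E_I k t hg) Sg; have := E_dist k t hf hg.
by rewrite (nrm_distC mu (S t f)); move: a1 a2; nrm_lra d; lra.
Qed.

Lemma S_step t u w : 0 <= t -> op u w -> nrm (fun x => S t u x - u x) <= t * nrm w.
Proof.
move=> t0 uw; have [I1 I2] := opI uw; apply: (@S_bound t u u _ 0) => // k.
rewrite mulr0 addr0 (le_trans (iterJ_step _ (h_gt0 k) uw))// ler_wpM2r ?nrm_ge0//.
by case/andP: (nsteps_itv k t0).
Qed.

Lemma S_taylor t u w w' z : 0 <= t -> op u w -> op w' z ->
  nrm (fun x => S t u x - u x - t * w x) <= t * (2 * nrm (fun x => w x - w' x) + t * nrm z).
Proof.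
move=> t0 uw wz; have [I1 I2] := opI uw; have [I3 I4] := opI wz.
have Ig1 := IgD (IgZ t I2) I1.
have -> : nrm (fun x => S t u x - u x - t * w x) = nrm (fun x => S t u x - (t * w x + u x)).
  by apply: eq_Rintegral => x _; congr `|_|; ring.
apply: (@S_bound t u _ _ (nrm w)) => // k; have /andP[n1 n2] := nsteps_itv k t0.
have := iterJ_taylor (nsteps k t) (h_gt0 k) uw wz.
set tk := (nsteps k t)%:R * h_ k in n1 n2 *; set v := E k t u => tay.
have Iv : Ig v by exact: E_I.
have -> : nrm (fun x => v x - (t * w x + u x)) = nrm (fun x => (v x - u x - tk * w x) + (tk - t) * w x).
  by apply: eq_Rintegral => x _; congr `|_|; ring.
apply: (le_trans (nrmD (IgB (IgB Iv I1) (IgZ tk I2)) (IgZ (tk - t) I2))); rewrite (nrmZ _ I2).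
apply: lerD.
  apply: (le_trans tay); have b0 := nrm_ge0 (IgB I2 I3); have z0 := nrm_ge0 I4.
  have tk0 : 0 <= tk by rewrite mulr_ge0// ltW.
  have c1 : tk * nrm z <= t * nrm z by rewrite ler_wpM2r.
  by apply: ler_pM; [|apply: addr_ge0; exact: mulr_ge0| |rewrite lerD2l].
rewrite ler_wpM2r ?nrm_ge0// distrC ger0_norm ?subr_ge0// lerBlDl ltW//.
Qed.

Lemma S_lin t a f g : 0 <= t -> Ig f -> Ig g ->
  {ae mu, forall x, S t (fun x => a * f x + g x) x = a * S t f x + S t g x}.
Proof.
move=> t0 hf hg; have hc := IgD (IgZ a hf) hg.
have [S1 c1] := SP t0 hf; have [S2 c2] := SP t0 hg; have [S3 c3] := SP t0 hc.
have c4 := Cv0D (Cv0D (Cv0Z a c1) c2) (Cv0Z (-1) c3).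
have : {ae mu, forall x, S t (fun x => a * f x + g x) x - (a * S t f x + S t g x) = 0}.
  apply: Cv0_cst; apply: (Cv0_eq c4) => [k|k].
    exact: Ig_mf (IgB S3 (IgD (IgZ a S1) S2)).
  by apply: filterS (iterJ_lin (nsteps k t) a (h_gt0 k) hf hg) => x ->; ring.
by apply: filterS => x /eqP; rewrite subr_eq0 => /eqP.
Qed.

Lemma S_add s t f : 0 <= s -> 0 <= t -> Ig f ->
  {ae mu, forall x, S (s + t) f x = S s (S t f) x}.
Proof.
move=> s0 t0 hf; have st0 : 0 <= s + t by rewrite addr_ge0.
have St := S_I t0 hf; have Sst := S_I st0 hf; have Ss := S_I s0 St.
have : nrm (fun x => S (s + t) f x - S s (S t f) x) <= 0.
  apply/ler_addgt0Pr => e e0; rewrite add0r; have e4 : 0 < e / 8 by rewrite divr_gt0.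
  have [u [w [uw fu]]] := op_dense hf e4; have [I1 I2] := opI uw.
  have [N1 h1] := S_near t0 hf e4; have [N2 h2] := S_near s0 St e4.
  have [N3 h3] := S_near st0 hf e4; have [N4 h4] := h_small (nrm w) e4.
  pose k := maxn (maxn N1 N2) (maxn N3 N4).
  have {}h1 := h1 k _; have {}h2 := h2 k _; have {}h3 := h3 k _; have {}h4 := h4 k _.
  have {}h1 : nrm (fun x => E k t f x - S t f x) <= e / 8 by apply: h1; rewrite !leq_max leqnn.
  have {}h2 : nrm (fun x => E k s (S t f) x - S s (S t f) x) <= e / 8.
    by apply: h2; rewrite !leq_max leqnn orbT.
  have {}h3 : nrm (fun x => E k (s + t) f x - S (s + t) f x) <= e / 8.
    by apply: h3; rewrite !leq_max leqnn !orbT.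
  have {}h4 : h_ k * nrm w <= e / 8 by apply: h4; rewrite !leq_max leqnn !orbT.
  have If := E_I k t hf; have h5 := E_dist k s If St.
  have IE := E_I k s If; have IE2 := E_I k (s + t) hf.
  have step (g v : T -> R) : op v w -> nrm (fun x => J (h_ k) v x - v x) <= e / 8.
    by move=> vw; apply: (le_trans (J_step (h_gt0 k) vw)).
  (* The iterates satisfy the semigroup law up to one extra step. A single step is known to be small
     on the domain only, so [f] is replaced by the nearby [u]. *)
  have h6 : nrm (fun x => E k (s + t) f x - E k s (E k t f) x) <= 3 * (e / 8).
    have [b ->] := nstepsD k s0 t0; rewrite !iterD; set g := iter _ _ (iter _ _ f).
    have Ig' : Ig g by exact: IE.
    case: b => /=; last by rewrite nrm_subrr; move: e4; nrm_lra d; lra.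
    pose g' := E k s (E k t u).
    have op' : op g' (E k s (E k t w)) by do 2 apply: iterJ_op => //.
    have [J1 J2] := opI op'.
    have b1 : nrm (fun x => g x - g' x) <= e / 8.
      by rewrite (le_trans (E_dist k s If (E_I k t I1)))// (le_trans (E_dist k t hf I1)).
    have b2 := J_dist (h_gt0 k) Ig' J1.
    have b3 : nrm (fun x => J (h_ k) g' x - g' x) <= e / 8.
      apply: (le_trans (J_step (h_gt0 k) op')); apply: (le_trans _ h4).
      rewrite ler_wpM2l ?(ltW (h_gt0 k))//.
      by rewrite (le_trans (iterJ_nrm _ (h_gt0 k) (E_I k t I2)))// iterJ_nrm.
    have K1 := J_I Ig' (h_gt0 k); have K2 := J_I J1 (h_gt0 k).
    have t1 := nrm_tri K1 K2 Ig'; have t2 := nrm_tri K2 J1 Ig'.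
    by rewrite (nrm_distC mu g') in t2; move: t1 t2 b1 b2 b3; nrm_lra d; lra.
  have IEs := E_I k s St.
  have t1 := nrm_tri Sst IE2 Ss; rewrite (nrm_distC mu (S (s + t) f) (E k (s + t) f)) in t1.
  have t2 := nrm_tri IE2 IE Ss; have t3 := nrm_tri IE IEs Ss.
  by move: t1 t2 t3 h1 h2 h3 h5 h6; nrm_lra d; lra.
move/(nrm_eq0 (IgB Sst Ss)); apply: filterS => x /eqP; rewrite subr_eq0 => /eqP //.
Qed.

(** The scheme converges on the dense domain of the square, and contractivity extends the limit to
    the whole space; continuity at 0 rests on [S_step] and the inclusion of generators on
    [S_taylor]. *)
Theorem lumer_phillips : exists2 S, C0_semigroup mu setT S & extends op (sg_generator mu setT S).
Proof.
have S_nrm t f : 0 <= t -> Ig f -> nrm (S t f) <= nrm f.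
  move=> t0 hf; have E0 g : nrm (fun x => g x - 0) = nrm g by apply: eq_Rintegral => x _; rewrite subr0.
  rewrite -E0; apply: (@S_bound t f (fun=> 0) (nrm f) 0 t0 hf (Ig0 mu)) => k.
  by rewrite mulr0 addr0 E0 iterJ_nrm.
have hS : C0_semigroup mu setT S.
  split.
  - by move=> t f t0 /LpT hf; apply/LpT; apply: S_I => //; exact: ltW.
  - by move=> t a f g t0 /LpT hf /LpT hg; apply: filterS (S_lin a (ltW t0) hf hg) => x ->.
  - move=> t t0; exists 1 => f /LpT hf; rewrite mul1e !N1E//; last exact: S_I (ltW t0) hf.
    by rewrite lee_fin S_nrm// ltW.
  - by move=> s t f s0 t0 /LpT hf; apply: filterS (S_add (ltW s0) (ltW t0) hf) => x ->.
  - move=> f /LpT hf; apply/(right0P (fun t => Lnorm_ge0 _ _ _)) => e e0.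
    have e4 : 0 < e / 4 by rewrite divr_gt0.
    have [u [w [uw fu]]] := op_dense hf e4; have [I1 I2] := opI uw; have w0 := nrm_ge0 I2.
    exists (e / (4 * (nrm w + 1))) => [|t /andP[t0 te]].
      by rewrite divr_gt0// mulr_gt0// ltr_wpDl.
    have St := S_I (ltW t0) hf; have Su := S_I (ltW t0) I1.
    rewrite N1E; last exact: IgB.
    rewrite lee_fin; have t1 := nrm_tri St Su hf; have t2 := nrm_tri Su I1 hf.
    rewrite (nrm_distC mu u) in t2; have t3 := S_dist (ltW t0) hf I1.
    have t4 : nrm (fun x => S t u x - u x) <= e / 4.
      apply: (le_trans (S_step (ltW t0) uw)); apply: (le_trans (ler_wpM2r w0 (ltW te))).
      have -> : e / (4 * (nrm w + 1)) * nrm w = (e / 4) * (nrm w / (nrm w + 1)).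
        by field; rewrite gt_eqF ?ltr_wpDl.
      by rewrite ler_piMr ?(ltW e4)// ler_pdivrMr ?ltr_wpDl// mul1r lerDl.
    apply: (le_trans t1); move: t2 t3 t4 fu; nrm_lra d; lra.
exists S => // u w uw; have [I1 I2] := opI uw; apply/(sg_genP hS); split; [exact/LpT|exact/LpT|].
move=> e e0; have e4 : 0 < e / 4 by rewrite divr_gt0.
have [w' [z [wz ww]]] := op_dense I2 e4; have [_ I4] := opI wz; have z0 := nrm_ge0 I4.
exists (e / (4 * (nrm z + 1))) => [|t /andP[t0 te]].
  by rewrite divr_gt0// mulr_gt0// ltr_wpDl.
apply: (le_trans (S_taylor (ltW t0) uw wz)); rewrite ler_wpM2l ?(ltW t0)//.
have : t * nrm z <= e / 4.
  apply: (le_trans (ler_wpM2r z0 (ltW te))).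
  have -> : e / (4 * (nrm z + 1)) * nrm z = (e / 4) * (nrm z / (nrm z + 1)).
    by field; rewrite gt_eqF ?ltr_wpDl.
  by rewrite ler_piMr ?(ltW e4)// ler_pdivrMr ?ltr_wpDl// mul1r lerDl.
by move: ww e4; nrm_lra d; lra.
Qed.

End dissipative.

(** * Local bounds, positivity and resolvents of semigroups *)

Section positivity_preserving.
Context {R : realType} {d : nat} (mu : {measure set 'rV[R]_d -> \bar R}).
Local Notation T := 'rV[R]_d.
Local Notation nrm := (nrm mu).
Local Notation Ig := (Ig mu).
Implicit Types (u v f g w z : T -> R) (S : R -> (T -> R) -> (T -> R)).

Lemma ae_ge0_approx h : Ig h ->
  (forall e : R, 0 < e -> exists g, [/\ Ig g, {ae mu, forall x, 0 <= g x} & nrm (fun x => h x - g x) <= e]) ->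
  {ae mu, forall x, 0 <= h x}.
Proof.
move=> hI happ; pose m x := Num.max (- h x) 0.
have mI : Ig m.
  apply: (Ig_le _ hI); first by apply: measurable_maxr; [exact: Ig_mf (IgN hI)|exact: measurable_cst].
  by apply: aeW => x; rewrite /m; case: (leP (- h x) 0) => a; rewrite ?normr0 ?normrN.
have : nrm m <= 0.
  apply/ler_addgt0Pr => e e0; rewrite add0r; have [g [gI g0 hg]] := happ e e0.
  apply: (le_trans _ hg); apply: Rint_le; [exact: Ig_abs|exact: Ig_abs (IgB hI gI)|].
  apply: filterS g0 => x g0; rewrite /m; case: (leP (- h x) 0) => a; first by rewrite normr0.
  rewrite gtr0_norm// -normrN; apply: (le_trans _ (ler_norm _)); rewrite opprB; lra.
move/(nrm_eq0 mI); apply: filterS => x; rewrite /m; case: (leP (- h x) 0) => a; first by move: a; lra.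
by move=> e; move: a; rewrite e ltxx.
Qed.

(** [C0_semigroup] bounds each operator separately. Without a common bound near 0, operators at
    times [t_n <= n.+1%:R^-1] would have norms exceeding [n.+1], although [S t_n f] is bounded for
    every [f] by strong continuity; this contradicts uniform boundedness. *)
Lemma sg_local_bound S : C0_semigroup mu setT S ->
  exists M r : R, [/\ 1 <= M, 0 < r & forall t f, 0 < t <= r -> Ig f -> nrm (S t f) <= M * nrm f].
Proof.
move=> hS; apply: contrapT => hn.
have bad n : exists p : R * (T -> R), [/\ 0 < p.1 <= n.+1%:R^-1, Ig p.2 & n.+1%:R * nrm p.2 < nrm (S p.1 p.2)].
  apply: contrapT => hb; apply: hn; exists n.+1%:R, n.+1%:R^-1; split=> [||t f tr hf].
  - by rewrite ler1n.
  - by rewrite invr_gt0.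
  - by rewrite leNgt; apply/negP => lt; apply: hb; exists (t, f).
have [p hp] := choice bad.
have t0 n : 0 < (p n).1 by have [/andP[]] := hp n.
have II f : Lp mu 1 setT f <-> Ig f by exact: LpT.
have [||||K K0 hK] := @uniform_boundedness _ _ _ mu (fun n => S (p n).1).
- by move=> n f hf; exact: (sg_I hS (t0 n) (iffRL (II f) hf)).
- by move=> n a f g hf hg; exact: (sg_lin hS a (t0 n) (iffRL (II f) hf) (iffRL (II g) hg)).
- by move=> n; have [C C0 hC] := sg_bd hS (t0 n); exists C => f /II; exact: hC.
- move=> f hf; have pf := iffRL (II f) hf; have [del del0 hdel] := sg_cont hS pf ltr01.
  pose N := Num.bound del^-1; pose q n := nrm (S (p n).1 f).
  have [C hC] : exists C : R, forall n, (n < N)%N -> q n <= C.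
    exists (\sum_(i < N) `|q i|) => n nN; rewrite (bigD1 (Ordinal nN))//= (le_trans (ler_norm _))// lerDl.
    exact: sumr_ge0.
  exists (Num.max C (nrm f + 1)) => n; have [nN|Nn] := ltnP n N; first by rewrite le_max hC.
  have Sf := sg_I hS (t0 n) pf; have td : (p n).1 < del.
    have [/andP[_ tn] _ _] := hp n; apply: (le_lt_trans tn).
    rewrite -[ltRHS]invrK ltf_pV2 ?posrE ?invr_gt0//.
    apply: (lt_le_trans (archi_boundP _)); first by rewrite invr_ge0 ltW.
    by rewrite ler_nat (leq_trans Nn).
  have := hdel _ (introT andP (conj (t0 n) td)) => h1.
  rewrite le_max; apply/orP; right.
  have -> : nrm (S (p n).1 f) = nrm (fun x => (S (p n).1 f x - f x) + f x).
    by apply: eq_Rintegral => x _; congr `|_|; ring.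
  by rewrite (le_trans (nrmD (IgB Sf hf) hf))// addrC lerD2l.
pose n := Num.bound K; have [_ pI pn] := hp n.
have := lt_le_trans pn (hK n _ pI); apply/negP; rewrite -leNgt ler_wpM2r ?nrm_ge0//.
by rewrite (le_trans (ltW (archi_boundP K0)))// ler_nat.
Qed.

Section contraction.
Variables (V : set T) (S : R -> (T -> R) -> (T -> R)) (hS : C0_semigroup mu V S).
Local Notation P := (Lp mu 1 V).
Local Notation gen := (sg_generator mu V S).

Lemma sg_gen_0 z : gen (fun=> 0) z -> {ae mu, forall x, z x = 0}.
Proof.
move=> /(sg_genP hS)[p0 pz hg]; have zI := Lp_Ig pz; apply: nrm_eq0 => //.
apply/ler_addgt0Pr => e e0; rewrite add0r; have [del del0 hdel] := hg e e0.
have t0 : 0 < del / 2 by rewrite divr_gt0.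
have td : 0 < del / 2 < del by rewrite t0/= ltr_pdivrMr// ltr_pMr// ltr1n.
have := hdel _ td; set t := del / 2 in t0 *.
have Sf := sg_I hS t0 p0.
have e1 : {ae mu, forall x, S t (fun=> 0) x = 0}.
  have [C C0 hC] := sg_bd hS t0; apply: nrm_eq0 => //.
  by rewrite (le_trans (hC _ p0))// nrm0 mulr0.
rewrite (nrm_ae (g := fun x => - t * z x)).
- by rewrite nrmZ// normrN gtr0_norm// ler_pM2l.
- exact: (IgB (IgB Sf (Ig0 mu)) (IgZ t zI)).
- exact: IgZ.
- by apply: filterS e1 => x ->; ring.
Qed.

Lemma sg_gen_fun u w w' : gen u w -> gen u w' -> {ae mu, forall x, w x = w' x}.
Proof.
move=> h h'; have [pu pw _] := h; have := sg_gen_comb hS (-1) h h' => h2.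
have p0 := Lp0 mu V; have pw2 : P (fun x => -1 * w x + w' x) by case: h2.
have := sg_gen_ext hS h2 p0 pw2; move=> h3; have := h3 _ _.
have e1 : {ae mu, forall x, -1 * u x + u x = 0} by apply: aeW => x; ring.
move=> {}h3; have := sg_gen_0 (h3 e1 (aeW mu (fun=> erefl))).
by apply: filterS => x /eqP; rewrite mulN1r addrC subr_eq0 => /eqP.
Qed.

(** [S s] commutes with [S t], so the first-order defect at [S s u] is the image under [S s] of the
    defect at [u]. *)
Lemma sg_defect C s t u w : 0 < s -> 0 < t -> P u -> P w ->
  (forall f, P f -> nrm (S s f) <= C * nrm f) ->
  nrm (fun x => S t (S s u) x - S s u x - t * S s w x) <= C * nrm (fun x => S t u x - u x - t * w x).
Proof.
move=> s0 t0 pu pw hC; have pSu := sg_P hS t0 pu.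
have pr : P (fun x => S t u x - u x - t * w x) by apply: LpB; [exact: LpB|exact: LpZ].
have I1 := sg_I hS t0 (sg_P hS s0 pu); have I2 := sg_I hS s0 pu; have I3 := sg_I hS s0 pw.
rewrite (nrm_ae (g := S s (fun x => S t u x - u x - t * w x))); first exact: hC.
- exact: (IgB (IgB I1 I2) (IgZ t I3)).
- exact: (sg_I hS s0 pr).
have pc : P (fun x => (-t) * w x + (-1 * u x + S t u x)) by apply: Lp_comb => //; exact: Lp_comb.
have e2 : {ae mu, forall x, S s (fun x => S t u x - u x - t * w x) x = S s (fun x => (-t) * w x + (-1 * u x + S t u x)) x}.
  by apply: (sg_ae hS s0 pr pc); apply: aeW => x; ring.
have e3 := sg_lin hS (-t) s0 pw (Lp_comb (-1) pu pSu).
have e4 := sg_lin hS (-1) s0 pu pSu; have e5 := sg_add hS s0 t0 pu; have e6 := sg_add hS t0 s0 pu.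
apply: filterS2 (filterI e2 (filterI e3 e4)) (filterI e5 e6) => x [-> [-> ->]] [<-].
by rewrite addrC => <-; ring.
Qed.

Lemma sg_gen_S s u w : 0 < s -> gen u w -> gen (S s u) (S s w).
Proof.
move=> s0 /(sg_genP hS)[pu pw hg]; apply/(sg_genP hS); split; [exact: sg_P|exact: sg_P|].
move=> e e0; have [C C0 hC] := sg_bd hS s0.
have e1 : 0 < e / (C + 1) by rewrite divr_gt0// ltr_wpDl.
have [del del0 hdel] := hg _ e1; exists del => // t td; have t0 : 0 < t by case/andP: td.
apply: (le_trans (sg_defect s0 t0 pu pw hC)).
rewrite (le_trans (ler_wpM2l C0 (hdel _ td)))// mulrCA ler_wpM2l ?(ltW t0)//.
by rewrite mulrCA ler_piMr ?(ltW e0)// ler_pdivrMr ?ltr_wpDl// mul1r lerDl.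
Qed.

Hypotheses (hC : contractive mu V S) (hM : sub_Markovian mu V S).

Lemma sg_contr t f : 0 < t -> P f -> nrm (S t f) <= nrm f.
Proof.
by move=> t0 pf; have := hC t0 pf; rewrite (N1E (sg_I hS t0 pf)) (N1E (Lp_Ig pf)) lee_fin.
Qed.

Lemma sg_dist t f g : 0 < t -> P f -> P g ->
  nrm (fun x => S t f x - S t g x) <= nrm (fun x => f x - g x).
Proof.
move=> t0 pf pg; rewrite (nrm_ae (g := S t (fun x => -1 * g x + f x))).
- rewrite (le_trans (sg_contr t0 (Lp_comb (-1) pg pf)))//; apply: eq_lerW.
  by apply: eq_Rintegral => x _; congr `|_|; ring.
- exact: (IgB (sg_I hS t0 pf) (sg_I hS t0 pg)).
- exact: (sg_I hS t0 (Lp_comb (-1) pg pf)).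
- by apply: filterS (sg_lin hS (-1) t0 pg pf) => x ->; ring.
Qed.

(** The sub-Markov property speaks of [0 <= f <= 1]: the truncations [f_ k] of [f] at height [k.+1]
    are scaled into this range, and positivity passes to the limit in mean. *)
Lemma sg_pos t f : 0 < t -> P f -> {ae mu, forall x, 0 <= f x} -> {ae mu, forall x, 0 <= S t f x}.
Proof.
move=> t0 pf f0; have fI := Lp_Ig pf; have mf := Ig_mf fI.
pose f_ (k : nat) x := Num.min (f x) k.+1%:R.
have mf_ k : meas (f_ k) by apply: measurable_minr => //; exact: measurable_cst.
have f_le k : {ae mu, forall x, 0 <= f_ k x <= f x}.
  by apply: filterS f0 => x x0; rewrite /f_ le_min x0 ge_min lexx !andbT/=.
have pf_ k : P (f_ k).
  by apply: (Lp_abs_le pf) => //; apply: filterS (f_le k) => x /andP[a b]; rewrite !ger0_norm// (le_trans a).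
apply: ae_ge0_approx; first exact: (sg_I hS t0 pf).
move=> e e0; have cv : Cv0 mu (fun k x => f x - f_ k x).
  apply: (@Cv0_dct _ _ _ mu _ (fun x => `|f x|)) => //; first by move=> k; apply: measurable_funB.
  - exact: Ig_abs.
  - by move=> k; apply: filterS (f_le k) => x /andP[a b]; rewrite !ger0_norm ?subr_ge0 ?(le_trans a)// gerBl.
  - apply: aeW => x; apply/cvgrPdist_le => e' e'0; exists (Num.bound `|f x|) => // k /= kN.
    have -> : f_ k x = f x; last by rewrite subrr subr0 normr0 ltW.
    apply/min_idPl; rewrite (le_trans (ler_norm _))// (le_trans (ltW (archi_boundP (normr_ge0 _))))//.
    by rewrite ler_nat (leq_trans kN).
have /(Cv0_nrm (fun k => IgB fI (Lp_Ig (pf_ k)))) /(_ e e0) [N /(_ N (leqnn _)) hN] := cv.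
exists (S t (f_ N)); split; [exact: (sg_I hS t0 (pf_ N))| |by rewrite (le_trans (sg_dist t0 pf (pf_ N)))].
pose c : R := N.+1%:R^-1; have c0 : 0 < c by rewrite invr_gt0.
have pcf : P (fun x => c * f_ N x) by exact: LpZ.
have := hM t0 pcf _; have h01 : {ae mu, forall x, 0 <= c * f_ N x <= 1}.
  apply: filterS (f_le N) => x /andP[a b]; rewrite mulr_ge0 ?(ltW c0)//= /c mulrC ler_pdivrMr// mul1r.
  by rewrite /f_ ge_min lexx orbT.
move=> /(_ h01) hS1.
have e1 : {ae mu, forall x, S t (fun x => c * f_ N x) x = S t (fun x => (c - 1) * f_ N x + f_ N x) x}.
  apply: (sg_ae hS t0 pcf (Lp_comb (c - 1) (pf_ N) (pf_ N))).
  by apply: aeW => x; ring.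
have e2 := sg_lin hS (c - 1) t0 (pf_ N) (pf_ N).
apply: filterS2 hS1 (filterI e1 e2) => x /andP[+ _] [k1 k2]; rewrite k1 k2.
by rewrite (_ : _ + _ = c * S t (f_ N) x) ?pmulr_rge0//; ring.
Qed.

(** Write [(1 + t lam) u = S t u + t f] up to an error [o(t)], take norms and divide by [t]. *)
Lemma res_contr lam u f : 0 < lam -> P f -> gen u (fun x => lam * u x - f x) -> lam * nrm u <= nrm f.
Proof.
move=> l0 pf /(sg_genP hS)[pu pw hg]; apply/ler_addgt0Pr => e e0.
have [del del0 hdel] := hg _ e0; have t0 : 0 < del / 2 by rewrite divr_gt0.
have td : 0 < del / 2 < del by rewrite t0/= ltr_pdivrMr// ltr_pMr// ltr1n.
have := hdel _ td; set t := del / 2 in t0 * => ht.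
have I1 := sg_I hS t0 pu; have I2 := Lp_Ig pu; have I3 := Lp_Ig pw; have I4 := Lp_Ig pf.
have J := IgB (IgB I1 I2) (IgZ t I3).
have E : nrm (fun x => (1 + t * lam) * u x) = nrm (fun x => (S t u x + t * f x) - (S t u x - u x - t * (lam * u x - f x))).
  by apply: eq_Rintegral => x _; congr `|_|; ring.
rewrite nrmZ// gtr0_norm in E; last by rewrite addr_gt0// mulr_gt0.
have a2 := nrmD I1 (IgZ t I4); rewrite (nrmZ t I4) gtr0_norm// in a2.
have : (1 + t * lam) * nrm u <= nrm u + t * nrm f + t * e.
  rewrite E (le_trans (nrmB (IgD I1 (IgZ t I4)) J))// lerD//.
  by apply: (le_trans a2); rewrite lerD2r; exact: sg_contr.
by rewrite mulrDl mul1r -addrA lerD2l -mulrDr -mulrA ler_pM2l.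
Qed.

(** The same expansion for the negative part: [S t] is positive, so
    [(1 + t lam) u^- <= S t u^- + o(t)] when [f >= 0], and contractivity leaves
    [lam * nrm u^- <= 0]. *)
Lemma res_pos lam u f : 0 < lam -> P f -> gen u (fun x => lam * u x - f x) ->
  {ae mu, forall x, 0 <= f x} -> {ae mu, forall x, 0 <= u x}.
Proof.
move=> l0 pf /(sg_genP hS)[pu pw hg] f0.
have I2 := Lp_Ig pu; have I3 := Lp_Ig pw; have I4 := Lp_Ig pf; have mu' := Ig_mf I2.
pose m x := Num.max (- u x) 0; pose p x := Num.max (u x) 0.
have m0 x : 0 <= m x by rewrite /m le_max lexx orbT.
have mm : meas m by apply: measurable_maxr; [exact: Ig_mf (IgN I2)|exact: measurable_cst].
have mp : meas p by apply: measurable_maxr; [exact: mu'|exact: measurable_cst].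
have pm : P m.
  apply: (Lp_abs_le pu) => //; apply: aeW => x; rewrite (ger0_norm (m0 x)) /m ge_max normr_ge0 andbT.
  by rewrite -normrN ler_norm.
have pp : P p.
  apply: (Lp_abs_le pu) => //; apply: aeW => x; rewrite ger0_norm /p ?le_max ?lexx ?orbT//.
  by rewrite ge_max normr_ge0 ler_norm.
have uE x : u x = -1 * m x + p x.
  by rewrite /m /p; case: (leP (- u x) 0) => a; case: (leP (u x) 0) => b; lra.
have Im := Lp_Ig pm.
have : lam * nrm m <= 0.
  apply/ler_addgt0Pr => e e0; rewrite add0r; have [del del0 hdel] := hg _ e0.
  have t0 : 0 < del / 2 by rewrite divr_gt0.
  have td : 0 < del / 2 < del by rewrite t0/= ltr_pdivrMr// ltr_pMr// ltr1n.
  have := hdel _ td; set t := del / 2 in t0 * => ht.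
  have I1 := sg_I hS t0 pu; have J := IgB (IgB I1 I2) (IgZ t I3).
  have Sm := sg_I hS t0 pm; have Sm0 := sg_pos t0 pm (aeW mu m0).
  have p0 x : 0 <= p x by rewrite /p le_max lexx orbT.
  have Sp0 := sg_pos t0 pp (aeW mu p0).
  have e1 : {ae mu, forall x, S t u x = S t (fun x => -1 * m x + p x) x}.
    by apply: (sg_ae hS t0 pu (Lp_comb (-1) pm pp)); apply: aeW => x; exact: uE.
  have e2 := sg_lin hS (-1) t0 pm pp.
  have tl0 : 0 < 1 + t * lam by rewrite addr_gt0// mulr_gt0.
  have key : (1 + t * lam) * nrm m <= nrm (S t m) + nrm (fun x => S t u x - u x - t * (lam * u x - f x)).
    rewrite -{1}(gtr0_norm tl0) -nrmZ// -RintD; [|exact: Ig_abs|exact: Ig_abs J].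
    apply: Rint_le; [exact: Ig_abs (IgZ _ Im)|by apply: IgD; [exact: Ig_abs|exact: Ig_abs J]|].
    apply: filterS2 (filterI Sm0 Sp0) (filterI (filterI e1 e2) f0) => x [s0 sp] [[k1 k2] fx].
    rewrite (ger0_norm s0); rewrite k1 k2.
    have tf : 0 <= t * f x by rewrite mulr_ge0// ltW.
    set r := _ - t * _; have rE : r = -1 * S t m x + S t p x - u x - t * (lam * u x - f x) by [].
    have r1 := ler_norm r.
    rewrite ger0_norm ?mulr_ge0 ?(ltW tl0)//.
    rewrite {1}/m; case: (leP (- u x) 0) => a; first by rewrite mulr0 addr_ge0.
    by apply: (le_trans _ (lerD (lexx _) r1)); rewrite rE; move: sp tf; lra.
  have a3 := sg_contr t0 pm; have := le_trans key (lerD a3 ht).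
  by rewrite mulrDl mul1r lerD2l -mulrA ler_pM2l.
rewrite pmulr_rle0// => /(nrm_eq0 Im); apply: filterS => x; rewrite /m.
case: (leP (- u x) 0) => a; first by move: a; lra.
by move=> e; move: a; rewrite e ltxx.
Qed.

Variables (G : R -> (T -> R) -> (T -> R)) (hR : is_resolvent mu V gen G).

Lemma res_P lam f : 0 < lam -> P f -> P (G lam f). Proof. by move=> l0 pf; case: (hR l0 pf). Qed.

Lemma res_I lam f : 0 < lam -> P f -> Ig (G lam f). Proof. by move=> l0 pf; exact: Lp_Ig (res_P l0 pf). Qed.

Lemma res_gen lam f : 0 < lam -> P f -> gen (G lam f) (fun x => lam * G lam f x - f x).
Proof. by move=> l0 pf; have [p h] := hR l0 pf; apply/(h _ p); exact: aeW. Qed.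

Lemma res_uniq lam f u : 0 < lam -> P f -> gen u (fun x => lam * u x - f x) ->
  {ae mu, forall x, u x = G lam f x}.
Proof.
move=> l0 pf hg; have [p h] := hR l0 pf; have pu : P u by case: hg.
by apply: filterS (iffRL (h _ pu) hg) => x; exact.
Qed.

Lemma res_lin lam a f g : 0 < lam -> P f -> P g ->
  {ae mu, forall x, G lam (fun x => a * f x + g x) x = a * G lam f x + G lam g x}.
Proof.
move=> l0 pf pg; have := sg_gen_comb hS a (res_gen l0 pf) (res_gen l0 pg) => h.
have : gen (fun x => a * G lam f x + G lam g x)
    (fun x => lam * (a * G lam f x + G lam g x) - (a * f x + g x)).
  suff -> : (fun x => lam * (a * G lam f x + G lam g x) - (a * f x + g x)) =
      (fun x => a * (lam * G lam f x - f x) + (lam * G lam g x - g x)) by [].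
  by apply/funext => x; ring.
move/(res_uniq l0 (Lp_comb a pf pg)); exact: filterS.
Qed.

Lemma res_nrm lam f : 0 < lam -> P f -> lam * nrm (G lam f) <= nrm f.
Proof. by move=> l0 pf; exact: res_contr l0 pf (res_gen l0 pf). Qed.

Lemma res_ge0 lam f : 0 < lam -> P f -> {ae mu, forall x, 0 <= f x} -> {ae mu, forall x, 0 <= G lam f x}.
Proof. by move=> l0 pf; exact: res_pos l0 pf (res_gen l0 pf). Qed.

Lemma res_mass lam f : 0 < lam -> P f -> {ae mu, forall x, 0 <= f x} ->
  0 <= \int[mu]_x f x - lam * \int[mu]_x G lam f x.
Proof.
move=> l0 pf f0; have := res_nrm l0 pf; have g0 := res_ge0 l0 pf f0.
have IG := res_I l0 pf; have If := Lp_Ig pf.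
have -> : nrm (G lam f) = \int[mu]_x G lam f x.
  apply: ae_Rint; [exact: Ig_mf (Ig_abs IG)|exact: (Ig_mf IG)|].
  by apply: filterS g0 => x h _; exact: ger0_norm.
have -> : nrm f = \int[mu]_x f x.
  apply: ae_Rint; [exact: Ig_mf (Ig_abs If)|exact: (Ig_mf If)|].
  by apply: filterS f0 => x h _; exact: ger0_norm.
by rewrite subr_ge0.
Qed.

End contraction.
End positivity_preserving.

(** * Lost mass and the generator that puts it back *)

Section mass_conservation.
Context {R : realType} {d : nat} (mu : {measure set 'rV[R]_d -> \bar R}).
Local Notation T := 'rV[R]_d.
Local Notation nrm := (nrm mu).
Local Notation Ig := (Ig mu).
Local Notation P := (Lp mu 1 setT).
Implicit Types (u v f g w z : T -> R).
Variables (S : R -> (T -> R) -> (T -> R)) (hS : C0_semigroup mu setT S).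
Hypotheses (hC : contractive mu setT S) (hM : sub_Markovian mu setT S).
Local Notation gen := (sg_generator mu setT S).
Hypothesis dense : forall f e, Ig f -> 0 < e -> exists u w, gen u w /\ nrm (fun x => f x - u x) <= e.

Lemma gen_Ig u w : gen u w -> Ig u /\ Ig w.
Proof. by case=> /LpT h1 /LpT h2 _. Qed.

Lemma Rint_close u v : Ig u -> Ig v -> `|\int[mu]_x u x - \int[mu]_x v x| <= nrm (fun x => u x - v x).
Proof. by move=> hu hv; rewrite -RintB//; exact: Rint_abs_le (IgB hu hv). Qed.

(** Over a partition each step changes the integral along an orbit from the domain by a first-order
    defect only, and [sg_defect] bounds the defect at [S s u] by that at [u]. Density and
    contractivity give all [f]. *)
Lemma invariant_mass0 : (forall u w, gen u w -> \int[mu]_x w x = 0) -> invariant_measure mu S.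
Proof.
move=> h0 t f t0 pf _ _; have fI := iffLR (LpT _ _) pf; have Sf := sg_I hS t0 pf.
have conserve u w : gen u w -> \int[mu]_x S t u x = \int[mu]_x u x.
  move=> uw; have [pu pw _] := uw; have [uI wI] := gen_Ig uw.
  apply/eqP; rewrite -subr_eq0 -normr_le0; apply/ler_addgt0Pr => e e0; rewrite add0r.
  have e1 : 0 < e / t by rewrite divr_gt0.
  have [n [h [hh0 tE hr]]] := sg_gen_partition hS uw t0 e1.
  have first_step v z : gen v z -> `|\int[mu]_x S h v x - \int[mu]_x v x| <= nrm (fun x => S h v x - v x - h * z x).
    move=> vz; have [vI zI] := gen_Ig vz; have [pv _ _] := vz; have Sv := sg_I hS hh0 pv.
    apply: (le_trans _ (Rint_abs_le (IgB (IgB Sv vI) (IgZ h zI)))).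
    by rewrite (RintB (IgB Sv vI) (IgZ h zI)) (RintB Sv vI) RintZ// (h0 _ _ vz) mulr0 subr0.
  have key k : `|\int[mu]_x S (k.+1%:R * h) u x - \int[mu]_x u x| <= k.+1%:R * (h * (e / t)).
    elim: k => [|k IH]; first by rewrite !mul1r (le_trans (first_step _ _ uw)).
    have s0 : 0 < k.+1%:R * h by rewrite mulr_gt0// ltr0n.
    have kE : k.+2%:R * h = h + k.+1%:R * h by rewrite -[k.+2%:R]natr1 mulrDl mul1r addrC.
    set s := k.+1%:R * h in IH s0 kE; have sh0 : 0 < h + s by rewrite addr_gt0.
    have -> : \int[mu]_x S (k.+2%:R * h) u x = \int[mu]_x S h (S s u) x.
      rewrite kE; apply: ae_Rint; [exact: Ig_mf (sg_I hS sh0 pu)|exact: Ig_mf (sg_I hS hh0 (sg_P hS s0 pu))|].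
      by apply: filterS (sg_add hS hh0 s0 pu) => x.
    have b : nrm (fun x => S h (S s u) x - S s u x - h * S s w x) <= 1 * nrm (fun x => S h u x - u x - h * w x).
      by apply: (sg_defect hS s0 hh0 pu pw) => v pv; rewrite mul1r; exact: (sg_contr hS hC s0 pv).
    rewrite mul1r in b; have := lerD (le_trans (first_step _ _ (sg_gen_S hS s0 uw)) (le_trans b hr)) IH.
    rewrite -[k.+2%:R]natr1 mulrDl mul1r [leRHS]addrC => /(le_trans _); apply.
    by rewrite (le_trans _ (ler_normD _ _))// addrA subrK.
  by have := key n; rewrite mulrA tE mulrC divfK ?gt_eqF.
apply/eqP; rewrite -subr_eq0 -normr_le0; apply/ler_addgt0Pr => e e0; rewrite add0r.
have e2 : 0 < e / 2 by rewrite divr_gt0.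
have [u [w [uw fu]]] := dense fI e2; have [uI wI] := gen_Ig uw; have pu := iffRL (LpT _ _) uI.
have Su := sg_I hS t0 pu.
have -> : \int[mu]_x S t f x - \int[mu]_x f x =
   (\int[mu]_x S t f x - \int[mu]_x S t u x) + (\int[mu]_x u x - \int[mu]_x f x).
  by rewrite (conserve _ _ uw) addrA subrK.
rewrite (le_trans (ler_normD _ _))// [leRHS]splitr lerD//.
  by rewrite (le_trans (Rint_close Sf Su))// (le_trans (sg_dist hS hC t0 pf pu)).
by rewrite distrC (le_trans (Rint_close fI uI)).
Qed.

Variables (G : R -> (T -> R) -> (T -> R)) (hR : is_resolvent mu setT gen G) (y : T -> R).
Hypotheses (yI : Ig y) (y0 : {ae mu, forall x, 0 <= y x}) (y1 : \int[mu]_x y x = 1).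

(* The mass lost by the semigroup is put back with profile y. *)
Definition refeed u w : Prop := Ig w /\ exists2 w0, gen u w0 &
  {ae mu, forall x, w x = w0 x - (\int[mu]_z w0 z) * y x}.

(** With [c = - int w0], the rate at which mass is put back, solving [lam u - w = f] gives
    [u = G f + c G y], while [w] has integral 0. *)
Lemma refeed_resolvent lam u w : 0 < lam -> refeed u w -> exists2 c, 
  {ae mu, forall x, u x = G lam (fun x => lam * u x - w x) x + c * G lam y x} &
  \int[mu]_x (lam * u x - w x) = lam * \int[mu]_x u x.
Proof.
move=> l0 [wI [w0 uw0 wE]]; have [uI w0I] := gen_Ig uw0; set c := \int[mu]_z w0 z in wE.
have fI : Ig (fun x => lam * u x - w x) := IgB (IgZ lam uI) wI.
have pf := iffRL (LpT _ _) fI; have py := iffRL (LpT mu _) yI.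
have w0mass : \int[mu]_x w x = 0.
  have -> : \int[mu]_x w x = \int[mu]_x (w0 x - c * y x).
    apply: ae_Rint; [exact: Ig_mf wI|exact: Ig_mf (IgB w0I (IgZ c yI))|by apply: filterS wE => x h _].
  by rewrite RintB// ?RintZ// ?y1 ?mulr1 ?subrr//; exact: IgZ.
exists (- c); last by rewrite RintB// ?RintZ// ?w0mass ?subr0//; exact: IgZ.
have pg : P (fun x => (-c) * y x + (lam * u x - w x)) by exact: Lp_comb.
have h : gen u (fun x => lam * u x - ((-c) * y x + (lam * u x - w x))).
  apply: (sg_gen_ext hS uw0); [exact/LpT|by apply/LpT; apply: IgB; [exact: IgZ|exact/LpT]|exact: aeW|].
  by apply: filterS wE => x ->; ring.
apply: filterS2 (res_uniq hR l0 pg h) (res_lin hS hR (-c) l0 py pf) => x -> ->.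
by rewrite addrC.
Qed.

(** By mass balance [lam c int (G y)] is the mass [int f - lam int (G f)] lost by [f], at most the
    mass lost by [|f|], since [|f| + f] and [|f| - f] lose nonnegative mass. With
    [|u| <= G |f| + |c| G y] the lost part and the remaining part of [|f|] add up to [nrm f]. *)
Lemma refeed_dissipative u w h : refeed u w -> 0 < h -> nrm u <= nrm (fun x => u x - h * w x).
Proof.
move=> uw h0; have l0 : 0 < h^-1 by rewrite invr_gt0.
have [c uE fu] := refeed_resolvent l0 uw; have [wI [w0 uw0 _]] := uw; have [uI _] := gen_Ig uw0.
set lam := h^-1 in l0 uE fu; set f := (fun x => lam * u x - w x) in uE fu.
have fI : Ig f := IgB (IgZ lam uI) wI.
have pf := iffRL (LpT _ _) fI; have py := iffRL (LpT mu _) yI.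
pose af x := `|f x|; have afI : Ig af := Ig_abs fI; have paf := iffRL (LpT _ _) afI.
have Gf := res_I hR l0 pf; have Gy := res_I hR l0 py; have Gaf := res_I hR l0 paf.
have Gy0 := res_ge0 hS hC hM hR l0 py y0.
have Gmono g : P g -> {ae mu, forall x, 0 <= g x} -> {ae mu, forall x, 0 <= G lam g x} := res_ge0 hS hC hM hR l0.
have p1 : P (fun x => 1 * f x + af x) by exact: Lp_comb.
have p2 : P (fun x => -1 * f x + af x) by exact: Lp_comb.
have p10 : {ae mu, forall x, 0 <= 1 * f x + af x}.
  by apply: aeW => x; have := ler_norm (- f x); rewrite normrN /af; lra.
have p20 : {ae mu, forall x, 0 <= -1 * f x + af x}.
  by apply: aeW => x; rewrite mulN1r addrC subr_ge0 ler_norm.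
have l1 := res_lin hS hR 1 l0 pf paf; have l2 := res_lin hS hR (-1) l0 pf paf.
have absG : {ae mu, forall x, `|G lam f x| <= G lam af x}.
  apply: filterS2 (filterI (Gmono _ p1 p10) (Gmono _ p2 p20)) (filterI l1 l2) => x [a b] [k1 k2].
  by rewrite ler_norml; move: a b; rewrite k1 k2; lra.
have RG s g : P g -> \int[mu]_x G lam (fun x => s * f x + g x) x = s * \int[mu]_x G lam f x + \int[mu]_x G lam g x.
  move=> pg; rewrite -RintZ// -RintD//; [|exact: IgZ|exact: (res_I hR l0 pg)].
  apply: ae_Rint; [exact: Ig_mf (res_I hR l0 (Lp_comb s pf pg))|exact: Ig_mf (IgD (IgZ s Gf) (res_I hR l0 pg))|].
  by apply: filterS (res_lin hS hR s l0 pf pg) => x h' _.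
have m1 := res_mass hS hC hM hR l0 p1 p10; have m2 := res_mass hS hC hM hR l0 p2 p20.
rewrite RG// RintD// ?RintZ// in m1; last exact: IgZ.
rewrite RG// RintD// ?RintZ// in m2; last exact: IgZ.
have GyI : 0 <= \int[mu]_x G lam y x by apply: Rint_ge0 => //; exact: Ig_mf Gy.
have uI2 : \int[mu]_x u x = \int[mu]_x G lam f x + c * \int[mu]_x G lam y x.
  rewrite -RintZ// -RintD//; last exact: IgZ.
  by apply: ae_Rint; [exact: Ig_mf uI|exact: Ig_mf (IgD Gf (IgZ c Gy))|apply: filterS uE => x h' _].
have cG : lam * (`|c| * \int[mu]_x G lam y x) <= \int[mu]_x af x - lam * \int[mu]_x G lam af x.
  rewrite -[X in `|c| * X](ger0_norm GyI) -normrM -[X in X * _](gtr0_norm l0) -normrM.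
  move: fu; rewrite uI2 => fu; rewrite ler_norml.
  move: m1 m2 fu; move: (\int[mu]_x f x) (\int[mu]_x G lam f x) (\int[mu]_x af x) (\int[mu]_x G lam af x).
  by move: (c * _) => p a b a' b' m1 m2 fu; apply/andP; split; move: m1 m2 fu; lra.
have nu : lam * nrm u <= nrm f.
  have : nrm u <= \int[mu]_x G lam af x + `|c| * \int[mu]_x G lam y x.
    rewrite -RintZ// -RintD//; last exact: IgZ.
    apply: Rint_le; [exact: Ig_abs|by apply: IgD => //; exact: IgZ|].
    apply: filterS2 (filterI uE absG) Gy0 => x [-> a] b.
    by rewrite (le_trans (ler_normD _ _))// lerD// normrM (ger0_norm b).
  move=> /(ler_wpM2l (ltW l0)) /le_trans; apply.
  by rewrite mulrDr -lerBrDl; exact: cG.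
have -> : nrm (fun x => u x - h * w x) = h * nrm f.
  rewrite -{2}(gtr0_norm h0) -nrmZ//; apply: eq_Rintegral => x _; congr `|_|.
  by rewrite /f /lam; field; rewrite gt_eqF.
by rewrite -ler_pdivrMl.
Qed.

(** If [G y] had integral 0 it would vanish, and so would [y], whose integral is 1. The mass balance
    can thus be solved by division. *)
Lemma resolvent_profile_gt0 lam : 0 < lam -> 0 < \int[mu]_x G lam y x.
Proof.
move=> l0; have py := iffRL (LpT mu _) yI; have Gy := res_I hR l0 py.
have Gy0 := res_ge0 hS hC hM hR l0 py y0.
rewrite lt_neqAle Rint_ge0 ?andbT//; last exact: Ig_mf Gy.
apply/negP => /eqP /esym e0; have e1 : \int[mu]_x G lam y x <= 0 by rewrite e0.
have z : {ae mu, forall x, G lam y x = 0} by apply: filterS (Rint_ge0_eq0 Gy Gy0 e1) => x; exact.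
have h := res_gen hR l0 py; have p0 := Lp0 mu setT.
have pmy : P (fun x => (-1) * y x) by exact: LpZ.
have := sg_gen_0 hS (sg_gen_ext hS h p0 pmy z _) => hz.
have {}hz : {ae mu, forall x, -1 * y x = 0} by apply: hz; apply: filterS z => x ->; ring.
have : \int[mu]_x y x = \int[mu]_x (0 : R).
  apply: ae_Rint; [exact: Ig_mf yI|exact: measurable_cst|].
  by apply: filterS hz => x /eqP; rewrite mulN1r oppr_eq0 => /eqP.
by rewrite y1 Rint0 => /eqP; rewrite oner_eq0.
Qed.

Lemma refeed_generates : exists2 S', C0_semigroup mu setT S' & extends refeed (sg_generator mu setT S').
Proof.
have py := iffRL (LpT mu _) yI.
apply: lumer_phillips.
- by move=> u w [wI [w0 /gen_Ig[uI _] _]].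
- move=> u w u' w' [wI [w0 uw0 wE]] u'I w'I uu ww; split=> //; exists w0.
    have [_ p0 _] := uw0; apply: (sg_gen_ext hS uw0) => //; [exact/LpT|exact: aeW].
  by apply: filterS2 ww wE => x <- ->.
- move=> a u w v z [wI [w0 uw0 wE]] [zI [z0 vz0 zE]]; split; first exact: (IgD (IgZ a wI) zI).
  exists (fun x => a * w0 x + z0 x); first exact: sg_gen_comb.
  have [_ w0I] := gen_Ig uw0; have [_ z0I] := gen_Ig vz0.
  by rewrite RintD// ?RintZ//; [|exact: IgZ]; apply: filterS2 wE zE => x -> ->; ring.
- exact: refeed_dissipative.
- move=> f h fI h0; have l0 : 0 < h^-1 by rewrite invr_gt0.
  set lam := h^-1 in l0; have yp := resolvent_profile_gt0 l0.
  pose g x := lam * f x; have gI : Ig g := IgZ lam fI; have pg := iffRL (LpT _ _) gI.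
  (* Solves the mass balance [lam * int u = int g] for [u = G (c y + g)]; the image of [u] under the
     old generator then has integral [- c], and the new one puts [c y] back. *)
  pose c := (\int[mu]_x g x - lam * \int[mu]_x G lam g x) / (lam * \int[mu]_x G lam y x).
  have pq : P (fun x => c * y x + g x) by exact: Lp_comb.
  pose u := G lam (fun x => c * y x + g x); have hg := res_gen hR l0 pq.
  have [uI w0I] := gen_Ig hg; exists u, (fun x => lam * u x - g x).
  have Gg := res_I hR l0 pg; have Gy := res_I hR l0 py.
  have ue := res_lin hS hR c l0 py pg.
  have um : lam * \int[mu]_x u x = \int[mu]_x g x.
    have -> : \int[mu]_x u x = c * \int[mu]_x G lam y x + \int[mu]_x G lam g x.
      rewrite -RintZ// -RintD//; last exact: IgZ.
      by apply: ae_Rint; [exact: Ig_mf uI|exact: Ig_mf (IgD (IgZ c Gy) Gg)|apply: filterS ue => x h' _].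
    by rewrite /c; field; rewrite !gt_eqF.
  split; last by apply: aeW => x; rewrite /g /lam; field; rewrite gt_eqF.
  split; first exact: (IgB (IgZ lam uI) gI).
  exists (fun x => lam * u x - (c * y x + g x)) => //.
  have -> : \int[mu]_x (lam * u x - (c * y x + g x)) = - c.
    rewrite RintB; [|exact: IgZ|exact: (IgD (IgZ c yI) gI)].
    have -> : \int[mu]_x (c * y x + g x) = c + \int[mu]_x g x.
      by rewrite RintD//; [rewrite RintZ// y1 mulr1|exact: IgZ].
    by rewrite RintZ// um; ring.
  by apply: aeW => x; ring.
- move=> f e fI e0; have [u [w0 [uw0 fu]]] := dense fI e0; have [_ w0I] := gen_Ig uw0.
  exists u, (fun x => w0 x - (\int[mu]_z w0 z) * y x); split=> //; split.
    exact: (IgB w0I (IgZ _ yI)).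
  by exists w0 => //; apply: aeW.
Qed.

End mass_conservation.

(** * The dual of L1 and a density criterion *)

Section diffusion_operator.
Context {R : realType} {d : nat} (mu : {measure set 'rV[R]_d -> \bar R})
  (b : 'rV[R]_d -> 'rV[R]_d) (hmu : ibp_measure mu b).
Local Notation T := 'rV[R]_d.
Local Notation nrm := (nrm mu).
Local Notation Ig := (Ig mu).
Local Notation id1 := (fun _ : T => 1%:M : 'M[R]_d).
Local Notation cut n := (@cutoff R d n%:R).
Local Notation C n := (@cube R d n.+1%:R).
Implicit Types (u v f w : T -> R) (V W : set T).

Section L1_duality.
Implicit Types (g h : T -> R).

Lemma L2_complete (f_ : nat -> T -> R) : (forall n, L2 mu (f_ n)) ->
  (forall e : R, 0 < e -> exists N, forall n m, (N <= n)%N -> (N <= m)%N ->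
    \int[mu]_x (f_ n x - f_ m x) ^+ 2 <= e) ->
  exists f, L2 mu f /\ Cv0 mu (fun n x => (f_ n x - f x) ^+ 2).
Proof.
move=> hf cau.
have [G [mG cG]] : exists G : T -> unit -> R, (forall i, meas (fun x => G x i)) /\
    Cv0 mu (fun n x => (f_ n x - G x tt) ^+ 2).
  apply: (@riesz_fischer R _ T mu unit (fun n x _ => f_ n x) (fun x xi => xi tt ^+ 2)).
  - by move=> n _; case: (hf n).
  - by move=> x xi; exact: sqr_ge0.
  - by move=> H mH; exact: measurable_funX.
  - move=> x; exists 1 => xi k [] h; rewrite mul1r -(@ler_pXn2r _ 2)// ?nnegrE ?exprn_ge0//.
    rewrite real_normK ?num_real// (le_trans h)// -exprM mulnC exprM expr2 -invfM.
    by rewrite (_ : 2 * 2 = 4 :> R)//; lra.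
  - by move=> x xi xi0 h; rewrite expr2; under eq_fun do rewrite expr2; apply: cvgM; exact: h.
  - move=> e /cau[N hN]; exists N => n m Nn Nm; have [_ i] := L2B (hf n) (hf m).
    have := Rint_fineE i; under eq_integral do rewrite ger0_norm ?sqr_ge0//.
    under eq_Rintegral do rewrite ger0_norm ?sqr_ge0//.
    by move=> ->; rewrite lee_fin; exact: hN.
pose g x := G x tt; exists g; split; last exact: cG.
have [N hN] := Cv0_small cG ltr01; have [i _] := hN N (leqnn _).
have Lg : L2 mu (fun x => f_ N x - g x).
  by split=> //; apply: measurable_funB; [case: (hf N)|exact: mG].
by have := L2B (hf N) Lg; congr L2; apply/funext => x; rewrite opprB addrC subrK.
Qed.

(** The functional [u |-> l (cut n * u)] is bounded on L2 and represented by some [h_ n] there. The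
    bound [K] follows by testing with [(|h_ n| - K)^+] times the sign of [h_ n]; the [h_ n] agree on
    cubes and are glued by [cubes_patch]. *)
Lemma L1_dual (l : (T -> R) -> R) (K : R) : 0 <= K ->
  (forall a f g, Ig f -> Ig g -> l (fun x => a * f x + g x) = a * l f + l g) ->
  (forall f, Ig f -> `|l f| <= K * nrm f) ->
  exists h, [/\ meas h, {ae mu, forall x, `|h x| <= K} &
    forall f, Ig f -> l f = \int[mu]_x (f x * h x)].
Proof.
move=> K0 lL lK.
have Icut n u : L2 mu u -> Ig (fun x => cut n x * u x).
  by move=> hu; exact: (L2_mul (L2_test hmu (@cutoff_test R d n%:R)) hu).
have Labs u : L2 mu u -> L2 mu (fun x => `|u x|).
  move=> [mu_ iu]; split; first exact: measurableT_comp.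
  by under eq_fun do rewrite real_normK ?num_real//.
have /choice[h_ hh] : forall n : nat, exists h, L2 mu h /\ forall u, L2 mu u ->
    \int[mu]_x (h x * u x) = l (fun x => cut n x * u x).
  move=> n; have Lc := L2_test hmu (@cutoff_test R d n%:R).
  have [||||||||h Lh hl] := @riesz R _ (L2 mu) (fun a u v x => a * u x + v x)
    (fun u v => \int[mu]_x (u x * v x)) (fun u => l (fun x => cut n x * u x)).
  - by move=> a u v hu hv; exact: (L2D (L2Z a hu) hv).
  - by move=> u v _ _; apply: eq_Rintegral => x _; rewrite mulrC.
  - move=> a u v w hu hv hw; rewrite -(RintZ _ (L2_mul hu hw)) -(RintD (IgZ _ (L2_mul hu hw)) (L2_mul hv hw)).
    by apply: eq_Rintegral => x _; ring.
  - move=> u [mfu _]; apply: Rint_ge0; last exact: measurable_funM.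
    by apply: aeW => x; rewrite -expr2 sqr_ge0.
  - move=> a u v hu hv; rewrite -lL; [|exact: Icut|exact: Icut].
    by congr l; apply/funext => x; ring.
  - exists (fun=> 0); split; first exact: measurable_cst.
    by under eq_fun do rewrite expr0n; exact: Ig0.
  - exists (K ^+ 2 * \int[mu]_x (cut n x ^+ 2)) => [|u hu].
      rewrite mulr_ge0 ?sqr_ge0//; apply: Rint_ge0; first by apply: aeW => x; exact: sqr_ge0.
      by apply: measurable_funX; case: Lc.
    have Lu := Labs _ hu.
    apply: (@le_trans _ _ (K ^+ 2 * (\int[mu]_x (cut n x * `|u x|)) ^+ 2)).
      rewrite -exprMn -(real_normK (num_real (l _))) lerXn2r ?nnegrE//.
        rewrite mulr_ge0//; apply: Rint_ge0; last exact: Ig_mf (Icut n _ Lu).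
        by apply: aeW => x; rewrite mulr_ge0 ?cutoff_ge0.
      rewrite (le_trans (lK _ (Icut n _ hu)))// ler_wpM2l//; apply: eq_lerW.
      by apply: eq_Rintegral => x _; rewrite normrM ger0_norm ?cutoff_ge0.
    rewrite -mulrA ler_wpM2l ?sqr_ge0// (le_trans (Rint_CS Lc Lu))//.
    apply: eq_lerW; congr (_ * _).
    by apply: eq_Rintegral => x _; rewrite real_normK ?num_real// expr2.
  - move=> u_ hu cau; have [|w [Lw cw]] := L2_complete hu.
      move=> e /cau[N hN]; exists N => i j Ni Nj; rewrite (le_trans _ (hN i j Ni Nj))//.
      by apply: eq_lerW; apply: eq_Rintegral => x _; ring.
    exists w => // e e0; have [N hN] := Cv0_small cw e0; exists N => i /hN[_ /ltW].
    rewrite -[X in _ -> X <= _](_ : \int[mu]_x `|(u_ i x - w x) ^+ 2| = _)//.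
    by apply: eq_Rintegral => x _; rewrite ger0_norm ?sqr_ge0//; ring.
  - by exists h; split.
have Lh n : L2 mu (h_ n) := (hh n).1; have mh n : meas (h_ n) by case: (Lh n).
have hK n : {ae mu, forall x, `|h_ n x| <= K}.
  pose w x := Num.max (`|h_ n x| - K) 0; pose u x := w x * (h_ n x * (`|h_ n x|)^-1).
  have w0 x : 0 <= w x by rewrite /w le_max lexx orbT.
  have mw : meas w.
    by apply: measurable_maxr => //; apply: measurable_funB => //; exact: measurableT_comp.
  have wle x : w x <= `|h_ n x| by rewrite /w ge_max normr_ge0 andbT lerBlDr lerDl.
  have sle x : `|h_ n x * (`|h_ n x|)^-1| <= 1.
    have [->|h0] := eqVneq (h_ n x) 0; first by rewrite mul0r normr0.
    by rewrite normrM normfV normr_id divff ?normr_eq0.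
  have mu_ : meas u.
    apply: measurable_funM => //; apply: measurable_funM => //.
    by apply: measurable_fun_invr; exact: measurableT_comp.
  have Lw : L2 mu w.
    by apply: (L2_le mw (Lh n)); apply: aeW => x; rewrite ger0_norm.
  have Lu : L2 mu u.
    apply: (L2_le mu_ Lw); apply: aeW => x; rewrite normrM ler_piMr//.
  have E1 x : h_ n x * u x = `|h_ n x| * w x.
    rewrite /u; have [->|h0] := eqVneq (h_ n x) 0; first by rewrite normr0 !mul0r.
    have : `|h_ n x| != 0 by rewrite normr_eq0.
    move=> h1; have sq : h_ n x * h_ n x = `|h_ n x| * `|h_ n x|.
      by rewrite -!expr2 real_normK ?num_real.
    by rewrite mulrCA [h_ n x * (_ * _)]mulrA sq mulfK// mulrC.
  have I1 := L2_mul (Labs _ (Lh n)) Lw; have I2 := IgZ K (Icut n _ Lw).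
  have z : \int[mu]_x (w x ^+ 2) <= 0.
    apply: (@le_trans _ _ (\int[mu]_x (`|h_ n x| * w x - K * (cut n x * w x)))).
      apply: Rint_le; [by case: Lw|exact: IgB|apply: aeW => x].
      have c1 : cut n x * w x <= w x by rewrite ler_piMl// cutoff_le1.
      have c2 : K * (cut n x * w x) <= K * w x by rewrite ler_wpM2l.
      rewrite lerBrDr (le_trans (lerD (lexx _) c2))//.
      have [h0|h0] := leP (`|h_ n x| - K) 0; first by rewrite /w max_r// expr0n mulr0 addr0 mulr0.
      by rewrite /w max_l ?(ltW h0)// expr2 -mulrDl subrK.
    rewrite RintB// (RintZ _ (Icut n _ Lw)) subr_le0.
    under eq_Rintegral do rewrite -E1.
    rewrite (hh n).2// (le_trans (ler_norm _))// (le_trans (lK _ (Icut n _ Lu)))// ler_wpM2l//.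
    apply: Rint_le; [exact/Ig_abs/Icut|exact: Icut|apply: aeW => x].
    rewrite normrM ger0_norm ?cutoff_ge0// ler_wpM2l ?cutoff_ge0// normrM ger0_norm// ler_piMr//.
  apply: filterS (Rint_ge0_eq0 Lw.2 (aeW _ (fun x => sqr_ge0 (w x))) z) => x /(_ I)/eqP.
  rewrite sqrf_eq0 /w => /eqP h0; rewrite -subr_le0 -[leRHS]h0 le_max lexx//.
(* Both sides represent the functional [u |-> l (cut n * cut m * u)]. *)
have comp n m : {ae mu, forall x, cut m x * h_ n x = cut n x * h_ m x}.
  have Lc k u : L2 mu u -> L2 mu (fun x => cut k x * u x).
    have ct := @cutoff_test R d k%:R; have [Kc hKc] := test_bounded ct.
    exact: (L2_mul_bounded (test_mf ct) hKc).
  pose D x := cut m x * h_ n x - cut n x * h_ m x.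
  have LD : L2 mu D := L2B (Lc m _ (Lh n)) (Lc n _ (Lh m)).
  have z : \int[mu]_x (D x ^+ 2) = 0.
    have -> : \int[mu]_x (D x ^+ 2) = \int[mu]_x (h_ n x * (cut m x * D x)) - \int[mu]_x (h_ m x * (cut n x * D x)).
      rewrite -RintB; [|exact: (L2_mul (Lh _) (Lc _ _ LD))|exact: (L2_mul (Lh _) (Lc _ _ LD))].
      by apply: eq_Rintegral => x _; rewrite /D; ring.
    rewrite (hh n).2 ?(hh m).2; [|exact: Lc|exact: Lc].
    by apply/eqP; rewrite subr_eq0; apply/eqP; congr l; apply/funext => x; ring.
  have := Rint_ge0_eq0 LD.2 (aeW _ (fun x => sqr_ge0 (D x))); rewrite z lexx => /(_ isT).
  by apply: filterS => x /(_ I)/eqP; rewrite sqrf_eq0 subr_eq0 => /eqP.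
have [||h [mfh hE]] := @cubes_patch _ _ mu (fun n => h_ n.+1).
- by move=> n; exact: mh.
- move=> n; apply: filterS (comp n.+1 n.+2) => x e xn.
  rewrite (cut1 xn) mul1r in e; rewrite -e cut1 ?mul1r//.
  by apply: cubeS xn; rewrite ler_nat.
have hb : {ae mu, forall x, `|h x| <= K}.
  apply: ae_cubes => n; apply: filterS2 (hE n) (hK n.+1) => x e1 e2 xn.
  by rewrite e1.
exists h; split=> // f hf.
have mf := Ig_mf hf.
pose f_ n x := cut n x * trunc n%:R (f x).
have mt n : meas (fun x => trunc n%:R (f x)).
  apply: (measurableT_comp (f := trunc n%:R)) mf.
  exact: continuous_measurable_fun (smooth1_cont (@trunc_smooth R n%:R)).
have bf n : bcs (f_ n).
  apply: (bcs_mul (bcs_test (@cutoff_test R d n%:R)) (mt n) (K := n%:R + 2)) => x.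
  exact: trunc_le.
have Lf n : L2 mu (f_ n) := L2_bcs hmu (bf n).
have If n : Ig (f_ n) := Ig_bcs hmu (bf n).
have outf n x : ~ C n x -> f_ n x = 0.
  by move=> xn; rewrite /f_ cutoff_out ?mul0r//; rewrite natr1.
have lf n : l (f_ n) = \int[mu]_x (f_ n x * h x).
  have -> : f_ n = (fun x => cut n.+1 x * f_ n x).
    apply/funext => x; have [xn|/outf ->] := pselect (C n x); last by rewrite mulr0.
    by rewrite cut1// mul1r.
  rewrite -(hh n.+1).2//; apply: ae_Rint.
  - by apply: measurable_funM => //; case: (Lf n).
  - by do 2?apply: measurable_funM => //; [exact: test_mf (@cutoff_test R d n.+1%:R)|case: (Lf n)].
  - apply: filterS (hE n) => x e _; have [xn|/outf ->] := pselect (C n x).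
      by rewrite e// cut1// mul1r mulrC.
    by rewrite !mulr0 mul0r.
have cf : Cv0 mu (fun n x => f_ n x - f x).
  apply: (Cv0_dct (h := fun x => 2 * `|f x|)).
  - by move=> n; apply: measurable_funB => //; case: (Lf n).
  - exact/IgZ/Ig_abs.
  - move=> n; apply: aeW => x; rewrite (le_trans (ler_normB _ _))// mulrDl mul1r lerD2r.
    rewrite normrM ger0_norm ?cutoff_ge0// (le_trans _ (trunc_le_abs n%:R (f x)))//.
    by rewrite ler_piMl// cutoff_le1.
  - apply: aeW => x; have [N xN] := mem_cube x; apply: cvg_near_cst.
    exists (maxn N (Num.bound `|f x|)) => // n /=; rewrite geq_max => /andP[Nn fn].
    have xn i : `|x ord0 i| <= n%:R by rewrite ltW// (lt_le_trans (xN i))// ler_nat.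
    rewrite /f_ (cutoff1 xn) mul1r trunc_id ?subrr//.
    rewrite (le_trans (ltW (archi_boundP (normr_ge0 _))))// (@le_trans _ _ n%:R) ?ler_nat//.
    by rewrite lerDl.
have Ifh g : Ig g -> Ig (fun x => g x * h x).
  move=> ig; apply: (Ig_le _ (IgZ K ig)); first by apply: measurable_funM => //; exact: Ig_mf ig.
  by apply: filterS hb => x e; rewrite !normrM mulrC ler_wpM2r// (le_trans e)// ler_norm.
apply/eqP; rewrite -subr_eq0 -normr_eq0 eq_le normr_ge0 andbT.
apply/ler_addgt0Pr => e e0; rewrite add0r.
have k1 : 0 < 2 * K + 1 by rewrite ltr_wpDl// mulr_ge0.
have /(Cv0_nrm (fun n => IgB (If n) hf)) /(_ (e / (2 * K + 1)))[|N hN] := cf; first by rewrite divr_gt0.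
have hn := hN N (leqnn N).
have dI := IgB (If N) hf.
have E : l f - \int[mu]_x (f x * h x) = - l (fun x => f_ N x - f x) + \int[mu]_x ((f_ N x - f x) * h x).
  have -> : (fun x => f_ N x - f x) = (fun x => -1 * f x + f_ N x) by apply/funext => x; ring.
  rewrite lL// lf.
  have -> : \int[mu]_x ((f_ N x - f x) * h x) = \int[mu]_x (f_ N x * h x) - \int[mu]_x (f x * h x).
    rewrite -RintB; [|exact: Ifh|exact: Ifh].
    by apply: eq_Rintegral => x _; ring.
  by ring.
rewrite E (le_trans (ler_normD _ _))// normrN.
have b2 : `|\int[mu]_x ((f_ N x - f x) * h x)| <= K * nrm (fun x => f_ N x - f x).
  rewrite (le_trans (Rint_abs_le (Ifh _ dI)))// -RintZ; last exact: Ig_abs.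
  apply: Rint_le; [exact/Ig_abs/Ifh|exact/IgZ/Ig_abs|].
  by apply: filterS hb => x hx; rewrite normrM mulrC ler_wpM2r.
rewrite (le_trans (lerD (lK _ dI) b2))//.
have n0 := nrm_ge0 dI; rewrite ler_pdivlMr// in hn; nra.
Qed.

(** A function at positive distance from the subspace is separated from it by [hahn_banach], and the
    separating functional is a bounded function that annihilates [W]. *)
Lemma L1_dense (W : set (T -> R)) : (forall w, W w -> Ig w) -> (exists w, W w) ->
  (forall a u v, W u -> W v -> W (fun x => a * u x + v x)) ->
  (forall h, meas h -> ess_bounded mu h ->
    (forall w, W w -> \int[mu]_x (w x * h x) = 0) -> {ae mu, forall x, h x = 0}) ->
  forall f, Ig f -> forall e : R, 0 < e -> exists2 w, W w & nrm (fun x => f x - w x) < e.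
Proof.
move=> WI W0 Wc hW f hf e e0; apply: contrapT => hn.
have hd w : W w -> e <= nrm (fun x => f x - w x).
  by move=> hw; rewrite leNgt; apply/negP => h; apply: hn; exists w.
have [l [lL lb lW lf]] := hahn_banach WI W0 Wc hf (ltW e0) hd.
have [||h [mfh hb lE]] := @L1_dual l 1 _ lL; first by [].
  by move=> g hg; rewrite mul1r; exact: lb.
have h0 := hW h mfh (ex_intro _ 1 hb) (fun w hw => etrans (esym (lE w (WI w hw))) (lW w hw)).
move: lf; rewrite lE// => z; move: e0; rewrite -z.
have -> : \int[mu]_x (f x * h x) = \int[mu]_x ((fun=> 0 : R) x).
  apply: ae_Rint; [by apply: measurable_funM => //; exact: Ig_mf hf|exact: measurable_cst|].
  by apply: filterS h0 => x ->; rewrite mulr0.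
by rewrite Rint0 ltxx.
Qed.

Lemma test_dense_L1 f : Ig f -> forall e : R, 0 < e ->
  exists2 w, test_fun setT w & nrm (fun x => f x - w x) < e.
Proof.
apply: L1_dense.
- by move=> w hw; exact: (Ig_test hmu hw).
- by exists (cut 0); exact: cutoff_test.
- by move=> a u v hu hv; apply: testD => //; exact: testZ.
- move=> h mfh [M hM] hW.
  have : h = (fun=> 0) %[ae mu].
    apply: test_separates => // [r|eta te].
      have it := Ig_test hmu (@cutoff_test R d r).
      apply: (Ig_le _ (IgZ M it)); first by apply: measurable_funM => //; exact: Ig_mf it.
      by apply: filterS hM => x e; rewrite !normrM ler_wpM2r// (le_trans e)// ler_norm.
    by under eq_Rintegral do rewrite mulrC; exact: hW.
  by apply: filterS => x; exact.
Qed.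

End L1_duality.

Variables (A : T -> 'M[R]_d) (eA : elliptic A).
Local Notation q x xi := (bilin (A x) xi xi).
Implicit Types (g h : T -> T).

(** * Resolvents and weak regularity in the form domain *)

Section form_domain.
Variable V : set T.
Local Notation H := (HA mu A V).

(** The inner product of the form domain, on pairs of a function and a gradient, so that no choice
    of gradient is involved. *)
Definition E1 u g v h : R := energy mu A g h + \int[mu]_x (u x * v x).

Lemma HA_comb a u g v h : H u g -> H v h -> H (fun x => a * u x + v x) (fun x => a *: g x + h x).
Proof. by move=> hu hv; apply: (HAD eA (HAZ a hu) hv). Qed.

Lemma HA_bilin u g v h : H u g -> H v h -> Ig (fun x => bilin (A x) (g x) (h x)).
Proof.
move=> hu hv; have [_ mg _] := hu; have [_ mh _] := hv.
exact: (Ig_bilin eA mg mh (HA_Ig_q hmu eA hu) (HA_Ig_q hmu eA hv)).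
Qed.

Lemma HA_prod u g v h : H u g -> H v h -> Ig (fun x => u x * v x).
Proof. by move=> hu hv; exact: (L2_mul (HA_L2 hmu hu) (HA_L2 hmu hv)). Qed.

Lemma energyC g h : energy mu A g h = energy mu A h g.
Proof. by congr (_ * _); apply: eq_Rintegral => x _; exact: (qC eA). Qed.

Lemma energyL a u g v h w k : H u g -> H v h -> H w k ->
  energy mu A (fun x => a *: g x + h x) k = a * energy mu A g k + energy mu A h k.
Proof.
move=> hu hv hw; have i1 := HA_bilin hu hw; have i2 := HA_bilin hv hw; rewrite /energy.
have -> : \int[mu]_x bilin (A x) (a *: g x + h x) (k x) =
    \int[mu]_x (a * bilin (A x) (g x) (k x) + bilin (A x) (h x) (k x)).
  by apply: eq_Rintegral => x _; rewrite bilinDl bilinZl.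
rewrite RintD//; last exact: IgZ.
by rewrite RintZ// mulrDr mulrCA.
Qed.

Lemma E1C u g v h : E1 u g v h = E1 v h u g.
Proof. by rewrite /E1 energyC; congr (_ + _); apply: eq_Rintegral => x _; rewrite mulrC. Qed.

Lemma E1L a u g v h w k : H u g -> H v h -> H w k ->
  E1 (fun x => a * u x + v x) (fun x => a *: g x + h x) w k = a * E1 u g w k + E1 v h w k.
Proof.
move=> hu hv hw; have i1 := HA_prod hu hw; have i2 := HA_prod hv hw; rewrite /E1 (energyL _ hu hv hw).
have -> : \int[mu]_x ((a * u x + v x) * w x) = \int[mu]_x (a * (u x * w x) + v x * w x).
  by apply: eq_Rintegral => x _; ring.
rewrite RintD//; last exact: IgZ.
by rewrite RintZ//; ring.
Qed.

Lemma energy_ge0 g : mfield g -> 0 <= energy mu A g g.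
Proof.
move=> mg; rewrite mulr_ge0// Rint_ge0//; last exact: (mf_q eA).
by apply: aeW => x; exact: (q_ge0 eA).
Qed.

Lemma E1_ge0 u g : H u g -> 0 <= E1 u g u g.
Proof.
move=> hu; have [mfu mg _] := hu; rewrite addr_ge0 ?energy_ge0// Rint_ge0//.
  by apply: aeW => x; rewrite -expr2 sqr_ge0.
exact: measurable_funM.
Qed.

Lemma HA_riesz (l : (T -> R) -> (T -> T) -> R) :
  (forall a u g v h, H u g -> H v h ->
    l (fun x => a * u x + v x) (fun x => a *: g x + h x) = a * l u g + l v h) ->
  (exists2 C : R, 0 <= C & forall u g, H u g -> l u g ^+ 2 <= C * E1 u g u g) ->
  exists w k, H w k /\ forall v h, H v h -> E1 w k v h = l v h.
Proof.
move=> lL [C C0 hC].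
pose comb a (p r : (T -> R) * (T -> T)) := ((fun x => a * p.1 x + r.1 x), (fun x => a *: p.2 x + r.2 x)).
have [||||||||[w k] hw hl] := @riesz R _ (fun p : (T -> R) * (T -> T) => H p.1 p.2) comb
  (fun p r => E1 p.1 p.2 r.1 r.2) (fun p => l p.1 p.2).
- by move=> a u v hu hv; exact: HA_comb.
- by move=> u v _ _; exact: E1C.
- by move=> a u v w hu hv hw; exact: E1L.
- by move=> u; exact: E1_ge0.
- by move=> a u v; exact: lL.
- by exists ((fun=> 0), (fun=> 0)); exact: HA_zero.
- by exists C => // u; exact: hC.
- move=> u_ hu cau.
  have le1 u g : H u g -> \int[mu]_x (u x ^+ 2) <= E1 u g u g /\ \int[mu]_x q x (g x) <= 2 * E1 u g u g.
    move=> hug; have [mfu mg _] := hug; have h1 := energy_ge0 mg.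
    have h2 : 0 <= \int[mu]_x (u x ^+ 2).
      by apply: Rint_ge0; [apply: aeW => x; exact: sqr_ge0|exact: measurable_funX].
    rewrite /E1; under [X in energy _ _ _ _ + X]eq_Rintegral do rewrite -expr2.
    by move: h1; rewrite /energy; split; lra.
  have hd n m : H (fun x => -1 * (u_ m).1 x + (u_ n).1 x) (fun x => -1 *: (u_ m).2 x + (u_ n).2 x).
    exact: HA_comb.
  have [|w [k [hw cw ck]]] := @HA_complete _ _ _ _ hmu A eA V (fun n => (u_ n).1) (fun n => (u_ n).2) hu.
    move=> eps eps0; have [|N hN] := cau (eps / 2); first by rewrite divr_gt0.
    exists N => n m Nn Nm; have [h1 h2] := le1 _ _ (hd n m); have h3 := hN n m Nn Nm.
    have -> : \int[mu]_x ((u_ n).1 x - (u_ m).1 x) ^+ 2 = \int[mu]_x ((-1 * (u_ m).1 x + (u_ n).1 x) ^+ 2).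
      by apply: eq_Rintegral => x _; rewrite mulN1r addrC.
    have -> : \int[mu]_x q x ((u_ n).2 x - (u_ m).2 x) = \int[mu]_x q x (-1 *: (u_ m).2 x + (u_ n).2 x).
      by apply: eq_Rintegral => x _; rewrite scaleN1r addrC.
    by split; [apply: (le_trans h1)|apply: (le_trans h2)]; move: h3; rewrite /comb/=; lra.
  exists (w, k) => // eps eps0.
  have e2 : 0 < eps / 2 by rewrite divr_gt0.
  have [N1 h1] := Cv0_small cw e2; have [N2 h2] := Cv0_small ck e2.
  exists (maxn N1 N2) => n; rewrite geq_max => /andP[/h1[i1 k1] /h2[i2 k2]].
  rewrite /E1 /energy /comb /=.
  have -> : \int[mu]_x bilin (A x) (-1 *: k x + (u_ n).2 x) (-1 *: k x + (u_ n).2 x) =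
      \int[mu]_x `|q x ((u_ n).2 x - k x)|.
    by apply: eq_Rintegral => x _; rewrite scaleN1r addrC ger0_norm// (q_ge0 eA).
  have -> : \int[mu]_x ((-1 * w x + (u_ n).1 x) * (-1 * w x + (u_ n).1 x)) =
      \int[mu]_x `|((u_ n).1 x - w x) ^+ 2|.
    by apply: eq_Rintegral => x _; rewrite mulN1r addrC ger0_norm ?sqr_ge0// expr2.
  have k0 : 0 <= \int[mu]_x `|q x ((u_ n).2 x - k x)| by apply: Rint_ge0; [exact: aeW|exact: measurableT_comp (Ig_mf i2)].
  by move: k0 k1 k2; set p := Rintegral _ _ _; set r := Rintegral _ _ _; lra.
- exists w, k; split; first exact: hw.
  by move=> v h hv; exact: (hl (v, h) hv).
Qed.

Lemma resolvent_exists f : L2 mu f -> exists u g, gen mu A V u g (fun x => u x - f x).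
Proof.
move=> hf; have [||w [k [hw hl]]] := @HA_riesz (fun v _ => \int[mu]_x (f x * v x)).
- move=> a u g v h hu hv; have Lu := HA_L2 hmu hu; have Lv := HA_L2 hmu hv.
  rewrite -RintZ; last exact: L2_mul.
  rewrite -RintD; [|by apply: IgZ; exact: L2_mul|exact: L2_mul].
  by apply: eq_Rintegral => x _; ring.
- exists (\int[mu]_x (f x ^+ 2)) => [|v h hv].
    by apply: Rint_ge0; [apply: aeW => x; exact: sqr_ge0|apply: measurable_funX; case: hf].
  have Lv := HA_L2 hmu hv; have [_ mh _] := hv.
  apply: (le_trans (Rint_CS hf Lv)); rewrite ler_wpM2l//.
    by apply: Rint_ge0; [apply: aeW => x; exact: sqr_ge0|apply: measurable_funX; case: hf].
  by rewrite /E1 [leLHS](_ : _ = \int[mu]_x (v x * v x)) ?lerDr ?energy_ge0//; apply: eq_Rintegral => x _; rewrite expr2.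
exists w, k; have Lw := HA_L2 hmu hw; split; [exact: hw|exact: L2B|move=> v h hv].
have := hl v h hv; have Lv := HA_L2 hmu hv; rewrite /E1.
have -> : \int[mu]_x ((w x - f x) * v x) = \int[mu]_x (w x * v x) - \int[mu]_x (f x * v x).
  by rewrite -RintB; [apply: eq_Rintegral => x _; ring|exact: L2_mul|exact: L2_mul].
lra.
Qed.

Lemma genN u g f : gen mu A V u g f -> gen mu A V (fun x => - u x) (fun x => - g x) (fun x => - f x).
Proof.
move=> [hu hf he]; split; [exact: HAN|exact: L2N|move=> v h hv].
have Lv := HA_L2 hmu hv.
under eq_Rintegral do rewrite mulNr; rewrite RintN; last exact: L2_mul.
rewrite opprK -[RHS]opprK -(he v h hv) /energy -mulrN -RintN; last exact: (HA_bilin hu hv).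
by congr (_ * _); apply: eq_Rintegral => x _; rewrite bilinNl.
Qed.

(** Test with [(u - M)^+]: its energy against [u] is nonnegative, which leaves an integral at most 0
    for the square of this positive part. *)
Lemma resolvent_le u g f (M : R) : 0 <= M -> gen mu A V u g (fun x => u x - f x) ->
  {ae mu, forall x, f x <= M} -> {ae mu, forall x, u x <= M}.
Proof.
move=> M0 [hu hf he] fM; have [mfu mg _] := hu.
have hw := HA_pos hmu eA M0 hu; have Lw := HA_L2 hmu hw.
set w := fun x => Num.max (u x - M) 0 in hw Lw; set k := fun x => _ *: g x in hw.
have [mw mk _] := hw.
have e0 : 0 <= energy mu A g k.
  rewrite mulr_ge0// Rint_ge0//.
    by apply: aeW => x; rewrite /k bilinZr mulr_ge0 ?(q_ge0 eA)//; case: ifP.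
  by apply: mf_bilin => //; exact: ell_mf eA.
have i1 : Ig (fun x => (u x - f x) * w x) by exact: L2_mul.
have [_ i2] := Lw.
have z : \int[mu]_x (w x ^+ 2) <= 0.
  apply: (@le_trans _ _ (\int[mu]_x ((u x - f x) * w x))).
    apply: Rint_le => //; apply: filterS fM => x h; rewrite /w expr2.
    by have [u0|u0] := leP (u x - M) 0; [rewrite !mulr0|rewrite ler_wpM2r ?(ltW u0)// lerB].
  by rewrite -oppr_ge0 -(he _ _ hw).
have := Rint_ge0_eq0 i2 (aeW _ (fun x => sqr_ge0 (w x))) z.
apply: filterS => x /(_ I)/eqP; rewrite sqrf_eq0 /w => /eqP h.
by rewrite -subr_le0 -[leRHS]h le_max lexx.
Qed.

Lemma resolvent_bounded u g f (M : R) : 0 <= M -> gen mu A V u g (fun x => u x - f x) ->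
  {ae mu, forall x, `|f x| <= M} -> {ae mu, forall x, `|u x| <= M}.
Proof.
move=> M0 hu fM.
have h1 : {ae mu, forall x, u x <= M}.
  by apply: (resolvent_le M0 hu); apply: filterS fM => x; rewrite ler_norml => /andP[].
have h2 : {ae mu, forall x, - u x <= M}.
  apply: (@resolvent_le _ (fun x => - g x) (fun x => - f x) _ M0).
    by have := genN hu; congr (gen _ _ _ _ _ _); apply/funext => x; rewrite opprB opprK addrC.
  by apply: filterS fM => x; rewrite ler_norml lerNl => /andP[].
by apply: filterS2 h1 h2 => x k1 k2; rewrite ler_norml lerNl k2.
Qed.

(** A function [h] known only against [(1 - L) u], for bounded [u] in the domain, is identified with
    the Riesz representative [w] of [l]: for bounded square integrable [f] vanishing off [V], the
    resolvent [u = (1 - L)^-1 f] is bounded by the maximum principle and hence admissible, so that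
    [h - w] is orthogonal to [f]. *)
Lemma weak_regularity (h : T -> R) (l : (T -> R) -> (T -> T) -> R) : L2 mu h ->
  {ae mu, forall x, ~ V x -> h x = 0} ->
  (forall a u g v k, H u g -> H v k ->
    l (fun x => a * u x + v x) (fun x => a *: g x + k x) = a * l u g + l v k) ->
  (exists2 C : R, 0 <= C & forall u g, H u g -> l u g ^+ 2 <= C * E1 u g u g) ->
  (forall u g f, gen mu A V u g f -> ess_bounded mu u -> {ae mu, forall x, ~ V x -> f x = 0} ->
    \int[mu]_x ((u x - f x) * h x) = l u g) ->
  exists k, H h k /\ forall v k', H v k' -> E1 h k v k' = l v k'.
Proof.
move=> hh h0 lL lb hl; have [w [k [hw wl]]] := HA_riesz lL lb.
have Lw := HA_L2 hmu hw; have w0 := HA_out hw; have [mw mk _] := hw.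
have [mh _] := hh; have Lhw := L2B hh Lw.
(* Has the sign of [h - w], and is bounded by 1, which makes its resolvent bounded, as well as by
   [|h - w|], which makes it square integrable. *)
pose f x := (h x - w x) / (1 + `|h x - w x|).
have p1 x : 0 < 1 + `|h x - w x| by rewrite ltr_pwDl.
have f1 x : `|f x| <= 1.
  by rewrite normrM normfV (gtr0_norm (p1 x)) ler_pdivrMr// mul1r lerDr.
have fle x : `|f x| <= `|h x - w x|.
  by rewrite normrM normfV (gtr0_norm (p1 x)) ler_pdivrMr// ler_peMr// lerDl.
have mhw : meas (fun x => h x - w x) by exact: measurable_funB.
have mf : meas f.
  apply: measurable_funM => //; apply: measurable_fun_invr.
  by apply: measurable_funD => //; exact: measurableT_comp.
have Lf : L2 mu f by apply: (L2_le mf Lhw); exact: aeW.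
have [u [g hu]] := resolvent_exists Lf; have [hug _ he] := hu; have Lu := HA_L2 hmu hug.
have ub := resolvent_bounded ler01 hu (aeW _ f1).
have e1 : \int[mu]_x (f x * h x) = E1 w k u g.
  rewrite wl// -(hl u g _ hu); last 2 first.
  - by exists 1.
  - apply: filterS2 (filterI h0 w0) (HA_out hug) => x [k1 k2] k3 Vx.
    by rewrite /f k1// k2// k3// !subrr mul0r subr0.
  by apply: eq_Rintegral => x _; rewrite opprB addrC subrK.
have e2 : E1 w k u g = \int[mu]_x (f x * w x).
  rewrite E1C// /E1 (he _ _ hw).
  have -> : \int[mu]_x ((u x - f x) * w x) = \int[mu]_x (u x * w x) - \int[mu]_x (f x * w x).
    by rewrite -RintB; [apply: eq_Rintegral => x _; ring|exact: L2_mul|exact: L2_mul].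
  lra.
have i : Ig (fun x => f x * (h x - w x)) by exact: L2_mul.
have z : \int[mu]_x (f x * (h x - w x)) <= 0.
  under eq_Rintegral do rewrite mulrBr.
  by rewrite RintB ?e1 ?e2 ?subrr//; exact: L2_mul.
have f0 x : 0 <= f x * (h x - w x).
  by rewrite /f mulrAC -expr2 divr_ge0 ?sqr_ge0// ltW.
have hwE : {ae mu, forall x, w x = h x}.
  apply: filterS (Rint_ge0_eq0 i (aeW _ f0) z) => x /(_ I)/eqP.
  rewrite /f mulrAC -expr2 mulf_eq0 invr_eq0 (gt_eqF (p1 x)) orbF sqrf_eq0 subr_eq0.
  by move=> /eqP.
exists k; split; first exact: (HA_ext eA hw mh mk hwE (aeW _ (fun x => erefl _))).
move=> v k' hv; rewrite -(wl _ _ hv) /E1; congr (_ + _).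
have [mv _ _] := hv.
apply: ae_Rint; [exact: measurable_funM|exact: measurable_funM|].
by apply: filterS hwE => x ->.
Qed.

End form_domain.

(** * The operator on test functions *)

Hypothesis lA : forall i j, Hloc mu (fun x => A x i j).

Let a' i j := wgrad mu (fun x => A x i j).
Let la i j : locgrad mu (fun x => A x i j) (a' i j). Proof. exact: (Hloc_locgrad hmu (lA i j)). Qed.

(** The drift [beta^{rho,A}], with [b] in place of [grad rho / rho]. *)
Definition beta x : T :=
  \row_i (2^-1 * \sum_j (wgrad mu (fun y => A y i j) x ord0 j + A x i j * b x ord0 j)).

Lemma ell_bounded (r : R) : exists K : R, forall x i j, cube r x -> `|A x i j| <= K.
Proof.
have [nu nu0 h] := ell_cube eA r; exists nu => x i j xr.
pose e i : T := delta_mx ord0 i.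
have E : A x i j = bilin (A x) (e j) (e i).
  rewrite bilinE (bigD1 i)//= [X in _ + X]big1 ?addr0 => [|k ki].
    rewrite (bigD1 j)//= [X in _ + X]big1 ?addr0 => [|k kj].
      by rewrite !mxE !eqxx !mul1r mulr1.
    by rewrite !mxE !eqxx/= (negbTE kj) mulr0.
  by rewrite big1// => l _; rewrite !mxE eqxx/= (negbTE ki) !mul0r.
have D k : dot (e k) (e k) = 1.
  rewrite dotE (bigD1 k)//= big1 ?addr0 => [|l lk]; first by rewrite !mxE !eqxx mul1r.
  by rewrite !mxE eqxx/= (negbTE lk) mul0r.
rewrite E (le_trans (bilin_le eA x _ _ ltr01))// invr1 !mul1r.
have := (h x (e i) xr).2; have := (h x (e j) xr).2; rewrite !D; lra.
Qed.

Lemma bcs_ell f i j : bcs f -> bcs (fun x => f x * A x i j).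
Proof.
move=> [mf [K fK] [r r0 fr]]; have [L hL] := ell_bounded r.
split; first by apply: measurable_funM => //; exact: ell_mf eA i j.
  exists (`|K| * `|L|) => x; have [xr|/fr ->] := pselect (cube r x); last first.
    by rewrite mul0r normr0 mulr_ge0.
  by rewrite normrM ler_pM// ?(le_trans (fK x)) ?(le_trans (hL x i j xr)) ?ler_norm.
by exists r => // x /fr ->; rewrite mul0r.
Qed.

Lemma L2_sum (I : Type) (s : seq I) (F : I -> T -> R) :
  (forall i, L2 mu (F i)) -> L2 mu (fun x => \sum_(i <- s) F i x).
Proof.
move=> hF; elim: s => [|i s IH].
  under eq_fun do rewrite big_nil; split; first exact: measurable_cst.
  by under eq_fun do rewrite expr0n; exact: Ig0.
by under eq_fun do rewrite big_cons; exact: L2D.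
Qed.

Lemma L2_beta eta i : test_fun setT eta -> L2 mu (fun x => eta x * beta x ord0 i).
Proof.
move=> te.
have -> : (fun x => eta x * beta x ord0 i) = (fun x => 2^-1 * \sum_j (a' i j x ord0 j * eta x + eta x * A x i j * b x ord0 j)).
  apply/funext => x; rewrite mxE mulrCA mulr_sumr; congr (_ * _).
  by apply: eq_bigr => j _; rewrite mulrDr mulrA [eta x * _ in LHS]mulrC.
apply: L2Z; apply: L2_sum => j; apply: L2D; first exact: (locgrad_gradL2 hmu j (la i j) te).
by apply: (bcs_b hmu); apply: bcs_ell; exact: bcs_test te.
Qed.

(** [L^0] on test functions, in non-divergence form. *)
Definition Ltest chi x := 2^-1 * (\sum_i \sum_j A x i j * partial i (partial j chi) x) +
  dot (beta x) (cgrad chi x).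

Lemma L2_second_order chi : test_fun setT chi ->
  L2 mu (fun x => 2^-1 * (\sum_i \sum_j A x i j * partial i (partial j chi) x)).
Proof.
move=> tc; apply: L2Z; apply: L2_sum => i; apply: L2_sum => j.
exact: (locgrad_L2 hmu (la i j) (test_partial i (test_partial j tc))).
Qed.

Lemma L2_Ltest chi : test_fun setT chi -> L2 mu (Ltest chi).
Proof.
move=> tc; apply: L2D; first exact: L2_second_order.
under eq_fun do rewrite dotE; apply: L2_sum => i.
have := L2_beta i (test_partial i tc); congr L2; apply/funext => x.
by rewrite [cgrad _ _ _ _]mxE mulrC.
Qed.

(** Partial integration is applied to each [a_ij d_i chi], an energy function because [a_ij] is one
    locally; the derivatives of [a_ij] together with [b] make up [beta]. *)
Lemma Ltest_energy chi eta : test_fun setT chi -> test_fun setT eta ->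
  energy mu A (cgrad chi) (cgrad eta) = - \int[mu]_x (Ltest chi x * eta x).
Proof.
move=> tc te; have L2e := L2_test hmu te.
pose u i j x := partial i chi x * A x i j.
pose g i j x := partial i chi x *: a' i j x + A x i j *: cgrad (partial i chi) x.
have hu i j : HA mu id1 setT (u i j) (g i j) := locgradP (@elliptic1 R d) (la i j) (test_partial i tc).
have bu i j : bcs (u i j) := bcs_ell i j (bcs_test (test_partial i tc)).
have Lg i j : L2 mu (fun x => g i j x ord0 j).
  have mg : mfield (g i j) by case: (hu i j).
  split; first exact: mg.
  apply: (Ig_le _ (HA_Ig_q hmu (@elliptic1 R d) (hu i j))); first by apply: measurable_funX; exact: mg.
  apply: aeW => x; rewrite !ger0_norm ?sqr_ge0 ?(q_ge0 (@elliptic1 R d))// bilin1; exact: sqr_coord_le.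
have Iu i j : Ig (fun x => u i j x * partial j eta x).
  by apply: L2_mul; [exact: (L2_bcs hmu)|exact: (L2_test hmu (test_partial j te))].
have Ib i j : Ig (fun x => u i j x * b x ord0 j * eta x).
  by apply: L2_mul => //; exact: (bcs_b hmu).
have Ige i j : Ig (fun x => g i j x ord0 j * eta x) by exact: L2_mul.
have E i j : \int[mu]_x (u i j x * partial j eta x) =
    - \int[mu]_x (g i j x ord0 j * eta x + u i j x * b x ord0 j * eta x).
  have := HA_ibp hmu (@elliptic1 R d) j (hu i j) te.
  have -> : \int[mu]_x (u i j x * (partial j eta x + eta x * b x ord0 j)) =
     \int[mu]_x (u i j x * partial j eta x) + \int[mu]_x (u i j x * b x ord0 j * eta x).
    by rewrite -RintD//; apply: eq_Rintegral => x _; ring.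
  rewrite RintD// => ->; lra.
have -> : energy mu A (cgrad chi) (cgrad eta) = 2^-1 * \sum_i \sum_j \int[mu]_x (u i j x * partial j eta x).
  congr (_ * _); rewrite -(eq_bigr _ (fun i _ => Rint_sum _ (Iu i))).
  rewrite -Rint_sum; last by move=> i; apply: Ig_sum; exact: Iu.
  apply: eq_Rintegral => x _; rewrite bilinE exchange_big/=; apply: eq_bigr => i _; apply: eq_bigr => j _.
  by rewrite !mxE /u -(ell_sym eA x i j); ring.
under eq_bigr do under eq_bigr do rewrite E.
have Iall i j : Ig (fun x => g i j x ord0 j * eta x + u i j x * b x ord0 j * eta x) by exact: IgD.
rewrite (eq_bigr (fun i => - \int[mu]_x \sum_j (g i j x ord0 j * eta x + u i j x * b x ord0 j * eta x))); last first.
  by move=> i _; rewrite sumrN Rint_sum.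
rewrite sumrN -Rint_sum; last by move=> i; apply: Ig_sum; exact: Iall.
rewrite mulrN -RintZ; last by apply: Ig_sum => i; apply: Ig_sum; exact: Iall.
congr (- _); apply: eq_Rintegral => x _; rewrite /Ltest dotE.
have -> : \sum_i \sum_j A x i j * partial i (partial j chi) x =
    \sum_i \sum_j A x i j * partial j (partial i chi) x.
  rewrite [LHS]exchange_big.
  apply: eq_bigr => i _.
  apply: eq_bigr => j _.
  rewrite (ell_sym eA x i j).
  reflexivity.
rewrite !mulr_sumr -big_split/= mulr_suml; apply: eq_bigr => i _.
rewrite [beta x ord0 i]mxE [cgrad chi x ord0 i]mxE.
have F (s1 s2 c e : R) : (2^-1 * s1 + 2^-1 * s2 * c) * e = 2^-1 * ((s1 + s2 * c) * e) by ring.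
rewrite F mulr_suml -big_split/= mulr_suml; congr (_ * _); apply: eq_bigr => j _.
by rewrite /g /u !mxE; ring.
Qed.

Lemma gen_test chi : test_fun setT chi -> gen mu A setT chi (cgrad chi) (Ltest chi).
Proof.
move=> tc; apply: (gen_of_test hmu eA); [exact: HA_test|exact: L2_Ltest|].
by move=> v; exact: Ltest_energy.
Qed.

(** * The drift and its antisymmetry *)

Variable D : T -> T.
Hypotheses (hD : L2loc mu D) (infD : infinitesimally_invariant mu A D).

Definition drift x := D x - beta x.
Local Notation B := drift.

Lemma L2_G eta i : test_fun setT eta -> L2 mu (fun x => eta x * D x ord0 i).
Proof.
move=> te; have [mG iG] := hD; have [n hn] := test_cubeP te; have [M hM] := test_bounded te.
have mm : meas (fun x => eta x * D x ord0 i).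
  by apply: measurable_funM; [exact: test_mf te|exact: mG].
split=> //; apply/IgP; split; first exact: measurable_funX.
pose K := [set x : T | forall i, `|x ord0 i| <= n.+1%:R].
have cK : compact K by exact: closed_cube_compact.
have mK : measurable K by exact: compact_measurable_rV.
have mdG : meas (fun x => M ^+ 2 * dot (D x) (D x)).
  by apply: measurable_funM => //; exact: mf_dot.
have -> : (\int[mu]_x `|(eta x * D x ord0 i) ^+ 2|%:E = \int[mu]_(x in K) `|(eta x * D x ord0 i) ^+ 2|%:E)%E.
  rewrite [RHS]integral_mkcond; apply: eq_integral => x _; rewrite patchE.
  have [xK|xK] := pselect (K x); first by rewrite mem_set.
  rewrite memNset// hn ?mul0r ?expr0n ?normr0// => xn; apply: xK => k; exact: ltW.
apply: (@le_lt_trans _ _ (\int[mu]_(x in K) ((M ^+ 2)%:E * (dot (D x) (D x))%:E))%E).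
  apply: ge0_le_integral => //.
  - by apply: measurable_funTS; apply: mf_abs; exact: measurable_funX.
  - by apply: measurable_funTS; apply/measurable_EFinP.
  - move=> x _; rewrite -EFinM lee_fin ger0_norm ?sqr_ge0// exprMn ler_pM ?sqr_ge0//.
      by rewrite -(real_normK (num_real (eta x))) lerXn2r// nnegrE// (le_trans _ (hM x)).
    exact: sqr_coord_le.
rewrite ge0_integralZl//.
- by rewrite lte_mul_pinfty// ?lee_fin ?sqr_ge0// iG.
- by apply: measurable_funTS; apply: mf_E; exact: mf_dot.
- by move=> x _; rewrite lee_fin dot_ge0.
- by rewrite lee_fin sqr_ge0.
Qed.

Lemma L2_drift f i : bcs f -> L2 mu (fun x => f x * B x ord0 i).
Proof.
move=> hf; have [mf [K fK] [r r0 fr]] := hf; have tc := @cutoff_test R d r.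
have := L2_mul_bounded mf fK (L2B (L2_G i tc) (L2_beta i tc)); congr L2; apply/funext => x.
by rewrite -mulrBr mulrA (bcs_cut hf fr) !mxE.
Qed.

Lemma mf_drift : mfield B.
Proof.
apply: mfieldB; first by case: hD.
move=> i; have mc n := (L2_beta i (@cutoff_test R d n%:R)).1.
apply: (measurable_fun_cvg mc) => x _; apply: cvg_near_cst; have [n xn] := mem_cube x.
exists n => // m /= nm; rewrite cutoff1 ?mul1r// => k; rewrite ltW// (lt_le_trans (xn k))//.
by rewrite ler_nat.
Qed.

Lemma Ig_drift f g : bcs f -> mfield g -> Ig (fun x => q x (g x)) ->
  Ig (fun x => f x * dot (B x) (g x)).
Proof.
move=> hf mg ig; have [mf [K fK] [r r0 fr]] := hf; have tc := @cutoff_test R d r.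
have E x : f x * dot (B x) (g x) = \sum_i (f x * B x ord0 i) * (cutoff r x * g x ord0 i).
  rewrite dotE mulr_sumr; apply: eq_bigr => i _.
  by rewrite mulrACA (bcs_cut hf fr) !mulrA.
under eq_fun do rewrite E; apply: Ig_sum => i; apply: L2_mul; first exact: L2_drift.
exact: (bcs_comp eA i (bcs_test tc) mg ig).
Qed.

Lemma Cv0_drift f (g_ : nat -> T -> T) : bcs f -> (forall n, mfield (g_ n)) ->
  Cv0 mu (fun n x => q x (g_ n x)) -> Cv0 mu (fun n x => f x * dot (B x) (g_ n x)).
Proof.
move=> hf mg cg; have [mf [K fK] [r r0 fr]] := hf; have tc := @cutoff_test R d r.
have E x n : f x * dot (B x) (g_ n x) = \sum_i (cutoff r x * g_ n x ord0 i) * (f x * B x ord0 i).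
  rewrite dotE mulr_sumr; apply: eq_bigr => i _.
  by rewrite mulrACA [cutoff _ _ * _]mulrC (bcs_cut hf fr); ring.
under [X in Cv0 _ X]eq_fun do under eq_fun do rewrite E.
apply: Cv0_sum => i; apply: Cv0_mulL2; [|move=> n|exact: L2_drift].
  exact: (Cv0_bcs eA i (bcs_test tc) mg cg).
by apply: measurable_funM; [exact: test_mf tc|exact: mg].
Qed.

Lemma test_cut_split eta : test_fun setT eta -> exists m : nat, forall x,
  (cut m x = 1 /\ cgrad (cut m) x = 0) \/
  (exists U : set T, [/\ open U, U x & forall y, U y -> eta y = 0]).
Proof.
move=> te; have [n hn] := test_cubeP te; exists n.+2 => x.
have c1 (y : T) : cube n.+2%:R y -> cut n.+2 y = 1 by move=> yn; apply: cutoff1 => i; exact: ltW.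
have oc : open (cube n.+2%:R : set T) by exact: open_cube.
have [xn|xn] := pselect (cube n.+2%:R x); [left|right].
  by split; [exact: c1|exact: (cgrad_near_cst (test_smooth (@cutoff_test R d n.+2%:R)) oc c1 xn)].
exists (~` [set x : T | forall i, `|x ord0 i| <= n.+1%:R]); split.
- apply: closed_openC; exact: compact_closed (@norm_hausdorff _ _) (@closed_cube_compact _ _ _).
- by move=> h; apply: xn => i; rewrite (le_lt_trans (h i))// ltr_nat.
- by move=> y /= yn; apply: hn => h; apply: yn => i; exact: ltW.
Qed.

(** Infinitesimal invariance says that [Ltest eta + <B, grad eta>] has integral 0. So does
    [Ltest eta], as its integral is minus the energy of [eta] against a cut-off that is constant
    wherever [eta] is not locally zero. *)
Lemma drift_test eta : test_fun setT eta -> \int[mu]_x dot (B x) (cgrad eta x) = 0.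
Proof.
move=> te; have [m hm] := test_cut_split te; have tc := @cutoff_test R d m%:R.
have L2L := L2_Ltest te; have Lc := L2_test hmu tc.
have E1 x : bilin (A x) (cgrad eta x) (cgrad (cut m) x) = 0.
  have [[_ ->]|[U [oU Ux U0]]] := hm x; first by rewrite bilin0r.
  by rewrite (cgrad_near0 oU U0 Ux) bilin0l.
have E2 x : Ltest eta x * cut m x = Ltest eta x.
  have [[-> _]|[U [oU Ux U0]]] := hm x; first by rewrite mulr1.
  suff -> : Ltest eta x = 0 by rewrite mul0r.
  rewrite /Ltest (cgrad_near0 oU U0 Ux) dot0r addr0 big1 ?mulr0// => i _.
  by rewrite big1// => j _; rewrite (partial_near0 i oU (partial_near0 j oU U0) Ux) mulr0.
have E3 x : cut m x * dot (B x) (cgrad eta x) = dot (B x) (cgrad eta x).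
  have [[-> _]|[U [oU Ux U0]]] := hm x; first by rewrite mul1r.
  by rewrite (cgrad_near0 oU U0 Ux) dot0r mulr0.
have iL : Ig (Ltest eta) by have := L2_mul L2L Lc; under eq_fun do rewrite E2.
have iB : Ig (fun x => dot (B x) (cgrad eta x)).
  have := Ig_drift (bcs_test tc) (mfield_cgrad te) (Ig_q_test hmu eA te).
  by under eq_fun do rewrite E3.
have z : \int[mu]_x Ltest eta x = 0.
  have := Ltest_energy te tc; rewrite /energy; under eq_Rintegral do rewrite E1.
  by rewrite Rint0 mulr0; under eq_Rintegral do rewrite E2; move=> /esym/eqP; rewrite oppr_eq0 => /eqP.
have := infD te.
have -> : \int[mu]_x (2^-1 * (\sum_i \sum_j A x i j * partial i (partial j eta) x) + dot (D x) (cgrad eta x)) =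
  \int[mu]_x (Ltest eta x + dot (B x) (cgrad eta x)).
  apply: eq_Rintegral => x _; rewrite /Ltest -addrA; congr (_ + _).
  by rewrite -(subrK (beta x) (D x)) !(dotC _ (cgrad eta x)) dotDr addrC.
by rewrite RintD// z add0r.
Qed.

Lemma Ig_drift_mul n g v : mfield g -> Ig (fun x => q x (g x)) -> meas v ->
  ess_bounded mu v -> {ae mu, forall x, ~ C n x -> dot (B x) (g x) * v x = 0} ->
  Ig (fun x => dot (B x) (g x) * v x).
Proof.
move=> mg ig mv [M vM] h.
have ii := IgZ M (Ig_drift (bcs_test (@cutoff_test R d n.+1%:R)) mg ig).
apply: (Ig_le _ ii).
  by apply: measurable_funM => //; apply: mf_dot => //; exact: mf_drift.
apply: filterS2 vM h => x vx hx; have [xn|/hx ->] := pselect (C n x); last by rewrite normr0.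
rewrite cut1// mul1r !normrM mulrC ler_wpM2r// (le_trans vx)//; exact: ler_norm.
Qed.

(** The approximating test functions need not be supported in a common compact set, and [B] is only
    locally square integrable. Multiplication by the cut-off repairs this; its gradient drops out in
    the limit, since the cut-off is constant on [C n] and [u] vanishes elsewhere. *)
Lemma drift_HA V u g n : HA mu A V u g -> {ae mu, forall x, ~ C n x -> u x = 0} ->
  \int[mu]_x dot (B x) (g x) = 0.
Proof.
move=> hu u0; have g0 := HA_grad0 hmu eA hu; have [mfu mg [u_ hu_]] := hu; have [tu cu cg] := hu_.
have iq := HA_Ig_q hmu eA hu; have L2u := HA_L2 hmu hu.
have tc := @cutoff_test R d n.+1%:R; have sc := test_smooth tc.
have bc := bcs_test tc; have mB := mf_drift.
have LBc : L2 mu (fun x => dot (B x) (cgrad (cut n.+1) x)).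
  under eq_fun do rewrite dotE; apply: L2_sum => i.
  have := L2_drift i (bcs_test (test_partial i tc)); congr L2; apply/funext => x.
  by rewrite [cgrad _ _ _ _]mxE mulrC.
have I1 k : Ig (fun x => cut n.+1 x * dot (B x) (cgrad (u_ k) x)).
  exact: (Ig_drift bc (mfield_cgrad (tu k)) (Ig_q_test hmu eA (tu k))).
have I2 k : Ig (fun x => u_ k x * dot (B x) (cgrad (cut n.+1) x)).
  exact: (L2_mul (L2_test hmu (tu k)) LBc).
have J1 : Ig (fun x => cut n.+1 x * dot (B x) (g x)) by exact: (Ig_drift bc mg iq).
have J2 : Ig (fun x => u x * dot (B x) (cgrad (cut n.+1) x)) by exact: (L2_mul L2u LBc).
have E k : \int[mu]_x (cut n.+1 x * dot (B x) (cgrad (u_ k) x) + u_ k x * dot (B x) (cgrad (cut n.+1) x)) = 0.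
  have sk := test_smooth (tu k).
  rewrite -(drift_test (testMl sk tc)); apply: eq_Rintegral => x _.
  by rewrite (cgradM x sk sc) dotDr !dotZr addrC.
have l : (fun k => \int[mu]_x (cut n.+1 x * dot (B x) (cgrad (u_ k) x) + u_ k x * dot (B x) (cgrad (cut n.+1) x)))
    @ \oo --> (\int[mu]_x (cut n.+1 x * dot (B x) (g x) + u x * dot (B x) (cgrad (cut n.+1) x)) : R).
  apply: Cv0_Rint => [k||]; [exact: (IgD (I1 k) (I2 k))|exact: (IgD J1 J2)|].
  have c1 := Cv0_drift bc (fun k => approx_mB k hu_ mg) cg.
  have c2 := Cv0_mulL2 cu (fun k => approx_mB0 k hu_ mfu) LBc.
  have := Cv0D c1 c2; congr (Cv0 _ _); apply/funext => k; apply/funext => x.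
  by rewrite dotDr dotNr; ring.
have z := cvg_const_eq l E.
rewrite -[RHS]z; apply: ae_Rint; [by apply: mf_dot|by case/IgP: (IgD J1 J2)|].
have oc : open (C n) by exact: open_cube.
apply: filterS2 u0 g0 => x h1 h2 _; have [xn|/h1 u00] := pselect (C n x).
  have cn y : C n y -> cut n.+1 y = 1 by exact: cut1.
  by rewrite (cn x xn) (cgrad_near_cst sc oc cn xn) dot0r mulr0 addr0 mul1r.
by rewrite u00 (h2 u00) !dot0r mulr0 mul0r addr0.
Qed.

(** This is [drift_HA] for the product [u v]: boundedness of both factors makes it an energy
    function, and the compact support of one factor localizes it. *)
Lemma drift_anti V W u g v h n : HA mu A V u g -> HA mu A W v h -> ess_bounded mu u ->
  ess_bounded mu v -> {ae mu, forall x, ~ C n x -> v x = 0} ->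
  [/\ Ig (fun x => dot (B x) (g x) * v x), Ig (fun x => dot (B x) (h x) * u x) &
    \int[mu]_x (dot (B x) (g x) * v x) = - \int[mu]_x (dot (B x) (h x) * u x)].
Proof.
move=> hu hv ub vb v0; have [mfu mg _] := hu; have [mfv mh _] := hv.
have I1 : Ig (fun x => dot (B x) (g x) * v x).
  apply: (@Ig_drift_mul n g v mg (HA_Ig_q hmu eA hu) mfv vb).
  by apply: filterS v0 => x h0 /h0 ->; rewrite mulr0.
have I2 : Ig (fun x => dot (B x) (h x) * u x).
  apply: (@Ig_drift_mul n h u mh (HA_Ig_q hmu eA hv) mfu ub).
  by apply: filterS2 v0 (HA_grad0 hmu eA hv) => x h0 h1 /h0/h1 ->; rewrite dot0r mul0r.
split=> //; apply/eqP; rewrite -addr_eq0 addrC -RintD//; apply/eqP.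
have uv := HA_mul hmu eA hu hv ub vb.
rewrite -(drift_HA (n := n) uv); first by apply: eq_Rintegral => x _; rewrite dotDr !dotZr; ring.
by apply: filterS v0 => x h0 /h0 ->; rewrite mulr0.
Qed.

Lemma L2_bilin_test chi g : test_fun setT chi -> mfield g -> Ig (fun x => q x (g x)) ->
  L2 mu (fun x => bilin (A x) (cgrad chi x) (g x)).
Proof.
move=> tc mg ig; have [K hK] := q_cgrad_bounded eA tc; have mc := mfield_cgrad tc.
have mm : meas (fun x => bilin (A x) (cgrad chi x) (g x)).
  by apply: mf_bilin => //; exact: ell_mf eA.
split=> //; apply: (Ig_le _ (IgZ K ig)); first exact: measurable_funX.
apply: aeW => x; have q0 := q_ge0 eA x (g x); have qc := q_ge0 eA x (cgrad chi x).
rewrite ger0_norm ?sqr_ge0// ger0_norm; last by rewrite mulr_ge0// (le_trans qc).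
apply: (@le_trans _ _ (q x (cgrad chi x) * q x (g x))); last by rewrite ler_wpM2r.
rewrite -(real_normK (num_real (bilin _ _ _))) -[leRHS]sqr_sqrtr ?mulr_ge0//.
by rewrite lerXn2r ?nnegrE ?sqrtr_ge0// sqrtrM//; exact: bilin_CS.
Qed.

(** Leibniz rule for [L^0]; the mixed term has coefficient 1 because the form carries the factor
    [2^-1]. Against a test function [v] it combines the equation of [u] tested with [chi v] and that
    of [chi] tested with [u v]. *)
Lemma gen_mul_test u g f chi : gen mu A setT u g f -> ess_bounded mu u -> test_fun setT chi ->
  gen mu A setT (fun x => chi x * u x) (fun x => chi x *: g x + u x *: cgrad chi x)
    (fun x => chi x * f x + u x * Ltest chi x + bilin (A x) (cgrad chi x) (g x)).
Proof.
move=> [hu hf he] [M uM] tc; have [mfu mg _] := hu; have iq := HA_Ig_q hmu eA hu.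
have [K hK] := test_bounded tc; have mc := test_mf tc; have mcg := mfield_cgrad tc.
have Lc := L2_Ltest tc; have iqc := Ig_q_test hmu eA tc.
have L1 : L2 mu (fun x => chi x * f x) by exact: (L2_mul_bounded mc hK hf).
have L2' : L2 mu (fun x => u x * Ltest chi x) by exact: (L2_mul_ess mfu uM Lc).
have L3 := L2_bilin_test tc mg iq.
apply: (gen_of_test hmu eA); [exact: (HA_cut eA eA hu tc)|exact: (L2D (L2D L1 L2') L3)|move=> v tv].
have mv := test_mf tv; have mvg := mfield_cgrad tv; have iqv := Ig_q_test hmu eA tv.
have Lv := L2_test hmu tv; have [Kv hKv] := test_bounded tv.
have mA := ell_mf eA.
have e1 := he _ _ (HA_test mu A (testMl (test_smooth tc) tv)).
have [_ _ hgen] := gen_test tc.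
have e2 := hgen _ _ (HA_cut eA eA hu tv).
have I1 : Ig (fun x => chi x * bilin (A x) (g x) (cgrad v x)).
  by apply: (Ig_mul_bounded mc hK); exact: Ig_bilin.
have I2 : Ig (fun x => u x * bilin (A x) (cgrad chi x) (cgrad v x)).
  have := IgZ M (Ig_bilin eA mcg mvg iqc iqv) => i; apply: (Ig_le _ i).
    by apply: measurable_funM => //; exact: mf_bilin.
  by apply: filterS uM => x h; rewrite !normrM ler_wpM2r// (le_trans h)// ler_norm.
have I3 : Ig (fun x => v x * bilin (A x) (cgrad chi x) (g x)).
  by apply: (Ig_mul_bounded mv hKv); exact: Ig_bilin.
have J1 : Ig (fun x => chi x * f x * v x) by exact: L2_mul.
have J2 : Ig (fun x => u x * Ltest chi x * v x) by exact: L2_mul.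
have E1 : 2^-1 * (\int[mu]_x (chi x * bilin (A x) (g x) (cgrad v x)) +
    \int[mu]_x (v x * bilin (A x) (cgrad chi x) (g x))) = - \int[mu]_x (chi x * f x * v x).
  rewrite -RintD//; transitivity (energy mu A g (cgrad (fun x => chi x * v x))).
    congr (_ * _); apply: eq_Rintegral => x _.
    by rewrite (cgradM x (test_smooth tc) (test_smooth tv)) bilinDr !bilinZr (qC eA x (g x) (cgrad chi x)).
  by rewrite e1; congr (- _); apply: eq_Rintegral => x _; ring.
have E2 : 2^-1 * (\int[mu]_x (v x * bilin (A x) (cgrad chi x) (g x)) +
    \int[mu]_x (u x * bilin (A x) (cgrad chi x) (cgrad v x))) = - \int[mu]_x (u x * Ltest chi x * v x).
  rewrite -RintD//; transitivity (energy mu A (cgrad chi) (fun x => v x *: g x + u x *: cgrad v x)).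
    by congr (_ * _); apply: eq_Rintegral => x _; rewrite bilinDr !bilinZr.
  by rewrite e2; congr (- _); apply: eq_Rintegral => x _; ring.
have -> : energy mu A (fun x => chi x *: g x + u x *: cgrad chi x) (cgrad v) =
    2^-1 * (\int[mu]_x (chi x * bilin (A x) (g x) (cgrad v x)) +
     \int[mu]_x (u x * bilin (A x) (cgrad chi x) (cgrad v x))).
  by rewrite -RintD//; congr (_ * _); apply: eq_Rintegral => x _; rewrite bilinDl !bilinZl.
have -> : \int[mu]_x ((chi x * f x + u x * Ltest chi x + bilin (A x) (cgrad chi x) (g x)) * v x) =
    \int[mu]_x (chi x * f x * v x) + \int[mu]_x (u x * Ltest chi x * v x) +
    \int[mu]_x (v x * bilin (A x) (cgrad chi x) (g x)).
  rewrite -!RintD//; last exact: IgD.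
  by apply: eq_Rintegral => x _; ring.
by move: E1 E2; lra.
Qed.

Local Notation op := (L_op mu A B).

Lemma L_op_elim u w : op u w -> exists g f n,
  [/\ gen mu A setT u g f, {ae mu, forall x, ~ C n x -> u x = 0}, ess_bounded mu u, Ig w &
      {ae mu, forall x, w x = f x + dot (B x) (g x)}].
Proof.
move=> [[_ cu bu] /LpT wI [f /(L0P hmu eA)[g hg] wE]].
have [hu _ _] := hg; have [mfu _ _] := hu.
have [n u0] := iffLR (compact_suppP mu mfu) cu.
exists g, f, n; split=> //.
by apply: filterS2 wE (HA_wgrad hmu eA hu) => x + ->; exact.
Qed.

Lemma L_op_intro u w g f n : gen mu A setT u g f -> {ae mu, forall x, ~ C n x -> u x = 0} ->
  ess_bounded mu u -> Ig w -> {ae mu, forall x, w x = f x + dot (B x) (g x)} -> op u w.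
Proof.
move=> hg u0 bu wI wE; have [hu hf _] := hg; have [mfu _ _] := hu.
have hL0 : L0 mu A u f by apply/(L0P hmu eA); exists g.
split; [split=> //; first by exists f|exact/LpT|exists f => //].
- by apply/(compact_suppP mu mfu); exists n.
- by apply: filterS2 wE (HA_wgrad hmu eA hu) => x -> -> _.
Qed.

Lemma Ig_L2_C f n : L2 mu f -> {ae mu, forall x, ~ C n x -> f x = 0} -> Ig f.
Proof.
move=> hf f0; have hc := L2_test hmu (@cutoff_test R d n.+1%:R).
apply: (Ig_le (hf.1) (L2_mul hf hc)); apply: filterS f0 => x h.
have [xn|xn] := pselect (C n x); last by rewrite h// normr0.
by rewrite cut1// mulr1.
Qed.

Lemma Ig_drift_C V u g n : HA mu A V u g -> {ae mu, forall x, ~ C n x -> u x = 0} ->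
  Ig (fun x => dot (B x) (g x)).
Proof.
move=> hu u0; have [_ mg _] := hu; have g0 := HA_grad0 hmu eA hu.
have := @Ig_drift_mul n g (fun=> 1) mg (HA_Ig_q hmu eA hu) (measurable_cst _).
have bo : ess_bounded mu (fun _ : T => 1) by exists 1; apply: aeW => x; rewrite normr1.
have z : {ae mu, forall x, ~ C n x -> dot (B x) (g x) * 1 = 0}.
  by apply: filterS2 u0 g0 => x h1 h2 /h1/h2 ->; rewrite dot0r mul0r.
by move=> /(_ bo z); under eq_fun do rewrite mulr1.
Qed.

(* With cut-offs chi = 1 near the support of u, the integral of L^0 u is - E^0(u, chi) = 0. *)
Lemma L_op_mass0 u w : op u w -> \int[mu]_x w x = 0.
Proof.
move=> /L_op_elim[g [f [n [[hu hf he] u0 bu wI wE]]]].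
have [_ mg _] := hu; have Bg := Ig_drift_C hu u0.
have Bg0 := drift_HA hu u0.
have mf := hf.1; have fI : Ig f.
  apply: (Ig_le mf (IgB wI Bg)); apply: filterS wE => x ->.
  by rewrite addrK.
have -> : \int[mu]_x w x = \int[mu]_x f x.
  rewrite -[RHS]addr0 -Bg0 -RintD//.
  by apply: ae_Rint; [exact: Ig_mf wI|exact: Ig_mf (IgD fI Bg)|apply: filterS wE => x h _].
have g0 := HA_grad0 hmu eA hu.
have tc m := @cutoff_test R d m%:R.
have fc m : (n < m)%N -> \int[mu]_x (f x * cut m x) = 0.
  move=> nm; have := he _ _ (HA_test mu A (tc m)) => /esym/eqP; rewrite eqr_oppLR => /eqP ->.
  apply/eqP; rewrite oppr_eq0 /energy mulf_eq0; apply/orP; right; apply/eqP.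
  rewrite -(Rint0 mu); apply: ae_Rint; [|exact: measurable_cst|].
    exact: (mf_bilin (fun i j => Hloc_mf hmu (lA i j)) mg (mfield_cgrad (tc m))).
  apply: filterS2 u0 g0 => x h1 h2 _; have [xn|/h1/h2 ->] := pselect (C n x); last by rewrite bilin0l.
  rewrite (@cgrad_near_cst _ _ (cut m) 1 (C n) x (test_smooth (tc m)) (open_cube (ltr0Sn _ n))) ?bilin0r//.
  by move=> z zn; apply: cutoff1 => i; apply: ltW; apply: (lt_le_trans (zn i)); rewrite ler_nat.
have cv : Cv0 mu (fun m x => f x * cut m.+1 x - f x).
  have mfc m : meas (fun x => f x * cut m.+1 x - f x).
    by apply: measurable_funB => //; apply: measurable_funM => //; exact: test_mf (tc m.+1).
  apply: (Cv0_dct mfc (Ig_abs fI)) => [m|].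
    apply: aeW => x; rewrite -[X in _ - X]mulr1 -mulrBr normrM ler_piMr//.
    rewrite distrC ger0_norm ?subr_ge0 ?cutoff_le1//; have := @cutoff_ge0 _ _ m.+1%:R x; lra.
  apply: aeW => x; have [k xk] := mem_cube x; apply/cvgrPdist_le => e e0; exists k => // m /= km.
  rewrite cutoff1 ?mulr1 ?subrr ?subr0 ?normr0 ?ltW// => i.
  by apply/ltW/(lt_le_trans (xk i)); rewrite ler_nat leqW.
have Ifc m : Ig (fun x => f x * cut m.+1 x).
  exact: (L2_mul hf (L2_test hmu (tc m.+1))).
have := Cv0_Rint Ifc fI cv => l1.
have l2 : (\int[mu]_x (f x * cut m.+1 x)) @[m --> \oo] --> (0 : R).
  by apply: cvg_near_cst; exists n => // m /= nm; rewrite fc.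
exact: (cvg_unique (@Rhausdorff R) l1 l2).
Qed.

Lemma test_out chi : test_fun setT chi -> exists n : nat, forall x, ~ C n x ->
  [/\ chi x = 0, cgrad chi x = 0 & Ltest chi x = 0].
Proof.
move=> tc; have [n hn] := test_cubeP tc; exists n.+1 => x xn.
pose U := ~` [set x : T | forall i, `|x ord0 i| <= n.+1%:R].
have oU : open U.
  apply: closed_openC; exact: compact_closed (@norm_hausdorff _ _) (@closed_cube_compact _ _ _).
have Ux : U x by move=> h; apply: xn => i; rewrite (le_lt_trans (h i))// ltr_nat.
have c0 y : U y -> chi y = 0 by move=> yn; apply: hn => h; apply: yn => i; exact: ltW.
have g0 y : U y -> cgrad chi y = 0 by exact: cgrad_near0.
have p0 j y : U y -> partial j chi y = 0.
  by move=> /g0 /rowP /(_ j); rewrite !mxE.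
split; [exact: c0|exact: g0|].
rewrite /Ltest g0// dot0r addr0 big1 ?mulr0// => i _; rewrite big1// => j _.
by have /rowP /(_ i) := cgrad_near0 oU (p0 j) Ux; rewrite !mxE => ->; rewrite mulr0.
Qed.

Lemma L_op_test chi : test_fun setT chi -> exists w, op chi w.
Proof.
move=> tc; have hg := gen_test tc; have [hu hf _] := hg.
have [n hn] := test_out tc; have [M hM] := test_bounded tc.
have u0 : {ae mu, forall x, ~ C n x -> chi x = 0} by apply: aeW => x /hn[].
have Lz : {ae mu, forall x, ~ C n x -> Ltest chi x = 0} by apply: aeW => x /hn[].
exists (fun x => Ltest chi x + dot (B x) (cgrad chi x)); apply: (L_op_intro hg u0).
- by exists M; apply: aeW.
- by apply: IgD; [exact: Ig_L2_C hf Lz|exact: (Ig_drift_C hu u0)].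
- exact: aeW.
Qed.

(** * From uniqueness to invariance *)

Section invariance_from_uniqueness.
Variables (S : R -> (T -> R) -> (T -> R)) (hS : C0_semigroup mu setT S).
Hypotheses (hC : contractive mu setT S) (hM : sub_Markovian mu setT S)
  (hext : extends op (sg_generator mu setT S)).
Variables (Res : R -> (T -> R) -> (T -> R)) (hR : is_resolvent mu setT (sg_generator mu setT S) Res).

Lemma generator_dense f e : Ig f -> 0 < e ->
  exists u w, sg_generator mu setT S u w /\ nrm (fun x => f x - u x) <= e.
Proof.
move=> fI e0; have [chi tc fc] := test_dense_L1 fI e0; have [w cw] := L_op_test tc.
by exists chi, w; split; [exact: hext|exact: ltW].
Qed.

(** Putting mass back leaves [L] unchanged by [L_op_mass0], but changes the generator at every [u]
    whose image has nonzero integral. *)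
Lemma L1_unique_invariant : L1_unique mu op -> invariant_measure mu S.
Proof.
move=> [op' [_ uniq]]; apply: (invariant_mass0 hS hC generator_dense) => u w uw.
apply: contrapT => w0; have [uI wI] := gen_Ig uw; have wn0 := nrm_ge0 wI.
have wpos : 0 < nrm w.
  rewrite lt_neqAle wn0 andbT; apply/negP => /eqP/esym e0.
  have z : {ae mu, forall x, w x = 0} by apply: nrm_eq0 => //; rewrite e0.
  apply: w0; rewrite -(Rint0 mu); apply: ae_Rint; [exact: Ig_mf wI|exact: measurable_cst|].
  by apply: filterS z => x h _.
(* A profile that vanishes only where [w] does: comparing [w] with [w - (int w) y] then forces
   [w = 0]. *)
pose y x := (nrm w)^-1 * `|w x|.
have yI : Ig y by exact: (IgZ _ (Ig_abs wI)).
have y0 : {ae mu, forall x, 0 <= y x} by apply: aeW => x; rewrite mulr_ge0 ?invr_ge0.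
have y1 : \int[mu]_x y x = 1 by rewrite RintZ ?mulVf ?gt_eqF//; exact: Ig_abs.
have [S' hS' ext'] := refeed_generates hS hC hM generator_dense hR yI y0 y1.
have eS := uniq _ (conj hext (ex_intro2 _ _ S hS erefl)).
have ext2 : extends op (sg_generator mu setT S').
  move=> v z vz; apply: ext'; have [_ zI] := gen_Ig (hext vz); split=> //.
  exists z; first exact: hext.
  by rewrite (L_op_mass0 vz); apply: aeW => x; rewrite mul0r subr0.
have eS' := uniq _ (conj ext2 (ex_intro2 _ _ S' hS' erefl)).
have h2 : sg_generator mu setT S u (fun x => w x - (\int[mu]_z w z) * y x).
  rewrite -eS eS'; apply: ext'; split; first exact: (IgB wI (IgZ _ yI)).
  by exists w => //; exact: aeW.
have z : {ae mu, forall x, w x = 0}.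
  apply: filterS (sg_gen_fun hS uw h2) => x /eqP.
  rewrite -subr_eq0 opprB addrC subrK mulf_eq0 => /orP[/eqP /w0 //|].
  by rewrite mulf_eq0 invr_eq0 gt_eqF//= normr_eq0 => /eqP.
apply: w0; rewrite -(Rint0 mu); apply: ae_Rint; [exact: Ig_mf wI|exact: measurable_cst|].
by apply: filterS z => x h _.
Qed.
End invariance_from_uniqueness.

(** * Functionals of first order on the form domain *)

Section weak_functional.
Variable V : set T.
Variables (p : T -> R) (F : T -> T) (n : nat).
Hypotheses (Lp2 : L2 mu p) (LF : forall i, L2 mu (fun x => F x ord0 i))
  (F0 : {ae mu, forall x, ~ C n x -> F x = 0}).

Let mF : mfield F. Proof. by move=> i; exact: (LF i).1. Qed.

Let F_cut g : {ae mu, forall x, dot (F x) (g x) = dot (F x) (cut n.+1 x *: g x)}.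
Proof.
apply: filterS F0 => x h; have [xn|/h ->] := pselect (C n x); first by rewrite cut1// scale1r.
by rewrite !(dotC 0) !dot0r.
Qed.

Lemma Ig_dot_C g : mfield g -> Ig (fun x => q x (g x)) -> Ig (fun x => dot (F x) (g x)).
Proof.
move=> mg ig; have hc := bcs_test (@cutoff_test R d n.+1%:R).
have I0 : Ig (fun x => dot (F x) (cut n.+1 x *: g x)).
  under eq_fun do rewrite dotE; apply: Ig_sum => i.
  have := L2_mul (LF i) (bcs_comp eA i hc mg ig); congr (Ig _); apply/funext => x.
  by rewrite !mxE.
apply: (Ig_le (mf_dot mF mg) I0); apply: filterS (F_cut g) => x -> //.
Qed.

Lemma weak_functional_lin a u g v h : HA mu A V u g -> HA mu A V v h ->
  \int[mu]_x (p x * (a * u x + v x) + dot (F x) (a *: g x + h x)) =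
  a * \int[mu]_x (p x * u x + dot (F x) (g x)) + \int[mu]_x (p x * v x + dot (F x) (h x)).
Proof.
move=> hu hv; have [_ mg _] := hu; have [_ mh _] := hv.
have i1 := L2_mul Lp2 (HA_L2 hmu hu); have i2 := L2_mul Lp2 (HA_L2 hmu hv).
have i3 := Ig_dot_C mg (HA_Ig_q hmu eA hu); have i4 := Ig_dot_C mh (HA_Ig_q hmu eA hv).
rewrite -RintZ ?(IgD i1 i3)// -RintD; [|exact: (IgZ a (IgD i1 i3))|exact: (IgD i2 i4)].
by apply: eq_Rintegral => x _; rewrite dotDr dotZr; ring.
Qed.

(** The field [F] lives on a cube, where the energy controls the Euclidean gradient; the constant
    [2 * nu] undoes the factor [2^-1] in [energy]. *)
Lemma weak_functional_bounded : exists2 K : R, 0 <= K & forall u g, HA mu A V u g ->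
  (\int[mu]_x (p x * u x + dot (F x) (g x))) ^+ 2 <= K * E1 u g u g.
Proof.
have [nu nu0 hnu] := ell_cube eA (n.+1%:R + 1).
have iFF : Ig (fun x => dot (F x) (F x)).
  under eq_fun do rewrite dotE; apply: Ig_sum => i; exact: (L2_mul (LF i) (LF i)).
pose P := \int[mu]_x (p x ^+ 2 + dot (F x) (F x)).
have P0 : 0 <= P.
  apply: Rint_ge0; first by apply: aeW => x; rewrite addr_ge0 ?sqr_ge0// dot_ge0.
  exact: Ig_mf (IgD Lp2.2 iFF).
exists (P * Num.max 1 (2 * nu)) => [|u g hu]; first by rewrite mulr_ge0// le_max ler01.
have [mfu mg _] := hu; have iq := HA_Ig_q hmu eA hu; have Lu := HA_L2 hmu hu.
have hc := bcs_test (@cutoff_test R d n.+1%:R).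
pose g' x := cut n.+1 x *: g x; have Lg i : L2 mu (fun x => g' x ord0 i).
  by have := bcs_comp eA i hc mg iq; congr L2; apply/funext => x; rewrite mxE.
have igg : Ig (fun x => dot (g' x) (g' x)).
  under eq_fun do rewrite dotE; apply: Ig_sum => i; exact: (L2_mul (Lg i) (Lg i)).
have iFg : Ig (fun x => dot (F x) (g' x)).
  under eq_fun do rewrite dotE; apply: Ig_sum => i; exact: (L2_mul (LF i) (Lg i)).
have ipu := L2_mul Lp2 Lu; have iFg0 := Ig_dot_C mg iq.
have lE : \int[mu]_x (p x * u x + dot (F x) (g x)) = \int[mu]_x (p x * u x + dot (F x) (g' x)).
  apply: ae_Rint; [exact: Ig_mf (IgD ipu iFg0)|exact: Ig_mf (IgD ipu iFg)|].
  by apply: filterS (F_cut g) => x -> _.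
set l := \int[mu]_x _ in lE *; pose Q := \int[mu]_x (u x ^+ 2 + dot (g' x) (g' x)).
(* Cauchy-Schwarz for the pairs [(p, F)] and [(u, g')], by the discriminant of a nonnegative
   quadratic polynomial. *)
have CS : l ^+ 2 <= P * Q.
  apply: quadratic_ge0 => t.
  have -> : t ^+ 2 * P + 2 * t * l + Q =
      \int[mu]_x ((t * p x + u x) ^+ 2 + dot (t *: F x + g' x) (t *: F x + g' x)).
    have i1 := IgD Lp2.2 iFF; have i2 := IgD Lu.2 igg; have i3 := IgD ipu iFg.
    rewrite lE /P /Q -(RintZ (t ^+ 2) i1) -(RintZ (2 * t) i3).
    rewrite -(RintD (IgZ (t ^+ 2) i1) (IgZ (2 * t) i3)).
    rewrite -(RintD (IgD (IgZ (t ^+ 2) i1) (IgZ (2 * t) i3)) i2).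
    have dsq (xi eta : T) : dot (t *: xi + eta) (t *: xi + eta) =
        t ^+ 2 * dot xi xi + 2 * t * dot xi eta + dot eta eta.
      by rewrite dotDr dotZr (dotC _ xi) (dotC _ eta) !dotDr !dotZr (dotC eta xi); ring.
    by apply: eq_Rintegral => x _; rewrite dsq; ring.
  apply: Rint_ge0; first by apply: aeW => x; rewrite addr_ge0 ?sqr_ge0// dot_ge0.
  apply: measurable_funD; first by apply: measurable_funX; apply: measurable_funD => //; apply: measurable_funM => //; exact: Lp2.1.
  have mk : mfield (fun x => t *: F x + g' x).
    by apply: mfieldD; [exact: mfieldZc|move=> i; exact: (Lg i).1].
  exact: mf_dot.
apply: (le_trans CS); rewrite -mulrA ler_wpM2l//.
have QE : Q <= \int[mu]_x (u x ^+ 2) + nu * \int[mu]_x q x (g x).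
  rewrite -RintZ// -RintD//; [|exact: Lu.2|exact: IgZ].
  apply: Rint_le; [exact: (IgD Lu.2 igg)|by apply: (IgD Lu.2); exact: IgZ|].
  apply: aeW => x; rewrite lerD2l /g' dotZr dotC dotZr mulrA -expr2.
  have q0 := q_ge0 eA x (g x); have nq : 0 <= nu * q x (g x) by rewrite mulr_ge0// ltW.
  have [xn|xn] := pselect (cube (n.+1%:R + 1) x); last by rewrite cutoff_out// expr0n mul0r.
  have [h1 _] := hnu x (g x) xn; apply: (le_trans _ h1); rewrite ler_piMl ?dot_ge0//.
  by rewrite expr_le1 ?cutoff_ge0 ?cutoff_le1.
have en0 : 0 <= \int[mu]_x q x (g x).
  by apply: Rint_ge0; [apply: aeW => x; exact: (q_ge0 eA)|exact: (Ig_mf iq)].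
have u20 : 0 <= \int[mu]_x (u x ^+ 2).
  by apply: Rint_ge0; [apply: aeW => x; exact: sqr_ge0|exact: Ig_mf Lu.2].
apply: (le_trans QE); rewrite /E1 /energy.
have -> : \int[mu]_x (u x * u x) = \int[mu]_x (u x ^+ 2) by apply: eq_Rintegral => x _; rewrite expr2.
move: en0 u20; set e := \int[mu]_x q x (g x); set s := \int[mu]_x (u x ^+ 2) => e0 s0.
have m1 : 1 <= Num.max 1 (2 * nu) by rewrite le_max lexx.
have m2 : 2 * nu <= Num.max 1 (2 * nu) by rewrite le_max lexx orbT.
rewrite mulrDr addrC lerD//; last by rewrite ler_peMl.
have -> : nu * e = (2 * nu) * (2^-1 * e) by field.
by rewrite ler_wpM2r// mulr_ge0// invr_ge0.
Qed.

End weak_functional.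

Lemma L2_matrix_test chi i : test_fun setT chi -> L2 mu (fun x => (cgrad chi x *m A x) ord0 i).
Proof.
move=> tc; have [n hn] := test_out tc; have [K hK] := ell_bounded n.+1%:R.
have -> : (fun x => (cgrad chi x *m A x) ord0 i) = (fun x => \sum_j partial j chi x * A x j i).
  by apply/funext => x; rewrite mxE; apply: eq_bigr => j _; rewrite mxE.
apply: L2_sum => j; have tp := test_partial j tc.
apply: (L2_le _ (L2Z K (L2_test hmu tp))).
  by apply: measurable_funM; [exact: test_mf tp|exact: ell_mf eA _ _].
apply: aeW => x; have [xn|xn] := pselect (C n x).
  by rewrite !normrM mulrC ler_wpM2r// (le_trans (hK x j i xn))// ler_norm.
by have [_ /rowP /(_ j) + _] := hn x xn; rewrite !mxE => ->; rewrite mul0r normr0.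
Qed.

(** * Bounded functions annihilating the range of [alpha - L] *)

Section annihilator.
Variables (h : T -> R) (K alpha : R).
Hypotheses (mh : meas h) (hK : {ae mu, forall x, `|h x| <= K})
  (hann : forall u w, op u w -> \int[mu]_x ((alpha * u x - w x) * h x) = 0).

(** [p] and [F] collect what is left of [int (u - f) chi h] after [(alpha - L) (chi u)] has been
    expanded by the Leibniz rule and integrated to 0 against [h]. *)
Let p chi x := h x * ((1 - alpha) * chi x + dot (B x) (cgrad chi x) + Ltest chi x).
Let F chi x : T := h x *: (chi x *: B x + cgrad chi x *m A x).

Let Lp chi : test_fun setT chi -> L2 mu (p chi).
Proof.
move=> tc; apply: (L2_mul_ess mh hK); apply: L2D; last exact: (L2_Ltest tc).
apply: L2D; first exact: (L2Z _ (L2_test hmu tc)).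
under eq_fun do rewrite dotE; apply: L2_sum => i.
have := L2_drift i (bcs_test (test_partial i tc)); congr L2; apply/funext => x.
by rewrite [cgrad _ _ _ _]mxE mulrC.
Qed.

Let LF chi i : test_fun setT chi -> L2 mu (fun x => F chi x ord0 i).
Proof.
move=> tc; have := L2_mul_ess mh hK (L2D (L2_drift i (bcs_test tc)) (L2_matrix_test i tc)).
by congr L2; apply/funext => x; rewrite /F !mxE.
Qed.

(** The annihilator condition concerns compactly supported functions, so [h] is multiplied by [chi]:
    then [chi u] is admissible for every bounded [u] in the domain of [L^0], and [weak_regularity]
    applies. *)
Lemma annihilator_local chi : test_fun setT chi -> exists k,
  HA mu A setT (fun x => chi x * h x) k /\ forall v k', HA mu A setT v k' ->
    E1 (fun x => chi x * h x) k v k' = \int[mu]_x (p chi x * v x + dot (F chi x) (k' x)).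
Proof.
move=> tc; have [n hn] := test_out tc; have hp := Lp tc; have hF i := LF i tc.
have Fn0 : {ae mu, forall x, ~ C n x -> F chi x = 0}.
  by apply: aeW => x /hn[e1 e2 _]; rewrite /F e1 e2 mul0mx scale0r addr0 scaler0.
have mc := test_mf tc; have hc := L2_test hmu tc.
have Lh : L2 mu (fun x => chi x * h x).
  by have := L2_mul_ess mh hK hc; congr L2; apply/funext => x; rewrite mulrC.
apply: (weak_regularity Lh).
- by apply: aeW => x [].
- by move=> a u g v k; exact: (weak_functional_lin hp hF Fn0).
- exact: (weak_functional_bounded setT hp hF Fn0).
move=> u g f hg ub _; have [hu hf _] := hg; have [mfu mg _] := hu.
have iq := HA_Ig_q hmu eA hu; have Lu := HA_L2 hmu hu.
have hgc := gen_mul_test hg ub tc; have [hcu hfc _] := hgc.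
set gc := (fun x => chi x *: g x + _) in hgc hcu; set fc := (fun x => _ + bilin _ _ (g x)) in hgc hfc.
have u0 : {ae mu, forall x, ~ C n x -> chi x * u x = 0}.
  by apply: aeW => x /hn[-> _ _]; rewrite mul0r.
have ubc : ess_bounded mu (fun x => chi x * u x).
  have [M hM] := ub; have [Mc hMc] := test_bounded tc; exists (Mc * `|M|).
  apply: filterS hM => x hx; rewrite normrM ler_pM//; exact: le_trans (hx) (ler_norm _).
have fc0 : {ae mu, forall x, ~ C n x -> fc x = 0}.
  by apply: aeW => x /hn[e1 e2 e3]; rewrite /fc e1 e2 e3 bilin0l !(mul0r, mulr0) !addr0.
have Ifc := Ig_L2_C hfc fc0; have IB := Ig_drift_C hcu u0.
have hop := L_op_intro hgc u0 ubc (IgD Ifc IB) (aeW mu (fun=> erefl)).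
have := hann hop => e0.
have ih v : Ig v -> Ig (fun x => v x * h x).
  move=> hv; apply: (Ig_le _ (IgZ K hv)); first exact: measurable_funM (Ig_mf hv) mh.
  by apply: filterS hK => x hx; rewrite !normrM mulrC ler_wpM2r// (le_trans hx) ?ler_norm.
have iFg := Ig_dot_C hF Fn0 mg iq.
have icu := Ig_L2_C (HA_L2 hmu hcu) u0.
have i1 := ih _ (IgB (IgZ alpha icu) (IgD Ifc IB)).
have i2 : Ig (fun x => (u x - f x) * (chi x * h x)) by exact: (L2_mul (L2B Lu hf) Lh).
have i3 : Ig (fun x => p chi x * u x + dot (F chi x) (g x)) by exact: (IgD (L2_mul hp Lu) iFg).
rewrite -[LHS]subr0 -e0 -(RintB i2 i1); apply: eq_Rintegral => x _.
have -> : dot (F chi x) (g x) = h x * (chi x * dot (B x) (g x) + bilin (A x) (cgrad chi x) (g x)).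
  by rewrite dotC /F dotZr dotDr dotZr (dotC (g x) (B x)) (dotC (g x)) (qC eA).
by rewrite /gc dotDr !dotZr /p /fc; ring.
Qed.

End annihilator.

Lemma cut_flat n x : C n x ->
  [/\ cut n.+1 x = 1, cgrad (cut n.+1) x = 0 & Ltest (cut n.+1) x = 0].
Proof.
move=> xn; have sc := test_smooth (@cutoff_test R d n.+1%:R).
have oC : open (C n) := open_cube (ltr0Sn _ n).
have c1 y : C n y -> cut n.+1 y = 1 by exact: cut1.
have g0 y : C n y -> cgrad (cut n.+1) y = 0 by exact: (cgrad_near_cst sc oC c1).
have p0 j y : C n y -> partial j (cut n.+1) y = 0.
  by move=> /g0 /rowP /(_ j); rewrite !mxE.
split; [exact: c1|exact: g0|].
rewrite /Ltest g0// dot0r addr0 big1 ?mulr0// => i _; rewrite big1// => j _.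
by have /rowP /(_ i) := cgrad_near0 oC (p0 j) xn; rewrite !mxE => ->; rewrite mulr0.
Qed.

Section comparison.
Variables (h : T -> R) (K alpha : R).
Hypotheses (mh : meas h) (hK : {ae mu, forall x, `|h x| <= K}) (K0 : 0 <= K)
  (alpha0 : 0 < alpha) (hann : forall u w, op u w -> \int[mu]_x ((alpha * u x - w x) * h x) = 0).

(** For [v] supported in [C n], where the cut-off is constant, all terms with its derivatives drop
    out of [annihilator_local], and antisymmetry moves the drift from [v] to [h]. *)
Lemma annihilator_eq n : exists k, HA mu A setT (fun x => cut n.+1 x * h x) k /\
  forall v gv, HA mu A setT v gv -> ess_bounded mu v -> {ae mu, forall x, ~ C n x -> v x = 0} ->
    energy mu A k gv + alpha * \int[mu]_x (cut n.+1 x * h x * v x) +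
      \int[mu]_x (dot (B x) (k x) * v x) = 0.
Proof.
have tc := @cutoff_test R d n.+1%:R.
have [k [hk ek]] := annihilator_local mh hK hann tc; exists k; split=> // v gv hv vb v0.
have [mfv mgv _] := hv; have gv0 := HA_grad0 hmu eA hv; have [mfh mk _] := hk.
set hz := (fun x => cut n.+1 x * h x) in hk ek mfh *.
have hzb : ess_bounded mu hz.
  exists K; apply: filterS hK => x hx; rewrite /hz normrM; apply: (le_trans _ hx).
  by rewrite ler_piMl// ger0_norm ?cutoff_ge0// cutoff_le1.
have [I1 I2 e2] := drift_anti hk hv hzb vb v0.
have Ihv := HA_prod hk hv.
have := ek _ _ hv; rewrite /E1 => e1.
have e3 : \int[mu]_x (h x * ((1 - alpha) * cut n.+1 x + dot (B x) (cgrad (cut n.+1) x) + Ltest (cut n.+1) x) * v x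
    + dot (h x *: (cut n.+1 x *: B x + cgrad (cut n.+1) x *m A x)) (gv x)) =
    \int[mu]_x ((1 - alpha) * (hz x * v x) + dot (B x) (gv x) * hz x).
  apply: ae_Rint; [|exact: Ig_mf (IgD (IgZ _ Ihv) I2)|].
    have mL := (L2_Ltest tc).1; have mB := mf_drift.
    have mct := test_mf tc; have mcg := mfield_cgrad tc; have mA := ell_mf eA.
    apply: measurable_funD.
      apply: measurable_funM => //; apply: measurable_funM => //; apply: measurable_funD => //.
      by apply: measurable_funD; [exact: measurable_funM|exact: mf_dot].
    apply: mf_dot => //; apply: mfieldZ => //; apply: mfieldD; first exact: mfieldZ.
    by move=> i; exact: (L2_matrix_test i tc).1.
  apply: filterS2 v0 gv0 => x h1 h2 _; have [xn|/h1 vx] := pselect (C n x); last first.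
    by rewrite vx (h2 vx) !dot0r !mulr0 mul0r addr0.
  have [c1 c2 c3] := cut_flat xn.
  by rewrite /hz c1 c2 c3 mul0mx addr0 scale1r dot0r !addr0 dotC dotZr dotC; ring.
rewrite e3 RintD// ?RintZ// in e1; last exact: IgZ.
by move: e1; rewrite e2; move: (energy _ _ _ _) (\int[mu]_x _) (\int[mu]_x _) => p q r; lra.
Qed.

(** Comparison principle: both relations are tested with [v = (s h - K chi)^+], supported in a cube
    because [chi >= 1] off the support of [(chi - 1)^-] while [|h| <= K]. The drift of [v] against
    [v] vanishes by antisymmetry, so the energy of [v] plus [alpha int v^2] is at most 0. The sign
    [s] covers [h] and [- h]. *)
Lemma supersolution_bound (chi : T -> R) (s : R) : `|s| = 1 -> Hloc mu chi ->
  bounded0 mu (H0 mu setT) (fun x => chi x - 1)^\- ->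
  (forall v, bounded0 mu (H0 mu setT) v -> {ae mu, forall x, 0 <= v x} ->
    0 <= energy mu A (wgrad mu chi) (wgrad mu v) + alpha * \int[mu]_x (chi x * v x)
       + \int[mu]_x (dot (B x) (wgrad mu chi x) * v x)) ->
  {ae mu, forall x, s * h x <= K * chi x}.
Proof.
move=> s1 hchi [_ cm [M mM]] hin; have [mchi mgc hl] := Hloc_locgrad hmu hchi.
have mE x : (fun x => chi x - 1)^\- x = Num.max (1 - chi x) 0 by rewrite /funrneg opprB.
have mm : meas (fun x => chi x - 1)^\-.
  by apply: measurable_funrneg; apply: measurable_funB => //; exact: measurable_cst.
have [n m0] := iffLR (compact_suppP mu mm) cm.
have [k [hk ek]] := annihilator_eq n; have tc := @cutoff_test R d n.+1%:R.
have hc := locgradP eA (Hloc_locgrad hmu hchi) tc.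
set hz := (fun x => cut n.+1 x * h x) in hk ek; set cz := (fun x => cut n.+1 x * chi x) in hc.
set gc := (fun x => _ + chi x *: _) in hc.
have hzz := HA_comb (- K) hc (HAZ s hk).
set z := (fun x => - K * cz x + s * hz x) in hzz; set gz := (fun x => - K *: gc x + s *: k x) in hzz.
have hv := HA_pos hmu eA (lexx 0) hzz.
set v := (fun x => Num.max (z x - 0) 0) in hv; set gv := (fun x => _ *: gz x) in hv.
have zE x : z x = cut n.+1 x * (s * h x - K * chi x) by rewrite /z /cz /hz; ring.
have v_ge0 : {ae mu, forall x, 0 <= v x} by apply: aeW => x; rewrite /v le_max lexx orbT.
have hsK : {ae mu, forall x, s * h x <= K}.
  by apply: filterS hK => x hx; rewrite (le_trans (ler_norm _))// normrM s1 mul1r.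
have out : {ae mu, forall x, ~ C n x -> s * h x - K * chi x <= 0}.
  apply: filterS2 m0 hsK => x h1 h2 /h1; rewrite mE => h3.
  have c1 : 1 <= chi x by rewrite -subr_le0 -h3 le_max lexx.
  by rewrite subr_le0 (le_trans h2)// ler_peMr.
have v0 : {ae mu, forall x, ~ C n x -> v x = 0}.
  apply: filterS out => x h1 /h1 h2; rewrite /v subr0; apply/max_idPr; rewrite zE.
  by rewrite mulr_ge0_le0// cutoff_ge0.
have vb : ess_bounded mu v.
  exists (K + K * (`|M| + 1)); apply: filterS2 mM hsK => x; rewrite mE => h1 h2.
  have c1 : - chi x <= `|M| + 1.
    have := le_trans (ler_norm _) h1; rewrite ge_max => /andP[h3 _].
    by have := ler_norm M; lra.
  rewrite ger0_norm; last by rewrite /v le_max lexx orbT.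
  rewrite /v subr0 ge_max addr_ge0 ?mulr_ge0 ?addr_ge0// andbT zE.
  have c2 : s * h x - K * chi x <= K + K * (`|M| + 1).
    by rewrite lerD// -mulrN ler_wpM2l.
  have [p|p] := leP 0 (s * h x - K * chi x).
    by rewrite (le_trans _ c2)// ler_piMl// cutoff_le1.
  by rewrite (@le_trans _ _ 0)// ?addr_ge0 ?mulr_ge0 ?addr_ge0// mulr_ge0_le0 ?cutoff_ge0// ltW.
have [mfv mgv _] := hv; have gv0 := HA_grad0 hmu eA hv.
have hv1 : H0 mu setT v.
  have h1 := HA_cut eA elliptic1 hv (@cutoff_test R d n.+1%:R).
  have [_ mg1 _] := h1; eexists; apply/(H0_gradP hmu).
  apply: (HA_ext elliptic1 h1 mfv mg1 _ (aeW mu (fun=> erefl))).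
  by apply: filterS v0 => x h2; have [xn|/h2 ->] := pselect (C n x); [rewrite cut1// mul1r|rewrite mulr0].
have b0v : bounded0 mu (H0 mu setT) v.
  by split=> //; apply/(compact_suppP mu mfv); exists n.
pose phi (u : T -> R) (g : T -> T) x :=
  2^-1 * bilin (A x) (g x) (gv x) + alpha * (u x * v x) + dot (B x) (g x) * v x.
have Idr u g : HA mu A setT u g -> Ig (fun x => dot (B x) (g x) * v x).
  move=> hu; have [_ mg _] := hu.
  apply: (Ig_drift_mul mg (HA_Ig_q hmu eA hu) mfv vb (n := n)).
  by apply: filterS v0 => x h1 /h1 ->; rewrite mulr0.
have Iphi u g : HA mu A setT u g -> Ig (phi u g).
  move=> hu; have i1 := HA_bilin hu hv; have i2 := HA_prod hu hv.
  exact: (IgD (IgD (IgZ _ i1) (IgZ _ i2)) (Idr _ _ hu)).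
have phiE u g : HA mu A setT u g -> \int[mu]_x phi u g x =
    energy mu A g gv + alpha * \int[mu]_x (u x * v x) + \int[mu]_x (dot (B x) (g x) * v x).
  move=> hu; have i1 := HA_bilin hu hv; have i2 := HA_prod hu hv.
  by rewrite /phi (RintD (IgD (IgZ _ i1) (IgZ _ i2)) (Idr _ _ hu)) (RintD (IgZ _ i1) (IgZ _ i2)) !RintZ.
have p1 : \int[mu]_x phi hz k x = 0 by rewrite (phiE _ _ hk) ek.
have p2 : 0 <= \int[mu]_x phi cz gc x.
  have := hin v b0v v_ge0; rewrite (phiE _ _ hc).
  have [mfc mgcz _] := hc; have mA := ell_mf eA; have mB := mf_drift.
  have mw : mfield (wgrad mu v) by case: (Hloc_locgrad hmu (locgrad_Hloc hmu (HA_locgrad eA hv))).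
  have onC : {ae mu, forall x, v x = 0 /\ gv x = 0 \/ chi x = cz x /\ wgrad mu chi x = gc x}.
    apply: filterS2 v0 gv0 => x h1 h2; have [xn|/h1 vx] := pselect (C n x); [right|left].
      have [c1 c2 _] := cut_flat xn.
      by rewrite /cz /gc c1 c2 mul1r scale1r scaler0 addr0.
    by rewrite vx h2.
  have -> : energy mu A (wgrad mu chi) (wgrad mu v) = energy mu A gc gv.
    congr (_ * _); apply: ae_Rint; [exact: mf_bilin|exact: mf_bilin|].
    apply: filterS2 onC (HA_wgrad hmu eA hv) => x [[_ ->]|[_ ->]] <- _ //.
    by rewrite !bilin0r.
  have -> : \int[mu]_x (chi x * v x) = \int[mu]_x (cz x * v x).
    apply: ae_Rint; [exact: measurable_funM|exact: measurable_funM|].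
    by apply: filterS onC => x [[-> _]|[-> _]] _; rewrite ?mulr0.
  have -> // : \int[mu]_x (dot (B x) (wgrad mu chi x) * v x) = \int[mu]_x (dot (B x) (gc x) * v x).
  apply: ae_Rint; [by apply: measurable_funM => //; exact: mf_dot|by apply: measurable_funM => //; exact: mf_dot|].
  by apply: filterS onC => x [[-> _]|[_ ->]] _; rewrite ?mulr0.
have p3 : \int[mu]_x phi z gz x <= 0.
  have -> : \int[mu]_x phi z gz x = \int[mu]_x (- K * phi cz gc x + s * phi hz k x).
    by apply: eq_Rintegral => x _; rewrite /phi /z /gz !(bilinDl, bilinZl, dotDr, dotZr); ring.
  rewrite (RintD (IgZ _ (Iphi _ _ hc)) (IgZ _ (Iphi _ _ hk))) (RintZ _ (Iphi _ _ hc)) (RintZ _ (Iphi _ _ hk)).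
  by rewrite p1 mulr0 addr0 mulNr oppr_le0 mulr_ge0.
have p4 : \int[mu]_x phi z gz x = \int[mu]_x phi v gv x.
  apply: ae_Rint; [exact: Ig_mf (Iphi _ _ hzz)|exact: Ig_mf (Iphi _ _ hv)|].
  apply: aeW => x _; rewrite /phi /gv /v subr0; case: (ltP 0 (z x)) => zx.
    by rewrite scale1r.
  by rewrite scale0r !bilin0r !mulr0.
have [_ _ anti] := drift_anti hv hv vb vb v0.
have p5 : \int[mu]_x (dot (B x) (gv x) * v x) = 0.
  by apply/eqP; rewrite -[_ == 0](mulrn_eq0 _ 2) mulr2n {1}anti addNr.
rewrite p4 (phiE _ _ hv) p5 addr0 in p3.
have en := energy_ge0 mgv; have vv := HA_prod hv hv.
have vz : {ae mu, forall x, v x * v x = 0}.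
  have le0 : \int[mu]_x (v x * v x) <= 0 by rewrite -(pmulr_rle0 _ alpha0); move: p3 en; move: (energy _ _ _ _) (\int[mu]_x _) => p q; lra.
  have ge : {ae mu, forall x, 0 <= v x * v x} by apply: aeW => x; rewrite -expr2 sqr_ge0.
  by apply: filterS (Rint_ge0_eq0 vv ge le0) => x; exact.
apply: filterS2 vz out => x /eqP; rewrite mulf_eq0 orbb => /eqP vx h1.
have [xn|/h1] := pselect (C n x); last by rewrite subr_le0.
have : z x <= v x by rewrite /v subr0 le_max lexx.
by rewrite vx zE (cut1 xn) mul1r subr_le0.
Qed.

End comparison.

Lemma L_op_comb a u w v z : op u w -> op v z -> op (fun x => a * u x + v x) (fun x => a * w x + z x).
Proof.
move=> /(L_op_elim)[g [f [n [[hu hf he] u0 [M uM] wI wE]]]].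
move=> /(L_op_elim)[k [f' [m [[hv hf' he'] v0 [M' vM] zI zE]]]].
have hg : gen mu A setT (fun x => a * u x + v x) (fun x => a *: g x + k x) (fun x => a * f x + f' x).
  split; [exact: HA_comb|exact: (L2D (L2Z a hf) hf')|move=> p q hp].
  have Lp := HA_L2 hmu hp; have i1 := L2_mul hf Lp; have i2 := L2_mul hf' Lp.
  rewrite (energyL _ hu hv hp) (he _ _ hp) (he' _ _ hp).
  have -> : \int[mu]_x ((a * f x + f' x) * p x) = \int[mu]_x (a * (f x * p x) + f' x * p x).
    by apply: eq_Rintegral => x _; ring.
  by rewrite RintD// ?RintZ//; [ring|exact: IgZ].
apply: (L_op_intro (n := maxn n m) hg).
- have sub k' : (k' <= maxn n m)%N -> C k' `<=` C (maxn n m).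
    by move=> kn; apply: cubeS; rewrite ler_nat ltnS.
  apply: filterS2 u0 v0 => x h1 h2 xn.
  by rewrite h1 ?h2 ?mulr0 ?addr0// => xk; apply: xn; apply: sub xk; rewrite ?leq_maxl ?leq_maxr.
- exists (`|a| * M + M'); apply: filterS2 uM vM => x h1 h2.
  by rewrite (le_trans (ler_normD _ _))// lerD// normrM ler_wpM2l.
- exact: (IgD (IgZ a wI) zI).
- by apply: filterS2 wE zE => x -> ->; rewrite dotDr dotZr; ring.
Qed.

(** * From supersolutions to uniqueness *)

Section uniqueness.
Variables (chi : nat -> T -> R) (alpha : R).
Hypotheses (alpha0 : 0 < alpha) (chi_loc : forall n, Hloc mu (chi n))
  (chi_supp : forall n, bounded0 mu (H0 mu setT) (fun x => chi n x - 1)^\-)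
  (chi_cvg : {ae mu, forall x, chi n x @[n --> \oo] --> (0 : R)})
  (chi_super : forall n v, bounded0 mu (H0 mu setT) v -> {ae mu, forall x, 0 <= v x} ->
    0 <= energy mu A (wgrad mu (chi n)) (wgrad mu v) + alpha * \int[mu]_x (chi n x * v x)
       + \int[mu]_x (dot (B x) (wgrad mu (chi n) x) * v x)).

Lemma annihilator_eq0 (h : T -> R) : meas h -> ess_bounded mu h ->
  (forall u w, op u w -> \int[mu]_x ((alpha * u x - w x) * h x) = 0) -> {ae mu, forall x, h x = 0}.
Proof.
move=> mh [M hM] hann; have K0 : 0 <= `|M| by [].
have hK : {ae mu, forall x, `|h x| <= `|M|} by apply: filterS hM => x /le_trans; apply; exact: ler_norm.
have bound n (s : R) : `|s| = 1 -> {ae mu, forall x, s * h x <= `|M| * chi n x}.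
  move=> s1; exact: (supersolution_bound mh hK K0 alpha0 hann s1 (chi_loc n)
    (chi_supp n) (@chi_super n)).
have b1 : {ae mu, forall x, forall n, 1 * h x <= `|M| * chi n x}.
  by apply: ae_foralln => n; apply: bound; exact: normr1.
have b2 : {ae mu, forall x, forall n, -1 * h x <= `|M| * chi n x}.
  by apply: ae_foralln => n; apply: bound; rewrite normrN normr1.
apply: filterS2 (filterI b1 b2) chi_cvg => x [h1 h2] hx.
have l0 : `|M| * chi n x @[n --> \oo] --> (`|M| * 0 : R) by apply: cvgM hx; exact: cvg_cst.
rewrite mulr0 in l0.
have z1 : 1 * h x <= 0 by apply: (cvgr_to_ge l0); exact: nearW.
have z2 : -1 * h x <= 0 by apply: (cvgr_to_ge l0); exact: nearW.
by move: z1 z2; lra.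
Qed.

Variables (S : R -> (T -> R) -> (T -> R)) (hS : C0_semigroup mu setT S).
Hypotheses (hC : contractive mu setT S) (hM : sub_Markovian mu setT S)
  (hext : extends op (sg_generator mu setT S)).
Variables (Res : R -> (T -> R) -> (T -> R)) (hR : is_resolvent mu setT (sg_generator mu setT S) Res).
Local Notation generator := (sg_generator mu setT S).

(* (alpha - L) has dense range, so the generator is the closure of L. *)
Lemma generator_core u w : generator u w -> exists u_ w_ : nat -> T -> R,
  [/\ forall n, op (u_ n) (w_ n), Cv0 mu (fun n x => u_ n x - u x) & Cv0 mu (fun n x => w_ n x - w x)].
Proof.
move=> uw; have [uI wI] := gen_Ig uw.
pose W := [set f | exists v z, op v z /\ f = (fun x => alpha * v x - z x)].
have WI f : W f -> Ig f.
  by move=> [v [z [vz ->]]]; have [vI zI] := gen_Ig (hext vz); exact: (IgB (IgZ alpha vI) zI).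
have fI : Ig (fun x => alpha * u x - w x) := IgB (IgZ alpha uI) wI.
have dW n : exists p : (T -> R) * (T -> R), op p.1 p.2 /\
    nrm (fun x => (alpha * u x - w x) - (alpha * p.1 x - p.2 x)) < n.+1%:R^-1.
  have [||||f [v [z [vz ->]]] hf] := @L1_dense W WI _ _ _ _ fI n.+1%:R^-1.
  - have [z0 hz0] := L_op_test (@cutoff_test R d 1).
    by exists (fun x => alpha * cutoff 1 x - z0 x); exists (cutoff 1), z0.
  - move=> a p q [v [z [vz ->]]] [v' [z' [vz' ->]]].
    exists (fun x => a * v x + v' x), (fun x => a * z x + z' x); split; first exact: L_op_comb.
    by apply/funext => x; ring.
  - move=> h mh bh hW; apply: (annihilator_eq0 mh bh) => v z vz.
    by apply: (hW (fun x => alpha * v x - z x)); exists v, z.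
  - by rewrite invr_gt0.
  by exists (v, z).
have [p hp] := choice dW.
exists (fun n => (p n).1), (fun n => (p n).2).
have pI n : Ig (p n).1 /\ Ig (p n).2 by have [/hext/gen_Ig] := hp n.
have rI n : Ig (fun x => (alpha * u x - w x) - (alpha * (p n).1 x - (p n).2 x)).
  by have [h1 h2] := pI n; exact: (IgB fI (IgB (IgZ alpha h1) h2)).
have cf : Cv0 mu (fun n x => (alpha * u x - w x) - (alpha * (p n).1 x - (p n).2 x)).
  apply: Cv0_ge0 => n; first exact: Ig_mf (rI n).
  by rewrite (Rint_fineE (rI n)) lee_fin ltW//; case: (hp n).
(* The resolvent bound [alpha * nrm u <= nrm ((alpha - L) u)] turns convergence of the images into
   convergence of the functions. *)
have cu : Cv0 mu (fun n x => (p n).1 x - u x).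
  have IB n : Ig (fun x => (p n).1 x - u x) by apply: IgB => //; case: (pI n).
  apply/(Cv0_nrm IB) => e e0; have ea : 0 < alpha * e by rewrite mulr_gt0.
  have /(Cv0_nrm rI) /(_ _ ea) [N hN] := cf; exists N => n Nn.
  rewrite -(ler_pM2l alpha0); apply: (le_trans _ (hN n Nn)).
  have := sg_gen_comb hS (-1) (hext (hp n).1) uw => hg.
  have hg' : generator (fun x => -1 * (p n).1 x + u x)
      (fun x => alpha * (-1 * (p n).1 x + u x) - ((alpha * u x - w x) - (alpha * (p n).1 x - (p n).2 x))).
    by move: hg; congr (sg_generator _ _ _ _ _); apply/funext => x; ring.
  have := res_contr hS hC alpha0 (iffRL (LpT _ _) (rI n)) hg'.
  congr (_ * _ <= _); rewrite nrm_distC; apply: eq_Rintegral => x _; congr `|_|; ring.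
split=> //; first by move=> n; case: (hp n).
have := Cv0D (Cv0Z alpha cu) cf; congr (Cv0 mu _); apply/funext => n; apply/funext => x; ring.
Qed.

Lemma L1_uniqueness : L1_unique mu op.
Proof.
exists generator; split; first by split=> //; exists S.
move=> op' [ext' [S' hS' e']]; subst op'.
have [M [r [M1 r0 hMr]]] := sg_local_bound hS'.
have hMr' t f : 0 < t <= r -> Lp mu 1 setT f -> nrm (S' t f) <= M * nrm f.
  by move=> tr /LpT; exact: hMr.
have sub u w : generator u w -> sg_generator mu setT S' u w.
  move=> uw; have [pu pw _] := uw; have [u_ [w_ [ho cu cw]]] := generator_core uw.
  by apply: (sg_gen_closed hS' M1 r0 hMr' (fun n => ext' _ _ (ho n)) pu pw cu cw).
apply/funext => u; apply/funext => w; apply/propext; split; first exact: sub.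
move=> uw; have [pu pw _] := uw.
have M0 : 0 < M by exact: lt_le_trans M1.
(* Large enough for [sg_gen_injective]: [u] and the resolvent of [S] at [lam u - w] have the same
   image under [lam - L'], hence coincide. *)
pose lam := (2 * M + 1) / r; have l0 : 0 < lam by rewrite divr_gt0// addr_gt0// mulr_gt0.
have lr : 2 * M < lam * r by rewrite /lam divfK ?gt_eqF// ltrDl.
have pf : Lp mu 1 setT (fun x => lam * u x - w x) by apply: LpB => //; exact: LpZ.
have hg := res_gen hR l0 pf; have hg' := sub _ _ hg.
have hd := sg_gen_comb hS' (-1) uw hg'.
have hd' : sg_generator mu setT S' (fun x => -1 * u x + Res lam (fun x => lam * u x - w x) x)
    (fun x => lam * (-1 * u x + Res lam (fun x => lam * u x - w x) x)).
  by move: hd; congr (sg_generator _ _ _ _ _); apply/funext => x; ring.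
have eu : {ae mu, forall x, Res lam (fun x => lam * u x - w x) x = u x}.
  apply: filterS (sg_gen_injective hS' M1 r0 hMr' lr hd') => x /eqP.
  by rewrite mulN1r addrC subr_eq0 => /eqP.
apply: (sg_gen_ext hS hg pu pw eu); apply: filterS eu => x ->; ring.
Qed.

End uniqueness.

(** * Invariance for generator and resolvent *)

Section invariance.
Variables (S : R -> (T -> R) -> (T -> R)) (hS : C0_semigroup mu setT S).
Hypotheses (hC : contractive mu setT S) (hinv : invariant_measure mu S).

(** The definition speaks of bounded nonnegative functions; test functions are differences of such,
    they are dense, and both sides are continuous in mean. *)
Lemma invariant_L1 t f : 0 < t -> Ig f -> \int[mu]_x S t f x = \int[mu]_x f x.
Proof.
move=> t0 fI; apply/eqP; rewrite -subr_eq0 -normr_le0; apply/ler_addgt0Pr => e e0; rewrite add0r.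
have e2 : 0 < e / 2 by rewrite divr_gt0.
have [chi tc /ltW fc] := test_dense_L1 fI e2; have cI := Ig_test hmu tc; have mc := test_mf tc.
have [K hK] := test_bounded tc.
pose p x := Num.max (chi x) 0; pose m x := Num.max (- chi x) 0.
have p0 x : 0 <= p x by rewrite /p le_max lexx orbT.
have m0 x : 0 <= m x by rewrite /m le_max lexx orbT.
have pb x : `|p x| <= `|chi x| by rewrite ger0_norm// /p ge_max normr_ge0 ler_norm.
have mb x : `|m x| <= `|chi x| by rewrite ger0_norm// /m ge_max normr_ge0 -normrN ler_norm.
have pI : Ig p.
  by apply: (Ig_le _ cI); [apply: measurable_maxr => //; exact: measurable_cst|exact: aeW].
have mI : Ig m.
  by apply: (Ig_le _ cI); [apply: measurable_maxr; [exact: Ig_mf (IgN cI)|exact: measurable_cst]|exact: aeW].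
have pb' : ess_bounded mu p by exists K; apply: aeW => x; exact: le_trans (pb x) (hK x).
have mb' : ess_bounded mu m by exists K; apply: aeW => x; exact: le_trans (mb x) (hK x).
have [pT mT] := (iffRL (LpT mu _) pI, iffRL (LpT mu _) mI).
have cE x : chi x = -1 * m x + p x.
  by rewrite /m /p; case: (leP (- chi x) 0) => a; case: (leP (chi x) 0) => c; lra.
have cT := iffRL (LpT mu _) cI; have fT := iffRL (LpT mu _) fI.
have Sc := sg_I hS t0 cT; have Sp := sg_I hS t0 pT; have Sm := sg_I hS t0 mT.
have ec : \int[mu]_x S t chi x = \int[mu]_x chi x.
  have -> : \int[mu]_x S t chi x = \int[mu]_x (-1 * S t m x + S t p x).
    apply: ae_Rint; [exact: Ig_mf Sc|exact: Ig_mf (IgD (IgZ _ Sm) Sp)|].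
    have e1 := sg_ae hS t0 cT (Lp_comb (-1) mT pT) (aeW mu cE).
    by apply: filterS2 e1 (sg_lin hS (-1) t0 mT pT) => x -> ->.
  rewrite RintD// ?RintZ//; last exact: IgZ.
  rewrite (hinv t0 pT pb' (aeW mu p0)) (hinv t0 mT mb' (aeW mu m0)) -RintZ// -RintD//; last exact: IgZ.
  by apply: eq_Rintegral => x _; rewrite cE.
have Sf := sg_I hS t0 fT.
have -> : \int[mu]_x S t f x - \int[mu]_x f x =
   (\int[mu]_x S t f x - \int[mu]_x S t chi x) + (\int[mu]_x chi x - \int[mu]_x f x).
  by rewrite ec addrA subrK.
rewrite (le_trans (ler_normD _ _))// [leRHS]splitr lerD//.
  by rewrite (le_trans (Rint_close Sf Sc))// (le_trans (sg_dist hS hC t0 fT cT)).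
by rewrite distrC (le_trans (Rint_close fI cI)).
Qed.

Lemma invariant_generator u w : sg_generator mu setT S u w -> \int[mu]_x w x = 0.
Proof.
move=> uw; have [uI wI] := gen_Ig uw; have [pu pw hg] := iffLR (sg_genP hS u w) uw.
apply/eqP; rewrite -normr_le0; apply/ler_addgt0Pr => e e0; rewrite add0r.
have [del del0 hdel] := hg _ e0.
have t0 : 0 < del / 2 by rewrite divr_gt0.
have td : 0 < del / 2 < del by rewrite t0/= ltr_pdivrMr// ltr_pMr// ltr1n.
have := hdel _ td; set t := del / 2 in t0 * => ht; rewrite -(ler_pM2l t0).
have Su := sg_I hS t0 pu; have I1 := IgB (IgB Su uI) (IgZ t wI).
apply: (le_trans _ ht); rewrite -[X in X * _](gtr0_norm t0) -normrM -normrN.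
apply: (le_trans _ (Rint_abs_le I1)).
by rewrite (RintB (IgB Su uI) (IgZ t wI)) (RintB Su uI) (invariant_L1 t0 uI) subrr sub0r RintZ.
Qed.

Lemma invariant_resolvent Res lam f : is_resolvent mu setT (sg_generator mu setT S) Res ->
  0 < lam -> Ig f -> lam * \int[mu]_x Res lam f x = \int[mu]_x f x.
Proof.
move=> hR l0 fI; have fT := iffRL (LpT mu _) fI; have h := res_gen hR l0 fT.
have [GI _] := gen_Ig h; have := invariant_generator h.
by rewrite (RintB (IgZ lam GI) fI) RintZ// => /eqP; rewrite subr_eq0 => /eqP.
Qed.

End invariance.

(** * The dual resolvent on a cube *)

Section cocore.
Variables (n : nat) (Res : R -> (T -> R) -> (T -> R)).
Local Notation V := (C n).
Hypothesis hRes : is_GV mu A B V Res.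

Lemma Lp_restrict f : Ig f -> Lp mu 1 V (f \* \1_V).
Proof.
move=> fI; apply/LpP; split.
  apply: (Ig_le _ fI); first by apply: measurable_funM; [exact: Ig_mf fI|exact: measurable_indic (measurable_cube _)].
  apply: aeW => x; rewrite /= indicE; case: (x \in V); first by rewrite mulr1.
  by rewrite mulr0 normr0.
by apply: aeW => x Vx; rewrite /= indicE memNset// mulr0.
Qed.

(* h = (1 - L_V^* )^{-1} 1 as an element of the dual of L^1. *)
Lemma dual_resolvent : exists h : T -> R, [/\ meas h, {ae mu, forall x, 0 <= h x <= 1},
  forall x, ~ V x -> h x = 0 &
  forall f, Ig f -> \int[mu]_x Res 1 (f \* \1_V) x = \int[mu]_x (f x * h x)].
Proof.
have [S [hS hC hM _ hR]] := hRes.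
pose l f := \int[mu]_x Res 1 (f \* \1_V) x.
have PV := Lp_restrict; have RI f : Ig f -> Ig (Res 1 (f \* \1_V)) by move=> fI; exact: (res_I hR ltr01 (PV _ fI)).
have [||h0 [mh0 h01 lE]] := @L1_dual l 1 ler01.
- move=> a f g fI gI; rewrite /l -RintZ; last exact: RI.
  rewrite -RintD; [|by apply: IgZ; exact: RI|exact: RI].
  have e0 : (fun x => a * f x + g x) \* \1_V = (fun x => a * (f \* \1_V) x + (g \* \1_V) x).
    by apply/funext => x /=; ring.
  apply: ae_Rint; [exact: Ig_mf (RI _ (IgD (IgZ a fI) gI))|exact: Ig_mf (IgD (IgZ a (RI _ fI)) (RI _ gI))|].
  by rewrite e0; apply: filterS (res_lin hS hR a ltr01 (PV _ fI) (PV _ gI)) => x -> _.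
- move=> f fI; rewrite mul1r (le_trans (Rint_abs_le (RI _ fI)))//.
  have := res_nrm hS hC hR ltr01 (PV _ fI); rewrite mul1r => /le_trans; apply.
  apply: Rint_le; [exact: Ig_abs (Lp_Ig (PV _ fI))|exact: Ig_abs|].
  by apply: aeW => x; rewrite /= indicE normrM ler_piMr//; case: (x \in V); rewrite ?normr1 ?normr0.
pose h x := h0 x * \1_V x.
have mh : meas h by apply: measurable_funM => //; exact: measurable_indic (measurable_cube _).
have hE f : Ig f -> l f = \int[mu]_x (f x * h x).
  move=> fI; have -> : l f = l (f \* \1_V).
    rewrite /l; suff -> : (f \* \1_V) \* \1_V = f \* \1_V by [].
    by apply/funext => x; rewrite /= indicE; case: (x \in V); rewrite ?mulr1 ?mulr0.
  rewrite (lE _ (Lp_Ig (PV _ fI))); apply: eq_Rintegral => x _; rewrite /h /=; ring.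
have hout x : ~ V x -> h x = 0 by move=> Vx; rewrite /h indicE memNset// mulr0.
have h_le : {ae mu, forall x, `|h x| <= 1}.
  apply: filterS h01 => x; rewrite /h indicE; case: (x \in V); rewrite ?mulr1 ?mulr0//.
  by rewrite normr0.
(* Positivity of the resolvent, tested with the negative part of [h]: the integral of [m h] is
   nonnegative, although [m h = - m^2]. *)
pose m x := Num.max (- h x) 0.
have m0 x : 0 <= m x by rewrite /m le_max lexx orbT.
have mm : meas m.
  apply: measurable_maxr; last exact: measurable_cst.
  exact: measurableT_comp mh.
have mI : Ig m.
  apply: (Ig_le mm (Ig_test hmu (@cutoff_test R d n.+1%:R))); apply: filterS h_le => x hx.
  have [xn|xn] := pselect (V x); last by rewrite /m hout// oppr0 maxxx normr0.
  rewrite cut1// normr1 ger0_norm// /m ge_max ler01 andbT; apply: le_trans hx.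
  by rewrite -normrN ler_norm.
have h_ge0 : {ae mu, forall x, 0 <= h x}.
  have mPV : {ae mu, forall x, 0 <= (m \* \1_V) x}.
    by apply: aeW => x; rewrite /= mulr_ge0// indicE.
  have g0 := res_ge0 hS hC hM hR ltr01 (PV _ mI) mPV.
  have l0 : 0 <= l m by apply: Rint_ge0 => //; exact: Ig_mf (RI _ mI).
  have imh : Ig (fun x => - (m x * h x)).
    apply: (Ig_le _ mI); first by apply: measurableT_comp => //; exact: measurable_funM.
    by apply: filterS h_le => x hx; rewrite normrN normrM ler_piMr.
  have mh0' : {ae mu, forall x, 0 <= - (m x * h x)}.
    apply: aeW => x; rewrite -mulrN /m; case: (leP (- h x) 0) => a; first by rewrite mul0r.
    by rewrite mulr_ge0// ltW.
  have le0 : \int[mu]_x (- (m x * h x)) <= 0.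
    rewrite RintN ?oppr_le0 -?hE//; have := IgN imh; congr (Ig _); apply/funext => x; exact: opprK.
  apply: filterS (Rint_ge0_eq0 imh mh0' le0) => x /(_ I) /eqP; rewrite oppr_eq0 /m.
  case: (leP (- h x) 0) => a; first by move: a; lra.
  by rewrite mulf_eq0 oppr_eq0 orbb => /eqP ->.
exists h; split=> //.
by apply: filterS2 h_le h_ge0 => x h1 h2; rewrite h2 (le_trans (ler_norm _)).
Qed.

Variables (h : T -> R).
Hypotheses (mh : meas h) (h01 : {ae mu, forall x, 0 <= h x <= 1})
  (hout : forall x, ~ V x -> h x = 0)
  (hdual : forall f, Ig f -> \int[mu]_x Res 1 (f \* \1_V) x = \int[mu]_x (f x * h x)).

Let h_bd : {ae mu, forall x, `|h x| <= 1}.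
Proof. by apply: filterS h01 => x /andP[a c]; rewrite ger0_norm. Qed.

Let hb : ess_bounded mu h. Proof. by exists 1. Qed.

Let hV0 : {ae mu, forall x, ~ V x -> h x = 0}. Proof. exact: aeW. Qed.

(** For bounded [u] in the domain of [L^{0,V}] with [f = L^{0,V} u], the resolvent at 1 of
    [u - f - <B, grad u>] is [u], so [hdual] becomes [int u = int (u - f - <B, grad u>) h]. This is
    the hypothesis of [weak_regularity] with [l v = int v + int <B, grad v> h]. *)
Lemma cocore_equation : exists k, HA mu A V h k /\ forall v gv, HA mu A V v gv ->
  E1 h k v gv = \int[mu]_x v x + \int[mu]_x (dot (B x) (gv x) * h x).
Proof.
have [S [hS hC hM hcl hR]] := hRes.
have tc := @cutoff_test R d n.+1%:R; have Lc := L2_test hmu tc; have bc := bcs_test tc.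
have Lh : L2 mu h.
  apply: (L2_le mh Lc); apply: filterS h_bd => x hx; have [xn|xn] := pselect (V x).
    by rewrite cut1// normr1.
  by rewrite hout// normr0.
have LF i : L2 mu (fun x => (h x *: B x) ord0 i).
  have := L2_mul_ess mh h_bd (L2_drift i bc); congr L2; apply/funext => x.
  by rewrite [RHS]mxE; have [xn|xn] := pselect (V x); [rewrite cut1// mul1r|rewrite hout// !mul0r].
have F0 : {ae mu, forall x, ~ C n x -> h x *: B x = 0}.
  by apply: aeW => x xn; rewrite hout// scale0r.
have vI v gv : HA mu A V v gv -> Ig v.
  by move=> hv; exact: (Ig_L2_C (HA_L2 hmu hv) (HA_out hv)).
have cutE v gv : HA mu A V v gv -> {ae mu, forall x, cut n.+1 x * v x = v x}.
  move=> hv; apply: filterS (HA_out hv) => x v0; have [xn|/v0 ->] := pselect (V x); last by rewrite mulr0.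
  by rewrite cut1// mul1r.
(* The cut-off stands for the constant 1, which need not be square integrable; against functions
   vanishing off [V] the two agree. *)
have lE v gv : HA mu A V v gv -> \int[mu]_x (cut n.+1 x * v x + dot (h x *: B x) (gv x)) =
    \int[mu]_x v x + \int[mu]_x (dot (B x) (gv x) * h x).
  move=> hv; have [_ mgv _] := hv; have i1 := Ig_dot_C LF F0 mgv (HA_Ig_q hmu eA hv).
  have E x : dot (h x *: B x) (gv x) = dot (B x) (gv x) * h x by rewrite dotC dotZr dotC mulrC.
  have i2 : Ig (fun x => dot (B x) (gv x) * h x) by move: i1; under eq_fun do rewrite E.
  rewrite -RintD//; last exact: vI hv.
  apply: ae_Rint; [exact: Ig_mf (IgD (L2_mul Lc (HA_L2 hmu hv)) i1)|exact: Ig_mf (IgD (vI _ _ hv) i2)|].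
  by apply: filterS (cutE _ _ hv) => x -> _; rewrite E.
have [|||k [hk ek]] := @weak_regularity V h
  (fun v gv => \int[mu]_x (cut n.+1 x * v x + dot (h x *: B x) (gv x))) Lh hV0.
- by move=> a u g v k; exact: (weak_functional_lin Lc LF F0).
- exact: (weak_functional_bounded V Lc LF F0).
- move=> u g f hg ub f0; have [hu hf _] := hg; rewrite (lE _ _ hu).
  have [_ mg _] := hu; have uI := vI _ _ hu; have fI := Ig_L2_C hf f0.
  have Bg := Ig_drift_C hu (HA_out hu).
  have wI := IgD fI Bg; have g0 := HA_grad0 hmu eA hu.
  have pu : Lp mu 1 V u by apply/LpP; split=> //; exact: HA_out hu.
  have pw : Lp mu 1 V (fun x => f x + dot (B x) (g x)).
    apply/LpP; split=> //; apply: filterS2 (filterI f0 g0) (HA_out hu) => x [h1 h2] h3 xn.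
    by rewrite h1// h2 ?h3// dot0r addr0.
  have hL : LV_op mu A B V u (fun x => f x + dot (B x) (g x)).
    split=> //; exists f; last by apply: filterS (HA_wgrad hmu eA hu) => x -> _.
    by apply/(L0VP hmu eA); [exact: cube_relatively_compact|split=> //; exists g].
  have hgen : sg_generator mu V S u (fun x => f x + dot (B x) (g x)).
    apply/hcl; split=> //; exists (fun=> u), (fun=> (fun x => f x + dot (B x) (g x))); split=> //.
      by apply/cvg_Lp1P; [move=> _; exact: Ig_mf uI|exact: Ig_mf uI|apply/(Cv0_nrm (fun=> IgB uI uI)) => e e0; exists 0%N => _ _; rewrite nrm_subrr ltW].
    by apply/cvg_Lp1P; [move=> _; exact: Ig_mf wI|exact: Ig_mf wI|apply/(Cv0_nrm (fun=> IgB wI wI)) => e e0; exists 0%N => _ _; rewrite nrm_subrr ltW].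
  have fI' : Ig (fun x => u x - (f x + dot (B x) (g x))) := IgB uI wI.
  have pf := Lp_restrict fI'.
  have hgen2 : sg_generator mu V S u (fun x => 1 * u x - ((fun x => u x - (f x + dot (B x) (g x))) \* \1_V) x).
    apply: (sg_gen_ext hS hgen pu); [|exact: aeW|].
      by apply: LpB => //; exact: LpZ.
    have [_ pw0] := iffLR (LpP _ _ _) pw; have [_ pu0] := iffLR (LpP _ _ _) pu.
    apply: filterS2 pw0 pu0 => x h1 h2; rewrite /= indicE.
    have [xn|xn] := pselect (V x); first by rewrite mem_set// mulr1; ring.
    by rewrite memNset// mulr0 h1// h2//; ring.
  have eu := res_uniq hR ltr01 pf hgen2.
  have e1 : \int[mu]_x u x = \int[mu]_x ((u x - (f x + dot (B x) (g x))) * h x).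
    rewrite -(hdual fI'); apply: ae_Rint; [exact: Ig_mf uI|exact: Ig_mf (res_I hR ltr01 pf)|].
    by apply: filterS eu => x -> _.
  have ih v : Ig v -> Ig (fun x => v x * h x).
    move=> hv; apply: (Ig_le _ hv); first exact: measurable_funM (Ig_mf hv) mh.
    by apply: filterS h_bd => x hx; rewrite normrM ler_piMr.
  rewrite e1 -RintD; [|exact: ih|exact: ih].
  by apply: eq_Rintegral => x _; ring.
exists k; split=> // v gv hv; rewrite ek//; exact: lE.
Qed.

End cocore.

(** * Extension by zero *)

Section subsolution.
Variables (n : nat) (h : T -> R) (k : T -> T).
Hypotheses (h01 : {ae mu, forall x, 0 <= h x <= 1}) (hk : HA mu A (C n) h k)
  (ek : forall v gv, HA mu A (C n) v gv ->
    E1 h k v gv = \int[mu]_x v x + \int[mu]_x (dot (B x) (gv x) * h x)).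

(* Test with v min(h/e, 1), which vanishes off V, and let e tend to 0. *)
Lemma zero_extension_subsolution v gv m : HA mu A setT v gv -> ess_bounded mu v ->
  {ae mu, forall x, 0 <= v x} -> {ae mu, forall x, ~ C m x -> v x = 0} ->
  energy mu A k gv + \int[mu]_x (h x * v x) + \int[mu]_x (dot (B x) (k x) * v x) <= \int[mu]_x v x.
Proof.
move=> hv vb v_ge0 v0; have hkT : HA mu A setT h k := HA_mono (@subsetT _ _) hk.
have h_b : ess_bounded mu h by exists 1; apply: filterS h01 => x /andP[a c]; rewrite ger0_norm.
have [mfh mk _] := hk; have [mfv mgv _] := hv.
have vI : Ig v := Ig_L2_C (HA_L2 hmu hv) v0.
have [J3 _ _] := drift_anti hkT hv h_b vb v0.
have J1 := HA_bilin hkT hv; have J2 := HA_prod hkT hv.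
pose Psi x := 2^-1 * bilin (A x) (k x) (gv x) + h x * v x + dot (B x) (k x) * v x.
have PI : Ig Psi := IgD (IgD (IgZ _ J1) J2) J3.
have -> : energy mu A k gv + \int[mu]_x (h x * v x) + \int[mu]_x (dot (B x) (k x) * v x) = \int[mu]_x Psi x.
  by rewrite /Psi (RintD (IgD (IgZ _ J1) J2) J3) (RintD (IgZ _ J1) J2) RintZ.
have k0 := HA_grad0 hmu eA hk.
pose e (i : nat) : R := i.+1%:R^-1.
have e0 i : 0 < e i by rewrite invr_gt0.
(* For [h >= 0] this is the minimum of [h / e i] and 1, written with positive parts so that [HA_pos]
   yields its gradient. *)
pose phi i x := (e i)^-1 * (Num.max (h x - 0) 0 - Num.max (h x - e i) 0).
have phi01 i : {ae mu, forall x, 0 <= phi i x <= 1}.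
  apply: filterS h01 => x /andP[a c]; rewrite /phi subr0 mulrC; set s := e i; have s0 := e0 i.
  rewrite divr_ge0 ?(ltW s0)//= ?ler_pdivrMr// ?mul1r; rewrite -/s in s0;
    by case: (leP (h x) 0) => p; case: (leP (h x - s) 0) => r; move: a c p r s0; lra.
have phiE i x : e i <= h x -> phi i x = 1.
  move=> ex; have hx := lt_le_trans (e0 i) ex; rewrite /phi subr0.
  rewrite (max_idPl (ltW hx)) (max_idPl _) ?subr_ge0//.
  by rewrite opprB addrC subrK mulVf// gt_eqF.
have mphi i : meas (phi i).
  by have [+ _ _] := HAZ (e i)^-1 (HAB eA (HA_pos hmu eA (lexx 0) hk) (HA_pos hmu eA (ltW (e0 i)) hk)).
have phiI i f : Ig f -> Ig (fun x => phi i x * f x).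
  move=> fI; apply: (Ig_le _ fI); first exact: measurable_funM (mphi i) (Ig_mf fI).
  by apply: filterS (phi01 i) => x /andP[a c]; rewrite normrM ler_piMl// ger0_norm.
have step i : \int[mu]_x (phi i x * Psi x) <= \int[mu]_x v x.
  pose gphi x := (e i)^-1 *: ((if 0 < h x then 1 else 0) *: k x - (if e i < h x then 1 else 0) *: k x).
  have hphi : HA mu A (C n) (phi i) gphi.
    exact: (HAZ (e i)^-1 (HAB eA (HA_pos hmu eA (lexx 0) hk) (HA_pos hmu eA (ltW (e0 i)) hk))).
  have pb : ess_bounded mu (phi i).
    by exists 1; apply: filterS (phi01 i) => x /andP[a c]; rewrite ger0_norm.
  have hw := HA_mul hmu eA hphi hv pb vb; have := ek hw; rewrite /E1.
  set w := (fun x => _ * v x) in hw *; set gw := (fun x => _ *: gv x + _) in hw *.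
  have wb : ess_bounded mu w.
    have [M hM] := vb; exists M; apply: filterS2 hM (phi01 i) => x vx /andP[a c].
    by rewrite normrM (le_trans _ vx)// ler_piMl// ger0_norm.
  have w0 := HA_out hw; have [I1 I2 ->] := drift_anti hw hk wb h_b (HA_out hk).
  have [I3 _ _] := drift_anti hk hw h_b wb w0.
  move=> eqn; have wI : Ig w := Ig_L2_C (HA_L2 hmu hw) w0.
  have w_le : \int[mu]_x w x <= \int[mu]_x v x.
    by apply: Rint_le => //; apply: filterS2 v_ge0 (phi01 i) => x vx /andP[a c]; rewrite ler_piMl.
  have L1 := HA_bilin hk hw; have L2 := HA_prod hk hw.
  (* The gradient of [phi i] contributes [(e i)^-1 * v * <A k, k>] on [0 < h <= e i]. It is
     nonnegative, and dropping it is what turns the equation on [C n] into an inequality on the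
     whole space. *)
  have en : \int[mu]_x (phi i x * (2^-1 * bilin (A x) (k x) (gv x))) <= energy mu A k gw.
    rewrite /energy -RintZ//; apply: Rint_le; [exact: (phiI _ _ (IgZ _ J1))|exact: IgZ|].
    apply: filterS v_ge0 => x vx; rewrite /gw bilinDr !bilinZr mulrCA ler_wpM2l ?invr_ge0//.
    rewrite lerDl mulr_ge0//; apply: mulr_ge0; first by rewrite invr_ge0 ltW.
    rewrite bilinDr bilinNr !bilinZr -mulrBl mulr_ge0 ?(q_ge0 eA)// subr_ge0.
    case: (ltP (e i) (h x)) => p; last by case: ifP.
    by rewrite (lt_trans (e0 i) p).
  have -> : \int[mu]_x (phi i x * Psi x) = \int[mu]_x (phi i x * (2^-1 * bilin (A x) (k x) (gv x)))
      + \int[mu]_x (h x * w x) + \int[mu]_x (dot (B x) (k x) * w x).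
    rewrite -(RintD (phiI i _ (IgZ _ J1)) L2) -(RintD (IgD (phiI i _ (IgZ _ J1)) L2) I3).
    by apply: eq_Rintegral => x _; rewrite /Psi /w; ring.
  apply: (le_trans _ w_le); move: eqn en; rewrite -/w.
  move: (\int[mu]_x (phi i x * _)) (energy _ _ _ _) (\int[mu]_x (h x * w x)) (\int[mu]_x w x) (\int[mu]_x (dot (B x) (k x) * w x)) => p q r s t.
  lra.
have cv : Cv0 mu (fun i x => phi i x * Psi x - Psi x).
  apply: (Cv0_dct _ (Ig_abs PI)) => [i|i|].
  - exact: Ig_mf (IgB (phiI i _ PI) PI).
  - apply: filterS (phi01 i) => x /andP[a c]; rewrite -[X in _ - X]mul1r -mulrBl normrM ler_piMl//.
    by rewrite ler_norml; apply/andP; split; move: a c; lra.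
  (* Where [h > 0] the factor [phi i] is eventually 1; where [h = 0] the gradient [k] vanishes as
     well, so [Psi] is 0. *)
  apply: filterS2 h01 k0 => x /andP[a c] kx; apply/cvgrPdist_le => ep ep0.
  have [hx|hx] := eqVneq (h x) 0.
    exists 0%N => // i _ /=; rewrite /Psi hx (kx hx) bilin0l dot0r !(mul0r, mulr0) !addr0 mulr0 subrr subr0 normr0.
    exact: ltW.
  have hx0 : 0 < h x by rewrite lt_neqAle eq_sym hx.
  exists (Num.bound (h x)^-1) => // i /= iN; rewrite phiE ?mul1r ?subrr ?subr0 ?normr0 ?(ltW ep0)//.
  rewrite /e -[leRHS]invrK lef_pV2 ?posrE ?invr_gt0//.
  apply: (le_trans (ltW (archi_boundP _))); first by rewrite invr_ge0 ltW.
  by rewrite ler_nat (leq_trans iN).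
have lim := Cv0_Rint (fun i => phiI i _ PI) PI cv.
by apply: (cvgr_to_le lim); exact: nearW.
Qed.

End subsolution.

Lemma locgrad_cst (c : R) : locgrad mu (fun=> c) (fun=> 0).
Proof.
split; [exact: measurable_cst|exact: mfield0|move=> chi tc].
have := HAZ c (HA_test mu id1 tc); congr (HA _ _ _ _); apply/funext => x; first by rewrite mulrC.
by rewrite scaler0 add0r.
Qed.

(** * From invariance to the functions of (iii) *)

Variables (S : R -> (T -> R) -> (T -> R)) (T_Tbar : is_Tbar mu A B S) (hinv : invariant_measure mu S).

Lemma exhaustion_cubes : exhaustion (fun n => C n).
Proof.
split=> [n|n|].
- by split; [exact: open_cube (ltr0Sn _ _)|exact: cube_relatively_compact].
- by apply: cubeS; rewrite ler_nat.
- apply/seteqP; split=> // x _; have [n xn] := mem_cube x; exists n => //.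
  by apply: cubeS xn; rewrite ler_nat.
Qed.

(** The integral of [f h_n] is that of the resolvent on [C n] applied to the restriction of [f]; it
    converges to the integral of the global resolvent of [f], which equals [int f] by invariance. *)
Lemma co_excessive : exists (h : nat -> T -> R) (k : nat -> T -> T),
  [/\ forall n, {ae mu, forall x, 0 <= h n x <= 1}, forall n, HA mu A (C n) (h n) (k n),
    forall n v gv, HA mu A (C n) v gv -> E1 (h n) (k n) v gv =
      \int[mu]_x v x + \int[mu]_x (dot (B x) (gv x) * h n x) &
    forall f, Ig f -> \int[mu]_x (f x * h n x) @[n --> \oo] --> \int[mu]_x f x].
Proof.
have [hS hC hM hext [G [GV [hR hGV hcv]]]] := T_Tbar.
have hGn n : is_GV mu A B (C n) (GV (C n)).
  by apply: hGV; [exact: open_cube (ltr0Sn _ _)|exact: cube_relatively_compact].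
have [h hh] := choice (fun n => dual_resolvent (hGn n)).
have hex n : exists k, HA mu A (C n) (h n) k /\ forall v gv, HA mu A (C n) v gv ->
    E1 (h n) k v gv = \int[mu]_x v x + \int[mu]_x (dot (B x) (gv x) * h n x).
  by have [m1 m2 m3 m4] := hh n; exact: (cocore_equation (hGn n) m1 m2 m3 m4).
have [k hk] := choice hex.
exists h, k; split=> [n|n|n|f fI].
- by have [] := hh n.
- by have [] := hk n.
- by have [] := hk n.
have fT := iffRL (LpT mu _) fI; have GI := res_I hR ltr01 fT.
have GnI n : Ig (GV (C n) 1 (f \* \1_(C n))).
  by have [Sn [hSn hCn hMn _ hRn]] := hGn n; exact: (res_I hRn ltr01 (Lp_restrict n fI)).
have cv : Cv0 mu (fun n x => GV (C n) 1 (f \* \1_(C n)) x - G 1 f x).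
  apply/cvg_Lp1P; [by move=> n; exact: Ig_mf (GnI n)|exact: Ig_mf GI|].
  exact: (hcv _ _ _ exhaustion_cubes ltr01 fT).
have := Cv0_Rint GnI GI cv; rewrite -[\int[mu]_x G 1 f x]mul1r.
rewrite (invariant_resolvent hS hC hinv hR ltr01 fI) => l; apply: cvg_trans l.
by apply: near_eq_cvg; apply: nearW => n; have [_ _ _ /(_ f fI) <-] := hh n.
Qed.

Lemma invariant_exhaustion : exists (chi : nat -> T -> R) (alpha : R),
  [/\ 0 < alpha, forall n, Hloc mu (chi n),
      forall n, bounded0 mu (H0 mu setT) (fun x => chi n x - 1)^\-,
      {ae mu, forall x, chi n x @[n --> \oo] --> (0 : R)} &
      forall n v, bounded0 mu (H0 mu setT) v -> {ae mu, forall x, 0 <= v x} ->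
        0 <= energy mu A (wgrad mu (chi n)) (wgrad mu v) + alpha * \int[mu]_x (chi n x * v x)
             + \int[mu]_x (dot (B x) (wgrad mu (chi n) x) * v x)].
Proof.
have [h [k [h01 hk ek hcv]]] := co_excessive.
have tc m := @cutoff_test R d m%:R; have cI m := Ig_test hmu (tc m).
have h_b n : {ae mu, forall x, `|h n x| <= 1} by apply: filterS (h01 n) => x /andP[a c]; rewrite ger0_norm.
have mh n : meas (h n) by have [] := hk n.
have chI m n : Ig (fun x => cut m x * h n x).
  apply: (Ig_le _ (cI m)); first exact: measurable_funM (Ig_mf (cI m)) (mh n).
  by apply: filterS (h_b n) => x hx; rewrite normrM ler_piMr.
have c1hI m n : Ig (fun x => cut m x * (1 - h n x)).
  by have := IgB (cI m) (chI m n); under eq_fun do rewrite -[X in X - _]mulr1 -mulrBr.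
(* As [1 - h n >= 0], weak convergence against the cut-off is convergence in mean; the rate
   [8^-1 ^+ m] along a subsequence is the one that [fast_ae] asks for. *)
have pick m : exists n, \int[mu]_x `|cut m x * (1 - h n x)| <= 8^-1 ^+ m.
  have e0 : 0 < 8^-1 ^+ m :> R by rewrite exprn_gt0.
  have /cvgrPdist_le /(_ _ e0) [N _ hN] := hcv _ (cI m); exists N.
  have := hN N (leqnn N); rewrite -(RintB (cI m) (chI m N)) => /(le_trans (ler_norm _)).
  congr (_ <= _); apply: ae_Rint; [exact: Ig_mf (IgB (cI m) (chI m N))|exact: Ig_mf (Ig_abs (c1hI m N))|].
  apply: filterS (h01 N) => x /andP[a c] _; rewrite ger0_norm; first by ring.
  by rewrite mulr_ge0 ?cutoff_ge0// subr_ge0.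
have [s hs] := choice pick.
have ae0 : {ae mu, forall x, \forall m \near \oo, `|cut m x * (1 - h (s m) x)| <= 4^-1 ^+ m}.
  apply: fast_ae => m; first exact: Ig_mf (c1hI m (s m)).
  by rewrite (Rint_fineE (c1hI m (s m))) lee_fin.
have hl n := HA_locgrad eA (hk n).
have chil n : locgrad mu (fun x => 1 - h n x) (fun x => - k n x).
  have := locgradD (locgradZ (-1) (hl n)) (locgrad_cst 1).
  by congr (locgrad _ _ _); apply/funext => x; rewrite ?mulN1r ?scaleN1r ?addr0// addrC.
(* [alpha = 1] because [h] comes from the resolvent at 1; subtracting from the constant 1 turns the
   subsolution inequality into the one for supersolutions. *)
exists (fun m x => 1 - h (s m) x), 1; split=> //.
- by move=> m; exact: (locgrad_Hloc hmu (chil (s m))).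
- move=> m; set n := s m; have h1 := HA_mono (@subsetT _ _) (HA_change eA elliptic1 (@cube_relatively_compact _ _ _) (hk n)).
  have mE x : (fun x => 1 - h n x - 1)^\- x = Num.max (h n x - 0) 0.
    by rewrite /funrneg; congr Num.max; ring.
  have mfE : (fun x => 1 - h n x - 1)^\- = (fun x => Num.max (h n x - 0) 0) by apply/funext.
  rewrite mfE; have hp := HA_pos hmu elliptic1 (lexx 0) h1; split.
  + by eexists; apply/(H0_gradP hmu); exact: hp.
  + have [mp _ _] := hp; apply/(compact_suppP mu mp); exists n.
    by apply: filterS (HA_out (hk n)) => x h0 /h0 ->; rewrite subr0 maxxx.
  + exists 1; apply: filterS (h01 n) => x /andP[a c]; rewrite subr0 (max_idPl a) ger0_norm//.
- apply: filterS ae0 => x hx; have [N xN] := mem_cube x.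
  apply/norm_cvg0P; apply: (squeeze_cvgr _ (cvg_cst _)); last first.
    by apply: (@cvg_expr _ 4^-1); rewrite ger0_norm//; lra.
  have hN : \forall m \near \oo, (N <= m)%N by exists N.
  apply: filterS2 hx hN => m + Nm; rewrite normr_ge0/= cutoff1 ?mul1r// => i.
  by apply/ltW/(lt_le_trans (xN i)); rewrite ler_nat.
move=> m v [[gv0 /(H0_gradP hmu) hv1] cv vb] v_ge0; set n := s m.
have [mfv _ _] := hv1; have [N v0] := iffLR (compact_suppP mu mfv) cv.
have hv2 := HA_cut elliptic1 eA hv1 (@cutoff_test R d N.+1%:R); have [_ mgv _] := hv2.
have hv : HA mu A setT v (fun x => cut N.+1 x *: gv0 x + v x *: cgrad (cut N.+1) x).
  apply: (HA_ext eA hv2 mfv mgv _ (aeW mu (fun=> erefl))).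
  by apply: filterS v0 => x h2; have [xn|/h2 ->] := pselect (C N x); [rewrite cut1// mul1r|rewrite mulr0].
set gv := (fun x => _ + _) in hv mgv.
have sub := zero_extension_subsolution (h01 n) (hk n) (ek n) hv vb v_ge0 v0.
have hkT := HA_mono (@subsetT _ _) (hk n).
have hb : ess_bounded mu (h n) by exists 1.
have [J3 _ _] := drift_anti hkT hv hb vb v0.
have J2 := HA_prod hkT hv; have vI : Ig v := Ig_L2_C (HA_L2 hmu hv) v0.
have ewc := locgrad_wgrad hmu (chil n); have ewv := HA_wgrad hmu eA hv.
have mw u g : locgrad mu u g -> mfield (wgrad mu u).
  by move=> hu; case: (Hloc_locgrad hmu (locgrad_Hloc hmu hu)).
have mA := ell_mf eA; have mB := mf_drift; have mk : mfield (k n) by case: (hk n).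
have mwc := mw _ _ (chil n); have mwv := mw _ _ (HA_locgrad eA hv).
have -> : energy mu A (wgrad mu (fun x => 1 - h n x)) (wgrad mu v) = - energy mu A (k n) gv.
  rewrite /energy -mulrN -RintN; last exact: (HA_bilin hkT hv).
  congr (_ * _); apply: ae_Rint; [exact: mf_bilin|by apply: measurableT_comp => //; exact: mf_bilin|].
  by apply: filterS2 ewc ewv => x <- <- _; rewrite bilinNl.
have -> : \int[mu]_x (dot (B x) (wgrad mu (fun x => 1 - h n x) x) * v x) = - \int[mu]_x (dot (B x) (k n x) * v x).
  rewrite -RintN//; apply: ae_Rint; [by apply: measurable_funM => //; exact: mf_dot|exact: Ig_mf (IgN J3)|].
  by apply: filterS ewc => x <- _; rewrite dotNr mulNr.
have -> : \int[mu]_x ((1 - h n x) * v x) = \int[mu]_x v x - \int[mu]_x (h n x * v x).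
  by rewrite -RintB//; apply: eq_Rintegral => x _; ring.
rewrite mul1r; move: sub; move: (energy _ _ _ _) (\int[mu]_x v x) (\int[mu]_x (h n x * v x)) (\int[mu]_x (dot _ _ * v x)) => p q r t.
lra.
Qed.

End diffusion_operator.

Unset Implicit Arguments.

Theorem proposition2p10 (R : realType) (d : nat) (d_gt0 : (0 < d)%N)
  (phi : 'rV[R]_d -> R) (mu : {measure set 'rV[R]_d -> \bar R})
  (A : 'rV[R]_d -> 'M[R]_d) (G : 'rV[R]_d -> 'rV[R]_d)
  (rho := fun x => phi x ^+ 2)
  (B := fun x => G x - log_drift mu rho A x)
  (phi_Hloc : Hloc (lebesgue_rV d) phi)
  (mu_density : has_density mu rho)
  (mu_supp : msupp mu = setT)
  (A_Hloc : forall i j, Hloc mu (fun x => A x i j))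
  (A_sym : forall x i j, A x j i = A x i j)
  (A_elliptic : locally_strictly_elliptic A)
  (G_L2loc : L2loc mu G)
  (mu_inf_inv : infinitesimally_invariant mu A G)
  (T : R -> ('rV[R]_d -> R) -> ('rV[R]_d -> R))
  (T_Tbar : is_Tbar mu A B T) :
  [<-> L1_unique mu (L_op mu A B);
       invariant_measure mu T;
       exists (chi : ('rV[R]_d -> R)^nat) (alpha : R),
         [/\ 0 < alpha,
             forall n, Hloc mu (chi n),
             forall n, bounded0 mu (H0 mu setT) (fun x => chi n x - 1)^\-,
             {ae mu, forall x, chi n x @[n --> \oo] --> (0 : R)} &
             forall n v, bounded0 mu (H0 mu setT) v ->
               {ae mu, forall x, 0 <= v x} ->
               0 <= energy mu A (wgrad mu (chi n)) (wgrad mu v)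
                    + alpha * \int[mu]_x (chi n x * v x)
                    + \int[mu]_x (dot (B x) (wgrad mu (chi n) x) * v x)]].
Proof.
have hmu := weighted_ibp phi_Hloc mu_density.
have eA : elliptic A by split=> // i j; exact (Hloc_mf hmu (A_Hloc i j)).
(* [log_drift] is [beta] with [logder phi] for [b], the form in which the operator has been
   studied. *)
have BE : B = drift mu (logder phi) A G.
  apply/funext => x; rewrite /B /drift; congr (_ - _); apply/rowP => i; rewrite !mxE; congr (_ * _).
  by apply: eq_bigr => j _; rewrite mxE.
rewrite BE in T_Tbar *; have [hS hC hM hext [Res [GV [hR _ _]]]] := T_Tbar.
tfae.
- exact: (L1_unique_invariant hmu eA A_Hloc G_L2loc mu_inf_inv hS hC hM hext hR).
- move=> hinv; exact: (invariant_exhaustion hmu eA A_Hloc G_L2loc mu_inf_inv T_Tbar hinv).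
- move=> [chi [alpha [alpha0 h1 h2 h3 h4]]].
  exact: (L1_uniqueness hmu eA A_Hloc G_L2loc mu_inf_inv alpha0 h1 h2 h3 h4 hS hC hext hR).
Qed.
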